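(* Let $n=m+r$ with $m,r\ge1$ and let $H(t,q,p)=h(p)-\epsilon^2G(t,q,p)$ on $\mathbb{T}\times\mathbb{T}^n\times\mathbb{R}^n$, with $h$, $G$ smooth (or at least $C^s$ for a sufficiently large $s$) and independent of $\epsilon$. Let $p_0=(p_1^0,p_2^0)\in\mathbb{R}^m\times\mathbb{R}^r$ satisfy $\partial h(p_0)=(\omega,0)\in\mathbb{R}^m\times\mathbb{R}^r$ with $\omega$ Diophantine. Assume that $h$ is convex with positive definite Hessian and that $V(q_2)=\int_{\mathbb{T}\times\mathbb{T}^m} G(t,q_1,q_2,p_0)\,dt\,dq_1$ has a non-degenerate local minimum at $q_2=0\in\mathbb{T}^r$. Let $B\subset\mathbb{R}^m$ be the open ball containing $p_1^0$, and $Q_2^\epsilon$, $P_2^\epsilon$, $A^\epsilon$ (for $0<\epsilon<\epsilon_0$) the functions and weakly invariant, normally hyperbolic, symplectic cylinder described in the context. Set $$A^{\epsilon}_0=\big\{(q_1,Q_2^{\epsilon}(0,q_1,p_1),p_1,P_2^{\epsilon}(0,q_1,p_1)):(q_1,p_1)\in\mathbb{T}^m\times B\big\}\subset\mathbb{T}^n\times\mathbb{R}^n,$$ let $\phi:A_0^\epsilon\to\mathbb{T}^n\times\mathbb{R}^n$ be the time-one flow of $H$ (from time $0$ to time $1$; well-defined on $A_0^\epsilon$ for small $\epsilon$), and define $\Phi:\mathbb{T}^m\times B\to\mathbb{T}^m\times\mathbb{R}^m$ by $$\Phi(q_1,p_1)=(q_1,p_1)\circ\phi\big(q_1,Q_2^{\epsilon}(0,q_1,p_1),p_1,P_2^{\epsilon}(0,q_1,p_1)\big),$$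 i.e. the $(q_1,p_1)$-components of the image. For an open ball $B_0\subset\mathbb{R}^m$ containing $p_1^0$ whose closure is contained in $B$, set $$A^{\epsilon}_{00}=\big\{(q_1,Q_2^{\epsilon}(0,q_1,p_1),p_1,P_2^{\epsilon}(0,q_1,p_1)):(q_1,p_1)\in\mathbb{T}^m\times B_0\big\}.$$ Then: (i) For every such $B_0$, the map $\Phi$ converges uniformly on $\mathbb{T}^m\times B_0$, as $\epsilon\to0$, to $$\Phi_0:(q_1,p_1)\longmapsto\big(q_1+\partial_{p_1}h(p_1,P_2(p_1)),\;p_1\big).$$ (ii) For every such $B_0$, $\phi(A^{\epsilon}_{00})\subset A^{\epsilon}_0$ when $\epsilon$ is small enough. (iii) Given $\eta>0$, the ball $B_0$ can be chosen small enough (independently of $\epsilon$) so that $\|d\Phi-d\Phi_0\|_{C^0}\le\eta$ holds on $\mathbb{T}^m\times B_0$ when $\epsilon$ is small enough.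
   Context: $\mathbb{T}=\mathbb{R}/\mathbb{Z}$; $q=(q_1,q_2)\in\mathbb{T}^m\times\mathbb{T}^r$, $p=(p_1,p_2)\in\mathbb{R}^m\times\mathbb{R}^r$. The extended Hamiltonian vector field of $H$ on $\mathbb{T}\times\mathbb{T}^n\times\mathbb{R}^n$ is $\dot t=1$, $\dot q=\partial_pH$, $\dot p=-\partial_qH$. Diophantine: there are $\gamma>0,\tau>0$ with $|k\cdot\omega+l|\ge\gamma\|(k,l)\|^{-\tau}$ for all $(k,l)\in\mathbb{Z}^m\times\mathbb{Z}$, $(k,l)\neq0$. $P_2$ is the smooth $\mathbb{R}^r$-valued function determined near $p_1^0$ by $\partial_{p_2}h(p_1,P_2(p_1))=0$, $P_2(p_1^0)=p_2^0$. The cylinder. Fix $\kappa>0$. Under the stated hypotheses there exist (and we fix) an open ball $B\subset\mathbb{R}^m$ containing $p_1^0$, a (small) neighborhood $U$ of $0$ in $\mathbb{T}^r$, $\epsilon_0>0$ and, for $0<\epsilon<\epsilon_0$, $C^1$ functions $Q_2^\epsilon:\mathbb{T}\times\mathbb{T}^m\times B\to U$ and $P_2^\epsilon:\mathbb{T}\times\mathbb{T}^m\times B\to\mathbb{R}^r$ such that, with $$A^{\epsilon}=\{(t,q_1,Q_2^{\epsilon}(t,q_1,p_1),p_1,P_2^{\epsilon}(t,q_1,p_1)):(t,q_1,p_1)\in\mathbb{T}\times\mathbb{T}^m\times B\}:$$ (a) the extended Hamiltonian vector field of $H$ is tangent to $A^\epsilon$ at each of its points (weak invariance); (b) with $P_2^0(t,q_1,p_1):=P_2(p_1)$,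 $P_2^\epsilon\to P_2^0$ uniformly as $\epsilon\to0$, $\|P_2^\epsilon-P_2^0\|_{C^1}\le\kappa$ and $\|Q_2^\epsilon\|_{C^1}\le\kappa/\epsilon$; (c) every set containing the full orbit of each of its points and contained in $\mathbb{T}\times\mathbb{T}^m\times U\times B\times\{p_2:\|p_2\|\le\epsilon\}$ is contained in $A^\epsilon$; (d) $A^\epsilon$ is normally hyperbolic, and symplectic (the form $dq\wedge dp$ is non-degenerate on its time sections). Normally hyperbolic, for a weakly invariant open manifold $N$ of a vector field $X$, means: there exist a vector field $Y$ on a compact manifold $M$, an embedding $i:W\to M$ of a neighborhood $W$ of $N$ conjugating $X|_W$ and $Y|_{i(W)}$, and a compact manifold $\tilde N\subset M$ invariant under the flow of $Y$ with $i(N)\subset\tilde N$ which is eventually absolutely $1$-normally hyperbolic for the time-one flow $f$ of $Y$: there is a continuous $df$-invariant splitting $TM|_{\tilde N}=E^u\oplus T\tilde N\oplus E^s$ such that, for a Riemannian metric and some $g=f^k$, $k\ge1$, for $i=0,1$, $\inf_x m(dg_x|_{E^u})>\sup_x\|dg_x|_{T\tilde N}\|^i$ and $\sup_x\|dg_x|_{E^s}\|<\inf_x m(dg_x|_{T\tilde N})^i$, with $m(L)=\inf_{\|v\|=1}\|Lv\|$. *)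

(* Defs.v *)
(* Tori are handled through their universal covers: a point of T = R/Z is
   represented by a real number, a function on a torus by a Z-periodic function,
   a subset of a torus by its Z-invariant preimage.  Phase space T^n x R^n, with
   n = m + r, is covered by pairs (q, p) of [pt R m r], q = (q1, q2) and
   p = (p1, p2); extended phase space by triples (t, q, p). *)
From HB Require Import structures.
From mathcomp Require Import all_boot all_order all_algebra.
From mathcomp Require Import all_classical all_reals all_analysis.
Set Implicit Arguments.
Unset Strict Implicit.
Unset Printing Implicit Defensive.
Import Order.TTheory GRing.Theory Num.Theory numFieldNormedType.Exports.
Local Open Scope classical_set_scope.
Local Open Scope ring_scope.

Notation pt R m r := ('rV[R]_m * 'rV[R]_r)%type.
Notation phase R m r := (pt R m r * pt R m r)%type.
Notation ext R m r := (R * pt R m r * pt R m r)%type.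
(* parameters (t, q1, p1) of the cylinder *)
Notation base R m := (R * 'rV[R]_m * 'rV[R]_m)%type.

(* Integer vectors, as elements of R^n. *)
Definition zvec (R : realType) (n : nat) (k : 'rV[int]_n) : 'rV[R]_n :=
  map_mx intr k.

Section Norms.
Context {R : realType}.

Definition dot (n : nat) (u v : 'rV[R]_n) : R := \sum_(i < n) u 0 i * v 0 i.

(* Euclidean norms (the library norm on row vectors is the sup norm). *)
Definition enorm (n : nat) (x : 'rV[R]_n) : R := Num.sqrt (dot x x).

Definition enorm2 (n k : nat) (x : pt R n k) : R :=
  Num.sqrt (dot x.1 x.1 + dot x.2 x.2).

Definition enorm3 (n : nat) (x : base R n) : R :=
  Num.sqrt (x.1.1 ^+ 2 + dot x.1.2 x.1.2 + dot x.2 x.2).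

Definition open_ball (n : nat) (B : set 'rV[R]_n) : Prop :=
  exists (c : 'rV[R]_n) (rad : R),
    0 < rad /\ B = [set x | enorm (x - c) < rad].

End Norms.

Section Calculus.
Context {R : realType}.

(* C^k on an open set A of a finite-dimensional space: all iterated
   directional derivatives of order at most k exist and are continuous on A. *)
Fixpoint Ck_on (k : nat) (V W : normedModType R) (A : set V) (f : V -> W)
    : Prop :=
  match k with
  | 0 => forall x, A x -> {for x, continuous f}
  | k'.+1 => (forall x, A x -> differentiable f x) /\
             (forall v : V, Ck_on k' A (fun x => 'D_v f x))
  end.

Definition smooth_on (V W : normedModType R) (A : set V) (f : V -> W) : Prop :=
  forall k : nat, Ck_on k A f.

(* ||f||_{C^1(A)} <= c, for f defined on parameters (t, q1, p1). *)
Definition C1_bound (n k : nat) (A : set (base R n))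
    (f : base R n -> 'rV[R]_k) (c : R) : Prop :=
  forall x, A x ->
    enorm (f x) <= c /\ forall v, enorm ('d f x v) <= c * enorm3 v.

(* ∂F for a function F of (x1, x2). *)
Definition grad (m r : nat) (F : pt R m r -> R) (x : pt R m r) : pt R m r :=
  (\row_(i < m) 'D_((delta_mx 0 i, 0) : pt R m r) F x,
   \row_(j < r) 'D_((0, delta_mx 0 j) : pt R m r) F x).

Definition convex_fun (m r : nat) (F : pt R m r -> R) : Prop :=
  forall (x y : pt R m r) (a : R), 0 <= a <= 1 ->
    F (a *: x + (1 - a) *: y) <= a * F x + (1 - a) * F y.

Definition hessian_pos_def (V : normedModType R) (F : V -> R) (x : V) : Prop :=
  forall v : V, v != 0 -> 0 < 'D_v (fun y => 'D_v F y) x.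

Definition nondegenerate_local_min (V : normedModType R) (F : V -> R) (x : V)
    : Prop :=
  (\forall y \near x, F x <= F y) /\
  (forall v : V, v != 0 -> exists w : V, 'D_w (fun y => 'D_v F y) x != 0).

(* Integral over T^n, as an iterated integral over [0, 1]^n. *)
Fixpoint torus_integral (n : nat) : ('rV[R]_n -> R) -> R :=
  match n return ('rV[R]_n -> R) -> R with
  | 0 => fun f => f 0
  | n'.+1 => fun f =>
      Rintegral lebesgue_measure `[0%R, 1%R]
        (fun x : R => torus_integral
           (fun y : 'rV[R]_n' => f (row_mx (x%:M : 'rV[R]_1) y)))
  end.

End Calculus.

Section Hamiltonian.
Context {R : realType} {m r : nat}.

(* Diophantine frequencies with exponent tau; "Diophantine" means that this
   holds for some tau > 0. *)
Definition diophantine (tau : R) (omega : 'rV[R]_m) : Prop :=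
  exists2 gamma : R, 0 < gamma &
    forall (k : 'rV[int]_m) (l : int), (k, l) != 0 ->
      gamma * (Num.sqrt (dot (zvec R k) (zvec R k) + l%:~R ^+ 2)) `^ (- tau)
        <= `| dot (zvec R k) omega + l%:~R |.

Definition hamiltonian (h : pt R m r -> R) (G : ext R m r -> R) (eps : R)
    (z : ext R m r) : R := h z.2 - eps ^+ 2 * G z.

Definition ham_periodic (G : ext R m r -> R) : Prop :=
  forall (a : int) (k : 'rV[int]_m) (l : 'rV[int]_r) (z : ext R m r),
    G (z + (a%:~R, (zvec R k, zvec R l), 0)) = G z.

Definition averaged (G : ext R m r -> R) (p0 : pt R m r) (q2 : 'rV[R]_r) : R :=
  Rintegral lebesgue_measure `[0%R, 1%R]
    (fun t : R => torus_integral (fun q1 : 'rV[R]_m => G (t, (q1, q2), p0))).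

(* (∂_p H, -∂_q H) and (1, ∂_p H, -∂_q H) *)
Definition ham_field (H : ext R m r -> R) (z : ext R m r) : phase R m r :=
  (grad (fun p => H (z.1, p)) z.2,
   - grad (fun q => H (z.1.1, q, z.2)) z.1.2).

Definition ext_field (H : ext R m r -> R) (z : ext R m r) : ext R m r :=
  (1, (ham_field H z).1, (ham_field H z).2).

(* z' is the value at time 1 of a solution starting from z at time 0. *)
Definition time_one (H : ext R m r -> R) (z z' : phase R m r) : Prop :=
  exists c : R -> phase R m r,
    [/\ c 0 = z, c 1 = z' &
        forall s : R, 0 <= s <= 1 ->
          is_derive s (1 : R) c (ham_field H (s, (c s).1, (c s).2))].

(* The time-one flow; its value is meaningful only where it is defined. *)
Definition flow1 (H : ext R m r -> R) (z : phase R m r) : phase R m r :=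
  xget z [set z' | time_one H z z'].

Definition full_orbit_closed (X : ext R m r -> ext R m r) (S : set (ext R m r))
    : Prop :=
  forall z, S z -> exists c : R -> ext R m r,
    [/\ c 0 = z, (forall s : R, is_derive s (1 : R) c (X (c s))) &
        forall s, S (c s)].

End Hamiltonian.

(* Normal hyperbolicity.  Compact manifolds are realised as compact embedded
   submanifolds of some R^N (Whitney). *)
Section NormalHyperbolicity.
Context {R : realType}.

(* M is a submanifold of codimension c of R^N: locally a regular level set. *)
Definition submanifold (reg : forall V W : normedModType R,
      set V -> (V -> W) -> Prop)
    (N c : nat) (M : set 'rV[R]_N) : Prop :=
  forall x, M x -> exists (O : set 'rV[R]_N) (g : 'rV[R]_N -> 'rV[R]_c),
    [/\ open O, O x, reg _ _ O g,
        (forall y, O y -> (M y <-> g y = 0)) &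
        (forall y, O y -> forall w, exists v, 'd g y v = w)].

Definition tangent (N : nat) (M : set 'rV[R]_N) (x : 'rV[R]_N)
    : set 'rV[R]_N :=
  [set v | exists c : R -> 'rV[R]_N,
     [/\ c 0 = x, is_derive (0 : R) (1 : R) c v &
         \forall s \near (0 : R), M (c s)]].

Definition subspace (N : nat) (E : set 'rV[R]_N) : Prop :=
  E 0 /\ forall (a : R) u v, E u -> E v -> E (a *: u + v).

Definition is_flow (N : nat) (Y : 'rV[R]_N -> 'rV[R]_N)
    (fl : R -> 'rV[R]_N -> 'rV[R]_N) : Prop :=
  forall x, fl 0 x = x /\
    forall s : R, is_derive s (1 : R) (fun u => fl u x) (Y (fl s x)).

Definition riemannian_metric (N : nat) (M : set 'rV[R]_N)
    (gm : 'rV[R]_N -> 'M[R]_N) : Prop :=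
  smooth_on setT gm /\
  forall x, M x -> (gm x)^T = gm x /\
    forall v, tangent M x v -> v != 0 -> 0 < (v *m gm x *m v^T) 0 0.

Definition mnorm (N : nat) (gm : 'rV[R]_N -> 'M[R]_N) (x v : 'rV[R]_N) : R :=
  Num.sqrt ((v *m gm x *m v^T) 0 0).

(* ||dg_x|_E|| and m(dg_x|_E) *)
Definition op_norm (N : nat) (gm : 'rV[R]_N -> 'M[R]_N)
    (g : 'rV[R]_N -> 'rV[R]_N) (x : 'rV[R]_N) (E : set 'rV[R]_N) : \bar R :=
  ereal_sup [set (mnorm gm (g x) ('d g x v))%:E
            | v in [set v | E v /\ mnorm gm x v <= 1]].

Definition co_norm (N : nat) (gm : 'rV[R]_N -> 'M[R]_N)
    (g : 'rV[R]_N -> 'rV[R]_N) (x : 'rV[R]_N) (E : set 'rV[R]_N) : \bar R :=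
  ereal_inf [set (mnorm gm (g x) ('d g x v))%:E
            | v in [set v | E v /\ mnorm gm x v = 1]].

(* TM|_Nt = Eu (+) TNt (+) Es, the splitting being continuous: the projections
   are restrictions of linear maps depending continuously on the point. *)
Definition continuous_splitting (N : nat) (M Nt : set 'rV[R]_N)
    (Eu Es : 'rV[R]_N -> set 'rV[R]_N) : Prop :=
  (forall x, Nt x ->
    [/\ subspace (Eu x), subspace (Es x),
        Eu x `<=` tangent M x, Es x `<=` tangent M x &
        forall a b c, Eu x a -> tangent Nt x b -> Es x c ->
          a + b + c = 0 -> [/\ a = 0, b = 0 & c = 0]]) /\
  exists Pu Pc Ps : 'rV[R]_N -> 'M[R]_N,
    [/\ {within Nt, continuous Pu}, {within Nt, continuous Pc},
        {within Nt, continuous Ps} &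
        forall x v, Nt x -> tangent M x v ->
          [/\ Eu x (v *m Pu x), tangent Nt x (v *m Pc x), Es x (v *m Ps x) &
              v = v *m Pu x + v *m Pc x + v *m Ps x]].

Definition eventually_abs_normally_hyperbolic (N : nat) (M Nt : set 'rV[R]_N)
    (f : 'rV[R]_N -> 'rV[R]_N) : Prop :=
  exists Eu Es : 'rV[R]_N -> set 'rV[R]_N,
    [/\ continuous_splitting M Nt Eu Es,
        (forall x, Nt x -> 'd f x @` Eu x = Eu (f x) /\
                           'd f x @` Es x = Es (f x)) &
        exists (gm : 'rV[R]_N -> 'M[R]_N) (k : nat),
          [/\ riemannian_metric M gm, (1 <= k)%N &
              forall i : nat, (i <= 1)%N ->
                (ereal_sup [set (op_norm gm (iter k f) x (tangent Nt x) ^+ i)%E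
                           | x in Nt]
                 < ereal_inf [set co_norm gm (iter k f) x (Eu x)
                             | x in Nt])%E /\
                (ereal_sup [set op_norm gm (iter k f) x (Es x) | x in Nt]
                 < ereal_inf [set
                     (co_norm gm (iter k f) x (tangent Nt x) ^+ i)%E
                     | x in Nt])%E]].

Section Torus.
Context {m r : nat}.

(* Same point of T x T^n x R^n. *)
Definition same_pt (z z' : ext R m r) : Prop :=
  exists (a : int) (k : 'rV[int]_m) (l : 'rV[int]_r),
    z' = z + (a%:~R, (zvec R k, zvec R l), 0).

(* Embedding into R^N of the image in T x T^n x R^n of the open,
   lattice-invariant set W. *)
Definition embedding (N : nat) (W : set (ext R m r))
    (i : ext R m r -> 'rV[R]_N) : Prop :=
  [/\ smooth_on W i,
      (forall z z', W z -> W z' -> (i z = i z' <-> same_pt z z')),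
      (forall z v, W z -> 'd i z v = 0 -> v = 0) &
      (forall z (O : set (ext R m r)), W z -> nbhs z O ->
         exists2 O' : set 'rV[R]_N, nbhs (i z) O' &
           forall z', W z' -> O' (i z') ->
             exists2 z'', same_pt z' z'' & O z'')].

(* The vector field Y on M and its flow are taken as restrictions of a C^1
   vector field of R^N with a global flow: a C^1 vector field on the compact
   submanifold M always has a compactly supported extension. *)
Definition normally_hyperbolic (X : ext R m r -> ext R m r)
    (A : set (ext R m r)) : Prop :=
  exists (N c ct : nat) (M Nt : set 'rV[R]_N)
         (Y : 'rV[R]_N -> 'rV[R]_N) (fl : R -> 'rV[R]_N -> 'rV[R]_N)
         (W : set (ext R m r)) (i : ext R m r -> 'rV[R]_N),
    [/\ [/\ compact M, submanifold smooth_on c M,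
            Ck_on 1 setT Y, is_flow Y fl &
            forall x, M x -> tangent M x (Y x)],
        [/\ open W, A `<=` W,
            (forall z z', same_pt z z' -> W z -> W z'),
            (forall z, W z -> M (i z)) &
            embedding W i],
        (forall z, W z -> 'd i z (X z) = Y (i z)),
        [/\ compact Nt, submanifold (Ck_on 1) ct Nt, Nt `<=` M,
            (forall s x, Nt x -> Nt (fl s x)) &
            forall z, A z -> Nt (i z)] &
        eventually_abs_normally_hyperbolic M Nt (fl 1)].

End Torus.
End NormalHyperbolicity.

Section Cylinder.
Context {R : realType} {m r : nat}.
Implicit Types (H : ext R m r -> R) (B : set 'rV[R]_m) (U : set 'rV[R]_r).
Implicit Types (Q P : base R m -> 'rV[R]_r).

(* T x T^m x B *)
Definition over B : set (base R m) := [set x | B x.2].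

Definition base_periodic B Q : Prop :=
  forall (a : int) (k : 'rV[int]_m) (x : base R m), over B x ->
    Q (x + (a%:~R, zvec R k, 0)) = Q x.

Definition param Q P (x : base R m) : ext R m r :=
  (x.1.1, (x.1.2, Q x), (x.2, P x)).

(* Parametrisation by (q1, p1) of the section at time t. *)
Definition section Q P (t : R) (x : pt R m m) : phase R m r :=
  ((x.1, Q (t, x.1, x.2)), (x.2, P (t, x.1, x.2))).

(* A^eps *)
Definition cylinder B Q P : set (ext R m r) :=
  [set z | exists (x : base R m) (l : 'rV[int]_r),
     over B x /\ z = param Q P x + (0, (0, zvec R l), 0)].

(* A_0^eps, and A_00^eps when B is replaced by a smaller ball *)
Definition cylinder0 B Q P : set (phase R m r) :=
  [set z | exists (x : pt R m m) (l : 'rV[int]_r),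
     B x.2 /\ z = section Q P 0 x + ((0, zvec R l), 0)].

(* The tangent space of the cylinder is the image of the differential of its
   parametrisation. *)
Definition weakly_invariant H B Q P : Prop :=
  forall x, over B x ->
    exists v : base R m, 'd (param Q P) x v = ext_field H (param Q P x).

Definition locally_maximal H B U (eps : R) Q P : Prop :=
  forall S : set (ext R m r),
    full_orbit_closed (ext_field H) S ->
    S `<=` [set z | [/\ exists l : 'rV[int]_r, U (z.1.2.2 - zvec R l),
                        B z.2.1 & enorm z.2.2 <= eps]] ->
    S `<=` cylinder B Q P.

Definition omega0 (u v : phase R m r) : R :=
  dot u.1.1 v.2.1 + dot u.1.2 v.2.2 - (dot v.1.1 u.2.1 + dot v.1.2 u.2.2).

Definition symplectic B Q P : Prop :=
  forall (t : R) (x : pt R m m), B x.2 ->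
  forall u : pt R m m, u != 0 ->
    exists v : pt R m m,
      omega0 ('d (section Q P t) x u) ('d (section Q P t) x v) != 0.

(* U is a neighborhood of 0 in
   R^r small enough to be identified with its image in T^r, so that the maps to
   T^r with values in U are periodic maps to U. *)
Definition cylinder_family (h : pt R m r -> R) (G : ext R m r -> R)
    (P2 : 'rV[R]_m -> 'rV[R]_r) (kappa : R) B U (eps0 : R)
    (Q P : R -> base R m -> 'rV[R]_r) : Prop :=
  (forall eps : R, 0 < eps < eps0 ->
    [/\ [/\ Ck_on 1 (over B) (Q eps), Ck_on 1 (over B) (P eps),
            base_periodic B (Q eps), base_periodic B (P eps) &
            forall x, over B x -> U (Q eps x)],
        weakly_invariant (hamiltonian h G eps) B (Q eps) (P eps),
        (C1_bound (over B) (fun x => P eps x - P2 x.2) kappa /\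
         C1_bound (over B) (Q eps) (kappa / eps)),
        locally_maximal (hamiltonian h G eps) B U eps (Q eps) (P eps) &
        (normally_hyperbolic (ext_field (hamiltonian h G eps))
           (cylinder B (Q eps) (P eps)) /\
         symplectic B (Q eps) (P eps))]) /\
  (forall delta : R, 0 < delta ->
     \forall eps \near 0^'+, forall x, over B x ->
       enorm (P eps x - P2 x.2) <= delta).

(* Lifts of Phi and Phi_0. *)
Definition Phi H Q P (x : pt R m m) : pt R m m :=
  let z := flow1 H (section Q P 0 x) in (z.1.1, z.2.1).

Definition Phi0 (h : pt R m r -> R) (P2 : 'rV[R]_m -> 'rV[R]_r)
    (x : pt R m m) : pt R m m :=
  (x.1 + (grad h (x.2, P2 x.2)).1, x.2).

Definition inner_ball (p : 'rV[R]_m) B (B0 : set 'rV[R]_m) : Prop :=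
  [/\ open_ball B0, B0 p & closure B0 `<=` B].

End Cylinder.

(* Main.v *)
(* Along the orbits that lie on the cylinder the momenta vary by O(eps) during times of
   order 1/eps; this gives (i) and (ii), once weak invariance has been turned into
   invariance by a Gronwall estimate and [P2] has been bounded, by convexity of [h].

   For (iii), vectors tangent to the cylinder are followed during times of order 1/eps,
   in the variables (eps dq, dp). Since the frequency is close to the nonresonant
   (1, omega), Weyl equidistribution allows to replace the Hessian of [G] in q by its mean,
   whose only nonzero block is the Hessian of the averaged potential. In slow time, the
   averaged linear equations split into a shear W' = A B, B' = 0 and a saddle X' = K Y,
   Y' = V X, with A, K and V positive definite. By the C^1 bounds on the cylinder its
   tangent vectors with dq1 = 0 form, at every time, a graph over dp1; the shear moves these
   graphs apart, hence the whole tangent space is a graph over (W, B) with a uniform bound.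
   As X.Y grows exponentially in the saddle, such a bound at all times forces X and Y to be
   small compared to (W, B): the tangent space is close to dp2 = 'd P2 dp1, eps dq2 = 0,
   on which the linearised time-one map is close to the derivative of [Phi0]. *)
Require Import Defs.
From HB Require Import structures.
From mathcomp Require Import all_boot all_order all_algebra.
From mathcomp Require Import all_classical all_reals all_analysis.
From mathcomp Require Import ring lra.
Set Implicit Arguments.
Unset Strict Implicit.
Unset Printing Implicit Defensive.
Import Order.TTheory GRing.Theory Num.Theory numFieldNormedType.Exports.
Local Open Scope classical_set_scope.
Local Open Scope ring_scope.

(** * Finite-dimensional sup-normed spaces *)

(** The bound [kappa / eps] on dQ explains why only tangent vectors with dq1 = 0 are controlled a
    priori: in the variables (eps dq, dp) the slope over dp1 is of order 1, but the slope over eps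
    dq1 is bounded only by kappa / eps. The shear recovers the missing directions. As kappa is
    fixed, smallness has to come from the dynamics: a bounded graph at all times of a long interval
    is nearly flat at time 0.

    This interval is long but fixed in slow time, chosen from eta before eps. Over it the momenta
    move by O(eps), so an orbit started over a small ball stays near p0; A and K can be frozen at
    p0, while V follows q2 and stays positive definite because U lies in the ball of radius rho. The
    oscillating Hessian is removed by a moving average over a window of fixed length, with a
    corrector of size O(eps): no cohomological equation is solved, and second derivatives of G are
    only required to be continuous. The choices are made in the order eta, slow time, tolerance,
    window, radius of B_0, eps. *)

Class fdim (R : realType) (V : normedModType R) := Fdim {
  fd_n : nat;
  fd_phi : V -> 'rV[R]_fd_n;
  fd_psi : 'rV[R]_fd_n -> V;
  fd_lin : linear fd_phi;
  fd_phiK : cancel fd_phi fd_psi;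
  fd_psiK : cancel fd_psi fd_phi;
  fd_norm : forall v, `|fd_phi v| = `|v| }.

Arguments fd_n {R} V {fdim}.

Section RowNorm.
Context {R : realType}.

Lemma rv_norm_coord n (v : 'rV[R]_n) i : `|v 0 i| <= `|v|.
Proof.
rewrite [leRHS]/Num.Def.normr/= mx_normrE.
exact: (le_bigmax _ (fun ij : 'I_1 * 'I_n => `|v ij.1 ij.2|) (0, i)).
Qed.

Lemma rv_norm_le n (v : 'rV[R]_n) M : 0 <= M ->
  (forall i, `|v 0 i| <= M) -> `|v| <= M.
Proof.
move=> M0 h; rewrite [leLHS]/Num.Def.normr/= mx_normrE.
apply: bigmax_le => [//|ij _]; rewrite (ord1 ij.1); exact: h.
Qed.

Lemma rv_norm_row_mx n k (u : 'rV[R]_n) (v : 'rV[R]_k) :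
  `|row_mx u v| = Num.max `|u| `|v|.
Proof.
apply/eqP; rewrite eq_le; apply/andP; split.
  apply: rv_norm_le => [|i]; first by rewrite le_max normr_ge0.
  rewrite mxE le_max; case: fintype.split => j; first by rewrite rv_norm_coord.
  by rewrite orbC rv_norm_coord.
rewrite ge_max; apply/andP; split; apply: rv_norm_le => // i.
  by rewrite -(row_mxEl u v) rv_norm_coord.
by rewrite -(row_mxEr u v) rv_norm_coord.
Qed.

End RowNorm.

#[global] Instance fdim_rV (R : realType) n : fdim ('rV[R]_n : normedModType R).
Proof. by exists n id id. Defined.

#[global] Instance fdim_R (R : realType) : fdim (R : normedModType R).
Proof.
exists 1%N (fun x => x%:M) (fun v => v 0 0).
- by move=> a u v; apply/matrixP => i j; rewrite !ord1 !mxE eqxx !mulr1n.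
- by move=> x; rewrite mxE eqxx mulr1n.
- by move=> v; apply/matrixP => i j; rewrite !ord1 !mxE eqxx mulr1n.
- move=> v; apply/eqP; rewrite eq_le; apply/andP; split.
    by apply: rv_norm_le => // i; rewrite !ord1 mxE eqxx mulr1n.
  by have := rv_norm_coord (v%:M : 'rV[R]_1) 0; rewrite mxE eqxx mulr1n.
Defined.

(** The product norm is the max norm, hence concatenation of coordinate rows is again an isometry.
    With the two base instances, all spaces built from row vectors, such as [ext] or [base], get
    sup-norm coordinates by inference, and estimates can be proved one real coordinate at a time. *)
#[global] Instance fdim_prod (R : realType) (V W : normedModType R)
  (fV : fdim V) (fW : fdim W) : fdim ((V * W)%type : normedModType R).
Proof.
exists (fd_n V + fd_n W)%N (fun x => row_mx (fd_phi x.1) (fd_phi x.2))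
  (fun v => (fd_psi (lsubmx v), fd_psi (rsubmx v))).
- by move=> a u v /=; rewrite !fd_lin scale_row_mx add_row_mx.
- by move=> x; rewrite row_mxKl row_mxKr !fd_phiK -surjective_pairing.
- by move=> v /=; rewrite !fd_psiK hsubmxK.
- by move=> v; rewrite rv_norm_row_mx !fd_norm.
Defined.

Section FdimTheory.
Context {R : realType} {V : normedModType R} {fV : fdim V}.

Definition crd (k : 'I_(fd_n V)) (v : V) : R := fd_phi v 0 k.
Definition bvec (k : 'I_(fd_n V)) : V := fd_psi (delta_mx 0 k).

Lemma crd_linear k : linear (crd k : V -> R).
Proof. by move=> a u v; rewrite /crd fd_lin !mxE. Qed.

Lemma crdD k u v : crd k (u + v) = crd k u + crd k v.
Proof. by have := crd_linear k 1 u v; rewrite !scale1r. Qed.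

Lemma crd0 k : crd k 0 = 0.
Proof. by have := crdD k 0 0; rewrite addr0 => /eqP; rewrite addrC -subr_eq subrr => /eqP. Qed.

Lemma crdZ k a u : crd k (a *: u) = a * crd k u.
Proof. by have := crd_linear k a u 0; rewrite crd0 !addr0. Qed.

Lemma crdN k u : crd k (- u) = - crd k u.
Proof. by rewrite -scaleN1r crdZ mulN1r. Qed.

Lemma crdB k u v : crd k (u - v) = crd k u - crd k v.
Proof. by rewrite crdD crdN. Qed.

Lemma crd_le k v : `|crd k v| <= `|v|.
Proof. by rewrite -(fd_norm v) rv_norm_coord. Qed.

Lemma norm_le_crd v M : 0 <= M -> (forall k, `|crd k v| <= M) -> `|v| <= M.
Proof. by move=> M0 h; rewrite -(fd_norm v); exact: rv_norm_le. Qed.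

Lemma crd_inj u v : (forall k, crd k u = crd k v) -> u = v.
Proof.
move=> h; apply: (can_inj fd_phiK); apply/rowP => k; exact: h.
Qed.

Definition of_crd (a : 'I_(fd_n V) -> R) : V := fd_psi (\row_k a k).

Lemma of_crdK a k : crd k (of_crd a) = a k.
Proof. by rewrite /crd /of_crd fd_psiK mxE. Qed.

Lemma crd_sum (I : finType) (F : I -> V) k :
  crd k (\sum_i F i) = \sum_i crd k (F i).
Proof. by elim/big_rec2: _ => [|i y1 y2 _ <-]; rewrite ?crd0 ?crdD. Qed.

Lemma crd_basis v : v = \sum_k crd k v *: bvec k.
Proof.
apply: crd_inj => k; rewrite crd_sum (bigD1 k) //= crdZ.
have cb j : crd k (bvec j) = (j == k)%:R.
  by rewrite /crd /bvec fd_psiK mxE eqxx /= eq_sym.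
rewrite cb eqxx mulr1 big1 ?addr0 // => j jk.
by rewrite crdZ cb (negbTE jk) mulr0.
Qed.

Lemma bvec_norm k : `|bvec k| <= 1.
Proof.
rewrite -(fd_norm _) fd_psiK; apply: rv_norm_le => // i.
by rewrite mxE eqxx /=; case: (i == k); rewrite ?normr1 ?normr0.
Qed.

Lemma linear_bound {W : normedModType R} (L : V -> W) : linear L ->
  exists2 C : R, 0 <= C & forall v, `|L v| <= C * `|v|.
Proof.
move=> linL; pose C := \sum_k `|L (bvec k)|; exists C.
  by apply: sumr_ge0.
move=> v; have LD u w : L (u + w) = L u + L w by have := linL 1 u w; rewrite !scale1r.
have L0 : L 0 = 0.
  by have := LD 0 0; rewrite addr0 => /eqP; rewrite addrC -subr_eq subrr => /eqP.
have LZ a u : L (a *: u) = a *: L u by have := linL a u 0; rewrite L0 !addr0.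
have -> : L v = \sum_k crd k v *: L (bvec k).
  rewrite {1}(crd_basis v).
  by elim/big_rec2: _ => [|i y1 y2 _ <-]; rewrite ?L0 ?LD ?LZ.
rewrite (le_trans (ler_norm_sum _ _ _)) // mulr_suml.
apply: ler_sum => k _; rewrite normrZ mulrC.
by apply: ler_wpM2l => //; exact: crd_le.
Qed.

End FdimTheory.

(** Identities between vectors become ring identities in each coordinate. *)
Ltac crd_ring := apply: crd_inj => ?; rewrite ?(crdD, crdN, crdZ, crd0); ring.

(** * Derivatives in epsilon-delta form *)

Section EpsDelta.
Context {R : realType}.

Lemma nbhs0_ex (V : normedModType R) (P : V -> Prop) :
  (\forall u \near (0 : V), P u) <->
  exists2 d : R, 0 < d & forall u, `|u| < d -> P u.
Proof.
split=> [/nbhs_ballP[d /= d0 h]|[d d0 h]].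
  by exists d => // u ud; apply: h; rewrite -ball_normE /= sub0r normrN.
apply/nbhs_ballP; exists d => //= u; rewrite -ball_normE /= sub0r normrN.
exact: h.
Qed.

Lemma fin_common_delta (I : finType) (P : I -> R -> Prop) :
  (forall k d d', 0 < d' <= d -> P k d -> P k d') ->
  (forall k, exists2 d : R, 0 < d & P k d) ->
  exists2 d : R, 0 < d & forall k, P k d.
Proof.
move=> mono H; pose dd k := s2val (cid2 (H k)).
have dd0 k : 0 < dd k by exact: s2valP (cid2 (H k)).
have Pd k : P k (dd k) by exact: s2valP' (cid2 (H k)).
have d0 : 0 < \big[Num.min/1]_k dd k.
  by elim/big_ind: _ => // x y; rewrite lt_min => -> ->.
exists (\big[Num.min/1]_k dd k) => // k; apply: mono (Pd k).
by rewrite d0 (bigD1 k) //= ge_min lexx.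
Qed.

(** The increment inequality behind [is_derive], with an explicit radius that can be shrunk and made
    common to all coordinates by [fin_common_delta]. *)
Definition eps_der (V : normedModType R) (c : R -> V) (s : R) (v : V) : Prop :=
  forall e : R, 0 < e -> exists2 d : R, 0 < d &
    forall h : R, `|h| < d -> `|c (s + h) - c s - h *: v| <= e * `|h|.

Lemma derive_eps (V : normedModType R) (c : R -> V) s v :
  is_derive s (1 : R) c v -> eps_der c s v.
Proof.
case=> /derivable_nbhs cd <- e e0.
have := cd => /eqaddoP /(_ e e0); rewrite -/(nbhs 0 _) => /nbhs0_ex [d d0 H].
exists d => // h hd; have := H h hd; congr (`|_| <= _).
rewrite -![(_ + _ : _ -> _) _]/(_ + _) -![(- _ : _ -> _) _]/(- _) /cst /=.
by rewrite [h *: 1]mulr1 [h + s]addrC opprD addrA.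
Qed.

Lemma eps_derive (V : normedModType R) (c : R -> V) s v :
  eps_der c s v -> is_derive s (1 : R) c v.
Proof.
move=> H.
have cv : (fun h : R => h^-1 *: ((c \o shift s) (h *: (1 : R)) - c s)) @ 0^' --> v.
  apply/cvgrPdist_le => e e0; have [d d0 Hd] := H e e0.
  suff K : \forall h \near (0 : R), h != 0 ->
      `|v - h^-1 *: ((c \o shift s) (h *: (1 : R)) - c s)| <= e by exact: K.
  apply/nbhs0_ex; exists d => // h hd h0.
  rewrite /= [h *: 1]mulr1 [h + s]addrC.
  have -> : v - h^-1 *: (c (s + h) - c s) =
            - (h^-1 *: (c (s + h) - c s - h *: v)).
    by rewrite [in RHS]scalerBr scalerA mulVf // scale1r opprB.
  rewrite normrN normrZ normfV ler_pdivrMl ?normr_gt0 // mulrC.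
  exact: Hd.
split; first by apply/cvg_ex; exists v.
exact: cvg_lim cv.
Qed.

Lemma diff_eps (V W : normedModType R) (f : V -> W) x : differentiable f x ->
  forall e : R, 0 < e -> exists2 d : R, 0 < d &
    forall u, `|u| < d -> `|f (x + u) - f x - 'd f x u| <= e * `|u|.
Proof.
move=> /diff_locally df e e0.
have := df => /eqaddoP /(_ e e0); rewrite -/(nbhs 0 _) => /nbhs0_ex [d d0 H].
exists d => // h hd; have := H h hd; congr (`|_| <= _).
rewrite -![(_ + _ : _ -> _) _]/(_ + _) -![(- _ : _ -> _) _]/(- _) /cst /=.
by rewrite [h + x]addrC opprD addrA.
Qed.

(** The candidate [L] only has to be linear: the continuity demanded of a differential comes from
    [linear_bound] in finite dimension. This is how explicit differentials are computed below. *)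
Lemma eps_diff (V W : normedModType R) {fV : fdim V} (f : V -> W) x (L : V -> W) :
  linear L ->
  (forall e : R, 0 < e -> exists2 d : R, 0 < d &
    forall u, `|u| < d -> `|f (x + u) - f x - L u| <= e * `|u|) ->
  differentiable f x /\ 'd f x = L :> (V -> W).
Proof.
move=> linL H; have [C C0 Lb] := linear_bound linL.
pose L' : {linear V -> W} := HB.pack L
  (GRing.isLinear.Build _ _ _ _ L linL).
have cL : continuous L'.
  move=> u; apply/cvgrPdist_le => e e0.
  have C1 : 0 < C + 1 by rewrite ltr_wpDl.
  apply/nbhs_ballP; exists (e / (C + 1)); first exact: divr_gt0.
  move=> v; rewrite -ball_normE /= => uv.
  have -> : L' u - L' v = L' (u - v) by rewrite linearB.
  apply: (le_trans (Lb _)); rewrite ltW // (@le_lt_trans _ _ ((C+1) * `|u - v|)) //.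
    by apply: ler_wpM2r => //; rewrite lerDl.
  by rewrite -ltr_pdivlMl // mulrC.
have E : f \o shift x = cst (f x) + L' +o_ 0 id.
  apply/eqaddoP => e e0; have [d d0 Hd] := H e e0.
  rewrite -/(nbhs 0 _); apply/nbhs0_ex; exists d => // h hd.
  have := Hd h hd; congr (`|_| <= _).
  rewrite -![(_ + _ : _ -> _) _]/(_ + _) -![(- _ : _ -> _) _]/(- _) /cst /=.
  by rewrite [h + x]addrC opprD addrA.
have := diff_unique cL E => dE.
split; last by rewrite dE.
by apply/diff_locallyP; rewrite dE.
Qed.

Lemma eps_der_continuous (V : normedModType R) (c : R -> V) s v :
  is_derive s (1 : R) c v -> {for s, continuous c}.
Proof.
by case=> /derivable1_diffP /differentiable_continuous.
Qed.

Lemma is_derive_comp_diff (V W : normedModType R) (f : V -> W) (c : R -> V) s v :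
  differentiable f (c s) -> is_derive s (1 : R) c v ->
  is_derive s (1 : R) (fun u => f (c u)) ('d f (c s) v).
Proof.
move=> df [dc <-]; have dc' := dc; move/derivable1_diffP: dc' => dc'.
have dfc : differentiable (f \o c) s by exact: differentiable_comp.
split; first exact/derivable1_diffP.
rewrite deriveE // diff_comp //= [in RHS]deriveE //.
Qed.

Lemma is_derive_lin (V W : normedModType R) {fV : fdim V} (L : V -> W)
    (c : R -> V) s v :
  linear L -> is_derive s (1 : R) c v ->
  is_derive s (1 : R) (fun u => L (c u)) (L v).
Proof.
move=> linL dc.
have [dL EL] : differentiable L (c s) /\ 'd L (c s) = L :> (V -> W).
  apply: eps_diff => // e e0; exists 1 => // u _.
  rewrite [c s + u]addrC -[X in L (X + _)]scale1r linL scale1r addrK subrr.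
  by rewrite normr0 mulr_ge0 // ltW.
by have := is_derive_comp_diff dL dc; rewrite EL.
Qed.

Lemma is_derive_pair (V W : normedModType R) (c : R -> V) (d : R -> W) s v w :
  is_derive s (1 : R) c v -> is_derive s (1 : R) d w ->
  is_derive s (1 : R) (fun u => (c u, d u)) (v, w).
Proof.
move=> [/derivable1_diffP dc cE] [/derivable1_diffP dd dE].
have dp : differentiable (fun u => (c u, d u)) s by exact: differentiable_pair.
split; first exact/derivable1_diffP.
by rewrite deriveE // diff_pair //= -!deriveE // cE dE.
Qed.

Lemma is_derive_crd (V : normedModType R) {fV : fdim V} (c : R -> V) s v k :
  is_derive s (1 : R) c v ->
  is_derive s (1 : R) (fun u => crd k (c u)) (crd k v).
Proof. by apply: is_derive_lin => //; exact: crd_linear. Qed.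

Lemma crd_is_derive (V : normedModType R) {fV : fdim V} (c : R -> V) s v :
  (forall k, is_derive s (1 : R) (fun u => crd k (c u)) (crd k v)) ->
  is_derive s (1 : R) c v.
Proof.
move=> H; apply: eps_derive => e e0.
have [k d d' /andP[_ dd'] K h hd|k|d d0 Hd] := @fin_common_delta 'I_(fd_n V)
    (fun k d => forall h : R, `|h| < d ->
      `|crd k (c (s + h)) - crd k (c s) - h * crd k v| <= e * `|h|).
- by apply: K; exact: lt_le_trans dd'.
- exact: (derive_eps (H k) e0).
- exists d => // h hd; apply: norm_le_crd => [|k]; first by rewrite mulr_ge0 // ltW.
  by rewrite !crdB crdZ; exact: Hd.
Qed.

End EpsDelta.

(** * Mean value inequality, Gronwall, Picard *)

Section MeanValue.
Context {R : realType}.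

Lemma cont_epsP (V W : normedModType R) (f : V -> W) x :
  {for x, continuous f} <->
  forall e : R, 0 < e -> exists2 d : R, 0 < d &
    forall y, `|y - x| < d -> `|f y - f x| <= e.
Proof.
split=> [/cvgrPdist_le cf e e0|H].
  have := cf e e0 => /nbhs_ballP[d /= d0 h]; exists d => // y yd.
  by rewrite distrC; apply: h; rewrite -ball_normE /= distrC.
apply/cvgrPdist_le => e e0; have [d d0 h] := H e e0.
apply/nbhs_ballP; exists d => //= y; rewrite -ball_normE /= => yd.
by rewrite distrC; apply: h; rewrite distrC.
Qed.

Lemma is_derive_ext (V : normedModType R) (f g : R -> V) (s : R) (v : V) :
  (forall t, f t = g t) -> is_derive s (1 : R) f v -> is_derive s (1 : R) g v.
Proof. by move=> /funext ->. Qed.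

Lemma der_ge0_le (f f' : R -> R) (a b : R) : a <= b ->
  (forall s : R, a <= s <= b -> is_derive s (1 : R) f (f' s)) ->
  (forall s : R, a <= s <= b -> 0 <= f' s) -> f a <= f b.
Proof.
move=> ab df f'0.
have [||c cab E] := @MVT_segment R f f' a b ab.
- move=> s sab; apply: df.
  by move: sab; rewrite in_itv /= => /andP[/ltW -> /ltW ->].
- apply: derivable_within_continuous => s sab.
  by have [] := df s ltac:(by move: sab; rewrite in_itv /=).
rewrite -subr_ge0 E mulr_ge0 ?subr_ge0 //; apply: f'0.
by move: cab; rewrite in_itv.
Qed.

(** In the sup norm it suffices to compare coordinates: [g + crd k c] and [g - crd k c] are
    nondecreasing for every [k], so that no dimensional constant appears. *)
Lemma mean_value_ineq (V : normedModType R) {fV : fdim V} (c c' : R -> V)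
    (g g' : R -> R) (a b : R) : a <= b ->
  (forall s : R, a <= s <= b -> is_derive s (1 : R) c (c' s)) ->
  (forall s : R, a <= s <= b -> is_derive s (1 : R) g (g' s)) ->
  (forall s : R, a <= s <= b -> `|c' s| <= g' s) ->
  `|c b - c a| <= g b - g a.
Proof.
move=> ab dc dg le; have g0 : g a <= g b.
  apply: (@der_ge0_le g g') => // s sab.
  by apply: le_trans (le s sab); exact: normr_ge0.
apply: norm_le_crd => [|k]; first by rewrite subr_ge0.
have lek s : a <= s <= b -> - g' s <= crd k (c' s) <= g' s.
  by move=> sab; rewrite -ler_norml (le_trans (crd_le _ _)) ?le.
rewrite crdB ler_norml; apply/andP; split.
- have : g a + crd k (c a) <= g b + crd k (c b).
    apply: (@der_ge0_le (fun s => g s + crd k (c s)) (fun s => g' s + crd k (c' s))) => //.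
      move=> s sab; have ? := dg s sab; have ? := is_derive_crd k (dc s sab).
      exact: is_deriveD.
    by move=> s sab; have /andP[] := lek s sab; lra.
  lra.
- have : g a - crd k (c a) <= g b - crd k (c b).
    apply: (@der_ge0_le (fun s => g s - crd k (c s)) (fun s => g' s - crd k (c' s))) => //.
      move=> s sab; have ? := dg s sab; have ? := is_derive_crd k (dc s sab).
      exact: is_deriveB.
    by move=> s sab; have /andP[] := lek s sab; lra.
  lra.
Qed.

Lemma is_derive_affine (V : normedModType R) (u : R -> V) (v : V) (al be s : R) :
  is_derive (al * s + be) (1 : R) u v ->
  is_derive s (1 : R) (fun t => u (al * t + be)) (al *: v).
Proof.
move=> [du uE]; have dfu : differentiable u (al * s + be) by exact/derivable1_diffP.
have dl : is_derive s (1 : R) (fun t : R => al * t + be) al.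
  apply: eps_derive => e e0; exists 1 => // h _.
  have -> : al * (s + h) + be - (al * s + be) - h *: al = 0.
    by rewrite [h *: al]mulrC; ring.
  by rewrite normr0 mulr_ge0 // ltW.
have := @is_derive_comp_diff R R V u (fun t => al * t + be) s al dfu dl.
suff -> : 'd u (al * s + be) al = al *: v by [].
by rewrite -uE deriveE // -linearZ /= [al *: 1]mulr1.
Qed.

Lemma mean_value_const (V : normedModType R) {fV : fdim V} (c c' : R -> V)
    (C a b : R) : a <= b ->
  (forall s : R, a <= s <= b -> is_derive s (1 : R) c (c' s)) ->
  (forall s : R, a <= s <= b -> `|c' s| <= C) ->
  `|c b - c a| <= C * (b - a).
Proof.
move=> ab dc le; rewrite mulrBr.
apply: (@mean_value_ineq _ _ c c' (fun s => C * s) (fun _ => C)) => // s _.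
have := @is_derive_affine R^o id 1 C 0 s (is_derive_id _ _).
rewrite [C *: _]mulr1; apply: is_derive_ext.
by move=> t; rewrite addr0.
Qed.

Lemma segment_bounded (V : normedModType R) (u : R -> V) (a b : R) :
  (forall s : R, a <= s <= b -> {for s, continuous u}) ->
  exists2 M : R, 0 <= M & forall s : R, a <= s <= b -> `|u s| <= M.
Proof.
move=> cu; have [ab|ba] := leP a b; last first.
  exists 0 => // s /andP[as_ sb]; have := le_trans as_ sb.
  by rewrite leNgt ba.
have [|c cab cm] := @EVT_max R (fun s => `|u s|) a b ab.
  apply/continuous_in_subspaceT => z /[1!inE] /=; rewrite in_itv /= => zab.
  by apply: (@continuous_comp _ _ _ u (@Num.norm R V)); [exact: cu|exact: norm_continuous].
by exists `|u c| => // s sab; apply: cm; rewrite in_itv.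
Qed.

Lemma expR_lin_derive (L s : R) :
  is_derive s (1 : R) (fun t => expR (L * t)) (L * expR (L * s)).
Proof.
have := @is_derive_affine R^o expR (expR (L * s + 0)) L 0 s (is_derive_expR _).
rewrite addr0 [L *: _]/(L * _); apply: is_derive_ext.
by move=> t; rewrite addr0.
Qed.

(** The norm is never differentiated. With [N] the maximum of the weighted norm, the integral of
    [L * N * expR (2 * L * (s - a))] is at most half of [N * expR (2 * L * (s - a))], so half of the
    maximum is bounded by the initial value and [K]. The two factors 2 are the price of this
    absorption. *)
Lemma gronwall_forward (V : normedModType R) {fV : fdim V} (u u' : R -> V)
    (L K a b : R) : 0 <= L -> 0 <= K -> a <= b ->
  (forall s : R, a <= s <= b -> is_derive s (1 : R) u (u' s)) ->
  (forall s : R, a <= s <= b -> `|u' s| <= L * `|u s| + K) ->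
  `|u b| <= 2 * (`|u a| + K * (b - a)) * expR (2 * L * (b - a)).
Proof.
move=> L0 K0 ab du le.
(* at a maximum of |u| weighted by exp (- 2 L s), the term L |u| is absorbed *)
pose f s := expR (- (2 * L) * (s - a)) * `|u s|.
have [|c] := @EVT_max R f a b ab.
  apply/continuous_in_subspaceT => z /[1!inE] /=; rewrite in_itv /= => zab.
  apply: (@continuousM R R (fun s => expR (- (2 * L) * (s - a))) (fun s => `|u s|)).
    have := @is_derive_affine R expR (expR (- (2 * L) * z + 2 * L * a))
      (- (2 * L)) (2 * L * a) z (is_derive_expR _).
    move=> /eps_der_continuous; rewrite (_ : (fun t => _) =
      (fun s => expR (- (2 * L) * (s - a)))) //.
    by apply/funext => t; congr expR; ring.
  apply: (@continuous_comp _ _ _ u (@Num.norm R V)); last exact: norm_continuous.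
  exact: eps_der_continuous (du z zab).
rewrite in_itv /= => cab cm; set N := f c in cm *.
have N0 : 0 <= N by rewrite /N /f mulr_ge0 ?expR_ge0.
have uN s : a <= s <= b -> `|u s| <= N * expR (2 * L * (s - a)).
  move=> sab; have := cm s ltac:(by rewrite in_itv).
  rewrite /f mulNr expRN ler_pdivrMl ?expR_gt0 // mulrC //.
have /andP[ac cb] := cab.
have key : `|u c - u a| <= (N / 2 * expR (2 * L * (c - a)) + K * c) -
   (N / 2 * expR (2 * L * (a - a)) + K * a).
  apply: (@mean_value_ineq _ _ u u'
    (fun s => N / 2 * expR (2 * L * (s - a)) + K * s)
    (fun s => L * (N * expR (2 * L * (s - a))) + K)) => // s /andP[as_ sc].
  - by apply: du; rewrite as_ (le_trans sc).
  - apply: is_deriveD; last first.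
      have := @is_derive_affine R^o id 1 K 0 s (is_derive_id _ _).
      rewrite [K *: _]mulr1; apply: is_derive_ext.
      by move=> t; rewrite addr0.
    have h1 := @is_derive_affine R^o expR (expR (2 * L * s + (- (2 * L * a))))
       (2 * L) (- (2 * L * a)) s (is_derive_expR _).
    have h2 := @is_deriveZ _ _ _ _ (N / 2) _ _ _ h1.
    have -> : L * (N * expR (2 * L * (s - a))) =
       (N / 2) *: ((2 * L) *: expR (2 * L * s - 2 * L * a)).
      by rewrite /GRing.scale /= -mulrBr; field.
    apply: is_derive_ext h2 => t.
    by rewrite -[LHS]/((N / 2) * _) -mulrBr.
  - have sab : a <= s <= b by rewrite as_ (le_trans sc).
    by apply: le_trans (le s sab) _; rewrite lerD2r ler_wpM2l // uN.
have ucE : `|u c| = N * expR (2 * L * (c - a)).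
  by rewrite /N /f mulNr expRN mulrC mulrA divff ?mul1r // gt_eqF // expR_gt0.
have e1 : 1 <= expR (2 * L * (c - a)).
  by rewrite -expR0 ler_expR mulr_ge0 ?mulr_ge0 // subr_ge0.
have Nb : N <= 2 * (`|u a| + K * (b - a)).
  have t1 : `|u c| <= `|u c - u a| + `|u a|.
    by rewrite -{1}(subrK (u a) (u c)) ler_normD.
  have t2 : K * (c - a) <= K * (b - a) by rewrite ler_wpM2l // lerD2r.
  rewrite subrr mulr0 expR0 in key; nra.
apply: le_trans (uN b _) _; first by rewrite ab lexx.
by apply: ler_wpM2r => //; exact: expR_ge0.
Qed.

Lemma gronwall (V : normedModType R) {fV : fdim V} (u u' : R -> V)
    (L K t0 T : R) : 0 <= L -> 0 <= K ->
  (forall s : R, `|s - t0| <= T -> is_derive s (1 : R) u (u' s)) ->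
  (forall s : R, `|s - t0| <= T -> `|u' s| <= L * `|u s| + K) ->
  forall s : R, `|s - t0| <= T -> `|u s| <= 2 * (`|u t0| + K * T) * expR (2 * L * T).
Proof.
move=> L0 K0 du le s sT.
suff : `|u s| <= 2 * (`|u t0| + K * `|s - t0|) * expR (2 * L * `|s - t0|).
  move=> /le_trans; apply; apply: ler_pM.
  - by rewrite mulr_ge0 // addr_ge0 // mulr_ge0.
  - exact: expR_ge0.
  - by rewrite ler_wpM2l // lerD2l ler_wpM2l.
  - by rewrite ler_expR ler_wpM2l // mulr_ge0.
have [st|ts] := leP t0 s.
  rewrite ger0_norm ?subr_ge0 //; rewrite ger0_norm ?subr_ge0 // in sT.
  have in_ z : t0 <= z <= s -> `|z - t0| <= T.
    by move=> /andP[z1 z2]; rewrite ger0_norm ?subr_ge0 // (le_trans _ sT) // lerD2r.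
  by apply: (@gronwall_forward V fV u u') => // z /in_; [exact: du|exact: le].
rewrite ltr0_norm ?subr_lt0 // opprB; rewrite ltr0_norm ?subr_lt0 // opprB in sT.
have in_ z : - t0 <= z <= - s -> `|(- 1 * z + 0) - t0| <= T.
  move=> /andP[z1 z2]; rewrite mulN1r addr0 ler0_norm; first lra.
  lra.
(* Times before [t0] are reached by reflection, written as an affine map so that [is_derive_affine]
   applies. *)
have := @gronwall_forward V fV (fun z => u (- 1 * z + 0))
   (fun z => (- 1) *: u' (- 1 * z + 0)) L K (- t0) (- s) L0 K0.
rewrite lerN2 (ltW ts) => /(_ isT).
rewrite !mulN1r !addr0 !opprK [- s + t0]addrC; apply.
  by move=> z /in_ zT; apply: is_derive_affine; exact: du.
by move=> z /in_ zT; rewrite normrZ normrN normr1 mul1r; exact: le.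
Qed.

Lemma ode_unique (V : normedModType R) {fV : fdim V} (f : R -> V -> V) (L : R)
    (u v : R -> V) (a b : R) : 0 <= L -> a <= b ->
  (forall s : R, a <= s <= b -> `|f s (u s) - f s (v s)| <= L * `|u s - v s|) ->
  (forall s : R, a <= s <= b -> is_derive s (1 : R) u (f s (u s))) ->
  (forall s : R, a <= s <= b -> is_derive s (1 : R) v (f s (v s))) ->
  u a = v a -> u b = v b.
Proof.
move=> L0 ab lip du dv uv0; apply/eqP; rewrite -subr_eq0 -normr_le0.
have := @gronwall_forward V fV (fun s => u s - v s)
   (fun s => f s (u s) - f s (v s)) L 0 a b L0 (lexx _) ab.
rewrite uv0 subrr normr0 mul0r addr0 mulr0 mul0r; apply.
  by move=> s sab; have ? := du s sab; have ? := dv s sab; exact: is_deriveB.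
by move=> s sab; rewrite addr0; exact: lip.
Qed.

(** * Primitives *)

Lemma real_primitive (f : R -> R) : continuous f ->
  exists F : R -> R, F 0 = 0 /\ forall s : R, is_derive s (1 : R) F (f s).
Proof.
move=> cf; pose mu := @lebesgue_measure R.
pose Fa (a x : R) := (\int[mu]_(t in `[a, x]) (f t))%R.
have dFa (a x : R) : a < x -> is_derive x (1 : R) (Fa a) (f x).
  move=> ax; have [|||d1 d2] := @continuous_FTC1 R f (BLeft a) x (x + 1) _ _ _ (cf x).
  - by rewrite ltrDl.
  - apply: continuous_compact_integrable; first exact: segment_compact.
    exact: continuous_subspaceT.
  - by rewrite lte_fin.
  by apply: DeriveDef; [exact: d1|rewrite -derive1E; exact: d2].
(* The integral from [a] is a primitive only to the right of [a], so the base point is moved to the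
   left of both [x] and 0; subtracting the value at 0 makes the result independent of it, which is
   [indep]. *)
pose F x := Fa (- (`|x| + 1)) x - Fa (- (`|x| + 1)) 0.
have indep (a b x : R) : a <= b -> b < x -> b < 0 -> Fa a x - Fa a 0 = Fa b x - Fa b 0.
  move=> ab bx b0.
  pose g s := Fa a s - Fa b s.
  have dg (s : R) : b < s -> is_derive s (1 : R) g 0.
    move=> bs; rewrite -(subrr (f s)); have ? := dFa a s (le_lt_trans ab bs).
    by have ? := dFa b s bs; exact: is_deriveB.
  have gc (s t : R) : b < s -> s <= t -> g s = g t.
    move=> bs st; apply/eqP; rewrite eq_sym -subr_eq0 -normr_le0.
    have := @mean_value_const _ _ g (fun _ => 0) 0 s t st; rewrite mul0r; apply.
      by move=> z /andP[sz _]; apply: dg; exact: lt_le_trans sz.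
    by move=> *; rewrite normr0.
  have : g x = g 0 by have [x0|x0] := leP x 0; [apply: gc|apply/esym/gc => //; exact: ltW].
  rewrite /g; lra.
exists F; split; first by rewrite /F subrr.
move=> s; pose a := - (`|s| + 2).
have : is_derive s (1 : R) (fun x => Fa a x - cst (Fa a 0) x) (f s - 0).
  have ? : is_derive s (1 : R) (Fa a) (f s).
    by apply: dFa; have := ler_norm (- s); rewrite normrN /a; lra.
  exact: is_deriveB.
rewrite subr0; apply: near_eq_is_derive.
near=> x; rewrite /F /=; apply: indep.
- rewrite /a lerN2; suff : `|x - s| <= 1.
    by have := ler_normD (x - s) s; rewrite subrK; lra.
  near: x; apply/nbhs_ballP; exists 1 => //= y; rewrite /ball /= distrC.
  exact: ltW.
- by have := ler_norm (- x); rewrite normrN; lra.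
- by have := normr_ge0 x; lra.
Unshelve. all: by end_near. Qed.

Lemma primitive (V : normedModType R) {fV : fdim V} (f : R -> V) (v0 : V) :
  continuous f ->
  exists F : R -> V, F 0 = v0 /\ forall s : R, is_derive s (1 : R) F (f s).
Proof.
move=> cf.
have H k : exists F : R -> R, F 0 = 0 /\
    forall s : R, is_derive s (1 : R) F (crd k (f s)).
  apply: real_primitive => s; apply/cont_epsP => e e0.
  have /cont_epsP/(_ e e0)[d d0 h] := cf s; exists d => // y yd.
  by rewrite -crdB; apply: le_trans (crd_le _ _) _; exact: h.
pose F k := sval (cid (H k)).
have F0 k : F k 0 = 0 by exact: (svalP (cid (H k))).1.
have dF k s : is_derive s (1 : R) (F k) (crd k (f s)).
  exact: (svalP (cid (H k))).2.
exists (fun s => v0 + of_crd (fun k => F k s)); split.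
  suff -> : of_crd (fun k => F k 0) = 0 :> V by rewrite addr0.
  by apply: crd_inj => k; rewrite of_crdK F0 crd0.
move=> s; apply: crd_is_derive => k; have dk := dF k s.
have dd : is_derive s (1 : R) (fun u => cst (crd k v0) u + F k u) (0 + crd k (f s)).
  exact: is_deriveD.
rewrite add0r in dd; by apply: is_derive_ext dd => t; rewrite crdD of_crdK.
Qed.

End MeanValue.

(** * Global solutions of Lipschitz equations and their linearisation *)

Section Picard.
Context {R : realType} {V : normedModType R} {fV : fdim V}.

(** In the norm weighted by [expR (- 2 * L * |s|)], integration followed by a Lipschitz map of
    constant [L] contracts by 1/2, on intervals of any length. *)
Lemma weighted_mean_value (w w' : R -> V) (L N T : R) : 0 <= L -> 0 <= N ->
  (forall s : R, `|s| <= T -> is_derive s (1 : R) w (w' s)) ->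
  (forall s : R, `|s| <= T -> `|w' s| <= L * (N * expR (2 * L * `|s|))) ->
  w 0 = 0 -> forall s : R, `|s| <= T -> `|w s| <= N / 2 * expR (2 * L * `|s|).
Proof.
move=> L0 N0 dw le w0 s sT.
have fwd (v v' : R -> V) (b : R) : 0 <= b -> v 0 = 0 ->
    (forall z : R, 0 <= z <= b -> is_derive z (1 : R) v (v' z)) ->
    (forall z : R, 0 <= z <= b -> `|v' z| <= L * (N * expR (2 * L * z))) ->
    `|v b| <= N / 2 * expR (2 * L * b).
  move=> b0 v0 dv lv.
  have : `|v b - v 0| <= N / 2 * expR (2 * L * b) - N / 2 * expR (2 * L * 0).
    apply: (@mean_value_ineq _ _ _ v v' (fun z => N / 2 * expR (2 * L * z))
      (fun z => L * (N * expR (2 * L * z)))) => // z _.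
    have h := @is_deriveZ _ _ _ _ (N / 2) _ _ _ (expR_lin_derive (2 * L) z).
    have -> : L * (N * expR (2 * L * z)) =
       (N / 2) *: (2 * L * expR (2 * L * z)) by rewrite /GRing.scale /=; field.
    exact: h.
  by rewrite v0 subr0 mulr0 expR0 mulr1 => /le_trans; apply; lra.
have [s0|s0] := leP 0 s.
  rewrite ger0_norm //; rewrite ger0_norm // in sT.
  apply: (fwd w w') => // z /andP[z0 zs]; have zT : `|z| <= T.
  - by rewrite ger0_norm // (le_trans zs).
  - exact: dw.
  - by rewrite ger0_norm // (le_trans zs).
  - by have := le z zT; rewrite (ger0_norm z0).
rewrite ltr0_norm //; rewrite ltr0_norm // in sT.
have := fwd (fun z => w (- 1 * z + 0)) (fun z => (- 1) *: w' (- 1 * z + 0)) (- s).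
rewrite !mulN1r !addr0 !oppr0 !opprK; apply => //.
- by rewrite oppr_ge0 ltW.
- move=> z /andP[z0 zs]; apply: is_derive_affine; apply: dw.
  by rewrite mulN1r addr0 normrN ger0_norm // (le_trans zs).
- move=> z /andP[z0 zs]; rewrite normrZ normrN normr1 mul1r.
  have := le (- 1 * z + 0); rewrite mulN1r addr0 normrN ger0_norm //; apply.
  exact: le_trans zs sT.
Qed.

(** Nested intervals: the limit is the supremum of the nondecreasing left ends [a n - 2 D / 2^n],
    each of which lies below all the right ends. *)
Lemma geometric_cauchy (a : nat -> R) (D : R) : 0 <= D ->
  (forall n, `|a n.+1 - a n| <= D * 2^-1 ^+ n) ->
  exists l : R, forall n, `|a n - l| <= 2 * D * 2^-1 ^+ n.
Proof.
move=> D0 H; pose lo n := a n - 2 * D * 2^-1 ^+ n.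
pose hi n := a n + 2 * D * 2^-1 ^+ n.
have hp n : 0 <= D * 2^-1 ^+ n by rewrite mulr_ge0 // exprn_ge0.
have stepE n : D * 2^-1 ^+ n.+1 = D * 2^-1 ^+ n / 2 by rewrite exprS; field.
have loS n : lo n <= lo n.+1.
  have := H n; rewrite /lo ler_norml -!mulrA stepE => /andP[]; lra.
have hiS n : hi n.+1 <= hi n.
  have := H n; rewrite /hi ler_norml -!mulrA stepE => /andP[]; lra.
have lohi n : lo n <= hi n by rewrite /lo /hi -!mulrA; have := hp n; lra.
have loM n k : lo n <= lo (n + k)%N.
  by elim: k => [|k]; rewrite ?addn0 // addnS => /le_trans; apply.
have hiM n k : hi (n + k)%N <= hi n.
  by elim: k => [|k]; rewrite ?addn0 // addnS; apply: le_trans.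
have cross n k : lo n <= hi k.
  apply: le_trans (loM n k) _; apply: le_trans (lohi _) _.
  by rewrite addnC; exact: hiM.
pose S := [set x | exists n, x = lo n].
have Sub : has_sup S.
  split; first by exists (lo 0%N), 0%N.
  by exists (hi 0%N) => _ [n ->].
exists (sup S) => n; rewrite ler_distl; apply/andP; split.
- have : sup S <= hi n by apply: ge_sup; [exact: Sub.1|move=> _ [k ->]; exact: cross].
  by rewrite /hi; lra.
- have : lo n <= sup S by apply: ub_le_sup; [exact: Sub.2|exists n].
  by rewrite /lo; lra.
Qed.

(** The contraction by 1/2 in the weighted norm holds on every [-T, T], so the solution is global.
    Time dependence is constrained only through continuity along continuous curves, and the limit of
    the iterates is taken coordinate by coordinate. *)
Lemma picard (f : R -> V -> V) (L : R) (x0 : V) : 0 <= L ->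
  (forall s x y, `|f s x - f s y| <= L * `|x - y|) ->
  (forall u : R -> V, continuous u -> continuous (fun s => f s (u s))) ->
  exists u : R -> V, u 0 = x0 /\ forall s : R, is_derive s (1 : R) u (f s (u s)).
Proof.
move=> L0 lip fc.
pose good (p : (R -> V) * (R -> V)) :=
  p.2 0 = x0 /\ forall s : R, is_derive s (1 : R) p.2 (f s (p.1 s)).
(* A discontinuous [u] is sent to itself, which makes the Picard map total. *)
have step (u : R -> V) : exists v : R -> V, continuous u -> good (u, v).
  have [cu|ncu] := pselect (continuous u); last by exists u => /ncu.
  by have [F [F0 dF]] := primitive x0 (fc _ cu); exists F.
pose nxt u := sval (cid (step u)).
have nxtP u : continuous u -> good (u, nxt u) by exact: svalP (cid (step u)).
pose U n := iter n nxt (cst x0).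
have cU n : continuous (U n).
  elim: n => [|n IH]; first exact: cst_continuous.
  by move=> s; have [_ /(_ s) /eps_der_continuous] := nxtP _ IH.
have US n : U n.+1 0 = x0 /\ forall s : R, is_derive s (1 : R) (U n.+1) (f s (U n s)).
  exact: nxtP.
have U0 n : U n 0 = x0 by case: n => [//|n]; exact: (US n).1.
have bnd T : exists2 C : R, 0 <= C & forall n (s : R), `|s| <= T ->
    `|U n.+1 s - U n s| <= C * 2^-1 ^+ n * expR (2 * L * `|s|).
  have [C C0 HC] := @segment_bounded R V (fun s => U 1%N s - U 0%N s) (- T) T
    (fun s _ => continuousB (cU 1%N s) (cU 0%N s)).
  exists C => //; elim=> [|n IH] s sT.
    rewrite expr0 mulr1; apply: le_trans (HC s _) _; first by rewrite -ler_norml.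
    by rewrite ler_peMr // -expR0 ler_expR mulr_ge0 // mulr_ge0.
  rewrite exprSr mulrA.
  apply: (@weighted_mean_value (fun s => U n.+2 s - U n.+1 s)
    (fun s => f s (U n.+1 s) - f s (U n s)) L (C * 2^-1 ^+ n) T) => //.
  - by rewrite mulr_ge0 // exprn_ge0.
  - move=> z _; have ? := (US n.+1).2 z; have ? := (US n).2 z.
    exact: is_deriveB.
  - by move=> z zT; apply: le_trans (lip _ _ _) _; rewrite ler_wpM2l // IH.
  - by rewrite !U0 subrr.
have lim (s : R) : exists l : V, forall k, exists D : R, forall n, 
    `|crd k (U n s) - crd k l| <= 2 * D * 2^-1 ^+ n.
  have [C C0 HC] := bnd `|s|; pose D := C * expR (2 * L * `|s|).
  have D0 : 0 <= D by rewrite mulr_ge0 // expR_ge0.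
  have H k : exists l : R, forall n, `|crd k (U n s) - l| <= 2 * D * 2^-1 ^+ n.
    apply: geometric_cauchy => // n; rewrite -crdB.
    apply: le_trans (crd_le _ _) _; apply: le_trans (HC n s (lexx _)) _.
    by rewrite /D mulrAC.
  exists (of_crd (fun k => sval (cid (H k)))) => k; exists D => n.
  by rewrite of_crdK; exact: (svalP (cid (H k))).
pose u s := sval (cid (lim s)).
have uP T : exists2 C : R, 0 <= C & forall n (s : R), `|s| <= T ->
    `|U n s - u s| <= C * 2^-1 ^+ n * expR (2 * L * `|s|).
  have [C C0 HC] := bnd T; exists (2 * C); first by rewrite mulr_ge0.
  move=> n s sT; pose D := C * expR (2 * L * `|s|).
  have D0 : 0 <= D by rewrite mulr_ge0 // expR_ge0.
  (* Telescoping from [n] to [n + p]. The subtracted term keeps the induction closed; it is dropped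
     once [p] is so large that the distance to the limit is below [e]. *)
  have tail k p : `|crd k (U n s) - crd k (U (n + p)%N s)| <= 2 * D * 2^-1 ^+ n - 2 * D * 2^-1 ^+ (n + p)%N.
    elim: p => [|p IH]; first by rewrite addn0 !subrr normr0.
    have := HC (n + p)%N s sT; move=> /(le_trans (crd_le k _)).
    rewrite crdB distrC addnS mulrAC -/D => h.
    apply: le_trans (ler_distD (crd k (U (n + p)%N s)) _ _) _.
    apply: le_trans (lerD IH h) _.
    by rewrite exprS; lra.
  apply: norm_le_crd => [|k]; first by rewrite !mulr_ge0 ?exprn_ge0 ?expR_ge0.
  have [D' HD'] := svalP (cid (lim s)) k; rewrite -/(u s) in HD'.
  rewrite crdB; apply/ler_addgt0Pr => e e0.
  have [p hp] : exists p, 2 * D' * 2^-1 ^+ (n + p)%N <= e.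
    have /cvgrPdist_le /(_ e e0) [p _ hp] :
        (fun p => 2 * D' * 2^-1 ^+ (n + p)%N) @ \oo --> (0 : R).
      rewrite -(mulr0 (2 * D')); apply: cvgMl_tmp.
      rewrite -(mulr0 (2^-1 ^+ n)); under eq_fun do rewrite exprD.
      apply: cvgMl_tmp; apply: cvg_expr.
      by rewrite ger0_norm //; lra.
    exists p; have := hp p (leqnn p); rewrite /= sub0r normrN => /(le_trans _); apply.
    exact: ler_norm.
  apply: le_trans (ler_distD (crd k (U (n + p)%N s)) _ _) _.
  apply: lerD; last exact: le_trans (HD' _) hp.
  apply: le_trans (tail k p) _; rewrite /D.
  have : 0 <= 2 * (C * expR (2 * L * `|s|)) * 2^-1 ^+ (n + p)%N.
    by rewrite !mulr_ge0 ?exprn_ge0 ?expR_ge0.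
  lra.
have half_to0 (A e : R) : 0 < e -> exists n, A * 2^-1 ^+ n <= e.
  move=> e0; have /cvgrPdist_le /(_ e e0) [n _ hn] :
      (fun n => A * 2^-1 ^+ n) @ \oo --> (0 : R).
    rewrite -(mulr0 A); apply: cvgMl_tmp; apply: cvg_expr.
    by rewrite ger0_norm //; lra.
  exists n; have := hn n (leqnn n); rewrite /= sub0r normrN => /(le_trans _); apply.
  exact: ler_norm.
have cu : continuous u.
  move=> s; apply/cont_epsP => e e0.
  have [C C0 HC] := uP (`|s| + 1).
  have e3 : 0 < e / 3 by rewrite divr_gt0.
  have [n hn] := half_to0 (C * expR (2 * L * (`|s| + 1))) (e / 3) e3.
  have close t : `|t| <= `|s| + 1 -> `|U n t - u t| <= e / 3.
    move=> tT; apply: le_trans (HC n t tT) _; apply: le_trans hn.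
    rewrite mulrAC; apply: ler_wpM2r; first exact: exprn_ge0.
    apply: ler_wpM2l => //; rewrite ler_expR; apply: ler_wpM2l => //.
    exact: mulr_ge0.
  have /cont_epsP/(_ _ e3)[d d0 hd] := cU n s.
  exists (Num.min d 1); first by rewrite lt_min d0 ltr01.
  move=> y; rewrite lt_min => /andP[yd y1].
  have y2 : `|y| <= `|s| + 1.
    by have := ler_normD (y - s) s; rewrite subrK; lra.
  have s2 : `|s| <= `|s| + 1 by lra.
  have -> : u y - u s = (U n y - U n s) - (U n y - u y) + (U n s - u s).
    by crd_ring.
  apply: le_trans (ler_normD _ _) _; have := close s s2.
  have : `|(U n y - U n s) - (U n y - u y)| <= e / 3 + e / 3.
    by apply: le_trans (ler_normB _ _) _; apply: lerD; [exact: hd|exact: close].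
  lra.
have [w [w0 dw]] := primitive x0 (fc _ cu).
suff wu s : w s = u s.
  by exists w; split => // s; rewrite wu; exact: dw.
apply/eqP; rewrite -subr_eq0 -normr_le0; apply/ler_addgt0Pr => e e0; rewrite add0r.
have [C C0 HC] := uP `|s|.
have [n hn] := half_to0 (C * expR (2 * L * `|s|)) (e / 2) ltac:(lra).
have k1 : `|w s - U n.+1 s| <= C * 2^-1 ^+ n / 2 * expR (2 * L * `|s|).
  apply: (@weighted_mean_value (fun s => w s - U n.+1 s)
    (fun s => f s (u s) - f s (U n s)) L (C * 2^-1 ^+ n) `|s|) => //.
  - by rewrite mulr_ge0 // exprn_ge0.
  - by move=> z _; have ? := (US n).2 z; have ? := dw z; exact: is_deriveB.
  - move=> z zT; apply: le_trans (lip _ _ _) _; rewrite ler_wpM2l // distrC.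
    exact: HC.
  - by rewrite U0 w0 subrr.
have k2 := HC n.+1 s (lexx _); rewrite exprSr mulrA in k2.
apply: le_trans (ler_distD (U n.+1 s) _ _) _.
apply: le_trans (lerD k1 k2) _; rewrite mulrAC in hn; lra.
Qed.

(* [A] is the linearisation of [X] along the orbit of [z0] *)
Lemma flow_differentiable (X : V -> V) (L : R) (phi : V -> R -> V) (z0 : V)
    (A : R -> V -> V) (LA T : R) :
  0 <= L -> 0 <= LA -> 0 <= T ->
  (forall x y, `|X x - X y| <= L * `|x - y|) ->
  (forall z, phi z 0 = z) ->
  (forall z (s : R), is_derive s (1 : R) (phi z) (X (phi z s))) ->
  (forall s, linear (A s)) -> (forall s v, `|A s v| <= LA * `|v|) ->
  (forall u : R -> V, continuous u -> continuous (fun s => A s (u s))) ->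
  (forall e : R, 0 < e -> exists2 d : R, 0 < d & forall (s : R) u, `|s| <= T ->
     `|u| < d -> `|X (phi z0 s + u) - X (phi z0 s) - A s u| <= e * `|u|) ->
  exists Y : V -> R -> V,
    [/\ forall v, Y v 0 = v,
        forall v (s : R), is_derive s (1 : R) (Y v) (A s (Y v s)),
        forall s, linear (Y ^~ s) &
        forall (s : R), `|s| <= T -> forall e : R, 0 < e ->
          exists2 d : R, 0 < d & forall u, `|u| < d ->
            `|phi (z0 + u) s - phi z0 s - Y u s| <= e * `|u|].
Proof.
move=> L0 LA0 T0 lip phi0 dphi linA bA cA unif.
have AD s u v : A s (u + v) = A s u + A s v.
  by have := linA s 1 u v; rewrite !scale1r.
have A0 s : A s 0 = 0.
  by have := AD s 0 0; rewrite addr0 => /eqP; rewrite addrC -subr_eq subrr => /eqP.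
have AZ s a u : A s (a *: u) = a *: A s u by have := linA s a u 0; rewrite A0 !addr0.
have AB s u v : A s (u - v) = A s u - A s v.
  by rewrite AD -scaleN1r AZ scaleN1r.
have exY v : exists u : R -> V, u 0 = v /\ forall s : R, is_derive s (1 : R) u (A s (u s)).
  by apply: (picard v LA0) => // s x y; rewrite -AB.
pose Y v := sval (cid (exY v)).
have Y0 v : Y v 0 = v by exact: (svalP (cid (exY v))).1.
have dY v (s : R) : is_derive s (1 : R) (Y v) (A s (Y v s)).
  exact: (svalP (cid (exY v))).2.
exists Y; split => //.
  move=> s a u v; apply/eqP; rewrite -subr_eq0 -normr_le0.
  have := @gronwall R V fV (fun s => Y (a *: u + v) s - (a *: Y u s + Y v s))
    (fun s => A s (Y (a *: u + v) s - (a *: Y u s + Y v s))) LA 0 0 `|s| LA0 (lexx _).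
  rewrite !Y0 subrr normr0 mul0r addr0 mulr0 mul0r; apply; last by rewrite subr0.
  - move=> z _; rewrite AB AD AZ.
    have ? := dY u z; have ? := dY v z; have ? := dY (a *: u + v) z.
    exact: is_deriveB.
  - by move=> z _; rewrite addr0.
move=> s sT e e0.
pose C1 := 2 * expR (2 * L * T); pose C2 := 2 * expR (2 * LA * T).
have C10 : 0 < C1 by rewrite mulr_gt0 // expR_gt0.
have C20 : 0 < C2 by rewrite mulr_gt0 // expR_gt0.
(* [C1] is the Lipschitz constant of the flow up to time [T], [C2] the Gronwall factor of the linear
   equation, and [T + 1] accounts for the length of the interval. *)
pose e1 := e / (C1 * C2 * (T + 1)).
have T1 : 0 < T + 1 by lra.
have e10 : 0 < e1 by rewrite divr_gt0 // mulr_gt0 // mulr_gt0.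
have [d d0 hd] := unif e1 e10.
exists (d / C1); first exact: divr_gt0.
move=> u ud.
have D z : `|z| <= T -> `|phi (z0 + u) z - phi z0 z| <= C1 * `|u|.
  move=> zT; have := @gronwall R V fV (fun s => phi (z0 + u) s - phi z0 s)
    (fun s => X (phi (z0 + u) s) - X (phi z0 s)) L 0 0 T L0 (lexx _).
  rewrite !phi0 mul0r addr0 addrAC subrr add0r => h; rewrite /C1 mulrAC.
  apply: h; last by rewrite subr0.
  by move=> z' _; rewrite addr0.
have := @gronwall R V fV (fun s => phi (z0 + u) s - phi z0 s - Y u s)
    (fun s => X (phi (z0 + u) s) - X (phi z0 s) - A s (Y u s)) LA (e1 * (C1 * `|u|)) 0 T LA0.
have -> : 0 <= e1 * (C1 * `|u|).
  by apply: mulr_ge0; [exact: ltW|apply: mulr_ge0; [exact: ltW|exact: normr_ge0]].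
rewrite !phi0 Y0 [z0 + u - z0]addrAC subrr add0r subrr normr0 add0r => /(_ isT) h.
have fin : 2 * (e1 * (C1 * `|u|) * T) * expR (2 * LA * T) <= e * `|u|.
  have -> : 2 * (e1 * (C1 * `|u|) * T) * expR (2 * LA * T) =
            e * `|u| * (T / (T + 1)).
    by rewrite /e1 /C2; field; rewrite !gt_eqF ?expR_gt0.
  rewrite ler_piMr ?mulr_ge0 ?(ltW e0) // ler_pdivrMr; lra.
apply: le_trans (h _ _ s _) fin; last by rewrite subr0.
move=> z; rewrite subr0 => zT.
have Dz := D z zT.
have -> : X (phi (z0 + u) z) - X (phi z0 z) - A z (Y u z) =
  A z (phi (z0 + u) z - phi z0 z - Y u z) +
  (X (phi z0 z + (phi (z0 + u) z - phi z0 z)) - X (phi z0 z) -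
    A z (phi (z0 + u) z - phi z0 z)).
  rewrite [phi z0 z + _]addrC subrK AB [A z _ - A z (Y u z) + _]addrC.
  by rewrite addrA subrK.
apply: le_trans (ler_normD _ _) _; apply: lerD => //.
apply: le_trans (hd _ _ zT _) _.
  by apply: le_lt_trans Dz _; rewrite mulrC -ltr_pdivlMr.
by rewrite ler_wpM2l // ltW.
Qed.

End Picard.

(** * Continuously differentiable maps, uniformly on tame sets *)

Section Tame.
Context {R : realType}.

(** Only one of the two points has to lie in [S]: the continuity is uniform up to a neighbourhood of
    [S], so that Taylor estimates based at points of [S] may leave it. *)
Definition unif_on (V W : normedModType R) (S : set V) (f : V -> W) : Prop :=
  forall e : R, 0 < e -> exists2 d : R, 0 < d &
    forall x y, S x -> `|y - x| < d -> `|f y - f x| <= e.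

Definition bdd_on (V W : normedModType R) (S : set V) (f : V -> W) : Prop :=
  exists2 C : R, 0 <= C & forall x, S x -> `|f x| <= C.

Definition periodic_for (V W : normedModType R) (Lam : set V) (f : V -> W) : Prop :=
  forall x l, Lam l -> f (x + l) = f x.

(* [S] is relatively compact modulo the translations [Lam] *)
Definition tame (V : normedModType R) (Lam S : set V) : Prop :=
  exists2 K : set V, compact K & forall x, S x ->
    exists k l, [/\ K k, Lam l & x = k + l].

Lemma compact_unif (V W : normedModType R) (K : set V) (f : V -> W) :
  compact K -> (forall x, K x -> {for x, continuous f}) -> unif_on K f.
Proof.
move=> /compact_near_coveringP cK cf e e0.
have e2 : 0 < e / 2 by lra.
have : \forall d \near (0 : R)^'+, K `<=` (fun x => forall y, `|y - x| < d -> `|f y - f x| <= e).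
  apply: cK => x Kx.
  have /cont_epsP/(_ _ e2)[d d0 hd] := cf x Kx.
  have dd2 : 0 < d / 2 by lra.
  exists (ball x (d / 2), [set t | t < d / 2]) => /=.
    by split; [exact: nbhsx_ballx|exact: nbhs_right_lt].
  move=> [x' t] /= [xx' td] y yx'.
  rewrite -ball_normE /= in xx'.
  have h1 : `|f y - f x| <= e / 2.
    apply: hd; have := ler_normD (y - x') (x' - x).
    by rewrite addrA subrK [`|x' - x|]distrC; lra.
  have h2 : `|f x' - f x| <= e / 2 by apply: hd; rewrite distrC; lra.
  have -> : f y - f x' = (f y - f x) - (f x' - f x) by rewrite opprB addrA subrK.
  by apply: le_trans (ler_normB _ _) _; lra.
move=> [d /= d0 hd]; exists (d / 2); first by lra.
move=> x y Kx yx; apply: (hd (d / 2) _ _ x Kx y yx) => /=; last by lra.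
by rewrite sub0r normrN gtr0_norm; lra.
Qed.

Lemma tame_unif (V W : normedModType R) (Lam S : set V) (f : V -> W) :
  tame Lam S -> periodic_for Lam f -> continuous f -> unif_on S f.
Proof.
move=> [K cK SK] pf cf e e0.
have [d d0 hd] := compact_unif cK (fun x _ => cf x) e0.
exists d => // x y Sx yx; have [k [l [Kk Ll xE]]] := SK x Sx.
have := hd k (y - l) Kk; rewrite xE in yx *.
rewrite -(pf (y - l) l Ll) subrK -(pf k l Ll); apply.
by move: yx; rewrite opprD addrA addrAC.
Qed.

Lemma tame_bdd (V W : normedModType R) (Lam S : set V) (f : V -> W) :
  tame Lam S -> periodic_for Lam f -> continuous f -> bdd_on S f.
Proof.
move=> [K cK SK] pf cf.
have : compact (f @` K).
  by apply: continuous_compact => //; exact: continuous_subspaceT.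
move=> /compact_bounded [M [_ hM]].
exists (`|M| + 1); first by rewrite addr_ge0.
move=> x Sx; have [k [l [Kk Ll ->]]] := SK x Sx; rewrite pf //.
apply: (hM (`|M| + 1)); last by exists k.
by apply: le_lt_trans (ler_norm M) _; rewrite ltrDl.
Qed.

Lemma ball_compact (V : normedModType R) {fV : fdim V} (c : V) (M : R) :
  compact [set x | `|x - c| <= M].
Proof.
pose A := [set v : 'rV[R]_(@fd_n R V fV) | `|v - @fd_phi R V fV c| <= M].
have -> : [set x | `|x - c| <= M] = fd_psi @` A.
  have phiB x y : fd_phi (x - y) = fd_phi x - fd_phi y :> 'rV[R]_(fd_n V).
    by rewrite addrC -scaleN1r fd_lin scaleN1r addrC.
  apply/seteqP; split=> x /=.
    move=> xM; exists (fd_phi x); last by rewrite fd_phiK.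
    by rewrite /A /= -phiB fd_norm.
  by move=> [v Av <-]; rewrite -fd_norm phiB fd_psiK.
apply: continuous_compact; last first.
  apply: bounded_closed_compact.
    exists (`|M| + `|fd_phi c|); split; first exact: num_real.
    move=> t tM v /= Av; apply: ltW; apply: le_lt_trans tM.
    have := ler_normD (v - fd_phi c) (fd_phi c); rewrite subrK.
    by move=> /le_trans; apply; rewrite lerD2r (le_trans Av) ?ler_norm.
  rewrite (_ : A = (fun v => `|v - fd_phi c|) @^-1` [set x | x <= M]) //.
  apply: closed_comp; last exact: closed_le.
  move=> v _; apply/cont_epsP => e e0; exists e => // y /ltW.
  apply: le_trans; apply: le_trans (ler_dist_dist _ _) _.
  by rewrite opprB addrA subrK.
apply: continuous_subspaceT => v; apply/cont_epsP => e e0; exists e => // y /ltW.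
have <- : `|fd_psi y - fd_psi v| = `|y - v|; last by [].
rewrite -fd_norm addrC -scaleN1r fd_lin !fd_psiK scaleN1r addrC //.
Qed.

Lemma tame_ball (V : normedModType R) {fV : fdim V} (c : V) (M : R) :
  tame [set 0] [set x | `|x - c| <= M].
Proof.
exists [set x | `|x - c| <= M]; first exact: ball_compact.
by move=> x xM; exists x, 0; split => //; rewrite addr0.
Qed.

Lemma periodic_for0 (V W : normedModType R) (f : V -> W) : periodic_for [set 0] f.
Proof. by move=> x _ ->; rewrite addr0. Qed.

Section C1.
Context {V W : normedModType R} {fV : fdim V} {fW : fdim W}.
Implicit Type f : V -> W.

Lemma diff_basis f x v : differentiable f x ->
  'd f x v = \sum_k crd k v *: 'D_(bvec k) f x.
Proof.
move=> df; rewrite {1}(crd_basis v) linear_sum /=.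
by apply: eq_bigr => k _; rewrite linearZ /= deriveE.
Qed.

(** Mean value inequality for [f (x + s u) - s w] on [0, 1]. The choice [w = 'd f x u] gives Taylor
    estimates and [w = 0] Lipschitz bounds. *)
Lemma segment_taylor f x u w (C : R) :
  (forall s : R, 0 <= s <= 1 -> differentiable f (x + s *: u)) ->
  (forall s : R, 0 <= s <= 1 -> `|'d f (x + s *: u) u - w| <= C) ->
  `|f (x + u) - f x - w| <= C.
Proof.
move=> df le.
have := @mean_value_const R W fW (fun s => f (x + s *: u) - s *: w)
  (fun s => 'd f (x + s *: u) u - w) C 0 1 ler01.
rewrite !scale1r !scale0r addr0 !subr0 mulr1.
have -> : f (x + u) - w - f x = f (x + u) - f x - w by rewrite addrAC.
apply=> // s s01.
have d1 : is_derive s (1 : R) (fun t : R => x + t *: u) u.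
  apply: eps_derive => e e0; exists 1 => // h _.
  have -> : x + (s + h) *: u - (x + s *: u) - h *: u = 0.
    by rewrite scalerDl; crd_ring.
  by rewrite normr0 mulr_ge0 // ltW.
have d2 : is_derive s (1 : R) (fun t : R => t *: w) w.
  apply: eps_derive => e e0; exists 1 => // h _.
  have -> : (s + h) *: w - s *: w - h *: w = 0.
    by rewrite scalerDl; crd_ring.
  by rewrite normr0 mulr_ge0 // ltW.
have d3 := @is_derive_comp_diff R V W f (fun t => x + t *: u) s u (df s s01) d1.
exact: is_deriveB.
Qed.

Lemma Ck1_diff (A : set V) f x : Ck_on 1 A f -> A x -> differentiable f x.
Proof. by case=> + _ Ax; apply. Qed.

Lemma periodic_derive (Lam : set V) f v :
  periodic_for Lam f -> periodic_for Lam (fun x => 'D_v f x).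
Proof.
move=> pf x l Ll; rewrite /derive.
rewrite (_ : (fun h : R => _) =
  (fun h => h^-1 *: ((f \o shift x) (h *: v) - f x))) //.
by apply/funext => h /=; rewrite addrA !(pf _ l Ll).
Qed.

Lemma sum_crd_bound (a : 'I_(fd_n V) -> W) (v : V) (e : R) :
  0 <= e -> (forall k, `|a k| <= e / (fd_n V).+1%:R) ->
  `|\sum_k crd k v *: a k| <= e * `|v|.
Proof.
move=> e0 ha; apply: le_trans (ler_norm_sum _ _ _) _.
apply: (@le_trans _ _ (\sum_(k < fd_n V) (e / (fd_n V).+1%:R * `|v|))).
  apply: ler_sum => k _; rewrite normrZ mulrC.
  by apply: ler_pM => //; exact: crd_le.
rewrite sumr_const card_ord -[_ *+ _]mulr_natr mulrAC; apply: ler_wpM2r => //.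
rewrite -mulrA ler_piMr // mulrC ler_pdivrMr ?ltr0n // mul1r ler_nat.
exact: leqnSn.
Qed.

Lemma C1_diff_bound (Lam S : set V) f : tame Lam S -> periodic_for Lam f ->
  Ck_on 1 setT f ->
  exists2 C : R, 0 <= C & forall x v, S x -> `|'d f x v| <= C * `|v|.
Proof.
move=> tS pf [df cdf].
have H k : exists C : R, 0 <= C /\ forall x, S x -> `|'D_(bvec k) f x| <= C.
  have [|C C0 hC] := @tame_bdd V W Lam S (fun x => 'D_(bvec k) f x) tS
    (periodic_derive _ pf); last by exists C.
  by move=> x; exact: cdf.
pose C := \sum_k sval (cid (H k)).
have Ck k : sval (cid (H k)) <= C.
  rewrite /C (bigD1 k) //= lerDl sumr_ge0 // => j _.
  exact: (svalP (cid (H j))).1.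
have C0 : 0 <= C by apply: sumr_ge0 => j _; exact: (svalP (cid (H j))).1.
exists (C * (fd_n V).+1%:R); first by rewrite mulr_ge0.
move=> x v Sx; rewrite diff_basis; last exact: df.
apply: sum_crd_bound => [|k]; first by rewrite mulr_ge0.
rewrite mulfK ?pnatr_eq0 //; apply: le_trans (Ck k).
exact: (svalP (cid (H k))).2.
Qed.

Lemma C1_diff_unif (Lam S : set V) f : tame Lam S -> periodic_for Lam f ->
  Ck_on 1 setT f ->
  forall e : R, 0 < e -> exists2 d : R, 0 < d & forall x y v, S x ->
    `|y - x| < d -> `|'d f y v - 'd f x v| <= e * `|v|.
Proof.
move=> tS pf [df cdf] e e0.
have n0 : 0 < e / (fd_n V).+1%:R by rewrite divr_gt0 // ltr0n.
have [k d d' /andP[_ dd'] K x y Sx yx|k|d d0 Hd] := @fin_common_delta R 'I_(fd_n V)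
  (fun k d => forall x y, S x -> `|y - x| < d ->
    `|'D_(bvec k) f y - 'D_(bvec k) f x| <= e / (fd_n V).+1%:R).
- by apply: K => //; exact: lt_le_trans dd'.
- apply: (@tame_unif V W Lam S (fun x => 'D_(bvec k) f x) tS (periodic_derive _ pf)) => //.
  by move=> x; exact: cdf.
exists d => // x y v Sx yx; rewrite !diff_basis; [|exact: df..].
rewrite -sumrB; under eq_bigr do rewrite -scalerBr.
by apply: sum_crd_bound => [|k]; [exact: ltW|exact: Hd].
Qed.

Lemma C1_taylor_unif (Lam S : set V) f : tame Lam S -> periodic_for Lam f ->
  Ck_on 1 setT f ->
  forall e : R, 0 < e -> exists2 d : R, 0 < d & forall x u, S x ->
    `|u| < d -> `|f (x + u) - f x - 'd f x u| <= e * `|u|.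
Proof.
move=> tS pf C1f e e0; have [d d0 hd] := C1_diff_unif tS pf C1f e0.
exists d => // x u Sx ud; apply: segment_taylor.
  by move=> s _; exact: Ck1_diff C1f _.
move=> s /andP[s0 s1]; apply: hd => //; rewrite addrAC subrr add0r normrZ.
by apply: le_lt_trans ud; rewrite ger0_norm // ler_piMl.
Qed.

Lemma C1_lip (S : set V) f (C : R) : Ck_on 1 setT f ->
  (forall x v, S x -> `|'d f x v| <= C * `|v|) ->
  forall x y, (forall s : R, 0 <= s <= 1 -> S (x + s *: (y - x))) ->
    `|f y - f x| <= C * `|y - x|.
Proof.
move=> C1f hC x y seg.
have := @segment_taylor f x (y - x) 0 (C * `|y - x|).
rewrite [x + (y - x)]addrC subrK subr0; apply.
  by move=> s _; exact: Ck1_diff C1f _.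
by move=> s s01; rewrite subr0; apply: hC; exact: seg.
Qed.

Lemma C1_diff_continuous (A : set V) f x : open A -> Ck_on 1 A f -> A x ->
  forall e : R, 0 < e -> exists2 d : R, 0 < d & forall y v,
    `|y - x| < d -> A y /\ `|'d f y v - 'd f x v| <= e * `|v|.
Proof.
move=> oA [df cdf] Ax e e0.
have n0 : 0 < e / (fd_n V).+1%:R by rewrite divr_gt0 // ltr0n.
have [k d d' /andP[_ dd'] K y yx|k|d d0 Hd] := @fin_common_delta R 'I_(fd_n V)
  (fun k d => forall y, `|y - x| < d ->
    `|'D_(bvec k) f y - 'D_(bvec k) f x| <= e / (fd_n V).+1%:R).
- by apply: K => //; exact: lt_le_trans dd'.
- by have /cont_epsP/(_ _ n0) := cdf (bvec k) x Ax.
have /nbhs_ballP[d1 /= d10 hd1] := open_nbhs_nbhs (conj oA Ax).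
exists (Num.min d d1); first by rewrite lt_min d0.
move=> y v; rewrite lt_min => /andP[yx yx1].
have Ay : A y by apply: hd1; rewrite -ball_normE /= distrC.
split=> //; rewrite !diff_basis; [|exact: df..].
rewrite -sumrB; under eq_bigr do rewrite -scalerBr.
by apply: sum_crd_bound => [|k]; [exact: ltW|exact: Hd].
Qed.

End C1.
End Tame.

(** * Iterated integrals over the torus *)

Section TorusIntegral.
Context {R : realType}.

Lemma Rintegral01_primitive (f F : R -> R) : continuous f ->
  (forall s : R, is_derive s (1 : R) F (f s)) ->
  Rintegral lebesgue_measure `[0%R, 1%R] f = F 1 - F 0.
Proof.
move=> cf dF; rewrite /Rintegral (@continuous_FTC2 R f F 0 1) //=.
- exact: continuous_subspaceT.
- have cF : continuous F by move=> s; exact: eps_der_continuous (dF s).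
  split; first by move=> s _; have [] := dF s.
  + by apply: cvg_at_right_filter; exact: cF.
  + by apply: cvg_at_left_filter; exact: cF.
- by move=> s _; rewrite derive1E; have [_ ->] := dF s.
Qed.

Lemma unif_continuous (V W : normedModType R) (f : V -> W) :
  unif_on setT f -> continuous f.
Proof.
move=> uf x; apply/cont_epsP => e e0; have [d d0 hd] := uf e e0.
by exists d => // y yx; exact: hd.
Qed.

Lemma unif_lin (V : normedModType R) (f g : V -> R) (c : R) :
  unif_on setT f -> unif_on setT g -> unif_on setT (fun x => f x + c * g x).
Proof.
move=> uf ug e e0; have c0 : 0 < `|c| + 1 by rewrite ltr_wpDl.
have [d1 d10 h1] := uf (e / 2) (divr_gt0 e0 (ltr0n _ 2)).
have [d2 d20 h2] := ug (e / 2 / (`|c| + 1)) (divr_gt0 (divr_gt0 e0 (ltr0n _ 2)) c0).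
exists (Num.min d1 d2); first by rewrite lt_min d10.
move=> x y _; rewrite lt_min => /andP[y1 y2].
have -> : f y + c * g y - (f x + c * g x) = (f y - f x) + c * (g y - g x) by ring.
apply: le_trans (ler_normD _ _) _; rewrite normrM [e]splitr lerD ?h1 //.
have := h2 x y I y2; rewrite ler_pdivlMr // => h.
apply: le_trans h; rewrite mulrC; apply: ler_wpM2l => //.
by rewrite lerDl.
Qed.

Definition slice n (f : 'rV[R]_n.+1 -> R) (x : R) (y : 'rV[R]_n) : R :=
  f (row_mx (x%:M : 'rV[R]_1) y).

Lemma norm_scalar1 (x : R) : `|x%:M : 'rV[R]_1| = `|x|.
Proof. exact: (@fd_norm R R (fdim_R R) x). Qed.

Lemma slice_dist n (x x' : R) (y y' : 'rV[R]_n) :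
  `|(row_mx (x%:M : 'rV[R]_1) y) - row_mx (x'%:M : 'rV[R]_1) y'| =
  Num.max `|x - x'| `|y - y'|.
Proof.
rewrite opp_row_mx add_row_mx rv_norm_row_mx; congr (Num.max _ _).
by rewrite -norm_scalar1 raddfB.
Qed.

Lemma unif_slice n (f : 'rV[R]_n.+1 -> R) x :
  unif_on setT f -> unif_on setT (slice f x).
Proof.
move=> uf e e0; have [d d0 hd] := uf e e0; exists d => // y y' _ yy'.
apply: hd => //; have := slice_dist x x y' y; rewrite subrr normr0 => ->.
by rewrite gt_max d0.
Qed.

(** Both properties go through one induction: the distance bound in dimension [n] makes the
    integrals over slices depend continuously on the first variable, and this gives the primitives
    needed for both properties in dimension [n + 1]. *)
Lemma torus_integral_props n :
  (forall (f g : 'rV[R]_n -> R) c, unif_on setT f -> unif_on setT g ->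
     torus_integral (fun x => f x + c * g x) =
     torus_integral f + c * torus_integral g) /\
  (forall (f g : 'rV[R]_n -> R) e, unif_on setT f -> unif_on setT g ->
     (forall x, `|f x - g x| <= e) ->
     `|torus_integral f - torus_integral g| <= e).
Proof.
elim: n => [|n [IH1 IH2]]; first by split => [//|f g e _ _]; exact.
have usl (f : 'rV[R]_n.+1 -> R) : unif_on setT f ->
    unif_on setT (fun x : R => torus_integral (slice f x)).
  move=> uf e e0; have [d d0 hd] := uf e e0; exists d => // x x' _ xx'.
  apply: IH2; [exact: unif_slice..|] => y; apply: hd => //.
  have := slice_dist x' x y y; rewrite subrr normr0 => ->.
  by rewrite gt_max d0 andbT.
have tiS (u : 'rV[R]_n.+1 -> R) : torus_integral u =
  Rintegral lebesgue_measure `[0%R, 1%R] (fun x : R => torus_integral (slice u x)).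
  by [].
split=> [f g c uf ug|f g e uf ug fg].
  have [F [_ dF]] := real_primitive (unif_continuous (usl f uf)).
  have [G [_ dG]] := real_primitive (unif_continuous (usl g ug)).
  have E1 := Rintegral01_primitive (unif_continuous (usl f uf)) dF.
  have E2 := Rintegral01_primitive (unif_continuous (usl g ug)) dG.
  have E3 : Rintegral lebesgue_measure `[0%R, 1%R]
     (fun x : R => torus_integral (slice f x) + c * torus_integral (slice g x)) =
     (F 1 + c * G 1) - (F 0 + c * G 0).
    apply: (@Rintegral01_primitive _ (fun s => F s + c * G s)).
    by apply: unif_continuous; apply: unif_lin; exact: usl.
  rewrite !tiS E1 E2 (_ : (fun x : R => _) = (fun x : R =>
    torus_integral (slice f x) + c * torus_integral (slice g x))); last first.
    by apply/funext => x; rewrite -IH1 //; exact: unif_slice.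
  by rewrite E3; ring.
have [F [_ dF]] := real_primitive (unif_continuous (usl f uf)).
have [G [_ dG]] := real_primitive (unif_continuous (usl g ug)).
have E1 := Rintegral01_primitive (unif_continuous (usl f uf)) dF.
have E2 := Rintegral01_primitive (unif_continuous (usl g ug)) dG.
rewrite !tiS E1 E2.
have := @mean_value_const R R _ (fun s => F s - G s)
   (fun s => torus_integral (slice f s) - torus_integral (slice g s)) e 0 1 ler01.
rewrite subr0 mulr1.
have -> : F 1 - F 0 - (G 1 - G 0) = F 1 - G 1 - (F 0 - G 0) by ring.
apply=> s _.
apply: IH2; [exact: unif_slice..|].
by move=> y; exact: fg.
Qed.

Lemma torus_integral_lin n (f g : 'rV[R]_n -> R) c :
  unif_on setT f -> unif_on setT g ->
  torus_integral (fun x => f x + c * g x) =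
  torus_integral f + c * torus_integral g.
Proof. exact: (torus_integral_props n).1. Qed.

Lemma torus_integral_dist n (f g : 'rV[R]_n -> R) e :
  unif_on setT f -> unif_on setT g -> (forall x, `|f x - g x| <= e) ->
  `|torus_integral f - torus_integral g| <= e.
Proof. exact: (torus_integral_props n).2. Qed.

Definition zlat n : set 'rV[R]_n := [set l | exists k : 'rV[int]_n, l = zvec R k].
Arguments zlat : clear implicits.

Lemma real_mod1 (x : R) : exists k : int, 0 <= x - k%:~R < 1.
Proof.
exists (Num.floor x); have := floor_itv x.
rewrite intrD => /andP[h1 h2]; apply/andP; split; lra.
Qed.

Lemma tame_torus n : tame (zlat n) [set: 'rV[R]_n].
Proof.
exists [set x | `|x - 0| <= 1]; first exact: ball_compact.
move=> x _; pose k := \row_i sval (cid (real_mod1 (x 0 i))).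
exists (x - zvec R k), (zvec R k); split; [|by exists k|by rewrite subrK].
rewrite /= subr0; apply: rv_norm_le => // i; rewrite !mxE.
by have /andP[h1 /ltW h2] := svalP (cid (real_mod1 (x 0 i))); rewrite ger0_norm.
Qed.

Lemma periodic_unif n (W : normedModType R) (f : 'rV[R]_n -> W) :
  continuous f -> periodic_for (zlat n) f -> unif_on setT f.
Proof. by move=> cf pf; exact: tame_unif (tame_torus n) pf cf. Qed.

End TorusIntegral.

Arguments zlat {R} n.

(** * Trigonometric polynomials and equidistribution *)

Section Weyl.
Context {R : realType} {n : nat}.
Implicit Types (f g : 'rV[R]_n -> R) (k : 'rV[int]_n).

Lemma dotDr (u v w : 'rV[R]_n) : dot u (v + w) = dot u v + dot u w.
Proof. by rewrite /dot -big_split /=; apply: eq_bigr => i _; rewrite mxE mulrDr. Qed.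

Lemma dotC (u v : 'rV[R]_n) : dot u v = dot v u.
Proof. by apply: eq_bigr => i _; rewrite mulrC. Qed.

Lemma dotZr (a : R) (u v : 'rV[R]_n) : dot u (a *: v) = a * dot u v.
Proof. by rewrite /dot mulr_sumr; apply: eq_bigr => i _; rewrite mxE mulrCA. Qed.

Lemma dotDl (u v w : 'rV[R]_n) : dot (u + v) w = dot u w + dot v w.
Proof. by rewrite dotC dotDr !(dotC w). Qed.

Lemma dotZl (a : R) (u v : 'rV[R]_n) : dot (a *: u) v = a * dot u v.
Proof. by rewrite dotC dotZr dotC. Qed.

Lemma dotNr (u v : 'rV[R]_n) : dot u (- v) = - dot u v.
Proof. by rewrite -scaleN1r dotZr mulN1r. Qed.

Lemma dotNl (u v : 'rV[R]_n) : dot (- u) v = - dot u v.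
Proof. by rewrite dotC dotNr dotC. Qed.

Lemma dot_bound (u v : 'rV[R]_n) : `|dot u v| <= n%:R * (`|u| * `|v|).
Proof.
apply: le_trans (ler_norm_sum _ _ _) _.
apply: (@le_trans _ _ (\sum_(i < n) (`|u| * `|v|))).
  by apply: ler_sum => i _; rewrite normrM; apply: ler_pM => //; exact: rv_norm_coord.
by rewrite sumr_const card_ord mulr_natl.
Qed.

Lemma zvecD k k' : zvec R (k + k') = zvec R k + zvec R k'.
Proof. by apply/rowP => i; rewrite !mxE intrD. Qed.

Lemma zvecN k : zvec R (- k) = - zvec R k.
Proof. by apply/rowP => i; rewrite !mxE intrN. Qed.

Lemma dot_zz k k' : exists a : int, dot (zvec R k) (zvec R k') = a%:~R.
Proof.
exists (\sum_i k 0 i * k' 0 i); rewrite /dot rmorph_sum /=.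
by apply: eq_bigr => i _; rewrite !mxE intrM.
Qed.

Lemma cos_period (a : int) (x : R) : cos (x + 2 * pi * a%:~R) = cos x.
Proof.
have nat_case (b : nat) (y : R) : cos (y + 2 * pi * b%:R) = cos y.
  have -> : 2 * pi * b%:R = pi *+ 2 *+ b :> R by rewrite -mulr_natr -mulr_natr; ring.
  exact: (periodicn (@cosD2pi R)).
case: a => b; first exact: nat_case.
rewrite NegzE intrN -[in RHS](subrK (2 * pi * b.+1%:R) x).
by rewrite nat_case mulrN.
Qed.

(** With a free phase, real cosines replace complex characters: a translation only changes the
    phase, and a product of two waves is half the sum of two waves. *)
Definition wave k (phi : R) (x : 'rV[R]_n) : R :=
  cos (2 * pi * dot (zvec R k) x + phi).

Lemma wave_periodic k phi : periodic_for (zlat n) (wave k phi).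
Proof.
move=> x _ [l ->]; rewrite /wave dotDr; have [a ->] := dot_zz k l.
by rewrite mulrDr addrAC cos_period.
Qed.

Lemma wave_continuous k phi : continuous (wave k phi).
Proof.
move=> x; apply: (@continuous_comp _ _ _
  (fun x => 2 * pi * dot (zvec R k) x + phi) cos); last exact: continuous_cos.
apply/cont_epsP => e e0.
pose C := 2 * pi * (n%:R * `|zvec R k|) + 1.
have C0 : 0 < C.
  by rewrite ltr_wpDl // !mulr_ge0 // pi_ge0.
exists (e / C); first exact: divr_gt0.
move=> y; rewrite ltr_pdivlMr // => /ltW yx; apply: le_trans yx.
have -> : 2 * pi * dot (zvec R k) y + phi - (2 * pi * dot (zvec R k) x + phi) =
  2 * pi * dot (zvec R k) (y - x) by rewrite dotDr dotNr; ring.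
rewrite normrM ger0_norm ?mulr_ge0 ?pi_ge0 //.
have p2 : 0 <= 2 * pi :> R by rewrite mulr_ge0 // pi_ge0.
have := dot_bound (zvec R k) (y - x); move=> /(ler_wpM2l p2).
by move=> h; apply: le_trans h _; rewrite /C; have := normr_ge0 (y - x); lra.
Qed.

Lemma wave_unif k phi : unif_on setT (wave k phi).
Proof. by apply: periodic_unif; [exact: wave_continuous|exact: wave_periodic]. Qed.

Inductive trig : ('rV[R]_n -> R) -> Prop :=
| trig_wave k phi : trig (wave k phi)
| trig_lin f g c : trig f -> trig g -> trig (fun x => f x + c * g x).

Lemma trig_ext f g : (forall x, f x = g x) -> trig f -> trig g.
Proof. by move=> /funext ->. Qed.

Lemma wave0 phi x : wave 0 phi x = cos phi.
Proof.
rewrite /wave (_ : zvec R 0 = 0); last by apply/rowP => i; rewrite !mxE.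
by rewrite -(scale0r 0) dotZl mul0r mulr0 add0r.
Qed.

Lemma trig_cst c : trig (fun _ => c).
Proof.
(* At frequency 0 the phases pi / 2 and 0 give the constants 0 and 1. *)
apply: (@trig_ext (fun x => wave 0 (pi / 2) x + c * wave 0 0 x)).
  by move=> x; rewrite !wave0 cos_pihalf cos0; ring.
by apply: trig_lin; exact: trig_wave.
Qed.

Lemma trigD f g : trig f -> trig g -> trig (fun x => f x + g x).
Proof.
by move=> tf tg; apply: (trig_ext _ (trig_lin 1 tf tg)) => x; rewrite mul1r.
Qed.

Lemma trigZ c f : trig f -> trig (fun x => c * f x).
Proof.
by move=> tf; apply: (trig_ext _ (trig_lin c (trig_cst 0) tf)) => x; rewrite add0r.
Qed.

Lemma trigM f g : trig f -> trig g -> trig (fun x => f x * g x).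
Proof.
move=> tf tg; elim: tf => [k phi|f1 f2 c _ h1 _ h2]; last first.
  by apply: (trig_ext _ (trig_lin c h1 h2)) => x; ring.
elim: tg => [k' phi'|g1 g2 c _ h1 _ h2]; last first.
  by apply: (trig_ext _ (trig_lin c h1 h2)) => x; ring.
apply: (trig_ext _ (trigZ (2^-1) (trigD (trig_wave (k + k') (phi + phi'))
  (trig_wave (k - k') (phi - phi'))))) => x.
rewrite /wave !zvecD zvecN !dotDl dotNl.
set a := dot _ x; set b := dot _ x.
have -> : 2 * pi * (a + b) + (phi + phi') =
  (2 * pi * a + phi) + (2 * pi * b + phi') by ring.
have -> : 2 * pi * (a - b) + (phi - phi') =
  (2 * pi * a + phi) - (2 * pi * b + phi') by ring.
by rewrite cosD cosB; field.
Qed.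

Lemma trigX f N : trig f -> trig (fun x => f x ^+ N).
Proof.
move=> tf; elim: N => [|N IH]; first exact: trig_cst.
by apply: (trig_ext _ (trigM tf IH)) => x; rewrite exprS.
Qed.

Lemma trig_sum (I : Type) (r : seq I) (F : I -> 'rV[R]_n -> R) :
  (forall i, trig (F i)) -> trig (fun x => \sum_(i <- r) F i x).
Proof.
move=> tF; elim: r => [|i r IH].
  by apply: (trig_ext _ (trig_cst 0)) => x; rewrite big_nil.
by apply: (trig_ext _ (trigD (tF i) IH)) => x; rewrite big_cons.
Qed.

Lemma trig_shift f y : trig f -> trig (fun x => f (x - y)).
Proof.
elim=> [k phi|f1 f2 c _ h1 _ h2]; last exact: trig_lin.
apply: (trig_ext _ (trig_wave k (phi - 2 * pi * dot (zvec R k) y))) => x.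
by rewrite /wave dotDr dotNr; congr cos; ring.
Qed.

Lemma trig_unif f : trig f -> unif_on setT f.
Proof. by elim=> [k phi|f1 f2 c _ h1 _ h2]; [exact: wave_unif|exact: unif_lin]. Qed.

Lemma trig_periodic f : trig f -> periodic_for (zlat n) f.
Proof.
elim=> [k phi|f1 f2 c _ h1 _ h2]; first exact: wave_periodic.
by move=> x l Ll; rewrite h1 // h2.
Qed.

Definition trig_approx f : Prop := forall e : R, 0 < e ->
  exists2 g, trig g & forall x, `|f x - g x| <= e.

(* a bump at the lattice points: 1 - bump x measures the distance of x to Z^n *)
Definition bump (x : 'rV[R]_n) : R :=
  1 - (\sum_i (1 - cos (2 * pi * x 0 i))) / (2 * n%:R + 1).

Lemma trig_bump : trig bump.
Proof.
have h : trig (fun x => \sum_(i <- index_enum 'I_n) (1 - cos (2 * pi * x 0 i))).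
  apply: trig_sum => i.
  apply: (trig_ext _ (trig_lin (- 1) (trig_cst 1) (trig_wave (delta_mx 0 i) 0))) => x.
  rewrite mulN1r /wave addr0; congr (1 - cos (_ * _)).
  rewrite /dot (bigD1 i) //= big1 ?addr0 => [|j ji]; rewrite !mxE ?eqxx ?mul1r //.
  by rewrite (negbTE ji) andbF mul0r.
apply: (trig_ext _ (trig_lin (- (2 * n%:R + 1)^-1) (trig_cst 1) h)) => x.
by rewrite /bump mulNr mulrC.
Qed.

Lemma den_gt0 : 0 < 2 * n%:R + 1 :> R.
Proof. by rewrite ltr_wpDl // mulr_ge0. Qed.

Lemma bump_le1 x : bump x <= 1.
Proof.
rewrite /bump gerBl divr_ge0 ?(ltW den_gt0) //; apply: sumr_ge0 => i _.
by rewrite subr_ge0 cos_le1.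
Qed.

Lemma bump_gt0 x : 0 < bump x.
Proof.
rewrite /bump subr_gt0 ltr_pdivrMr ?den_gt0 // mul1r.
apply: (@le_lt_trans _ _ (\sum_(i < n) 2)).
  by apply: ler_sum => i _; have := cos_geN1 (2 * pi * x 0 i); lra.
by rewrite sumr_const card_ord -mulr_natr; lra.
Qed.

Lemma bump0 : bump 0 = 1.
Proof.
rewrite /bump big1 ?mul0r ?subr0 // => i _.
by rewrite mxE mulr0 cos0 subrr.
Qed.

Lemma cos_near_int (d : R) : 0 < d -> exists2 eta : R, 0 < eta &
  forall x : R, 1 - cos (2 * pi * x) < eta -> exists k : int, `|x - k%:~R| < d.
Proof.
(* Capping at 1/2 keeps [2 * pi * d'] in [0, pi], where the cosine is decreasing; reduction modulo 1
   around 0 brings [x] into the same range. *)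
move=> d0; pose d' := Num.min d 2^-1.
have d'0 : 0 < d' by rewrite lt_min d0 invr_gt0 ltr0n.
have d'h : d' <= 2^-1 by rewrite ge_min lexx orbT.
have pp := @pi_gt0 R.
have cosd : cos (2 * pi * d') < 1.
  rewrite -[X in _ < X]cos0 ltr_cos ?in_itv /= ?lexx ?pi_ge0 //.
  - by rewrite !mulr_gt0.
  - by apply/andP; split; nra.
exists (1 - cos (2 * pi * d')); first by rewrite subr_gt0.
move=> x hx; have [k hk] := real_mod1 (x + 2^-1); exists k.
set y := x - k%:~R; have yb : - 2^-1 <= y <= 2^-1.
  by apply/andP; split; rewrite /y; lra.
have cy : cos (2 * pi * x) = cos (2 * pi * `|y|).
  have -> : cos (2 * pi * x) = cos (2 * pi * y).
    by rewrite -(cos_period k (2 * pi * y)); congr cos; rewrite /y; ring.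
  by case: (ger0P y) => // _; rewrite mulrN cosN.
rewrite ltNge; apply/negP => dy.
have : cos (2 * pi * `|y|) <= cos (2 * pi * d').
  rewrite leNgt ltr_cos ?in_itv /=; first by rewrite -leNgt ler_pM2l ?mulr_gt0 // ge_min dy.
  - apply/andP; split; first by rewrite !mulr_ge0 // ltW.
    have : `|y| <= 2^-1 by rewrite ler_norml.
    nra.
  - by apply/andP; split; nra.
by rewrite -cy; lra.
Qed.

Lemma bump_near_lattice (d : R) : 0 < d -> exists2 q : R, 0 < q < 1 &
  forall x, q < bump x -> exists2 l, zlat n l & `|x - l| < d.
Proof.
move=> d0; have [eta eta0 heta] := cos_near_int d0.
pose et := Num.min eta 2^-1.
have et0 : 0 < et by rewrite lt_min eta0 invr_gt0 ltr0n.
have et1 : et <= 2^-1 by rewrite ge_min lexx orbT.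
have D0 := den_gt0; have D1 : 1 <= 2 * n%:R + 1 :> R.
  by rewrite lerDr mulr_ge0.
(* Above this level the sum of the nonnegative terms is below [et], hence each of them is below
   [eta]; the cap of [et] at 1/2 keeps the level positive. *)
exists (1 - et / (2 * n%:R + 1)).
  have : et / (2 * n%:R + 1) < 1 by rewrite ltr_pdivrMr //; lra.
  have : 0 < et / (2 * n%:R + 1) by exact: divr_gt0.
  by lra.
move=> x hx.
have lt_et : \sum_i (1 - cos (2 * pi * x 0 i)) < et.
  have : (\sum_i (1 - cos (2 * pi * x 0 i))) / (2 * n%:R + 1) < et / (2 * n%:R + 1).
    by move: hx; rewrite /bump; lra.
  by rewrite ltr_pM2r // invr_gt0.
have hi i : exists k : int, `|x 0 i - k%:~R| < d.
  apply: heta; apply: (@lt_le_trans _ _ et); last by rewrite ge_min lexx.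
  apply: le_lt_trans lt_et; rewrite (bigD1 i) //= lerDl; apply: sumr_ge0 => j _.
  by have := cos_le1 (2 * pi * x 0 j); lra.
pose k := \row_i sval (cid (hi i)).
exists (zvec R k); first by exists k.
have [->|] := eqVneq (x - zvec R k) 0; first by rewrite normr0.
move=> nz; have := mx_norm_neq0 (x := x - zvec R k).
rewrite -[mx_norm _]/`|x - zvec R k| normr_eq0 => /(_ nz) [[i j] /= ->].
rewrite (ord1 i) !mxE; exact: svalP (cid (hi j)).
Qed.

Lemma exprn_to0 (A q e : R) : 0 <= q < 1 -> 0 < e -> exists N, A * q ^+ N <= e.
Proof.
move=> /andP[q0 q1] e0; have /cvgrPdist_le /(_ e e0) [N _ hN] :
    (fun N => A * q ^+ N) @ \oo --> (0 : R).
  rewrite -(mulr0 A); apply: cvgMl_tmp; apply: cvg_expr.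
  by rewrite ger0_norm.
exists N; have := hN N (leqnn N); rewrite /= sub0r normrN => /(le_trans _); apply.
exact: ler_norm.
Qed.

Lemma bump_net (q : R) : q < 1 ->
  exists ys : seq 'rV[R]_n, forall x, exists2 y, y \in ys & q < bump (x - y).
Proof.
move=> q1; have [K cK SK] := tame_torus (R := R) n.
have cb : continuous bump by exact: unif_continuous (trig_unif trig_bump).
move: cK; rewrite compact_cover => /(_ _ setT (fun y => [set x | q < bump (x - y)])).
case=> [y _||D _ hD].
- rewrite (_ : [set x | _] = (fun x => bump (x - y)) @^-1` [set t | q < t]) //.
  apply: open_comp; last exact: open_gt.
  by move=> x _; exact: (unif_continuous (trig_unif (trig_shift y trig_bump))).
- by move=> x _; exists x => //=; rewrite subrr bump0.
exists (finmap.enum_fset D) => x; have [k [l [Kk Ll ->]]] := SK x I.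
have [y /= yD hy] := hD k Kk; exists y => //.
by rewrite addrAC (trig_periodic trig_bump).
Qed.

(** Weierstrass approximation by an almost partition of unity: high powers of translated bumps
    concentrate near the points of a finite net, and values of [f] on the net are averaged with
    these weights. The three errors of size [e / 3] come from the modulus of continuity near [x],
    from the weights of the far points, and from the normalisation of the weights. *)
Lemma trig_dense f : continuous f -> periodic_for (zlat n) f -> trig_approx f.
Proof.
move=> cf pf e e0; have uf := periodic_unif cf pf.
have [M0 M00 hM0] := tame_bdd (tame_torus n) pf cf.
pose M := M0 + 1; have M1 : 0 < M by rewrite /M; lra.
have hM x : `|f x| <= M by rewrite /M; have := hM0 x I; lra.
have e3 : 0 < e / 3 by lra.
have [d d0 hd] := uf _ e3.
have [q /andP[q0 q1] hq] := bump_near_lattice d0.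
have modulus x y : q < bump (x - y) -> `|f x - f y| <= e / 3.
  move=> /hq [l Ll xyl].
  have -> : f x = f (x - l) by rewrite -(pf (x - l) l Ll) subrK.
  by apply: hd => //; rewrite addrAC.
(* The net is taken at a level higher than [q]: every [x] then has a total weight of at least
   [q' ^+ N], while a point [y] far from [x] has a weight of at most [q ^+ N], and the ratio tends
   to 0. *)
pose q' := (q + 1) / 2; have qq' : q < q' by rewrite /q'; lra.
have q'1 : q' < 1 by rewrite /q'; lra.
have q'0 : 0 < q' by lra.
have [ys hys] := bump_net q'1.
pose J := (size ys)%:R : R.
have J0 : 0 <= J by [].
have [N hN] : exists N, 2 * M * J * (q / q') ^+ N <= e / 3.
  apply: exprn_to0 => //; rewrite divr_ge0 ?(ltW q'0) ?(ltW q0) //=.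
  by rewrite ltr_pdivrMr // mul1r.
pose w y x := bump (x - y) ^+ N.
pose Wt x := \sum_(y <- ys) w y x.
have w0 y x : 0 <= w y x by rewrite exprn_ge0 // ltW // bump_gt0.
have w1 y x : w y x <= 1 by rewrite exprn_ile1 ?bump_le1 // ltW // bump_gt0.
have WJ x : Wt x <= J.
  apply: (@le_trans _ _ (\sum_(y <- ys) 1)); first by apply: ler_sum.
  by rewrite big_const_seq count_predT iter_addr addr0.
have Wq x : q' ^+ N <= Wt x.
  have [y yys hy] := hys x; rewrite /Wt (big_rem y) //=.
  apply: (@le_trans _ _ (w y x)).
    by rewrite /w lerXn2r ?nnegrE ?(ltW q'0) ?(ltW hy) // ltW // bump_gt0.
  by rewrite lerDl sumr_ge0.
pose D := J + 1; have D0 : 0 < D by rewrite /D; lra.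
have qN0 : 0 < q' ^+ N by exact: exprn_gt0.
have WD x : 0 <= 1 - Wt x / D <= 1 - q' ^+ N / D.
  rewrite subr_ge0 ler_pdivrMr // mul1r lerD2l lerN2 ler_pM2r ?invr_gt0 // Wq andbT.
  by apply: le_trans (WJ x) _; rewrite /D; lra.
have [K hK] : exists K, M * (1 - q' ^+ N / D) ^+ K <= e / 3.
  apply: exprn_to0 => //; apply/andP; split; last by rewrite gtrBl divr_gt0.
  by have /andP[a b] := WD 0; exact: le_trans a b.
(* A truncated geometric series for the inverse of [Wt x]: unlike the inverse, it is a trigonometric
   polynomial. The choice [D = J + 1] keeps [1 - Wt x / D] in [0, 1). *)
pose S x := D^-1 * \sum_(k < K) (1 - Wt x / D) ^+ k.
have WS x : Wt x * S x = 1 - (1 - Wt x / D) ^+ K.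
  by rewrite /S mulrA; have := subrX1 (1 - Wt x / D) K; lra.
have S0 x : 0 <= S x.
  rewrite mulr_ge0 ?invr_ge0 ?(ltW D0) //; apply: sumr_ge0 => k _.
  by apply: exprn_ge0; have /andP[] := WD x.
exists (fun x => \sum_(y <- ys) f y * (w y x * S x)).
  apply: trig_sum => y; apply: trigZ; apply: trigM.
    by apply: trigX; apply: trig_shift; exact: trig_bump.
  apply: trigZ; apply: (@trig_sum _ _ (fun (k : 'I_K) x => (1 - Wt x / D) ^+ k)) => k.
  apply: trigX.
  have tW : trig Wt.
    by apply: trig_sum => z; apply: trigX; apply: trig_shift; exact: trig_bump.
  apply: (trig_ext _ (trig_lin (- D^-1) (trig_cst 1) tW)) => x.
  by rewrite mulNr mulrC.
move=> x.
have -> : f x - \sum_(y <- ys) f y * (w y x * S x) =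
  f x * (1 - Wt x / D) ^+ K + \sum_(y <- ys) (f x - f y) * (w y x * S x).
  have -> : \sum_(y <- ys) (f x - f y) * (w y x * S x) =
    f x * (Wt x * S x) - \sum_(y <- ys) f y * (w y x * S x).
    rewrite /Wt mulr_suml mulr_sumr -sumrB.
    by apply: eq_bigr => y _; rewrite mulrBl.
  by rewrite WS; ring.
apply: le_trans (ler_normD _ _) _.
have p1 : `|f x * (1 - Wt x / D) ^+ K| <= e / 3.
  apply: le_trans hK; have /andP[u0 u1] := WD x.
  rewrite normrM (ger0_norm (exprn_ge0 K u0)); apply: ler_pM => //.
    exact: exprn_ge0.
  by rewrite lerXn2r ?nnegrE //; exact: le_trans u0 u1.
have WS1 : Wt x * S x <= 1.
  by rewrite WS gerBl; apply: exprn_ge0; have /andP[] := WD x.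
have Sq : S x <= (q' ^+ N)^-1.
  have W0 : 0 < Wt x by exact: lt_le_trans (Wq x).
  apply: (@le_trans _ _ (Wt x)^-1).
    by rewrite -[X in _ <= X]mul1r ler_pdivlMr // mulrC.
  by rewrite lef_pV2 ?posrE.
have p2 : `|\sum_(y <- ys) (f x - f y) * (w y x * S x)| <=
   \sum_(y <- ys) (e / 3 * (w y x * S x) + 2 * M * (q / q') ^+ N).
  apply: le_trans (ler_norm_sum _ _ _) _; apply: ler_sum => y _.
  have wS0 : 0 <= w y x * S x by exact: mulr_ge0.
  rewrite normrM (ger0_norm wS0).
  have qqN : 0 <= 2 * M * (q / q') ^+ N.
    by rewrite !mulr_ge0 ?(ltW M1) // exprn_ge0 // divr_ge0 // ltW.
  have [h|h] := ltP q (bump (x - y)).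
    apply: (@le_trans _ _ (e / 3 * (w y x * S x))); last by rewrite lerDl.
    by apply: ler_wpM2r => //; exact: modulus.
  apply: (@le_trans _ _ (2 * M * (q / q') ^+ N)); last first.
    by rewrite lerDr mulr_ge0 // ltW.
  apply: ler_pM => //.
    by apply: le_trans (ler_normB _ _) _; have := hM x; have := hM y; lra.
  rewrite expr_div_n; apply: ler_pM => //.
  by rewrite /w lerXn2r ?nnegrE ?(ltW q0) // ltW // bump_gt0.
have p3 : \sum_(y <- ys) (e / 3 * (w y x * S x) + 2 * M * (q / q') ^+ N) <= e / 3 + e / 3.
  rewrite big_split /= -mulr_sumr -mulr_suml -/(Wt x) lerD //.
    by rewrite ler_piMr // ltW.
  rewrite big_const_seq count_predT iter_addr addr0 -[_ *+ _]mulr_natr.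
  by rewrite mulrAC.
lra.
Qed.

End Weyl.

(** * Equidistribution of nonresonant lines on the torus *)

Section Equidistribution.
Context {R : realType}.

Lemma cos_lin_derive (a phi s : R) :
  is_derive s (1 : R) (fun x => sin (a * x + phi)) (a * cos (a * s + phi)).
Proof.
exact: (@is_derive_affine R R sin (cos (a * s + phi)) a phi s (is_derive_sin _)).
Qed.

(** Fixing the first coordinate leaves a wave in one dimension less, whose phase is affine in that
    coordinate; the induction therefore runs over all phases. *)
Lemma torus_wave n (k : 'rV[int]_n) (phi : R) :
  torus_integral (wave k phi) = if k == 0 then cos phi else 0.
Proof.
elim: n k phi => [|n IH] k phi.
  by rewrite [k]thinmx0 eqxx /= wave0.
have sl x : slice (wave k phi) x =
    wave (rsubmx (k : 'rV_(1 + n))) (2 * pi * (k 0 0)%:~R * x + phi).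
  apply/funext => y; rewrite /slice /wave; congr cos.
  rewrite {1}/dot big_ord_recl.
  have -> : row_mx (x%:M : 'rV[R]_1) y 0 ord0 = x.
    rewrite (_ : ord0 = lshift n (0 : 'I_1)); last exact: val_inj.
    by rewrite row_mxEl mxE eqxx.
  rewrite (_ : \sum_(i < n) _ = dot (zvec R (rsubmx (k : 'rV_(1 + n)))) y).
    by rewrite mxE; ring.
  apply: eq_bigr => i _; rewrite !mxE (_ : lift ord0 i = rshift 1 i).
    by congr (_ * _); have := row_mxEr (x%:M : 'rV[R]_1) y 0 i; rewrite mxE.
  exact: val_inj.
have ks : (k == 0) = (rsubmx (k : 'rV_(1 + n)) == 0) && (k 0 0 == 0).
  apply/eqP/andP => [->|[/eqP k1 /eqP k2]].
    by split; [apply/eqP/rowP => i|]; rewrite !mxE.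
  apply/rowP => i; rewrite mxE.
  have [j ->|->] := unliftP ord0 i; last by rewrite k2.
  have := k1 => /rowP /(_ (j : 'I_n)); rewrite !mxE => <-.
  by congr (k _ _); exact: val_inj.
rewrite -[torus_integral _]/(Rintegral lebesgue_measure `[0%R, 1%R]
  (fun x : R => torus_integral (slice (wave k phi) x))).
rewrite (_ : (fun x : R => _) = (fun x => if rsubmx (k : 'rV_(1 + n)) == 0 then
  cos (2 * pi * (k 0 0)%:~R * x + phi) else 0)); last first.
  by apply/funext => x; rewrite sl IH.
rewrite ks; case: (rsubmx (k : 'rV_(1 + n)) == 0) => /=; last first.
  have := @Rintegral01_primitive R (cst 0) (cst 0) (@cst_continuous _ _ _)
    (fun s => is_derive_cst _ _ _).
  by rewrite subrr.
have [k0|k0] := eqVneq (k 0 0) 0.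
  rewrite k0 (_ : (fun x => _) = cst (cos phi)); last first.
    by apply/funext => x; rewrite mulr0 mul0r add0r.
  have d1 (s : R) : is_derive s (1 : R) (fun x => cos phi * x) (cst (cos phi) s).
    have := @is_derive_affine R R id 1 (cos phi) 0 s (is_derive_id _ _).
    by rewrite [_ *: _]mulr1; apply: is_derive_ext => t; rewrite addr0.
  have := Rintegral01_primitive (@cst_continuous _ _ _) d1.
  by rewrite mulr1 mulr0 subr0 => ->.
set a := 2 * pi * (k 0 0)%:~R.
have a0 : a != 0.
  by rewrite !mulf_neq0 ?intr_eq0 // ?pnatr_eq0 // gt_eqF // pi_gt0.
have d1 (s : R) : is_derive s (1 : R) (fun x => a^-1 * sin (a * x + phi)) (cos (a * s + phi)).
  have := @is_deriveZ _ _ _ _ (a^-1) _ _ _ (cos_lin_derive a phi s).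
  by rewrite [_ *: _]mulrA mulVf // mul1r.
rewrite (Rintegral01_primitive _ d1).
  (* [a] is an integer multiple of 2 pi, so the primitive has equal values at both ends; the sine is
     read as a cosine with phase shifted by pi / 2. *)
  rewrite mulr1 mulr0 add0r [a + phi]addrC.
  have := cos_period (k 0 0) (phi - pi / 2); rewrite addrAC !cosBpihalf -/a => ->.
  by rewrite subrr.
move=> x; exact: (eps_der_continuous (@is_derive_affine R R cos _ a phi x (is_derive_cos _))).
Qed.

(** Time integrals are expressed by an arbitrary primitive along the line, which is the form in
    which they occur in the averaging; [T0] is uniform in the starting point. *)
Definition equidist n (om : 'rV[R]_n) (f : 'rV[R]_n -> R) : Prop :=
  forall e : R, 0 < e -> exists2 T0 : R, 0 < T0 & forall T, T0 <= T ->
    forall x (F : R -> R), (forall s : R, is_derive s (1 : R) F (f (x + s *: om))) ->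
      `|F T - F 0 - T * torus_integral f| <= e * T.

Lemma prim_dist (f g F G : R -> R) (e T : R) : 0 <= T ->
  (forall s : R, is_derive s (1 : R) F (f s)) ->
  (forall s : R, is_derive s (1 : R) G (g s)) ->
  (forall s, `|f s - g s| <= e) ->
  `|(F T - F 0) - (G T - G 0)| <= e * T.
Proof.
move=> T0 dF dG fg.
have := @mean_value_const R R _ (fun s => F s - G s) (fun s => f s - g s) e 0 T T0.
rewrite subr0 (_ : F T - F 0 - (G T - G 0) = F T - G T - (F 0 - G 0)); last by ring.
by apply.
Qed.

Lemma line_continuous n (f : 'rV[R]_n -> R) (x om : 'rV[R]_n) :
  continuous f -> continuous (fun s : R => f (x + s *: om)).
Proof.
move=> cf s; apply: (@continuous_comp _ _ _ (fun s : R => x + s *: om) f); last exact: cf.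
by apply: continuousD; [exact: cst_continuous|exact: scalel_continuous].
Qed.

Lemma weyl_trig n (om : 'rV[R]_n) (f : 'rV[R]_n -> R) :
  (forall k : 'rV[int]_n, k != 0 -> dot (zvec R k) om != 0) ->
  trig f -> equidist om f.
Proof.
move=> nr; elim=> [k phi|f1 f2 c t1 h1 t2 h2] e e0.
  rewrite torus_wave; have [->|k0] := eqVneq k 0.
    exists 1 => // T T1 x F dF.
    have T0 : 0 <= T by lra.
    have dG (s : R) : is_derive s (1 : R) (fun s => cos phi * s) (cos phi).
      have := @is_derive_affine R R id 1 (cos phi) 0 s (is_derive_id _ _).
      by rewrite [_ *: _]mulr1; apply: is_derive_ext => t; rewrite addr0.
    have := @prim_dist _ _ _ _ 0 T T0 dF dG.
    rewrite mulr0 subr0 [cos phi * T]mulrC mul0r => h.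
    apply: le_trans (h _) _; last by rewrite mulr_ge0 // ltW.
    by move=> s; rewrite wave0 subrr normr0.
  set a := 2 * pi * dot (zvec R k) om.
  have a0 : a != 0.
    by rewrite !mulf_neq0 ?pnatr_eq0 ?nr // gt_eqF // pi_gt0.
  have aN : 0 < `|a| by rewrite normr_gt0.
  (* Along the line a nonresonant wave has a primitive of amplitude [1 / |a|], which oscillates by
     at most [2 / |a|]. *)
  exists (2 / `|a| / e); first by rewrite !divr_gt0.
  move=> T TT x F dF; rewrite mulr0 subr0.
  have T0 : 0 <= T by apply: le_trans TT; rewrite !divr_ge0 // ltW.
  set b := 2 * pi * dot (zvec R k) x + phi.
  have dG (s : R) : is_derive s (1 : R) (fun s => a^-1 * sin (a * s + b)) (cos (a * s + b)).
    have := @is_deriveZ _ _ _ _ (a^-1) _ _ _ (cos_lin_derive a b s).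
    by rewrite [_ *: _]mulrA mulVf // mul1r.
  have := @prim_dist _ _ _ _ 0 T T0 dF dG; rewrite mul0r => h.
  have E : F T - F 0 = a^-1 * sin (a * T + b) - a^-1 * sin (a * 0 + b).
    apply/eqP; rewrite -subr_eq0 -normr_le0; apply: h => s.
    rewrite /wave dotDr dotZr (_ : 2 * pi * _ + phi = a * s + b).
      by rewrite subrr normr0.
    by rewrite /a /b; ring.
  rewrite E -mulrBr normrM normfV.
  apply: (@le_trans _ _ (`|a|^-1 * 2)).
    apply: ler_wpM2l; first by rewrite invr_ge0.
    apply: le_trans (ler_normB _ _) _.
    have := sin_max (a * T + b); have := sin_max (a * 0 + b); lra.
  move: TT; rewrite ler_pdivrMr // => h'; rewrite mulrC; apply: le_trans h' _.
  by rewrite mulrC.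
have c0 : 0 < `|c| + 1 by rewrite ltr_wpDl.
have e2 : 0 < e / 2 by lra.
have [T1 T10 hT1] := h1 _ e2.
have [T2 T20 hT2] := h2 _ (divr_gt0 e2 c0).
exists (Num.max T1 T2); first by rewrite lt_max T10.
move=> T; rewrite ge_max => /andP[TT1 TT2] x F dF.
have T0 : 0 <= T by lra.
have cc (t : 'rV[R]_n -> R) (tt : trig t) := @line_continuous n t x om (unif_continuous (trig_unif tt)).
have [F1 [_ dF1]] := real_primitive (cc _ t1).
have [F2 [_ dF2]] := real_primitive (cc _ t2).
have dG (s : R) : is_derive s (1 : R) (fun s => F1 s + c * F2 s)
    (f1 (x + s *: om) + c * f2 (x + s *: om)).
  have ? := dF1 s; have h := @is_deriveZ _ _ _ _ c _ _ _ (dF2 s).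
  exact: is_deriveD.
have := @prim_dist _ _ _ _ 0 T T0 dF dG; rewrite mul0r => h.
have E : F T - F 0 = (F1 T + c * F2 T) - (F1 0 + c * F2 0).
  by apply/eqP; rewrite -subr_eq0 -normr_le0; apply: h => s; rewrite subrr normr0.
rewrite E torus_integral_lin; [|exact: trig_unif..].
have b1 := hT1 T TT1 x F1 dF1; have b2 := hT2 T TT2 x F2 dF2.
have -> : F1 T + c * F2 T - (F1 0 + c * F2 0) -
    T * (torus_integral f1 + c * torus_integral f2) =
  (F1 T - F1 0 - T * torus_integral f1) + c * (F2 T - F2 0 - T * torus_integral f2).
  by ring.
apply: le_trans (ler_normD _ _) _; rewrite normrM.
have -> : e * T = e / 2 * T + e / 2 * T by lra.
apply: lerD => //.
apply: (@le_trans _ _ ((`|c| + 1) * (e / 2 / (`|c| + 1) * T))).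
  by apply: ler_pM => //; rewrite lerDl.
by rewrite mulrA [_ * (e / 2 / _)]mulrC divfK // gt_eqF.
Qed.

(** A uniformly close trigonometric polynomial changes the time average and the space average by at
    most [e / 3] each. *)
Theorem weyl n (om : 'rV[R]_n) (f : 'rV[R]_n -> R) :
  (forall k : 'rV[int]_n, k != 0 -> dot (zvec R k) om != 0) ->
  continuous f -> periodic_for (zlat n) f -> equidist om f.
Proof.
move=> nr cf pf e e0; have e3 : 0 < e / 3 by lra.
have [g tg fg] := trig_dense cf pf e3.
have [T0 T00 hT] := weyl_trig nr tg e3.
exists T0 => // T TT x F dF; have T1 : 0 <= T by lra.
have [G [_ dG]] := real_primitive (@line_continuous n g x om (unif_continuous (trig_unif tg))).
have b1 := hT T TT x G dG.
have b2 := prim_dist T1 dF dG (fun s => fg _).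
have b3 := torus_integral_dist (periodic_unif cf pf) (trig_unif tg) fg.
have -> : F T - F 0 - T * torus_integral f =
  (F T - F 0 - (G T - G 0)) + (G T - G 0 - T * torus_integral g) +
  (- T) * (torus_integral f - torus_integral g) by ring.
apply: le_trans (ler_normD _ _) _; apply: le_trans (lerD (ler_normD _ _) (lexx _)) _.
rewrite [X in _ + X]normrM normrN (ger0_norm T1).
have := ler_wpM2l T1 b3; lra.
Qed.

(** The means of [f] and of its translate are limits of time averages along one and the same line,
    so they agree; this replaces a change of variables in the iterated integral. *)
Lemma torus_integral_shift n (om : 'rV[R]_n) (f : 'rV[R]_n -> R) (a : 'rV[R]_n) :
  (forall k : 'rV[int]_n, k != 0 -> dot (zvec R k) om != 0) ->
  continuous f -> periodic_for (zlat n) f ->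
  torus_integral (fun x => f (x + a)) = torus_integral f.
Proof.
move=> nr cf pf; pose g x := f (x + a).
have cg : continuous g.
  move=> x; apply/cont_epsP => e e0.
  have /cont_epsP/(_ e e0)[d d0 hd] := cf (x + a); exists d => // y yx.
  by apply: hd; rewrite opprD addrACA subrr addr0.
have pg : periodic_for (zlat n) g by move=> x l Ll; rewrite /g addrAC pf.
apply/eqP; rewrite -subr_eq0 -normr_le0; apply/ler_addgt0Pr => e e0; rewrite add0r.
have e2 : 0 < e / 2 by lra.
have [T1 T10 h1] := weyl nr cf pf e2.
have [T2 T20 h2] := weyl nr cg pg e2.
pose T := Num.max T1 T2.
have TT1 : T1 <= T by rewrite le_max lexx.
have TT2 : T2 <= T by rewrite le_max lexx orbT.
have T0 : 0 < T by exact: lt_le_trans TT1.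
have [F [_ dF]] := real_primitive (@line_continuous n f a om cf).
have b1 := h1 T TT1 a F dF.
have b2 : `|F T - F 0 - T * torus_integral g| <= e / 2 * T.
  by apply: (h2 T TT2 0 F) => s; rewrite /g add0r addrC.
rewrite -(ler_pM2r T0) -[X in _ * X](ger0_norm (ltW T0)) -normrM.
have -> : (torus_integral g - torus_integral f) * T =
  (F T - F 0 - T * torus_integral f) - (F T - F 0 - T * torus_integral g) by ring.
by apply: le_trans (ler_normB _ _) _; lra.
Qed.

End Equidistribution.

(** * Averages over the fast angles *)

Section LineDerivative.
Context {R : realType}.

Lemma is_derive_lineP (V W : normedModType R) (f : V -> W) (z v : V) (d : W) :
  is_derive z v f d <-> is_derive (0 : R) (1 : R) (fun t : R => f (z + t *: v)) d.
Proof.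
suff E : (fun h : R => h^-1 *: ((f \o shift z) (h *: v) - f z)) =
    (fun h : R => h^-1 *: (((fun t : R => f (z + t *: v)) \o shift 0) (h *: (1 : R)) -
                           f (z + (0 : R) *: v))).
  by split=> -[h1 h2]; split; move: h1 h2; rewrite /derivable /derive E.
by apply/funext => h /=; rewrite [h *: 1]mulr1 [h + 0]addr0 scale0r [z + 0]addr0 [z + _]addrC.
Qed.

Lemma is_derive_line (V W : normedModType R) (f : V -> W) (z v : V) (s : R) (d : W) :
  is_derive (z + s *: v) v f d ->
  is_derive s (1 : R) (fun t : R => f (z + t *: v)) d.
Proof.
move=> /is_derive_lineP; rewrite -[X in is_derive X](subrr s) -[s in s - s]mul1r.
move=> /is_derive_affine; rewrite scale1r; apply: is_derive_ext => t.
by rewrite -addrA -scalerDl; congr (f (_ + _ *: _)); ring.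
Qed.

Lemma line_mvt (V : normedModType R) (f f' : V -> R) (z v : V) (h : R) : 0 < h ->
  (forall y, is_derive y v f (f' y)) ->
  exists2 xi : R, 0 < xi < h & f (z + h *: v) - f z = h * f' (z + xi *: v).
Proof.
move=> h0 df; have dl s := is_derive_line (df (z + s *: v)).
have [|c] := @MVT R (fun t => f (z + t *: v)) (fun t => f' (z + t *: v)) 0 h h0.
  by apply: derivable_within_continuous => s _; have [] := dl s.
rewrite in_itv /= scale0r addr0 subr0 => ch E; exists c => //.
by rewrite E mulrC.
Qed.

(** Phrased with directional derivatives because it is applied to averages of [G] in the slow angle,
    whose derivatives are obtained direction by direction. *)
Lemma schwarz (V : normedModType R) (f fv fw fvw fwv : V -> R) (v w x : V) :
  (forall y, is_derive y v f (fv y)) -> (forall y, is_derive y w f (fw y)) ->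
  (forall y, is_derive y w fv (fvw y)) -> (forall y, is_derive y v fw (fwv y)) ->
  {for x, continuous fvw} -> {for x, continuous fwv} -> fvw x = fwv x.
Proof.
move=> dv dw dvw dwv cvw cwv.
apply/eqP; rewrite -subr_eq0 -normr_le0; apply/ler_addgt0Pr => e e0; rewrite add0r.
have e2 : 0 < e / 2 by lra.
have /cont_epsP/(_ _ e2)[d1 d10 h1] := cvw.
have /cont_epsP/(_ _ e2)[d2 d20 h2] := cwv.
pose N := `|v| + `|w| + 1; have N0 : 0 < N by rewrite ltr_wpDl // addr_ge0.
pose h := Num.min d1 d2 / 2 / N.
have dd : 0 < Num.min d1 d2 by rewrite lt_min d10.
have h0 : 0 < h by rewrite !divr_gt0.
have small (a b : R) : 0 < a < h -> 0 < b < h ->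
    `|x + a *: v + b *: w - x| < Num.min d1 d2.
  move=> /andP[a0 ah] /andP[b0 bh]; rewrite addrAC [x + _]addrC addrK.
  apply: le_lt_trans (ler_normD _ _) _; rewrite !normrZ !gtr0_norm //.
  have k1 : a * `|v| <= h * `|v| by rewrite ler_wpM2r // ltW.
  have k2 : b * `|w| <= h * `|w| by rewrite ler_wpM2r // ltW.
  have : h * N = Num.min d1 d2 / 2 by rewrite /h divfK // gt_eqF.
  rewrite /N; nra.
(* both mixed derivatives compute the same second difference *)
have second (f0 a ab : V -> R) (p q : V) : (forall y, is_derive y p f0 (a y)) ->
    (forall y, is_derive y q a (ab y)) ->
    exists xi eta : R, [/\ 0 < xi < h, 0 < eta < h &
      f0 (x + h *: p + h *: q) - f0 (x + h *: p) - f0 (x + h *: q) + f0 x =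
      h * (h * ab (x + xi *: p + eta *: q))].
  move=> da dab.
  have dg y : is_derive y p (fun z => f0 (z + h *: q) - f0 z) (a (y + h *: q) - a y).
    have h3 : is_derive y p (fun z => f0 (z + h *: q)) (a (y + h *: q)).
      apply/is_derive_lineP; have /is_derive_lineP := da (y + h *: q).
      by apply: is_derive_ext => t; rewrite addrAC.
    by have ? := da y; exact: is_deriveB.
  have [xi xih E1] := line_mvt x h0 dg.
  have [eta etah E2] := line_mvt (x + xi *: p) h0 dab.
  exists xi, eta; split => //; rewrite -E2 -E1; ring.
have [xi [eta [k1 k2 E1]]] := second _ _ _ _ _ dv dvw.
have [xi' [eta' [k1' k2' E2]]] := second _ _ _ _ _ dw dwv.
have E : fvw (x + xi *: v + eta *: w) = fwv (x + eta' *: v + xi' *: w).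
  have hn : h != 0 by rewrite gt_eqF.
  apply: (mulfI hn); apply: (mulfI hn).
  rewrite -E1 [x + eta' *: v + _]addrAC -E2 [x + h *: w + _]addrAC; ring.
have m1 : Num.min d1 d2 <= d1 by rewrite ge_min lexx.
have m2 : Num.min d1 d2 <= d2 by rewrite ge_min lexx orbT.
have b1 := h1 _ (lt_le_trans (small _ _ k1 k2) m1).
have b2 := h2 _ (lt_le_trans (small _ _ k2' k1') m2).
have -> : fvw x - fwv x = (fwv (x + eta' *: v + xi' *: w) - fwv x) -
   (fvw (x + xi *: v + eta *: w) - fvw x) by rewrite E; ring.
by apply: le_trans (ler_normB _ _) _; lra.
Qed.

(** The even function [f z + f (- z)] has no first-order term, so two mean value steps express its
    increment by one value of [f''] near 0; a negative [f'' 0] would push [f] below the minimum at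
    [h v] or [- h v]. *)
Lemma local_min_second (V : normedModType R) (f f' f'' : V -> R) (v : V) :
  (forall y, is_derive y v f (f' y)) -> (forall y, is_derive y v f' (f'' y)) ->
  {for 0, continuous f''} -> (\forall y \near (0 : V), f 0 <= f y) -> 0 <= f'' 0.
Proof.
move=> df df' cf /nbhs0_ex[d1 d10 lmin]; rewrite leNgt; apply/negP => neg.
have e0 : 0 < - f'' 0 / 2 by lra.
have /cont_epsP/(_ _ e0)[d2 d20 h2] := cf.
pose N := `|v| + 1; have N0 : 0 < N by rewrite ltr_wpDl.
pose h := Num.min d1 d2 / N.
have dd : 0 < Num.min d1 d2 by rewrite lt_min d10.
have h0 : 0 < h by rewrite divr_gt0.
have hN : h * `|v| < Num.min d1 d2.
  have : h * N = Num.min d1 d2 by rewrite /h divfK // gt_eqF.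
  by rewrite /N mulrDr mulr1; lra.
have dN y : is_derive y v (fun z => f (- z)) (- f' (- y)).
  apply/is_derive_lineP.
  have := @is_derive_affine R R (fun t => f (- y + t *: v)) (f' (- y)) (- 1) 0 0.
  rewrite mulr0 addr0 => /(_ ((is_derive_lineP _ _ _ _).1 (df (- y)))).
  rewrite scaleN1r; apply: is_derive_ext => t; congr f.
  by rewrite mulN1r addr0 scaleNr opprD.
have du y : is_derive y v (fun z => f z + f (- z)) (f' y - f' (- y)).
  by have ? := df y; have ? := dN y; exact: is_deriveD.
have [xi /andP[x0 xh] E] := line_mvt 0 h0 du.
have x20 : 0 < 2 * xi by lra.
have [eta /andP[t0 th] E2] := line_mvt (- (xi *: v)) x20 df'.
have zE : - (xi *: v) + (2 * xi) *: v = xi *: v.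
  by rewrite -scaleNr -scalerDl; congr (_ *: _); ring.
rewrite zE in E2; rewrite !add0r oppr0 E2 in E.
have pt : `|- (xi *: v) + eta *: v - 0| < d2.
  rewrite subr0 -scaleNr -scalerDl normrZ.
  have : `|- xi + eta| <= h by rewrite ler_norml; apply/andP; split; lra.
  move=> /(ler_wpM2r (normr_ge0 v)) /le_lt_trans; apply.
  by apply: lt_le_trans hN _; rewrite ge_min lexx orbT.
have bad : f'' (- (xi *: v) + eta *: v) < 0.
  by have := h2 _ pt; rewrite ler_norml => /andP[]; lra.
have p1 : f 0 <= f (h *: v).
  apply: lmin; rewrite normrZ gtr0_norm //; apply: lt_le_trans hN _.
  by rewrite ge_min lexx.
have p2 : f 0 <= f (- (h *: v)).
  apply: lmin; rewrite normrN normrZ gtr0_norm //; apply: lt_le_trans hN _.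
  by rewrite ge_min lexx.
have : h * (2 * xi * f'' (- (xi *: v) + eta *: v)) < 0.
  by rewrite pmulr_rlt0 // pmulr_rlt0.
lra.
Qed.

Lemma sum_continuous (V : normedModType R) (I : finType) (F : I -> V -> R) :
  (forall i, continuous (F i)) -> continuous (fun x => \sum_i F i x).
Proof.
move=> cF; elim: (index_enum I) => [|i r IH].
  rewrite (_ : (fun x => _) = cst 0); first exact: cst_continuous.
  by apply/funext => x; rewrite big_nil.
rewrite (_ : (fun x => _) = (fun x => F i x + \sum_(j <- r) F j x)).
  by move=> x; apply: continuousD; [exact: cF|exact: IH].
by apply/funext => x; rewrite big_cons.
Qed.

Lemma posdef_coercive n (M : 'M[R]_n) :
  (forall u : 'rV[R]_n, u != 0 -> 0 < dot (u *m M) u) ->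
  exists2 c : R, 0 < c & forall u, c * `|u| ^+ 2 <= dot (u *m M) u.
Proof.
move=> pd; pose Q u := dot (u *m M) u.
have QZ a u : Q (a *: u) = a ^+ 2 * Q u.
  by rewrite /Q -scalemxAl dotZl dotZr mulrA expr2.
have cQ : continuous Q.
  rewrite (_ : Q = fun u => \sum_i (\sum_j u 0 j * M j i) * u 0 i); last first.
    by apply/funext => u; apply: eq_bigr => i _; rewrite mxE.
  apply: sum_continuous => i u; apply: continuousM; last exact: coord_continuous.
  apply: sum_continuous => j v; apply: continuousM; last exact: cst_continuous.
  exact: coord_continuous.
have nrm (u : 'rV[R]_n) : u != 0 ->
    `| `|u|^-1 *: u| = 1 /\ Q u = `|u| ^+ 2 * Q (`|u|^-1 *: u).
  move=> un; have nu : `|u| != 0 by rewrite normr_eq0.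
  split; first by rewrite normrZ normfV normr_id mulVf.
  by rewrite QZ mulrA exprVn divff ?mul1r // expf_neq0.
have Q0 : Q 0 = 0 by rewrite -(scale0r 0) QZ expr2 !mul0r.
(* In dimension 0 the unit sphere is empty and any constant will do; otherwise the constant is the
   minimum of the form on the compact sphere of the sup norm. *)
have [E|/set0P ne] := eqVneq [set u : 'rV[R]_n | `|u| = 1] set0.
  exists 1 => // u; have [->|un] := eqVneq u 0.
    by rewrite -/(Q 0) Q0 normr0 expr0n mulr0.
  have [h _] := nrm u un; have : set0 (`|u|^-1 *: u) by rewrite -E.
  by [].
have cS : compact [set u : 'rV[R]_n | `|u| = 1].
  apply: (@subclosed_compact _ _ [set x | `|x - 0| <= 1]).
  - rewrite (_ : [set u : 'rV[R]_n | `|u| = 1] = (fun u => `|u|) @^-1` [set 1]) //.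
    apply: closed_comp; last exact: closed_eq.
    by move=> u _; exact: norm_continuous.
  - exact: ball_compact.
  - by move=> u /= u1; rewrite subr0 u1.
have [u0 u01 umin] := EVT_min_rV ne cS (continuous_subspaceT cQ).
have u0n : u0 != 0.
  by rewrite -normr_eq0; move: u01; rewrite inE /= => ->; exact: oner_neq0.
exists (Q u0); first exact: pd.
move=> u; have [->|un] := eqVneq u 0.
  by rewrite -/(Q 0) Q0 normr0 expr0n mulr0.
have [h1 h2] := nrm u un; rewrite -/(Q u) h2 mulrC ler_wpM2l ?exprn_ge0 //.
by apply: umin; rewrite inE.
Qed.

End LineDerivative.

(** * Averages over time and the fast angles *)

Section Averaging.
Context {R : realType} {m r : nat}.
Implicit Types (phi psi G : ext R m r -> R) (q v w : 'rV[R]_r).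

Definition extlat : set (ext R m r) := [set l | exists (a : int) (k : 'rV[int]_m)
  (b : 'rV[int]_r), l = (a%:~R, (zvec R k, zvec R b), 0)].

Lemma norm_pair (V W : normedModType R) (a : V) (b : W) :
  `|(a, b)| = Num.max `|a| `|b|.
Proof. by []. Qed.

Lemma norm_pair_le (V W : normedModType R) (a : V) (b : W) (C : R) :
  `|a| <= C -> `|b| <= C -> `|(a, b)| <= C.
Proof. by move=> ha hb; rewrite norm_pair ge_max ha. Qed.

Lemma row_mx0 n (a : 'rV[R]_1) (v : 'rV[R]_n) :
  (row_mx a v : 'rV[R]_n.+1) 0 0 = a 0 0.
Proof.
rewrite -(row_mxEl a v 0 0); congr (fun_of_matrix (row_mx _ _) _ _).
exact: val_inj.
Qed.

Lemma pairD (V W : normedModType R) (a c : V) (b d : W) :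
  (a, b) + (c, d) = (a + c, b + d).
Proof. by []. Qed.

Lemma pairN (V W : normedModType R) (a : V) (b : W) : - (a, b) = (- a, - b).
Proof. by []. Qed.

Lemma pairZ (V W : normedModType R) (k : R) (a : V) (b : W) :
  k *: (a, b) = (k *: a, k *: b).
Proof. by []. Qed.

Lemma norm_fst (V W : normedModType R) (x : V * W) : `|x.1| <= `|x|.
Proof. by rewrite [`|x|]/Num.norm /= le_max lexx. Qed.

Lemma norm_snd (V W : normedModType R) (x : V * W) : `|x.2| <= `|x|.
Proof. by rewrite [`|x|]/Num.norm /= le_max lexx orbT. Qed.

Definition strip (p0 : pt R m r) (M : R) : set (ext R m r) := [set z | `|z.2 - p0| <= M].

Lemma rv_mod1 n (x : 'rV[R]_n) : exists k : 'rV[int]_n, `|x - zvec R k| <= 1.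
Proof.
exists (\row_i sval (cid (real_mod1 (x 0 i)))).
apply: rv_norm_le => // i; rewrite !mxE.
by have /andP[h1 /ltW h2] := svalP (cid (real_mod1 (x 0 i))); rewrite ger0_norm.
Qed.

Lemma tame_strip (p0 : pt R m r) (M : R) : tame extlat (strip p0 M).
Proof.
pose c : ext R m r := (0, 0, p0).
exists [set x | `|x - c| <= Num.max 1 M]; first exact: ball_compact.
move=> [[t [q1 q2]] p] zM; rewrite /strip /= in zM.
have [a /andP[a1 /ltW a2]] := real_mod1 t.
have [k hk] := rv_mod1 q1; have [b hb] := rv_mod1 q2.
exists (t - a%:~R, (q1 - zvec R k, q2 - zvec R b), p), (a%:~R, (zvec R k, zvec R b), 0).
split; last first.
- by rewrite !pairD !subrK addr0.
- by exists a, k, b.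
rewrite /= /c !pairN !pairD !subr0.
have w1 (x : R) : x <= 1 -> x <= Num.max 1 M by move=> h; rewrite le_max h.
apply: norm_pair_le; last by rewrite le_max zM orbT.
apply: norm_pair_le; first by apply: w1; rewrite ger0_norm.
by apply: norm_pair_le; exact: w1.
Qed.

(** Time and the fast angles form one torus of dimension [m + 1], time first, on which (1, omega) is
    a single frequency vector; the slow angle [q] is a parameter and the momentum is frozen at
    [p0]. *)
Definition emb (p0 : pt R m r) (x : 'rV[R]_m.+1) q : ext R m r :=
  (x 0 0, (rsubmx (x : 'rV_(1 + m)), q), p0).

Definition avg (p0 : pt R m r) phi q : R := torus_integral (fun x => phi (emb p0 x q)).

Lemma embD (p0 : pt R m r) (x y : 'rV[R]_m.+1) q w :
  emb p0 (x + y) (q + w) = emb p0 x q + (y 0 0, (rsubmx (y : 'rV_(1 + m)), w), 0).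
Proof.
rewrite /emb !pairD addr0 mxE; congr (_, (_, _), _).
by apply/rowP => i; rewrite !mxE.
Qed.

Lemma emb_dist (p0 : pt R m r) (x y : 'rV[R]_m.+1) q w :
  `|emb p0 x q - emb p0 y w| <= Num.max `|x - y| `|q - w|.
Proof.
rewrite -{1}(subrK y x) -{1}(subrK w q) [x - y + y]addrC [q - w + w]addrC embD.
rewrite addrAC subrr add0r !norm_pair normr0 !ge_max !le_max lexx !orbT !andbT /=.
rewrite normr0 normr_ge0 !andbT rv_norm_coord /=.
apply/orP; left; apply: rv_norm_le => // i; rewrite mxE.
exact: (rv_norm_coord (x - y)).
Qed.

Lemma emb_strip (p0 : pt R m r) x q : strip p0 0 (emb p0 x q).
Proof. by rewrite /strip /= subrr normr0. Qed.

Lemma emb_periodic (p0 : pt R m r) phi q : periodic_for extlat phi ->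
  periodic_for (zlat m.+1) (fun x => phi (emb p0 x q)).
Proof.
move=> pphi x _ [k ->]; rewrite -[q in LHS]addr0 embD pphi //.
exists (k 0 0), (rsubmx (k : 'rV_(1 + m))), 0; congr (_, (_, _), _).
- by rewrite mxE.
- by apply/rowP => i; rewrite !mxE.
- by apply/rowP => i; rewrite !mxE.
Qed.

Lemma emb_unif (p0 : pt R m r) phi : periodic_for extlat phi -> continuous phi ->
  forall e : R, 0 < e -> exists2 d : R, 0 < d & forall x y q w,
    `|x - y| < d -> `|q - w| < d -> `|phi (emb p0 x q) - phi (emb p0 y w)| <= e.
Proof.
move=> pphi cphi e e0; have [d d0 hd] := tame_unif (tame_strip p0 0) pphi cphi e0.
exists d => // x y q w xy qw; apply: hd; first exact: emb_strip.
by apply: le_lt_trans (emb_dist _ _ _ _ _) _; rewrite gt_max xy.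
Qed.

Lemma emb_unif_on (p0 : pt R m r) phi q : periodic_for extlat phi -> continuous phi ->
  unif_on setT (fun x => phi (emb p0 x q)).
Proof.
move=> pphi cphi e e0; have [d d0 hd] := emb_unif p0 pphi cphi e0.
by exists d => // x y _ xy; apply: hd => //; rewrite subrr normr0.
Qed.

Lemma averagedE (p0 : pt R m r) G q : averaged G p0 q = avg p0 G q.
Proof.
rewrite /averaged /avg /=; congr Rintegral; apply/funext => t.
congr torus_integral; apply/funext => q1; congr G; rewrite /emb row_mxKr.
by congr (_, _, _); rewrite row_mx0 mxE eqxx.
Qed.

Lemma avg_lin (p0 : pt R m r) phi psi c q :
  periodic_for extlat phi -> continuous phi ->
  periodic_for extlat psi -> continuous psi ->
  avg p0 (fun z => phi z + c * psi z) q = avg p0 phi q + c * avg p0 psi q.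
Proof. by move=> *; apply: torus_integral_lin; exact: emb_unif_on. Qed.

Lemma avg_continuous (p0 : pt R m r) phi : periodic_for extlat phi -> continuous phi ->
  forall e : R, 0 < e -> exists2 d : R, 0 < d & forall q w,
    `|q - w| < d -> `|avg p0 phi q - avg p0 phi w| <= e.
Proof.
move=> pphi cphi e e0; have [d d0 hd] := emb_unif p0 pphi cphi e0.
exists d => // q w qw; apply: torus_integral_dist; [exact: emb_unif_on..|].
by move=> x; apply: hd => //; rewrite subrr normr0.
Qed.

Definition q1dir (v : 'rV[R]_m) : ext R m r := (0, (v, 0), 0).
Definition q2dir v : ext R m r := (0, (0, v), 0).

Lemma C1_continuous phi : Ck_on 1 setT phi -> continuous phi.
Proof. by move=> [dphi _] z; apply: differentiable_continuous; exact: dphi. Qed.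

Lemma C1_D_continuous phi d : Ck_on 1 setT phi -> continuous (fun z => 'D_d phi z).
Proof. by move=> [_ h] z; exact: h. Qed.

(** Differentiation under the integral sign: the Taylor remainder is uniform in the fast variables
    by tameness, and uniformly close functions have close integrals. The displacement [y] of the
    fast variables is kept for [avg_q1_derive]. *)
Lemma avg_taylor (p0 : pt R m r) phi (y : 'rV[R]_m.+1) w :
  periodic_for extlat phi -> Ck_on 1 setT phi ->
  let d : ext R m r := (y 0 0, (rsubmx (y : 'rV_(1 + m)), w), 0) in
  forall e : R, 0 < e -> exists2 d0 : R, 0 < d0 & forall (h : R) q, `|h| < d0 ->
    `|torus_integral (fun x => phi (emb p0 (x + h *: y) (q + h *: w))) -
      (avg p0 phi q + h * avg p0 (fun z => 'D_d phi z) q)| <= e * `|h|.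
Proof.
move=> pphi C1 d e e0.
have cphi := C1_continuous C1; have cD := C1_D_continuous (d := d) C1.
have pD := periodic_derive d pphi.
pose N := `|d| + 1; have N0 : 0 < N by rewrite ltr_wpDl.
have [d0 d00 hd] := C1_taylor_unif (tame_strip p0 0) pphi C1 (divr_gt0 e0 N0).
exists (d0 / N); first exact: divr_gt0.
move=> h q; rewrite ltr_pdivlMr // => hN.
have hd' : `|h *: d| <= `|h| * N by rewrite normrZ ler_wpM2l // lerDl.
rewrite /avg -torus_integral_lin; [|exact: (emb_unif_on p0 q pphi cphi)|exact: (emb_unif_on p0 q pD cD)].
have emE x : emb p0 (x + h *: y) (q + h *: w) = emb p0 x q + h *: d.
  rewrite embD; congr (_ + _); rewrite /d pairZ scaler0 pairZ pairZ mxE.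
  by congr (_, (_, _), _); apply/rowP => i; rewrite !mxE.
apply: torus_integral_dist.
- move=> e1 e10; have [d1 d10 hd1] := emb_unif p0 pphi cphi e10.
  exists d1 => // x x' _ xx'; apply: hd1; last by rewrite subrr normr0.
  by rewrite opprD addrACA subrr addr0.
- by apply: unif_lin; [exact: (emb_unif_on p0 q pphi cphi)|exact: (emb_unif_on p0 q pD cD)].
move=> x; rewrite emE; have := hd (emb p0 x q) (h *: d) (emb_strip _ _ _).
rewrite linearZ /= -deriveE; last exact: Ck1_diff C1 _.
rewrite opprD addrA => h1; apply: le_trans (h1 _) _; first exact: le_lt_trans hN.
apply: le_trans (ler_wpM2l _ hd') _; first by rewrite divr_ge0 // ltW.
by rewrite mulrCA -mulrA mulVf ?mulr1 ?gt_eqF // mulrC.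
Qed.

Lemma avg_derive (p0 : pt R m r) phi w q : periodic_for extlat phi -> Ck_on 1 setT phi ->
  is_derive q w (avg p0 phi) (avg p0 (fun z => 'D_(q2dir w) phi z) q).
Proof.
move=> pphi C1; apply/is_derive_lineP; apply: eps_derive => e e0.
have [d0 d00 hd] := avg_taylor p0 0 w pphi C1 e0.
exists d0 => // h hh; have := hd h q hh.
have -> : ((0 : 'rV[R]_m.+1) 0 0, (rsubmx (0 : 'rV_(1 + m)), w), 0 : pt R m r) = q2dir w.
  by rewrite /q2dir mxE; congr (_, (_, _), _); apply/rowP => i; rewrite !mxE.
rewrite add0r scale0r addr0 opprD addrA -[h *: avg _ _ _]/(h * avg _ _ _).
rewrite (_ : (fun x : 'rV[R]_m.+1 => phi (emb p0 (x + h *: 0) (q + h *: w))) =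
  (fun x => phi (emb p0 x (q + h *: w)))) //.
by apply/funext => x; rewrite scaler0 addr0.
Qed.

(** By translation invariance the average is unchanged when the fast angles are shifted, so its
    first-order variation vanishes. *)
Lemma avg_q1_derive (p0 : pt R m r) (om : 'rV[R]_m.+1) phi (v : 'rV[R]_m) q :
  (forall k : 'rV[int]_m.+1, k != 0 -> dot (zvec R k) om != 0) ->
  periodic_for extlat phi -> Ck_on 1 setT phi ->
  avg p0 (fun z => 'D_(q1dir v) phi z) q = 0.
Proof.
move=> nr pphi C1; apply/eqP; rewrite -normr_le0; apply/ler_addgt0Pr => e e0.
rewrite add0r; pose y : 'rV[R]_m.+1 := row_mx (0 : 'rV[R]_1) v.
have [d0 d00 hd] := avg_taylor p0 y 0 pphi C1 e0.
pose h := d0 / 2; have h0 : 0 < h by rewrite divr_gt0.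
have hh : `|h| < d0 by rewrite gtr0_norm // /h; lra.
have := hd h q hh.
have -> : (y 0 0, (rsubmx (y : 'rV_(1 + m)), 0), 0 : pt R m r) = q1dir v.
  rewrite /q1dir /y row_mxKr; congr (_, _, _).
  by rewrite row_mx0 mxE.
have -> : torus_integral (fun x => phi (emb p0 (x + h *: y) (q + h *: 0))) = avg p0 phi q.
  rewrite scaler0 addr0.
  have := torus_integral_shift (h *: y) nr (unif_continuous (emb_unif_on p0 q pphi (C1_continuous C1)))
    (emb_periodic p0 q pphi).
  by [].
rewrite opprD addrA subrr sub0r normrN normrM mulrC ler_pM2r //.
by rewrite normr_gt0 gt_eqF.
Qed.

(** Uniformity in the slow angle: near a given [q] both the time averages and [avg] move by at most
    [e / 3], and compactness of the ball turns these local thresholds into one. *)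
Lemma weyl_strip (p0 : pt R m r) (om : 'rV[R]_m.+1) phi (M e : R) :
  (forall k : 'rV[int]_m.+1, k != 0 -> dot (zvec R k) om != 0) ->
  periodic_for extlat phi -> continuous phi -> 0 < e ->
  \forall T \near +oo, forall q, `|q| <= M ->
    forall x (F : R -> R), (forall s : R, is_derive s (1 : R) F (phi (emb p0 (x + s *: om) q))) ->
      `|F T - F 0 - T * avg p0 phi q| <= e * T.
Proof.
move=> nr pphi cphi e0.
have cK := (compact_near_coveringP _).1 (@ball_compact R 'rV[R]_r (fdim_rV R r) 0 M).
have e3 : 0 < e / 3 by lra.
have [d d0 hd] := emb_unif p0 pphi cphi e3.
have [d' d'0 hd'] := avg_continuous p0 pphi cphi e3.
suff: \forall T \near +oo, [set x | `|x - 0| <= M] `<=` (fun q =>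
    forall x (F : R -> R), (forall s : R, is_derive s (1 : R) F (phi (emb p0 (x + s *: om) q))) ->
      `|F T - F 0 - T * avg p0 phi q| <= e * T).
  by apply: filterS => T h q qM; apply: h; rewrite /= subr0.
apply: cK => q _.
have cu := unif_continuous (emb_unif_on p0 q pphi cphi).
have [T0 T00 hT] := weyl nr cu (emb_periodic p0 q pphi) e3.
exists (ball q (Num.min d d'), [set T | T0 <= T]) => /=.
  split; first by apply: nbhsx_ballx; rewrite lt_min d0.
  by apply: nbhs_pinfty_ge; exact: num_real.
move=> [q' T] /= [qq' TT] x F dF; rewrite -ball_normE /= lt_min in qq'.
have {qq'}/andP[q1 q2] := qq'; have T1 : 0 <= T by lra.
have [G [_ dG]] := real_primitive (@line_continuous R _ (fun x => phi (emb p0 x q)) x om cu).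
have b1 := hT T TT x G dG.
have b2 : `|F T - F 0 - (G T - G 0)| <= e / 3 * T.
  apply: (prim_dist T1 dF dG) => s; apply: hd; first by rewrite subrr normr0.
  by rewrite distrC.
have b3 := hd' q q' q2.
rewrite -/(avg p0 phi q) in b1.
have -> : F T - F 0 - T * avg p0 phi q' = (F T - F 0 - (G T - G 0)) +
  (G T - G 0 - T * avg p0 phi q) + T * (avg p0 phi q - avg p0 phi q') by ring.
apply: le_trans (ler_normD _ _) _; apply: le_trans (lerD (ler_normD _ _) (lexx _)) _.
rewrite [X in _ + X]normrM (ger0_norm T1).
have := ler_wpM2l T1 b3; lra.
Qed.

(** A nonzero integer vector has positive Euclidean norm, so the power in the Diophantine bound is
    positive. The coordinate [l] paired with time comes first, in accordance with [emb]. *)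
Lemma diophantine_nonresonant (tau : R) (omega : 'rV[R]_m) : diophantine tau omega ->
  forall k : 'rV[int]_m.+1, k != 0 ->
    dot (zvec R k) (row_mx (1%:M : 'rV[R]_1) omega) != 0.
Proof.
move=> [gam gam0 dio] k k0; pose k1 := rsubmx (k : 'rV_(1 + m)); pose l := k 0 0.
have E : dot (zvec R k) (row_mx (1%:M : 'rV[R]_1) omega) =
    dot (zvec R k1) omega + l%:~R.
  rewrite {1}/dot big_ord_recl [RHS]addrC; congr (_ + _).
    by rewrite mxE row_mx0 mxE eqxx mulr1.
  apply: eq_bigr => i _; rewrite !mxE (_ : lift ord0 i = rshift 1 i); last exact: val_inj.
  by congr (_ * _); have := row_mxEr (1%:M : 'rV[R]_1) omega 0 i; rewrite mxE.
have kl : (k1, l) != 0.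
  apply/eqP => -[e1 e2]; move/eqP: k0; apply; apply/rowP => i; rewrite mxE.
  have [j ->|->] := unliftP ord0 i; last exact: e2.
  have := e1 => /rowP /(_ (j : 'I_m)); rewrite !mxE => <-.
  by congr (k _ _); exact: val_inj.
rewrite E -normr_gt0; apply: lt_le_trans (dio k1 l kl); rewrite mulr_gt0 //.
apply: powR_gt0; rewrite sqrtr_gt0.
have sq n (x : 'rV[R]_n) : 0 <= dot x x.
  by apply: sumr_ge0 => i _; rewrite -expr2 sqr_ge0.
have [l0|l0] := eqVneq l 0; last first.
  by rewrite ltr_wpDl // exprn_even_gt0 //= intr_eq0.
have k10 : k1 != 0 by apply: contra kl => /eqP ->; rewrite l0.
apply: ltr_wpDr; first exact: sqr_ge0.
have [i ki] : exists i, k1 0 i != 0.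
  apply: contrapT => nex; move/eqP: k10; apply; apply/rowP => i.
  rewrite [RHS]mxE; apply/eqP; apply: contraT => h; exfalso; apply: nex.
  by exists i.
rewrite /dot (bigD1 i) //= ltr_pwDl //.
  by rewrite -expr2 exprn_even_gt0 //= mxE intr_eq0.
by apply: sumr_ge0 => j _; rewrite -expr2 sqr_ge0.
Qed.

End Averaging.

(** * Hessian of the averaged potential and block reduction of the Hessian of the kinetic part *)

Section Hessians.
Context {R : realType}.

Lemma dot0l n (u : 'rV[R]_n) : dot 0 u = 0.
Proof. by rewrite -(scale0r 0) dotZl mul0r. Qed.

Lemma dot0r n (u : 'rV[R]_n) : dot u 0 = 0.
Proof. by rewrite dotC dot0l. Qed.

Lemma Ck2_1 (V W : normedModType R) (A : set V) (f : V -> W) :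
  Ck_on 2 A f -> Ck_on 1 A f.
Proof.
move=> [df h]; split=> // v x Ax.
by apply: differentiable_continuous; have [+ _] := h v; apply.
Qed.

Lemma Ck2_D (V W : normedModType R) (A : set V) (f : V -> W) v :
  Ck_on 2 A f -> Ck_on 1 A (fun x => 'D_v f x).
Proof. by move=> [_ h]; exact: h. Qed.

Definition hess (V : normedModType R) (f : V -> R) (x v w : V) : R :=
  'D_w (fun y => 'D_v f y) x.

Lemma derive_linl (V W : normedModType R) (f : V -> W) x a u v :
  differentiable f x -> 'D_(a *: u + v) f x = a *: 'D_u f x + 'D_v f x.
Proof. by move=> df; rewrite !deriveE // linearP. Qed.

Lemma hess_linr (V : normedModType R) (f : V -> R) x v a w1 w2 : Ck_on 2 setT f ->
  hess f x v (a *: w1 + w2) = a * hess f x v w1 + hess f x v w2.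
Proof.
by move=> C2; apply: derive_linl; exact: Ck1_diff (Ck2_D v C2) _.
Qed.

Lemma hess_linl (V : normedModType R) (f : V -> R) x w a v1 v2 : Ck_on 2 setT f ->
  hess f x (a *: v1 + v2) w = a * hess f x v1 w + hess f x v2 w.
Proof.
move=> C2; rewrite /hess.
have -> : (fun y => 'D_(a *: v1 + v2) f y) =
    (a \*: (fun y => 'D_v1 f y)) + (fun y => 'D_v2 f y).
  by apply/funext => y; rewrite derive_linl //; exact: Ck1_diff (Ck2_1 C2) _.
have d1 v : derivable (fun y => 'D_v f y) x w.
  by apply: diff_derivable; exact: Ck1_diff (Ck2_D v C2) _.
by rewrite deriveD //; [rewrite deriveZ|exact: derivableZ].
Qed.

Lemma bilin_expand n (S : 'rV[R]_n -> 'rV[R]_n -> R) :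
  (forall w a u v, S (a *: u + v) w = a * S u w + S v w) ->
  (forall u a v w, S u (a *: v + w) = a * S u v + S u w) ->
  forall u w, S u w =
    \sum_i \sum_j u 0 i * w 0 j * S (delta_mx 0 i) (delta_mx 0 j).
Proof.
move=> hl hr u w.
have S0l v : S 0 v = 0 by have := hl v 1 0 0; rewrite scaler0 addr0; lra.
have S0r v : S v 0 = 0 by have := hr v 1 0 0; rewrite scaler0 addr0; lra.
rewrite {1}(row_sum_delta u).
have -> : S (\sum_j u 0 j *: delta_mx 0 j) w = \sum_i u 0 i * S (delta_mx 0 i) w.
  by elim/big_rec2: _ => [|i y1 y2 _ <-]; rewrite ?S0l ?hl.
apply: eq_bigr => i _; rewrite {1}(row_sum_delta w).
have -> : S (delta_mx 0 i) (\sum_j w 0 j *: delta_mx 0 j) =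
    \sum_j w 0 j * S (delta_mx 0 i) (delta_mx 0 j).
  by elim/big_rec2: _ => [|j y1 y2 _ <-]; rewrite ?S0r ?hr.
by rewrite mulr_sumr; apply: eq_bigr => j _; rewrite mulrA.
Qed.

Lemma linear_coercive n (L : 'rV[R]_n -> 'rV[R]_n) : linear L ->
  (forall u, u != 0 -> 0 < dot (L u) u) ->
  exists2 c : R, 0 < c & forall u, c * `|u| ^+ 2 <= dot (L u) u.
Proof.
move=> linL pd.
pose L' : {linear 'rV[R]_n -> 'rV[R]_n} := HB.pack L
  (GRing.isLinear.Build _ _ _ _ L linL).
have E u : u *m lin1_mx L' = L u by rewrite mul_rV_lin1.
have [u u0|c c0 hc] := @posdef_coercive R n (lin1_mx L'); first by rewrite E pd.
by exists c => // u; rewrite -E.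
Qed.

Section Avg.
Context {m r : nat}.

Lemma q2dirP a (u v : 'rV[R]_r) :
  q2dir (a *: u + v) = a *: q2dir u + q2dir v :> ext R m r.
Proof. by rewrite /q2dir !pairZ !pairD !scaler0 !addr0. Qed.

Definition avg_hess (p0 : pt R m r) (G : ext R m r -> R) (q v w : 'rV[R]_r) : R :=
  avg p0 (fun z => hess G z (q2dir v) (q2dir w)) q.

(** A local minimum makes the averaged Hessian at 0 nonnegative; being symmetric and non-degenerate,
    it has no isotropic vector and is positive definite. Continuity of its finitely many entries
    then gives a uniform bound on a ball. *)
Lemma avg_hess_posdef (p0 : pt R m r) (G : ext R m r -> R) :
  Ck_on 2 setT G -> periodic_for extlat G ->
  nondegenerate_local_min (averaged G p0) 0 ->
  exists rho c : R, [/\ 0 < rho < 2^-1, 0 < c &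
    forall q, `|q| < rho -> forall u, c * `|u| ^+ 2 <= avg_hess p0 G q u u].
Proof.
move=> C2 pG [lmin nondeg]; have C1 := Ck2_1 C2.
have VE : averaged G p0 = avg p0 G by apply/funext => q; exact: averagedE.
rewrite VE in lmin nondeg.
have pD v := periodic_derive v pG.
have CD v := Ck2_D v C2.
have dV v q : is_derive q v (avg p0 G) (avg p0 (fun z => 'D_(q2dir v) G z) q).
  exact: avg_derive.
have dS v w q : is_derive q w (avg p0 (fun z => 'D_(q2dir v) G z)) (avg_hess p0 G q v w).
  rewrite /avg_hess /hess.
  exact: (@avg_derive R m r p0 (fun z => 'D_(q2dir v) G z) w q (pD (q2dir v)) (CD (q2dir v))).
have DV v : (fun q => 'D_v (avg p0 G) q) = avg p0 (fun z => 'D_(q2dir v) G z).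
  by apply/funext => q; have [_ ->] := dV v q.
have pH v w : periodic_for extlat (fun z => hess G z (q2dir v) (q2dir w)).
  exact: periodic_derive.
have cH v w : continuous (fun z => hess G z (q2dir v) (q2dir w)).
  rewrite /hess.
  exact: (@C1_D_continuous R m r (fun z => 'D_(q2dir v) G z) (q2dir w) (CD (q2dir v))).
have cS v w : continuous (fun q => avg_hess p0 G q v w).
  move=> q; apply/cont_epsP => e e0.
  have [d d0 hd] := avg_continuous p0 (pH v w) (cH v w) e0.
  by exists d => // y yq; exact: hd.
have Sl q w a u v : avg_hess p0 G q (a *: u + v) w =
    a * avg_hess p0 G q u w + avg_hess p0 G q v w.
  rewrite [RHS]addrC /avg_hess -avg_lin //; congr avg; apply/funext => z.
  by rewrite q2dirP hess_linl // addrC.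
have Sr q u a v w : avg_hess p0 G q u (a *: v + w) =
    a * avg_hess p0 G q u v + avg_hess p0 G q u w.
  rewrite [RHS]addrC /avg_hess -avg_lin //; congr avg; apply/funext => z.
  by rewrite q2dirP hess_linr // addrC.
have sym v w : avg_hess p0 G 0 v w = avg_hess p0 G 0 w v.
  exact: (schwarz (dV v) (dV w) (dS v w) (dS w v) (cS v w 0) (cS w v 0)).
have psd v : 0 <= avg_hess p0 G 0 v v.
  exact: (local_min_second (dV v) (dS v v) (cS v v 0) lmin).
have alg (a b : R) : a != 0 -> let t := - (b + 1) / (2 * a) in
    t * (t * 0 + a) + (t * a + b) = - 1.
  by move=> a0 /=; field.
have pd v : v != 0 -> 0 < avg_hess p0 G 0 v v.
  move=> v0; rewrite lt_neqAle psd andbT; apply/eqP => Svv.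
  have [w] := nondeg v v0; rewrite DV; have [_ ->] := dS v w 0 => Svw.
  (* If [S v v = 0], the form takes at [t v + w] the value [2 t S v w + S w w], which is -1 for this
     [t]. *)
  pose S := avg_hess p0 G 0; pose t := - (S w w + 1) / (2 * S v w).
  have := psd (t *: v + w); rewrite Sl !Sr -Svv (sym w v).
  rewrite -/(S v w) -/(S w w) alg; last exact: Svw.
  by rewrite ler0N1.
pose M := \matrix_(i, j) avg_hess p0 G 0 (delta_mx 0 i) (delta_mx 0 j).
have ex q := bilin_expand (Sl q) (Sr q).
have ME u : dot (u *m M) u = avg_hess p0 G 0 u u.
  rewrite ex exchange_big /dot; apply: eq_bigr => j _; rewrite mxE mulr_suml.
  by apply: eq_bigr => i _; rewrite mxE mulrAC.
have [u u0|c c0 hc] := @posdef_coercive R r M; first by rewrite ME; exact: pd.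
pose N := r%:R * r%:R + 1 : R; have N0 : 0 < N by rewrite ltr_wpDl // mulr_ge0.
have cN : 0 < c / 2 / N by rewrite !divr_gt0.
have [k d d' /andP[_ dd'] K q qd|k|d d0 hd] := @fin_common_delta R ('I_r * 'I_r)%type
  (fun k d => forall q : 'rV[R]_r, `|q| < d ->
     `|avg_hess p0 G q (delta_mx 0 k.1) (delta_mx 0 k.2) -
       avg_hess p0 G 0 (delta_mx 0 k.1) (delta_mx 0 k.2)| <= c / 2 / N).
- by apply: K; exact: lt_le_trans dd'.
- have /cont_epsP/(_ _ cN)[d d0 hd] := cS (delta_mx 0 k.1) (delta_mx 0 k.2) 0.
  by exists d => // q qd; apply: hd; rewrite subr0.
(* The entries vary so little that half of the coercivity survives; the cap 1/4 keeps the radius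
   below 1/2, where a ball projects injectively to the torus. *)
exists (Num.min d 4^-1), (c / 2); split.
- apply/andP; split; first by rewrite lt_min d0 invr_gt0 ltr0n.
  by rewrite gt_min; apply/orP; right; lra.
- by lra.
move=> q; rewrite lt_min => /andP[qd _] u.
have diff : `|avg_hess p0 G q u u - avg_hess p0 G 0 u u| <= c / 2 * `|u| ^+ 2.
  rewrite !ex -sumrB; apply: le_trans (ler_norm_sum _ _ _) _.
  apply: (@le_trans _ _ (\sum_(i < r) \sum_(j < r) (`|u| * `|u| * (c / 2 / N)))).
    apply: ler_sum => i _; rewrite -sumrB; apply: le_trans (ler_norm_sum _ _ _) _.
    apply: ler_sum => j _; rewrite -mulrBr normrM; apply: ler_pM => //.
      by rewrite normrM; apply: ler_pM => //; exact: rv_norm_coord.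
    exact: (hd (i, j)).
  rewrite !sumr_const !card_ord -mulrnA -[_ *+ _]mulr_natr natrM -expr2.
  rewrite mulrC mulrCA mulrC; apply: ler_wpM2r; first exact: exprn_ge0.
  rewrite mulrA ler_pdivrMr // mulrC; apply: ler_wpM2l; first lra.
  by rewrite /N lerDl.
have h1 := hc u; rewrite ME in h1.
move: (avg_hess p0 G q u u) (avg_hess p0 G 0 u u) (`|u| ^+ 2) diff h1 => a b n.
by rewrite ler_norml => /andP[]; lra.
Qed.

(** Schur complement with respect to the lower block K, the map y to [(F (0, y)).2]. [N0 b] is the
    second component that annihilates the second component of [F (b, N0 b)], and the first component
    is then the complement, again positive definite; [M0] eliminates the action of [y] on the first
    component. As [F] is not assumed symmetric, [M0] is defined independently of [N0]. *)
Lemma posdef_blocks (F : pt R m r -> pt R m r) : linear F ->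
  (forall u : pt R m r, u != 0 -> 0 < dot (F u).1 u.1 + dot (F u).2 u.2) ->
  exists (N0 : 'rV[R]_m -> 'rV[R]_r) (M0 : 'rV[R]_r -> 'rV[R]_m) (cA cK : R),
    [/\ linear N0 /\ linear M0, 0 < cA /\ 0 < cK,
        forall b, (F (b, N0 b)).2 = 0 /\ cA * `|b| ^+ 2 <= dot (F (b, N0 b)).1 b,
        forall y, (F (0, y)).1 + M0 (F (0, y)).2 = 0 &
        forall y, cK * `|y| ^+ 2 <= dot (F (0, y)).2 y].
Proof.
move=> linF pd.
pose F' : {linear pt R m r -> pt R m r} := HB.pack F
  (GRing.isLinear.Build _ _ _ _ F linF).
have FE u : F u = F' u by [].
pose Lk y := (F (0, y)).2.
have linK : linear Lk.
  move=> a u v; rewrite /Lk (_ : (0, a *: u + v) = a *: (0, u) + (0, v)).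
    by rewrite linF.
  by rewrite pairZ pairD scaler0 addr0.
have pdK u : u != 0 -> 0 < dot (Lk u) u.
  move=> u0; have /pd : (0, u) != 0 :> pt R m r.
    by apply: contra u0 => /eqP[->].
  by rewrite /= dot0r add0r.
have [cK cK0 hK] := linear_coercive linK pdK.
pose K' : {linear 'rV[R]_r -> 'rV[R]_r} := HB.pack Lk
  (GRing.isLinear.Build _ _ _ _ Lk linK).
pose K := lin1_mx K'.
have KE y : y *m K = (F (0, y)).2 by rewrite mul_rV_lin1.
(* A vector of the kernel would have a vanishing quadratic form. *)
have Ku : K \in unitmx.
  rewrite -row_free_unit -kermx_eq0; apply/eqP/row_matrixP => i; rewrite row0.
  apply/eqP; apply: contraT => /pdK.
  have -> : Lk (row i (kermx K)) = 0.
    by rewrite /Lk -KE -row_mul mulmx_ker row0.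
  by rewrite dot0l ltxx.
pose N0 b := - ((F (b, 0)).2 *m invmx K).
pose M0 x := - (F (0, x *m invmx K)).1.
have split2 b y : F (b, y) = F (b, 0) + F (0, y).
  by rewrite !FE -linearD /= pairD addr0 add0r.
have linN : linear N0.
  move=> a u v; rewrite /N0 (_ : (a *: u + v, 0) = a *: (u, 0) + (v, 0)).
    by rewrite linF mulmxDl opprD scalerN -scalemxAl.
  by rewrite pairZ pairD scaler0 addr0.
have linM : linear M0.
  move=> a u v; rewrite /M0 mulmxDl -scalemxAl.
  rewrite (_ : (0, a *: (u *m invmx K) + v *m invmx K) =
    a *: (0, u *m invmx K) + (0, v *m invmx K)); last by rewrite pairZ pairD scaler0 addr0.
  by rewrite linF opprD scalerN.
have N2 b : (F (b, N0 b)).2 = 0.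
  rewrite split2 -[(_ + _).2]/(_ + _) -KE /N0 mulNmx mulmxKV //.
  by rewrite subrr.
pose LA b := (F (b, N0 b)).1.
have linA : linear LA.
  move=> a u v; rewrite /LA linN.
  rewrite (_ : (a *: u + v, a *: N0 u + N0 v) = a *: (u, N0 u) + (v, N0 v)).
    by rewrite linF.
  by rewrite pairZ pairD.
have pdA b : b != 0 -> 0 < dot (LA b) b.
  move=> b0; have /pd : (b, N0 b) != 0 :> pt R m r.
    by apply: contra b0 => /eqP[->].
  by rewrite N2 /= dot0l addr0.
have [cA cA0 hA] := linear_coercive linA pdA.
exists N0, M0, cA, cK; split => //.
by move=> y; rewrite /M0 -KE mulmxK // subrr.
Qed.

End Avg.
End Hessians.

(** * The cone estimate *)

Section ConeTools.
Context {R : realType}.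

Lemma injective_surjective (V : normedModType R) {fV : fdim V} (L : V -> V) :
  linear L -> (forall v, L v = 0 -> v = 0) -> forall w, exists v, L v = w.
Proof.
move=> linL inj w.
pose P (x : 'rV[R]_(@fd_n R V fV)) : 'rV[R]_(@fd_n R V fV) := fd_phi (L (fd_psi x)).
have psi_lin : linear (@fd_psi R V fV).
  by move=> a u v; apply: (can_inj fd_phiK); rewrite fd_lin !fd_psiK.
have linP : linear P by move=> a u v; rewrite /P psi_lin linL fd_lin.
pose P' : {linear 'rV[R]_(@fd_n R V fV) -> 'rV[R]_(@fd_n R V fV)} :=
  HB.pack P (GRing.isLinear.Build _ _ _ _ P linP).
have E x : x *m lin1_mx P' = P x by rewrite mul_rV_lin1.
have phi0 : fd_phi (0 : V) = 0.
  have := @fd_lin R V fV 1 0 0; rewrite !scale1r !addr0 => /eqP.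
  by rewrite -subr_eq subrr eq_sym => /eqP.
have U : lin1_mx P' \in unitmx.
  rewrite -row_free_unit -kermx_eq0; apply/eqP/row_matrixP => i; rewrite row0.
  have /(congr1 fd_psi) : P (row i (kermx (lin1_mx P'))) = 0.
    by rewrite -E -row_mul mulmx_ker row0.
  rewrite /P fd_phiK -{1}phi0 fd_phiK => /inj /(congr1 fd_phi).
  by rewrite fd_psiK phi0.
exists (fd_psi (fd_phi w *m invmx (lin1_mx P'))).
apply: (can_inj fd_phiK).
have := E (fd_phi w *m invmx (lin1_mx P')); by rewrite mulmxKV // => ->.
Qed.

Lemma exp_beats_square (lam A : R) : 0 < lam -> 0 <= A ->
  exists2 T : R, 2 <= T & A * (1 + T) ^+ 2 < expR (lam * (T - 1)).
Proof.
(* With [T = 1 + u] and [u >= 1], [(1 + T) ^+ 2] is at most [9 u ^+ 2], while the exponential is at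
   least [(lam u / 3) ^+ 3]; the inequality thus reduces to [9 * 27 * A < lam ^+ 3 * u], and 9 times
   27 is 243. *)
move=> l0 A0; pose u := 1 + 243 * A / lam ^+ 3.
have l3 : 0 < lam ^+ 3 by exact: exprn_gt0.
have u1 : 1 <= u.
  by rewrite /u lerDl; apply: divr_ge0; [apply: mulr_ge0; [exact: ler0n|]|exact: ltW].
exists (1 + u); first by lra.
have -> : lam * (1 + u - 1) = 3%:R * (lam * u / 3) by field.
rewrite expRM_natl.
have k1 : 1 + lam * u / 3 <= expR (lam * u / 3) by exact: expR_ge1Dx.
have lu : 0 < lam * u / 3 by rewrite divr_gt0 // mulr_gt0 //; lra.
apply: (@lt_le_trans _ _ ((lam * u / 3) ^+ 3)); last first.
  by rewrite lerXn2r ?nnegrE ?expR_ge0 //; lra.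
have uA : 243 * A < lam ^+ 3 * u.
  rewrite /u mulrDr mulr1 mulrCA divff ?gt_eqF // mulr1; lra.
apply: (@le_lt_trans _ _ (A * (9 * u ^+ 2))).
  by apply: ler_wpM2l => //; nra.
have -> : (lam * u / 3) ^+ 3 = (lam ^+ 3 * u) / 27 * u ^+ 2 by field.
have u2 : 0 < u ^+ 2 by rewrite exprn_gt0 //; lra.
rewrite mulrA ltr_pM2r //; lra.
Qed.

(** [q / lam] is the equilibrium of the equation [J' = lam * J - q]; the excess over it, multiplied
    by [expR (- lam * s)], is nondecreasing. *)
Lemma exp_growth (J J' : R -> R) (lam q a b : R) : 0 < lam -> a <= b ->
  (forall s : R, a <= s <= b -> is_derive s (1 : R) J (J' s)) ->
  (forall s : R, a <= s <= b -> lam * J s - q <= J' s) ->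
  q / lam + expR (lam * (b - a)) * (J a - q / lam) <= J b.
Proof.
move=> l0 ab dJ le.
have dE (s : R) : is_derive s (1 : R) (fun t => expR (- lam * t)) (- lam * expR (- lam * s)).
  exact: expR_lin_derive.
have mono : expR (- lam * a) * (J a - q / lam) <= expR (- lam * b) * (J b - q / lam).
  apply: (@der_ge0_le R (fun s => expR (- lam * s) * (J s - q / lam))
    (fun s => expR (- lam * s) * (J' s - (lam * J s - q)))) => // s sab.
    have h1 := dJ s sab.
    have h2 : is_derive s (1 : R) (fun s => J s - cst (q / lam) s) (J' s - 0).
      exact: is_deriveB.
    have h3 := @is_deriveM _ _ _ _ _ _ _ _ (dE s) h2.
    have -> : expR (- lam * s) * (J' s - (lam * J s - q)) =
      expR (- lam * s) *: (J' s - 0) + (J s - cst (q / lam) s) *: (- lam * expR (- lam * s)).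
      by rewrite /GRing.scale /= /cst; field; rewrite gt_eqF.
    exact: h3.
  by rewrite mulr_ge0 ?expR_ge0 // subr_ge0; exact: le.
have eb : expR (lam * b) * expR (- lam * b) = 1.
  by rewrite -expRD mulNr subrr expR0.
have eab : expR (lam * (b - a)) = expR (lam * b) * expR (- lam * a).
  by rewrite -expRD; congr expR; ring.
have := ler_wpM2l (expR_ge0 (lam * b)) mono.
by rewrite !mulrA eb -eab mul1r; lra.
Qed.

Lemma dot_derive n (u v u' v' : R -> 'rV[R]_n) (s : R) :
  is_derive s (1 : R) u (u' s) -> is_derive s (1 : R) v (v' s) ->
  is_derive s (1 : R) (fun t => dot (u t) (v t)) (dot (u' s) (v s) + dot (u s) (v' s)).
Proof.
move=> du dv; have h i : is_derive s (1 : R) (fun t => u t 0 i * v t 0 i)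
    (u' s 0 i * v s 0 i + u s 0 i * v' s 0 i).
  have h1 : is_derive s (1 : R) (fun t => u t 0 i) (u' s 0 i).
    by apply: (@is_derive_lin R _ _ _ (fun w : 'rV[R]_n => w 0 i)) => // a x y; rewrite !mxE.
  have h2 : is_derive s (1 : R) (fun t => v t 0 i) (v' s 0 i).
    by apply: (@is_derive_lin R _ _ _ (fun w : 'rV[R]_n => w 0 i)) => // a x y; rewrite !mxE.
  have := @is_deriveM _ _ _ _ _ _ _ _ h1 h2.
  by rewrite /GRing.scale /= addrC [v s 0 i * _]mulrC.
have -> : dot (u' s) (v s) + dot (u s) (v' s) =
  \sum_i (u' s 0 i * v s 0 i + u s 0 i * v' s 0 i) by rewrite big_split.
have := @is_derive_sum _ _ _ _ (fun i t => u t 0 i * v t 0 i) s 1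
  (fun i => u' s 0 i * v s 0 i + u s 0 i * v' s 0 i) h.
by apply: is_derive_ext => t; rewrite fct_sumE.
Qed.

(** Passing from the scalar product to sup norms costs a factor [n], increased to [n.+1] so that
    dimension 0 is covered. *)
Lemma coercive_lower n (L : 'rV[R]_n -> 'rV[R]_n) (c : R) b :
  c * `|b| ^+ 2 <= dot (L b) b -> c / n.+1%:R * `|b| <= `|L b|.
Proof.
move=> h; have [->|b0] := eqVneq b 0; first by rewrite normr0 mulr0.
have nb : 0 < `|b| by rewrite normr_gt0.
rewrite mulrAC ler_pdivrMr ?ltr0n // -(ler_pM2r nb) -mulrA -expr2.
apply: (le_trans h); apply: le_trans (ler_norm _) _.
apply: le_trans (dot_bound _ _) _.
rewrite [leRHS]mulrAC mulrC; apply: ler_wpM2l; first exact: mulr_ge0.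
by rewrite ler_nat.
Qed.

End ConeTools.

(** * From bounded graphs at all times to a narrow cone at time 0 *)

Section Cone.
Context {R : realType} {m r : nat}.

Notation Zt := (pt R m m * pt R r r)%type.

(* Families of curves Z v = ((W, B), (X, Y)) approximately solving
   W' = LA B, B' = 0, X' = LK Y, Y' = LV X, and whose tangent directions
   with W = M0 X are graphs over B *)
Definition cone_family (C cA cK cV kap delta T : R)
    (LA : 'rV[R]_m -> 'rV[R]_m) (LK : 'rV[R]_r -> 'rV[R]_r)
    (M0 : 'rV[R]_r -> 'rV[R]_m) (LV : R -> 'rV[R]_r -> 'rV[R]_r)
    (Z Z' : pt R m m -> R -> Zt) : Prop :=
  [/\ [/\ linear LA, linear M0, forall b, `|LA b| <= C * `|b|,
          forall b, cA * `|b| ^+ 2 <= dot (LA b) b & forall x, `|M0 x| <= C * `|x|],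
      [/\ forall y, `|LK y| <= C * `|y|, forall y, cK * `|y| ^+ 2 <= dot (LK y) y,
          forall (t : R) x, `|t| <= T -> `|LV t x| <= C * `|x| &
          forall (t : R) x, `|t| <= T -> cV * `|x| ^+ 2 <= dot (LV t x) x],
      [/\ forall t, linear (Z ^~ t),
          forall v (t : R), `|t| <= T -> is_derive t (1 : R) (Z v) (Z' v t) &
          forall v (t : R), `|t| <= T -> Z v t = 0 -> v = 0],
      [/\ forall v (t : R), `|t| <= T ->
            `|(Z' v t).1.1 - LA (Z v t).1.2| <= delta * `|Z v t|,
          forall v (t : R), `|t| <= T -> `|(Z' v t).1.2| <= delta * `|Z v t|,
          forall v (t : R), `|t| <= T ->
            `|(Z' v t).2.1 - LK (Z v t).2.2| <= delta * `|Z v t| &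
          forall v (t : R), `|t| <= T ->
            `|(Z' v t).2.2 - LV t (Z v t).2.1| <= delta * `|Z v t|] &
      forall v (t : R), `|t| <= T -> (Z v t).1.1 = M0 (Z v t).2.1 ->
        `|(Z v t).2| <= kap * `|(Z v t).1.2|].

Section Estimates.
Context {C cA cK cV kap delta T : R} {LA : 'rV[R]_m -> 'rV[R]_m}
  {LK : 'rV[R]_r -> 'rV[R]_r} {M0 : 'rV[R]_r -> 'rV[R]_m}
  {LV : R -> 'rV[R]_r -> 'rV[R]_r} {Z Z' : pt R m m -> R -> Zt}.
Context (C0 : 0 < C) (cA0 : 0 < cA) (kap0 : 0 < kap) (delta01 : 0 < delta <= 1).
Context (fam : cone_family C cA cK cV kap delta T LA LK M0 LV Z Z').

Lemma Zt_le (z : Zt) (M : R) : `|z.1.1| <= M -> `|z.1.2| <= M ->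
  `|z.2.1| <= M -> `|z.2.2| <= M -> `|z| <= M.
Proof.
case: z => [[a b] [c d]] /= *; apply: norm_pair_le; exact: norm_pair_le.
Qed.

Lemma Zt_comp (z : Zt) : [/\ `|z.1.1| <= `|z|, `|z.1.2| <= `|z|,
  `|z.2.1| <= `|z| & `|z.2.2| <= `|z|].
Proof.
split; [exact: le_trans (norm_fst _) (norm_fst _)|
        exact: le_trans (norm_snd _) (norm_fst _)|
        exact: le_trans (norm_fst _) (norm_snd _)|
        exact: le_trans (norm_snd _) (norm_snd _)].
Qed.

Lemma cone_speed v (t : R) : `|t| <= T -> `|Z' v t| <= (C + 1) * `|Z v t|.
Proof.
move=> tT; have [[_ _ bA _ _] [bK _ bV _] _ [e1 e2 e3 e4] _] := fam.
have /andP[d0 d1] := delta01; have [n1 n2 n3 n4] := Zt_comp (Z v t).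
have zz := normr_ge0 (Z v t).
have dz : delta * `|Z v t| <= `|Z v t| by rewrite ler_piMl.
have aux n (x y w : 'rV[R]_n) : `|x - y| <= delta * `|Z v t| -> `|y| <= C * `|w| ->
    `|w| <= `|Z v t| -> `|x| <= (C + 1) * `|Z v t|.
  move=> h1 h2 h3; rewrite -(subrK y x); apply: le_trans (ler_normD _ _) _.
  have := ler_wpM2l (ltW C0) h3; lra.
apply: Zt_le.
- exact: aux (e1 v t tT) (bA _) n2.
- by apply: le_trans (e2 v t tT) _; have := mulr_ge0 (ltW C0) zz; lra.
- exact: aux (e3 v t tT) (bK _) n4.
- exact: aux (e4 v t tT) (bV t _ tT) n3.
Qed.

Definition growth (S : R) : R := 2 * expR (2 * (C + 1) * S).

Lemma cone_growth v (t s S : R) : 0 <= S -> `|t| + S <= T -> `|s - t| <= S ->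
  `|Z v s| <= growth S * `|Z v t|.
Proof.
move=> S0 tS sS; have [_ _ [_ dZ _] _ _] := fam.
have inT (u : R) : `|u - t| <= S -> `|u| <= T.
  by move=> h; have := ler_normD (u - t) t; rewrite subrK; lra.
rewrite /growth -mulrA [X in _ <= X](_ : _ = 2 * (`|Z v t| + 0 * S) * expR (2 * (C + 1) * S));
  last by rewrite mul0r addr0; ring.
apply: (gronwall (u' := Z' v)) => //; first by have := C0; lra.
- by move=> u /inT; exact: dZ.
- by move=> u /inT uT; rewrite addr0; exact: cone_speed.
Qed.

Lemma proj_derive v (t : R) : `|t| <= T ->
  [/\ is_derive t (1 : R) (fun s => (Z v s).1.1) (Z' v t).1.1,
      is_derive t (1 : R) (fun s => (Z v s).1.2) (Z' v t).1.2,
      is_derive t (1 : R) (fun s => (Z v s).2.1) (Z' v t).2.1 &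
      is_derive t (1 : R) (fun s => (Z v s).2.2) (Z' v t).2.2].
Proof.
move=> tT; have [_ _ [_ dZ _] _ _] := fam; have h := dZ v t tT.
split.
- by apply: (@is_derive_lin R Zt _ _ (fun z => z.1.1)).
- by apply: (@is_derive_lin R Zt _ _ (fun z => z.1.2)).
- by apply: (@is_derive_lin R Zt _ _ (fun z => z.2.1)).
- by apply: (@is_derive_lin R Zt _ _ (fun z => z.2.2)).
Qed.

Lemma mean_value_sym (V : normedModType R) {fV : fdim V} (c c' : R -> V)
    (K t s : R) : 
  (forall u : R, `|u - t| <= `|s - t| -> is_derive u (1 : R) c (c' u)) ->
  (forall u : R, `|u - t| <= `|s - t| -> `|c' u| <= K) ->
  `|c s - c t| <= K * `|s - t|.
Proof.
move=> dc le; have [st|ts] := leP t s.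
  rewrite [`|s - t|]ger0_norm ?subr_ge0 //.
  have inn (u : R) : t <= u <= s -> `|u - t| <= `|s - t|.
    by move=> /andP[h1 h2]; rewrite !ger0_norm ?subr_ge0 // lerD2r.
  by apply: (@mean_value_const R V fV c c') => // u /inn; [exact: dc|exact: le].
rewrite [`|s - t|]ltr0_norm ?subr_lt0 // opprB distrC.
have inn (u : R) : s <= u <= t -> `|u - t| <= `|s - t|.
  move=> /andP[h1 h2]; rewrite [leRHS]ltr0_norm ?subr_lt0 //.
  by rewrite ler0_norm ?subr_le0 // lerN2 lerD2r.
apply: (@mean_value_const R V fV c c') => //; first exact: ltW.
  by move=> u /inn; exact: dc.
by move=> u /inn; exact: le.
Qed.

Lemma cone_B v (t s S : R) : 0 <= S -> `|t| + S <= T -> `|s - t| <= S ->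
  `|(Z v s).1.2 - (Z v t).1.2| <= delta * (S * growth S) * `|Z v t|.
Proof.
move=> S0 tS sS; have [_ _ _ [_ e2 _ _] _] := fam; have /andP[d0 _] := delta01.
have inT (u : R) : `|u - t| <= `|s - t| -> `|u| <= T /\ `|u - t| <= S.
  move=> h; have h' := le_trans h sS.
  by split=> //; have := ler_normD (u - t) t; rewrite subrK; lra.
have := @mean_value_sym 'rV[R]_m (fdim_rV R m) (fun u => (Z v u).1.2) (fun u => (Z' v u).1.2)
  (delta * (growth S * `|Z v t|)) t s.
move=> h; apply: le_trans (h _ _) _.
- by move=> u /inT[uT _]; have [] := proj_derive v uT.
- move=> u /inT[uT uS]; apply: le_trans (e2 v u uT) _.
  by apply: ler_wpM2l; [exact: ltW|exact: cone_growth].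
have g0 : 0 <= growth S * `|Z v t| by rewrite !mulr_ge0 ?expR_ge0.
have := ler_wpM2l (mulr_ge0 (ltW d0) g0) sS; lra.
Qed.

(** As [B] is constant up to an error of order [delta], [W] moves with the constant velocity [LA B].
    The error is proportional to [delta], with a factor depending only on the duration and on [C],
    so durations can be chosen before [delta]. *)
Lemma cone_W v (t s S : R) : 0 <= S -> `|t| + S <= T -> `|s - t| <= S ->
  `|(Z v s).1.1 - (Z v t).1.1 - (s - t) *: LA (Z v t).1.2| <=
    delta * (S * growth S * (1 + C * S)) * `|Z v t|.
Proof.
move=> S0 tS sS; have [[linA _ bA _ _] _ _ [e1 _ _ _] _] := fam.
have /andP[d0 _] := delta01.
have LAB a b : LA a - LA b = LA (a - b).
  by rewrite addrC -scaleN1r -linA scaleN1r addrC.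
have inT (u : R) : `|u - t| <= `|s - t| -> `|u| <= T /\ `|u - t| <= S.
  move=> h; have h' := le_trans h sS.
  by split=> //; have := ler_normD (u - t) t; rewrite subrK; lra.
have gz : 0 <= growth S * `|Z v t| by rewrite !mulr_ge0 ?expR_ge0.
pose K := delta * (growth S * (1 + C * S)) * `|Z v t|.
have := @mean_value_sym 'rV[R]_m (fdim_rV R m) (fun u => (Z v u).1.1 - (u - t) *: LA (Z v t).1.2)
  (fun u => (Z' v u).1.1 - LA (Z v t).1.2) K t s.
rewrite subrr scale0r subr0 addrAC => h; apply: le_trans (h _ _) _.
- move=> u /inT[uT _]; have [h1 _ _ _] := proj_derive v uT.
  have h2 : is_derive u (1 : R) (fun u => (u - t) *: LA (Z v t).1.2) (LA (Z v t).1.2).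
    apply: eps_derive => e e0; exists 1 => // k _.
    have -> : (u + k - t) *: LA (Z v t).1.2 - (u - t) *: LA (Z v t).1.2 -
      k *: LA (Z v t).1.2 = 0 by rewrite !scalerBl !scalerDl; crd_ring.
    by rewrite normr0 mulr_ge0 // ltW.
  exact: is_deriveB.
- move=> u /inT[uT uS].
  have -> : (Z' v u).1.1 - LA (Z v t).1.2 =
    ((Z' v u).1.1 - LA (Z v u).1.2) + LA ((Z v u).1.2 - (Z v t).1.2).
    by rewrite -LAB addrA subrK.
  apply: le_trans (ler_normD _ _) _; rewrite /K.
  have k1 : `|(Z' v u).1.1 - LA (Z v u).1.2| <= delta * (growth S * `|Z v t|).
    by apply: le_trans (e1 v u uT) _; rewrite ler_wpM2l ?(ltW d0) //; exact: cone_growth.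
  have k2 : `|LA ((Z v u).1.2 - (Z v t).1.2)| <=
      C * (delta * (S * growth S) * `|Z v t|).
    by apply: le_trans (bA _) _; rewrite ler_wpM2l ?(ltW C0) //; exact: cone_B.
  lra.
have K0 : 0 <= K.
  by rewrite /K !mulr_ge0 ?(ltW d0) ?expR_ge0 // addr_ge0 // mulr_ge0 // ltW.
by have := ler_wpM2l K0 sS; rewrite /K; lra.
Qed.

(** Bounds the whole vector by [B] on the slice [W = M0 X]: 1 stands for [B] itself, [kap] for (X,
    Y) and [C * kap] for [W]. *)
Definition slice_const : R := 1 + kap + C * kap.

Lemma cone_slice v (t : R) : `|t| <= T -> (Z v t).1.1 = M0 (Z v t).2.1 ->
  `|(Z v t).1.1| <= C * kap * `|(Z v t).1.2| /\
  `|Z v t| <= slice_const * `|(Z v t).1.2|.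
Proof.
move=> tT h; have [[_ _ _ _ bM] _ _ _ sl] := fam.
have h2 := sl v t tT h; have b0 := normr_ge0 (Z v t).1.2.
have w1 : `|(Z v t).1.1| <= C * kap * `|(Z v t).1.2|.
  rewrite h -mulrA; apply: le_trans (bM _) _; apply: ler_wpM2l; first exact: ltW.
  exact: le_trans (norm_fst _) h2.
have k1 := mulr_ge0 (ltW kap0) b0; have k2 := mulr_ge0 (ltW C0) k1.
split=> //; rewrite /slice_const; apply: Zt_le.
- lra.
- lra.
- by apply: le_trans (norm_fst _) _; lra.
- by apply: le_trans (norm_snd _) _; lra.
Qed.

Section TwoTimes.
(** Norms are abstracted to real variables, which keeps the linear arithmetic of [slice_drift]
    small. *)
Let drift_arith (k z b kz u ws wt e ck c : R) : 0 <= k -> 0 <= b ->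
  k * kz <= 1 -> 3 * ck + 2 <= c -> z <= kz * b -> wt <= ck * b ->
  e <= k * z -> c * b <= u -> u <= ws + wt + e -> (2 * ck + 1) * b <= ws.
Proof.
move=> k0 b0 kkz cc /(ler_wpM2l k0) h1 h2 h3 h4 h5.
by have := ler_wpM2r b0 kkz; have := ler_wpM2r b0 cc; lra.
Qed.

Let graph_arith (ck kz gr b w b2 B1 W1 W2 z1 z2 z z3 : R) : 0 <= ck -> 0 <= kz -> 0 <= gr ->
  0 <= b -> 0 <= w -> 0 <= b2 -> B1 <= b + 2 * b2 -> W2 <= w + W1 -> W1 <= ck * B1 ->
  z1 <= kz * B1 -> (2 * ck + 1) * b2 <= W2 -> z3 <= kz * b2 -> z2 <= gr * z3 ->
  z <= z1 + z2 -> z <= kz * (1 + (2 + gr) * (1 + ck)) * (w + b).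
Proof.
move=> ck0 kz0 gr0 b0 w0 b20 hB hW hW1 hz1 hb2 hz3 hz2 hz.
have h1 := ler_wpM2l ck0 hB.
have h2 : b2 <= (1 + ck) * (w + b) by have := mulr_ge0 ck0 w0; lra.
have h3 := ler_wpM2l kz0 hB; have h4 := ler_wpM2l gr0 hz3.
have h5 := ler_wpM2l kz0 h2; have h6 := ler_wpM2l (mulr_ge0 gr0 kz0) h2.
have h7 := mulr_ge0 kz0 w0; lra.
Qed.

Context (T1 : R) (T10 : 0 <= T1) (T1big : 3 * (C * kap) + 2 <= T1 * (cA / m.+1%:R)).
Context (small1 : delta * (T1 * growth T1 * (1 + C * T1)) * slice_const <= 1).

Lemma Kz_gt0 : 0 < slice_const.
Proof. by rewrite /slice_const; have := mulr_gt0 C0 kap0; have := kap0; lra. Qed.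

Lemma growth_gt0 S : 0 < growth S.
Proof. by rewrite mulr_gt0 ?expR_gt0. Qed.

Lemma drift_small : delta * (T1 * growth T1) * slice_const <= 1.
Proof.
have /andP[d0 _] := delta01; apply: le_trans small1.
rewrite ler_wpM2r ?(ltW Kz_gt0) // ler_wpM2l ?(ltW d0) //.
have g := mulr_ge0 T10 (ltW (growth_gt0 T1)).
rewrite -[leLHS]mulr1 ler_wpM2l // lerDl mulr_ge0 //; exact: ltW.
Qed.

(** In the slice [|W|] is at most [C * kap * |B|]. The shear displaces [W] by at least
    [(3 * (C * kap) + 2) * |B|] with an error of at most [|B|], which leaves
    [(2 * (C * kap) + 1) * |B|]. Since [B] at most doubles, membership in the slice at time [s]
    would require [|W|] to be at most [2 * (C * kap) * |B|]: a nonzero vector cannot lie in both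
    slices. *)
Lemma slice_drift v (t s : R) : `|t| <= T -> (Z v t).1.1 = M0 (Z v t).2.1 ->
  `|t| + T1 <= T -> `|s - t| = T1 ->
  `|(Z v s).1.2 - (Z v t).1.2| <= `|(Z v t).1.2| /\
  (2 * (C * kap) + 1) * `|(Z v t).1.2| <= `|(Z v s).1.1|.
Proof.
move=> tT h tT1 sT1; have [[_ _ _ cAP _] _ _ _ _] := fam.
have [w1 w2] := cone_slice tT h; have b0 := normr_ge0 (Z v t).1.2.
have sT : `|s - t| <= T1 by rewrite sT1.
have /andP[d0 _] := delta01; have kz := Kz_gt0.
have g := mulr_ge0 T10 (ltW (growth_gt0 T1)).
split.
  apply: le_trans (cone_B v T10 tT1 sT) _.
  have := ler_wpM2l (mulr_ge0 (ltW d0) g) w2.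
  have := ler_wpM2r b0 drift_small; lra.
have e := cone_W v T10 tT1 sT.
have lo : T1 * (cA / m.+1%:R) * `|(Z v t).1.2| <= `|(s - t) *: LA (Z v t).1.2|.
  rewrite normrZ sT1 -mulrA ler_wpM2l //; exact: coercive_lower.
have k0 : 0 <= delta * (T1 * growth T1 * (1 + C * T1)).
  by rewrite !mulr_ge0 ?(ltW d0) ?expR_ge0 // addr_ge0 // mulr_ge0 // ltW.
have e' : `|(s - t) *: LA (Z v t).1.2| <= `|(Z v s).1.1| + `|(Z v t).1.1| +
    `|(Z v s).1.1 - (Z v t).1.1 - (s - t) *: LA (Z v t).1.2|.
  rewrite -{1}[(s - t) *: LA (Z v t).1.2](subKr ((Z v s).1.1 - (Z v t).1.1)).
  by apply: le_trans (ler_normB _ _) _; rewrite lerD2r; exact: ler_normB.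
exact: (drift_arith k0 b0 small1 T1big w2 w1 e lo e').
Qed.

Definition graph_const : R :=
  slice_const * (1 + (2 + growth T1) * (1 + C * kap)).

(* The slices [W = M0 X] at times [t] and [t + T1] are complementary, because the drift
   [W' = LA B] moves the first one away from the second one; [v] is split accordingly. *)
Lemma cone_graph v (t : R) : `|t| + 2 * T1 <= T ->
  `|Z v t| <= graph_const * (`|(Z v t).1.1| + `|(Z v t).1.2|).
Proof.
move=> tT2; have [[_ linM _ _ _] _ [linZ dZ inj] _ _] := fam.
have T1p := T10; have tT1 : `|t| + T1 <= T by lra.
have tT : `|t| <= T by lra.
pose t1 := t + T1; have d1 : `|t1 - t| = T1 by rewrite /t1 addrC addKr ger0_norm.
have d1' : `|t - t1| = T1 by rewrite distrC.
have t1T1 : `|t1| + T1 <= T.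
  by have := ler_normD (t1 - t) t; rewrite subrK d1; lra.
have t1T : `|t1| <= T by lra.
pose a w (u : R) := (Z w u).1.1 - M0 (Z w u).2.1.
have lina u : linear (a ^~ u).
  by move=> k x y; rewrite /a linZ /= linM; crd_ring.
have aE w u : a w u = 0 -> (Z w u).1.1 = M0 (Z w u).2.1 by move/subr0_eq.
pose f w : pt R m m := (a w t, a w t1).
have linf : linear f by move=> k x y; rewrite /f !lina.
have injf w : f w = 0 -> w = 0.
  move=> [/aE h /aE h1]; apply: (inj w t tT); apply/eqP; rewrite -normr_eq0.
  have [e1 e2] := slice_drift tT h tT1 d1; have [w1 _] := cone_slice t1T h1.
  have [_ w2] := cone_slice tT h; have b0 := normr_ge0 (Z w t).1.2.
  have e3 : `|(Z w t1).1.2| <= 2 * `|(Z w t).1.2|.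
    by have := ler_normD ((Z w t1).1.2 - (Z w t).1.2) (Z w t).1.2; rewrite subrK; lra.
  have ck := mulr_gt0 C0 kap0; have := ler_wpM2l (ltW ck) e3 => e4.
  have b00 : `|(Z w t).1.2| = 0 by apply/le_anti; rewrite b0 andbT; lra.
  by move: w2; rewrite b00 mulr0 => w2; rewrite eq_le w2 normr_ge0.
(* Injectivity of [f] between spaces of equal dimension gives a vector [v1] in the slice at time [t]
   with the same defect [W - M0 X] as [v] at time [t1]; hence [v - v1] lies in the slice at time
   [t1]. *)
have [v1 [v1t v1t1]] := @injective_surjective R (pt R m m : normedModType R)
  (fdim_prod (fdim_rV R m) (fdim_rV R m)) f linf injf (0, a v t1).
pose v2 := v - v1.
have vE u : Z v u = Z v1 u + Z v2 u.
  by rewrite -[Z v1 u]scale1r -linZ /v2 scale1r addrC subrK.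
have v2t1 : a v2 t1 = 0.
  rewrite /v2 -scaleN1r addrC lina v1t1 scaleN1r addNr //.
have h1 := aE _ _ v1t; have h2 := aE _ _ v2t1.
have [p1 p2] := cone_slice tT h1.
have [q1 q2] := slice_drift t1T h2 t1T1 d1'.
have [_ q3] := cone_slice t1T h2.
have q4 : `|Z v2 t| <= growth T1 * `|Z v2 t1|.
  by apply: cone_growth => //; rewrite d1'.
set b2 := `|(Z v2 t1).1.2| in q1 q2 q3.
have b20 : 0 <= b2 by exact: normr_ge0.
have B2 : `|(Z v2 t).1.2| <= 2 * b2.
  have := ler_normD ((Z v2 t).1.2 - (Z v2 t1).1.2) (Z v2 t1).1.2.
  by rewrite subrK -/b2 => /le_trans; apply; rewrite mulr2n mulrDl mul1r lerD2r.
have B1 : `|(Z v1 t).1.2| <= `|(Z v t).1.2| + 2 * b2.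
  have -> : (Z v1 t).1.2 = (Z v t).1.2 - (Z v2 t).1.2 by rewrite vE /= addrK.
  by apply: le_trans (ler_normB _ _) _; rewrite lerD2l.
have W2 : `|(Z v2 t).1.1| <= `|(Z v t).1.1| + `|(Z v1 t).1.1|.
  have -> : (Z v2 t).1.1 = (Z v t).1.1 - (Z v1 t).1.1 by rewrite vE /= addrAC subrr add0r.
  exact: ler_normB.
have ck := mulr_gt0 C0 kap0; have kz := Kz_gt0; have gr := growth_gt0 T1.
have z : `|Z v t| <= `|Z v1 t| + `|Z v2 t| by rewrite vE ler_normD.
exact: (graph_arith (ltW ck) (ltW kz) (ltW gr) (normr_ge0 _) (normr_ge0 _) b20 B1 W2 p1 p2 q2 q3 q4 z).
Qed.

Section Saddle.
Context (c : R) (c0 : 0 < c) (ccK : c <= cK) (ccV : c <= cV) (T2 : R) (T22 : 2 <= T2).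
Context (T21 : T2 + 2 * T1 <= T).
Context (small2 : delta * (T2 * growth T2 * (1 + C * T2)) * graph_const <= 1).

Let size v := `|(Z v 0).1.1| + `|(Z v 0).1.2|.
Definition poly_const := graph_const * (3 + C * T2).

Let T2_ge0 : 0 <= T2. Proof. by have := T22; lra. Qed.

Lemma graph_const_gt0 : 0 < graph_const.
Proof.
have ck := mulr_gt0 C0 kap0; have g := growth_gt0 T1.
rewrite /graph_const mulr_gt0 ?Kz_gt0 // addr_gt0 // mulr_gt0 //; lra.
Qed.

(** At each time the whole vector is controlled by [W] and [B], and these follow the shear: [B]
    stays within [size v] of its initial value, and [W] grows by at most [C * T2 * |B|] up to
    another [size v]. Hence the factor [3 + C * T2], linear in [T2], which also bounds [X] and
    [Y]. *)
Lemma cone_poly v (s : R) : `|s| <= T2 -> `|Z v s| <= poly_const * size v.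
Proof.
move=> sT; have [[_ _ bA _ _] _ _ _ _] := fam; have /andP[d0 _] := delta01.
have inT : `|0 : R| + T2 <= T by rewrite normr0; have := T10; have := T21; lra.
have sT' : `|s - 0| <= T2 by rewrite subr0.
have hB := cone_B v T2_ge0 inT sT'; have hW := cone_W v T2_ge0 inT sT'.
have z0 : `|Z v 0| <= graph_const * size v.
  by apply: cone_graph; rewrite normr0; have := T22; have := T21; lra.
have zs : `|Z v s| <= graph_const * (`|(Z v s).1.1| + `|(Z v s).1.2|).
  by apply: cone_graph; have := T21; lra.
have E0 : 0 <= size v by rewrite addr_ge0.
have g0 := mulr_ge0 T2_ge0 (ltW (growth_gt0 T2)).
have ct : 0 <= C * T2 by rewrite mulr_ge0 // ltW.
have k0 : 0 <= delta * (T2 * growth T2 * (1 + C * T2)).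
  by rewrite mulr_ge0 ?(ltW d0) // mulr_ge0 // addr_ge0.
have e2 : delta * (T2 * growth T2 * (1 + C * T2)) * `|Z v 0| <= size v.
  by apply: le_trans (ler_wpM2l k0 z0) _; rewrite [leLHS]mulrA ler_piMl.
have e1 : delta * (T2 * growth T2) * `|Z v 0| <= size v.
  apply: le_trans e2; rewrite ler_wpM2r // ler_wpM2l ?(ltW d0) //.
  by rewrite -[leLHS]mulr1 ler_wpM2l // lerDl.
have {}hB : `|(Z v s).1.2| <= `|(Z v 0).1.2| + size v.
  have := ler_normD ((Z v s).1.2 - (Z v 0).1.2) (Z v 0).1.2; rewrite subrK.
  by move=> /le_trans; apply; rewrite addrC lerD2l (le_trans hB).
have {}hW : `|(Z v s).1.1| <= `|(Z v 0).1.1| + C * T2 * `|(Z v 0).1.2| + size v.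
  have -> : (Z v s).1.1 = (Z v 0).1.1 + (s - 0) *: LA (Z v 0).1.2 +
    ((Z v s).1.1 - (Z v 0).1.1 - (s - 0) *: LA (Z v 0).1.2) by crd_ring.
  apply: le_trans (ler_normD _ _) _; apply: lerD; last exact: le_trans hW e2.
  apply: le_trans (ler_normD _ _) _; rewrite lerD2l normrZ [C * T2]mulrC -mulrA.
  by apply: ler_pM.
apply: le_trans zs _; rewrite /poly_const -mulrA ler_wpM2l ?(ltW graph_const_gt0) //.
have := ler_wpM2l ct (_ : `|(Z v 0).1.2| <= size v).
rewrite lerDr normr_ge0 => /(_ isT).
move: hB hW; rewrite /size; lra.
Qed.

Let J v (s : R) : R := dot (Z v s).2.1 (Z v s).2.2.
Let J' v (s : R) : R :=
  dot (Z' v s).2.1 (Z v s).2.2 + dot (Z v s).2.1 (Z' v s).2.2.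

Lemma J_derive v (s : R) : `|s| <= T -> is_derive s (1 : R) (J v) (J' v s).
Proof.
by move=> /(proj_derive v)[_ _ h1 h2]; exact: (@dot_derive R r _ _
  (fun s => (Z' v s).2.1) (fun s => (Z' v s).2.2)).
Qed.

Lemma J_lower v (s : R) : `|s| <= T ->
  c * (`|(Z v s).2.1| ^+ 2 + `|(Z v s).2.2| ^+ 2) - 2 * r%:R * delta * `|Z v s| ^+ 2
    <= J' v s.
Proof.
move=> sT; have [_ [_ pK _ pV] _ [_ _ e3 e4] _] := fam.
have [_ _ n3 n4] := Zt_comp (Z v s); have /andP[d0 _] := delta01.
have aux (e y : 'rV[R]_r) : `|e| <= delta * `|Z v s| -> `|y| <= `|Z v s| ->
    - (r%:R * delta * `|Z v s| ^+ 2) <= dot e y.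
  move=> h1 h2; rewrite lerNl; apply: le_trans (ler_norm _) _; rewrite normrN.
  apply: le_trans (dot_bound _ _) _; rewrite -!mulrA ler_wpM2l //.
  by rewrite expr2 mulrA ler_pM.
have E1 : dot (Z' v s).2.1 (Z v s).2.2 = dot (LK (Z v s).2.2) (Z v s).2.2 +
   dot ((Z' v s).2.1 - LK (Z v s).2.2) (Z v s).2.2.
  by rewrite -dotDl addrC subrK.
have E2 : dot (Z v s).2.1 (Z' v s).2.2 = dot (LV s (Z v s).2.1) (Z v s).2.1 +
   dot ((Z' v s).2.2 - LV s (Z v s).2.1) (Z v s).2.1.
  by rewrite -dotDl addrC subrK dotC.
have a1 := aux _ _ (e3 v s sT) n4; have a2 := aux _ _ (e4 v s sT) n3.
have b1 := le_trans (ler_wpM2r (sqr_ge0 `|(Z v s).2.2|) ccK) (pK _).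
have b2 := le_trans (ler_wpM2r (sqr_ge0 `|(Z v s).2.1|) ccV) (pV s _ sT).
rewrite /J' E1 E2; move: a1 a2 b1 b2.
move: (dot (LK _) _) (dot (LV _ _) _) (dot (_ - _) _) (dot (_ - _) _) => u1 u2 u3 u4.
move: (`|(Z v s).2.1| ^+ 2) (`|(Z v s).2.2| ^+ 2) (`|Z v s| ^+ 2) => x y z; lra.
Qed.

(** Gronwall run from [s] back to 0: the saddle part cannot collapse within unit time, except for
    what the perturbation feeds into it. This produces the initial gain of [J]. *)
Lemma uv_lower v (s : R) : `|s| <= 1 ->
  `|(Z v 0).2| * (expR (- (2 * C)) / 2) - delta * (poly_const * size v) <= `|(Z v s).2|.
Proof.
move=> s1; have [_ [bK _ bV _] [_ dZ _] [_ _ e3 e4] _] := fam.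
have inT (u : R) : `|u - s| <= 1 -> `|u| <= T2 /\ `|u| <= T.
  move=> h; have := ler_normD (u - s) s; rewrite subrK => h'.
  by split; have := T22; have := T21; have := T10; lra.
have /andP[d0 _] := delta01.
have g : `|(Z v 0).2| <= 2 * (`|(Z v s).2| + delta * (poly_const * size v) * 1) * expR (2 * C * 1).
  apply: (@gronwall R (pt R r r) _ (fun u => (Z v u).2) (fun u => (Z' v u).2)).
  - exact: ltW.
  - rewrite mulr_ge0 ?(ltW d0) //; apply: le_trans (cone_poly v (s := 0) _) => //.
    by rewrite normr0.
  - move=> u /inT[_ uT]; have h := dZ v u uT.
    by apply: (@is_derive_lin R Zt _ _ (fun z => z.2)).
  - move=> u /inT[u2 uT].
    have dz : delta * `|Z v u| <= delta * (poly_const * size v).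
      by rewrite ler_wpM2l ?(ltW d0) //; exact: cone_poly.
    have aux (x y w : 'rV[R]_r) : `|x - y| <= delta * `|Z v u| -> `|y| <= C * `|w| ->
        `|w| <= `|(Z v u).2| -> `|x| <= C * `|(Z v u).2| + delta * (poly_const * size v).
      move=> h1 h2 h3; rewrite -(subrK y x); apply: le_trans (ler_normD _ _) _.
      rewrite addrC lerD //; last exact: le_trans h1 dz.
      by apply: le_trans h2 _; rewrite ler_wpM2l // ltW.
    rewrite [(Z' v u).2]surjective_pairing; apply: norm_pair_le.
      exact: aux (e3 v u uT) (bK _) (norm_snd _).
    exact: aux (e4 v u uT) (bV u _ uT) (norm_fst _).
  - by rewrite sub0r normrN.
move: g; rewrite !mulr1 => g.
have ee : expR (2 * C) * expR (- (2 * C)) = 1 by rewrite expRN divff // gt_eqF ?expR_gt0.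
have := ler_wpM2r (expR_ge0 (- (2 * C))) g; rewrite -[leRHS]mulrA ee mulr1.
move: (delta * _) => d; lra.
Qed.

Let lam : R := c / r.+1%:R.
Let lam_gt0 : 0 < lam. Proof. by rewrite divr_gt0. Qed.

(** The first bound gives growth at rate [lam] and rests on [|J| <= r |X| |Y|], whence the division
    by [r.+1]; the second one gives [J] its initial push on [-1, 1]. *)
Lemma J_growth v (s : R) : `|s| <= T2 ->
  lam * `|J v s| - 2 * r%:R * delta * (poly_const * size v) ^+ 2 <= J' v s /\
  c * `|(Z v s).2| ^+ 2 - 2 * r%:R * delta * (poly_const * size v) ^+ 2 <= J' v s.
Proof.
move=> s2; have sT : `|s| <= T by have := T21; have := T10; lra.
have lo := J_lower v sT; have zp := cone_poly v s2; have /andP[d0 _] := delta01.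
have zz : 2 * r%:R * delta * `|Z v s| ^+ 2 <=
    2 * r%:R * delta * (poly_const * size v) ^+ 2.
  rewrite ler_wpM2l //; first by rewrite !mulr_ge0 // ltW.
  by rewrite lerXn2r ?nnegrE //; exact: le_trans zp.
have x0 := normr_ge0 (Z v s).2.1; have y0 := normr_ge0 (Z v s).2.2.
split.
  apply: le_trans lo; apply: lerB => //.
  have h : lam * `|J v s| <= c * (`|(Z v s).2.1| * `|(Z v s).2.2|).
    have hb := dot_bound (Z v s).2.1 (Z v s).2.2.
    rewrite /lam mulrAC ler_pdivrMr ?ltr0n // -mulrA ler_wpM2l ?(ltW c0) //.
    rewrite mulrC; apply: le_trans hb _; rewrite ler_wpM2r ?mulr_ge0 //.
    by rewrite ler_nat.
  apply: le_trans h _; rewrite ler_wpM2l ?(ltW c0) //.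
  move: x0 y0; move: `|(Z v s).2.1| `|(Z v s).2.2| => x y x0 y0.
  by have := sqr_ge0 (x - y); have := mulr_ge0 x0 y0; rewrite sqrrB; lra.
apply: le_trans lo; apply: lerB => //; rewrite ler_wpM2l ?(ltW c0) //.
rewrite [(Z v s).2]surjective_pairing norm_pair; rewrite /Num.max.
by case: ifP => _; rewrite ?lerDl ?lerDr sqr_ge0.
Qed.

(** Half of the constant of [uv_lower]; the other half absorbs the perturbation, by [small3]. In the
    same way [kap1] retains half of [c * tht ^+ 2]. *)
Let tht : R := expR (- (2 * C)) / 4.
Let kap1 : R := c * tht ^+ 2 / 2.
Let tht_gt0 : 0 < tht. Proof. by rewrite divr_gt0 ?expR_gt0. Qed.
Let kap1_gt0 : 0 < kap1. Proof. by rewrite divr_gt0 // mulr_gt0 // exprn_gt0. Qed.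

Context (eta : R) (eta0 : 0 < eta).
Context (small3 : delta * poly_const <= eta * tht).
Context (small4 : 2 * r%:R * delta * poly_const ^+ 2 <= eta ^+ 2 * kap1).
Context (small5 : 2 * r%:R * delta * poly_const ^+ 2 <= eta ^+ 2 * (lam * (kap1 / 2))).
Context (big2 : r%:R * poly_const ^+ 2 < expR (lam * (T2 - 1)) * (eta ^+ 2 * (kap1 / 2))).

(** The equilibrium [q / lam] takes up at most half of the value at time 1, so the other half grows
    exponentially until [T2]. *)
Lemma escape (f f' : R -> R) (q H : R) : 0 <= q ->
  (forall s : R, 1 <= s <= T2 -> is_derive s (1 : R) f (f' s)) ->
  (forall s : R, 1 <= s <= T2 -> lam * f s - q <= f' s) ->
  q <= lam * (kap1 / 2) * H -> kap1 * H <= f 1 ->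
  expR (lam * (T2 - 1)) * (kap1 / 2 * H) <= f T2.
Proof.
move=> q0 df le qle f1.
have T12 : 1 <= T2 by have := T22; lra.
have g := exp_growth lam_gt0 T12 df le.
have ql : q / lam <= kap1 / 2 * H.
  by rewrite ler_pdivrMr // mulrC mulrA.
apply: le_trans g; have q1 : 0 <= q / lam by rewrite divr_ge0 // ltW.
apply: (@le_trans _ _ (expR (lam * (T2 - 1)) * (f 1 - q / lam))); last by rewrite lerDr.
rewrite ler_wpM2l ?expR_ge0 // lerBrDr.
by apply: le_trans f1; apply: le_trans (lerD (lexx _) ql) _; lra.
Qed.

(* If [(X, Y)] were not small, [J] would grow exponentially in forward or in backward
   time, which the linear growth in [cone_poly] forbids. *)
Lemma cone_main v : `|(Z v 0).2| <= eta * (`|(Z v 0).1.1| + `|(Z v 0).1.2|).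
Proof.
rewrite leNgt -/(size v); apply/negP => HE.
have T22' := T22; have T21' := T21; have T10' := T10.
set H := `|(Z v 0).2| in HE; have E0 : 0 <= size v by rewrite addr_ge0.
have H0 : 0 < H by apply: le_lt_trans HE; rewrite mulr_ge0 // ltW.
have H20 : 0 <= H ^+ 2 by exact: sqr_ge0.
have /andP[d0 _] := delta01.
pose q := 2 * r%:R * delta * (poly_const * size v) ^+ 2.
have q0 : 0 <= q by rewrite /q mulr_ge0 ?sqr_ge0 // mulr_ge0 ?(ltW d0) // mulr_ge0.
have E2 : eta ^+ 2 * size v ^+ 2 <= H ^+ 2.
  by rewrite -exprMn lerXn2r ?nnegrE ?(ltW HE) ?(ltW H0) // mulr_ge0 // ltW.
have qle (a : R) : 0 <= a -> 2 * r%:R * delta * poly_const ^+ 2 <= eta ^+ 2 * a -> q <= a * H ^+ 2.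
  move=> a0 h; apply: (@le_trans _ _ (eta ^+ 2 * a * size v ^+ 2)).
    have -> : q = 2 * r%:R * delta * poly_const ^+ 2 * size v ^+ 2.
      by rewrite /q; move: poly_const (size v) => x y; ring.
    move: h; move: (poly_const ^+ 2) (size v) => x y h.
    by apply: ler_wpM2r h; exact: sqr_ge0.
  by rewrite mulrAC [leLHS]mulrC ler_wpM2l.
have q1 : q <= kap1 * H ^+ 2 by apply: qle => //; exact: ltW.
have q2 : q <= lam * (kap1 / 2) * H ^+ 2.
  by apply: qle => //; rewrite mulr_ge0 ?(ltW lam_gt0) // divr_ge0 // ltW.
have u1 (s : R) : `|s| <= 1 -> tht * H <= `|(Z v s).2|.
  move=> s1; apply: le_trans (uv_lower v s1); rewrite -/H.
  have := ler_wpM2r E0 small3; have := ler_wpM2l (ltW tht_gt0) (ltW HE).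
  have -> : expR (- (2 * C)) = 4 * tht by rewrite /tht; field.
  by move: tht poly_const (size v) => x y z; lra.
have J1 (s : R) : `|s| <= 1 -> kap1 * H ^+ 2 <= J' v s.
  move=> s1; have s2 : `|s| <= T2 by lra.
  have [_ g] := J_growth v s2; apply: le_trans g; rewrite -/q.
  have : (tht * H) ^+ 2 <= `|(Z v s).2| ^+ 2.
    by rewrite lerXn2r ?nnegrE ?u1 // mulr_ge0 ?(ltW tht_gt0) // ltW.
  move=> /(ler_wpM2l (ltW c0)); rewrite exprMn; move: q1; rewrite /kap1.
  move: (tht ^+ 2) (H ^+ 2) (`|_| ^+ 2) => x y z; lra.
have dJ (s : R) : `|s| <= T2 -> is_derive s (1 : R) (J v) (J' v s).
  by move=> s2; apply: J_derive; lra.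
have Jb (s : R) : `|s| <= T2 -> `|J v s| <= r%:R * (poly_const * size v) ^+ 2.
  move=> s2; apply: le_trans (dot_bound _ _) _; rewrite ler_wpM2l // expr2.
  have [_ _ n3 n4] := Zt_comp (Z v s).
  by apply: ler_pM => //; [exact: le_trans n3 (cone_poly v s2)|
    exact: le_trans n4 (cone_poly v s2)].
(* With this gain, either [J] is at least [kap1 * H ^+ 2] at time 1, or it is at most
   [- kap1 * H ^+ 2] at time -1. *)
have step : J v (-1) + 2 * (kap1 * H ^+ 2) <= J v 1.
  have := @der_ge0_le R (fun s => J v s - s * (kap1 * H ^+ 2))
    (fun s => J' v s - kap1 * H ^+ 2) (-1) 1.
  have -> : (-1 <= 1 :> R) by lra.
  move=> /(_ isT) h; suff : J v (-1) - -1 * (kap1 * H ^+ 2) <= J v 1 - 1 * (kap1 * H ^+ 2).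
    move: (kap1 * H ^+ 2) => x; lra.
  apply: h => s /andP[s1 s2]; have s3 : `|s| <= 1 by rewrite ler_norml s1.
    have h1 := dJ s (le_trans s3 (_ : 1 <= T2)).
    have h2 : is_derive s (1 : R) (fun u : R => u * (kap1 * H ^+ 2)) (kap1 * H ^+ 2).
      apply: eps_derive => e e0; exists 1 => // k _.
      rewrite -[k *: _]/(k * _); have -> : (s + k) * (kap1 * H ^+ 2) -
        s * (kap1 * H ^+ 2) - k * (kap1 * H ^+ 2) = 0 by move: (kap1 * _) => x; ring.
      by rewrite normr0 mulr_ge0 // ltW.
    have {}h1 := h1 ltac:(lra); exact: is_deriveB.
  by rewrite subr_ge0 J1.
have fin (x : R) : expR (lam * (T2 - 1)) * (kap1 / 2 * H ^+ 2) <= x ->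
    x <= r%:R * (poly_const * size v) ^+ 2 -> False.
  move=> h1 h2; have := le_trans h1 h2; rewrite leNgt; apply/negP; rewrite negbK.
  have h3 : r%:R * (poly_const * size v) ^+ 2 * eta ^+ 2 <= r%:R * poly_const ^+ 2 * H ^+ 2.
    have p0 : 0 <= r%:R * poly_const ^+ 2 by rewrite mulr_ge0 ?sqr_ge0.
    by have := ler_wpM2l p0 E2; rewrite (exprMn 2 poly_const); move: (poly_const ^+ 2) (size v ^+ 2) => *; lra.
  have h4 : r%:R * poly_const ^+ 2 * H ^+ 2 <
      expR (lam * (T2 - 1)) * (eta ^+ 2 * (kap1 / 2)) * H ^+ 2.
    by rewrite ltr_pM2r // exprn_gt0.
  have e2 : 0 < eta ^+ 2 by rewrite exprn_gt0.
  rewrite -(ltr_pM2r e2); apply: (le_lt_trans h3); apply: (lt_le_trans h4).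
  by rewrite le_eqVlt; apply/orP; left; apply/eqP; ring.
have [Jp|Jn] := leP (kap1 * H ^+ 2) (J v 1).
  apply: (fin (J v T2)).
    apply: (@escape (J v) (J' v) q) => // s /andP[s1 s2].
      by apply: dJ; rewrite ger0_norm //; lra.
    have s3 : `|s| <= T2 by rewrite ger0_norm //; lra.
    have [g _] := J_growth v s3; apply: le_trans g; rewrite -/q.
    by rewrite lerD2r ler_wpM2l ?(ltW lam_gt0) // ler_norm.
  by apply: le_trans (ler_norm _) (Jb T2 _); rewrite ger0_norm //; lra.
apply: (fin (- J v (- T2))).
  apply: (@escape (fun s => - J v (- s)) (fun s => J' v (- s)) q) => //.
  - move=> s /andP[s1 s2].
    have h : is_derive (-1 * s + 0) (1 : R) (J v) (J' v (- s)).
      by rewrite addr0 mulN1r; apply: dJ; rewrite normrN ger0_norm //; lra.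
    have := @is_deriveN _ _ _ _ _ _ _ (is_derive_affine h).
    rewrite scaleN1r opprK; apply: is_derive_ext => u /=.
    by rewrite !fctE addr0 mulN1r.
  - move=> s /andP[s1 s2].
    have s3 : `|- s| <= T2 by rewrite normrN ger0_norm //; lra.
    have [g _] := J_growth v s3; apply: le_trans g; rewrite -/q.
    by rewrite lerD2r ler_wpM2l ?(ltW lam_gt0) // -normrN ler_norm.
  - by move: step Jn; move: (kap1 * _) => x; lra.
apply: le_trans (ler_norm _) _; rewrite normrN; apply: Jb.
by rewrite normrN ger0_norm //; lra.
Qed.

End Saddle.

End TwoTimes.
End Estimates.

(** The constants are chosen in the order [T1], for which the shear separates the slices, [T2], for
    which the exponential beats the square of the linear growth, and then [delta], small with
    respect to both. The total time [T2 + 2 * T1] leaves room for [cone_graph] at every time up to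
    [T2]. *)
Lemma cone_lemma (C cA cK cV kap eta : R) :
  0 < C -> 0 < cA -> 0 < cK -> 0 < cV -> 0 < kap -> 0 < eta ->
  exists T d0 : R, [/\ 0 < T, 0 < d0 & forall delta LA LK M0 LV Z Z',
    0 < delta <= d0 -> cone_family C cA cK cV kap delta T LA LK M0 LV Z Z' ->
    forall v, `|(Z v 0).2| <= eta * (`|(Z v 0).1.1| + `|(Z v 0).1.2|)].
Proof.
move=> C0 cA0 cK0 cV0 k0 e0.
have ck := mulr_gt0 C0 k0.
have a0 : 0 < cA / m.+1%:R by rewrite divr_gt0.
pose T1 := (3 * (C * kap) + 2) / (cA / m.+1%:R).
have T10 : 0 <= T1 by rewrite divr_ge0 ?(ltW a0) //; lra.
have T1big : 3 * (C * kap) + 2 <= T1 * (cA / m.+1%:R) by rewrite /T1 divfK // gt_eqF.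
pose c := Num.min cK cV; have c0 : 0 < c by rewrite lt_min cK0.
have cK' : c <= cK by rewrite ge_min lexx.
have cV' : c <= cV by rewrite ge_min lexx orbT.
pose Kz := @slice_const C kap; pose gr := @growth C.
have Kz0 : 0 < Kz by rewrite /Kz /slice_const; lra.
have gr0 S : 0 < gr S by rewrite mulr_gt0 ?expR_gt0.
pose C1 := @graph_const C kap T1.
have C10 : 0 < C1.
  by rewrite /C1 /graph_const mulr_gt0 // addr_gt0 // mulr_gt0 ?addr_gt0 //; exact: gr0.
pose lam : R := c / r.+1%:R; have lam0 : 0 < lam by rewrite divr_gt0.
pose tht := expR (- (2 * C)) / 4; have tht0 : 0 < tht by rewrite divr_gt0 ?expR_gt0.
pose kap1 : R := c * tht ^+ 2 / 2.
have kap10 : 0 < kap1 by rewrite divr_gt0 // mulr_gt0 // exprn_gt0.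
pose A := r%:R * (C1 * (3 + C)) ^+ 2 / (eta ^+ 2 * (kap1 / 2)).
have ek : 0 < eta ^+ 2 * (kap1 / 2) by rewrite mulr_gt0 ?exprn_gt0 // divr_gt0.
have A0 : 0 <= A by rewrite divr_ge0 ?(ltW ek) // mulr_ge0 ?sqr_ge0.
have [T2 T22 T2big] := exp_beats_square lam0 A0.
pose Pol := @poly_const C kap T1 T2.
have Pol0 : 0 < Pol.
  by rewrite /Pol /poly_const mulr_gt0 // addr_gt0 // mulr_gt0 //; lra.
(* [Pol] is at most [C1 * (3 + C) * (1 + T2)], which reduces this to the inequality of
   [exp_beats_square] with the constant [A]. *)
have big2 : r%:R * Pol ^+ 2 < expR (lam * (T2 - 1)) * (eta ^+ 2 * (kap1 / 2)).
  rewrite -ltr_pdivrMr //; apply: le_lt_trans T2big.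
  rewrite /A [leRHS]mulrAC ler_pM2r ?invr_gt0 // -mulrA ler_wpM2l // -exprMn.
  have C2 := mulr_ge0 (ltW C0) (_ : 0 <= T2).
  rewrite lerXn2r ?nnegrE ?(ltW Pol0) //.
    by apply: mulr_ge0; [apply: mulr_ge0; [exact: ltW|lra]|lra].
  rewrite /Pol /poly_const -[leRHS]mulrA ler_pM2l //.
  by have := C2 ltac:(lra); have := C0; lra.
pose K1 := T1 * gr T1 * (1 + C * T1) * Kz.
pose K2 := T2 * gr T2 * (1 + C * T2) * C1.
pose K3 := Pol / (eta * tht).
pose K4 := 2 * r%:R * Pol ^+ 2 / (eta ^+ 2 * kap1).
pose K5 := 2 * r%:R * Pol ^+ 2 / (eta ^+ 2 * (lam * (kap1 / 2))).
have T20 : 0 <= T2 by lra.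
have Kp S k : 0 <= S -> 0 < k -> 0 <= S * gr S * (1 + C * S) * k.
  move=> S0 k1; have := mulr_ge0 (ltW C0) S0; have g := gr0 S => cs.
  by apply: mulr_ge0; [apply: mulr_ge0; [apply: mulr_ge0 => //; exact: ltW|lra]|exact: ltW].
have K10 : 0 <= K1 by exact: Kp.
have K20 : 0 <= K2 by exact: Kp.
have et : 0 < eta * tht by exact: mulr_gt0.
have ek1 : 0 < eta ^+ 2 * kap1 by rewrite mulr_gt0 // exprn_gt0.
have ek2 : 0 < eta ^+ 2 * (lam * (kap1 / 2)).
  by rewrite mulr_gt0 ?exprn_gt0 // mulr_gt0 // divr_gt0.
have K30 : 0 <= K3 by rewrite divr_ge0 // ltW.
have rP : 0 <= 2 * r%:R * Pol ^+ 2 by rewrite mulr_ge0 ?sqr_ge0 // mulr_ge0.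
have K40 : 0 <= K4 by rewrite divr_ge0 // ltW.
have K50 : 0 <= K5 by rewrite divr_ge0 // ltW.
(* Each smallness condition reads [delta * K <= 1] for one of the five [K]; a common upper bound of
   these and of 1 gives a single threshold. *)
have [S [S0 S1 [SK1 SK2 SK3 [SK4 SK5]]]] : exists S : R,
    [/\ 0 < S, 1 <= S & [/\ K1 <= S, K2 <= S, K3 <= S & K4 <= S /\ K5 <= S]].
  exists (1 + K1 + K2 + K3 + K4 + K5); move: K1 K2 K3 K4 K5 K10 K20 K30 K40 K50; clear.
  by move=> *; split; [lra|lra|split; [lra|lra|lra|split; lra]].
exists (T2 + 2 * T1), S^-1; split; [lra|by rewrite invr_gt0|].
move=> delta LA LK M0 LV Z Z' /andP[d0 dS] fam v.
have dS1 : delta * S <= 1 by rewrite -ler_pdivlMr // mul1r.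
have sm K : 0 <= K -> K <= S -> delta * K <= 1.
  by move=> _ KS; apply: le_trans dS1; rewrite ler_wpM2l // ltW.
have delta1 : 0 < delta <= 1.
  by rewrite d0 /=; have := sm 1 ler01; rewrite mulr1; apply.
have s1 := sm K1 K10 SK1.
have s2 := sm K2 K20 SK2.
have s3 := sm K3 K30 SK3.
have s4 := sm K4 K40 SK4.
have s5 := sm K5 K50 SK5.
have dm (x y : R) : 0 < y -> delta * (x / y) <= 1 -> delta * x <= y.
  by move=> y0; rewrite mulrA ler_pdivrMr // mul1r.
have {}s3 := dm _ _ et s3; have {}s4 := dm _ _ ek1 s4; have {}s5 := dm _ _ ek2 s5.
have aux : 2 * r%:R * delta * Pol ^+ 2 = delta * (2 * r%:R * Pol ^+ 2) by ring.
apply: (@cone_main C cA cK cV kap delta (T2 + 2 * T1) LA LK M0 LV Z Z' C0 k0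
  delta1 fam T1 T10 T1big _ c c0 cK' cV' T2 T22 (lexx _) _ eta e0).
- by rewrite -mulrA.
- by rewrite -mulrA.
- exact: s3.
- by rewrite aux.
- by rewrite aux.
- exact: big2.
Qed.

End Cone.

(** * The Hamiltonian vector field *)

Section Assemble.
Context {R : realType} {V W : normedModType R} {fV : fdim V} {fW : fdim W}.

Lemma diff_crd (f : V -> W) x : (forall k, differentiable (fun y => crd k (f y)) x) ->
  differentiable f x /\ forall v k, crd k ('d f x v) = 'd (fun y => crd k (f y)) x v.
Proof.
move=> df; pose L v : W := @of_crd R W fW (fun k => 'd (fun y => crd k (f y)) x v).
have linL : linear L by move=> a u v; apply: crd_inj => k; rewrite crdD crdZ !of_crdK linearP.
have [|dF E] := @eps_diff R V W fV f x L linL.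
  move=> e e0; have [k d d' /andP[d'0 dd'] h u ud|k|d d0 hd] := @fin_common_delta R
    'I_(fd_n W) (fun k d => forall u, `|u| < d ->
      `|crd k (f (x + u)) - crd k (f x) - 'd (fun y => crd k (f y)) x u| <= e * `|u|).
  - by apply: h; exact: lt_le_trans ud dd'.
  - exact: (diff_eps (df k)).
  exists d => // u ud; apply: norm_le_crd; first by rewrite mulr_ge0 // ltW.
  by move=> k; rewrite !crdB of_crdK; exact: hd.
by split=> // v k; rewrite E of_crdK.
Qed.

Lemma continuous_crd (f : V -> W) x :
  (forall k, {for x, continuous (fun y => crd k (f y))}) -> {for x, continuous f}.
Proof.
move=> cf; apply/cont_epsP => e e0.
have [k d d' /andP[d'0 dd'] h y yd|k|d d0 hd] := @fin_common_delta R
    'I_(fd_n W) (fun k d => forall y, `|y - x| < d ->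
      `|crd k (f y) - crd k (f x)| <= e).
- by apply: h; exact: lt_le_trans yd dd'.
- exact: ((cont_epsP _ _).1 (cf k) e e0).
exists d => // y yd; apply: norm_le_crd; first exact: ltW.
by move=> k; rewrite !crdB; exact: hd.
Qed.

Lemma C1_crd (f : V -> W) : (forall k, Ck_on 1 setT (fun y => crd k (f y))) ->
  Ck_on 1 setT f.
Proof.
move=> cf; split=> [x _|v x _].
  by apply: (diff_crd _).1 => k; exact: (cf k).1.
apply: continuous_crd => k.
have -> : (fun y => crd k ('D_v f y)) = (fun y => 'D_v (fun y => crd k (f y)) y).
  apply/funext => y; have [|df E] := @diff_crd f y; first by move=> j; exact: (cf j).1.
  by rewrite !deriveE ?E //; exact: (cf k).1.
exact: (cf k).2.
Qed.

End Assemble.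

Section PairBasis.
Context {R : realType} {V W : normedModType R} {fV : fdim V} {fW : fdim W}.

Lemma fd_psi0 (U : normedModType R) (fU : fdim U) : fd_psi 0 = 0 :> U.
Proof.
apply: (can_inj fd_phiK); rewrite fd_psiK.
have := @fd_lin R U fU 1 0 0; rewrite !scale1r !addr0 => /eqP.
by rewrite -subr_eq subrr eq_sym => /eqP ->.
Qed.

Lemma crd_pairl (i : 'I_(fd_n V)) (x : V * W) :
  @crd R (V * W)%type (fdim_prod fV fW) (lshift (fd_n W) i) x = crd i x.1.
Proof. by rewrite /crd /= row_mxEl. Qed.

Lemma crd_pairr (i : 'I_(fd_n W)) (x : V * W) :
  @crd R (V * W)%type (fdim_prod fV fW) (rshift (fd_n V) i) x = crd i x.2.
Proof. by rewrite /crd /= row_mxEr. Qed.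

Lemma bvec_pairl (i : 'I_(fd_n V)) :
  @bvec R (V * W)%type (fdim_prod fV fW) (lshift (fd_n W) i) = (bvec i, 0) :> V * W.
Proof.
rewrite /bvec /=; congr pair.
  congr fd_psi; apply/rowP => j; rewrite !mxE !eqxx /=.
  by rewrite (inj_eq (@lshift_inj _ _)).
rewrite [X in fd_psi X](_ : _ = 0) ?fd_psi0 //; apply/rowP => j.
by rewrite !mxE eqxx /= eq_sym eq_lrshift.
Qed.

Lemma bvec_pairr (i : 'I_(fd_n W)) :
  @bvec R (V * W)%type (fdim_prod fV fW) (rshift (fd_n V) i) = (0, bvec i) :> V * W.
Proof.
rewrite /bvec /=; congr pair; last first.
  congr fd_psi; apply/rowP => j; rewrite !mxE !eqxx /=.
  by rewrite (inj_eq (@rshift_inj _ _)).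
rewrite [X in fd_psi X](_ : _ = 0) ?fd_psi0 //; apply/rowP => j.
by rewrite !mxE eqxx /= eq_lrshift.
Qed.

End PairBasis.

Section Field.
Context {R : realType} {m r : nat}.
Implicit Types (h : pt R m r -> R) (G : ext R m r -> R) (z : ext R m r).

Lemma grad_crd (F : pt R m r -> R) x (k : 'I_(fd_n (pt R m r))) :
  crd k (grad F x) = 'D_(bvec k) F x.
Proof.
case: (split_ordP (k : 'I_(m + r))) => i ->.
  rewrite (@crd_pairl R 'rV[R]_m 'rV[R]_r (fdim_rV R m) (fdim_rV R r) i) (@bvec_pairl R 'rV[R]_m 'rV[R]_r (fdim_rV R m) (fdim_rV R r) i).
  by rewrite /crd /= mxE.
rewrite (@crd_pairr R 'rV[R]_m 'rV[R]_r (fdim_rV R m) (fdim_rV R r) i) (@bvec_pairr R 'rV[R]_m 'rV[R]_r (fdim_rV R m) (fdim_rV R r) i).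
by rewrite /crd /= mxE.
Qed.

Lemma derive_congr (V1 V2 W : normedModType R) (f : V1 -> W) (g : V2 -> W) x1 v1 x2 v2 :
  (forall t : R, f (t *: v1 + x1) = g (t *: v2 + x2)) -> 'D_v1 f x1 = 'D_v2 g x2.
Proof.
move=> h; have h0 : f x1 = g x2 by have := h 0; rewrite !scale0r !add0r.
rewrite /derive; set F := (fun t : R => _); set F' := (fun t : R => t^-1 *: ((g \o _) _ - _)).
suff -> : F = F' by [].
by apply/funext => t; rewrite /F /F' /= h h0.
Qed.

Definition gQ G z : pt R m r := grad (fun q => G (z.1.1, q, z.2)) z.1.2.
Definition gP G z : pt R m r := grad (fun p => G (z.1, p)) z.2.
Definition qdir (d : pt R m r) : ext R m r := (0, d, 0).
Definition pdir (d : pt R m r) : ext R m r := (0, 0, d).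

Lemma qdirP a u v : qdir (a *: u + v) = a *: qdir u + qdir v.
Proof. by rewrite /qdir !pairZ !pairD !scaler0 !addr0. Qed.

Lemma gQ_crd G z k : crd k (gQ G z) = 'D_(qdir (bvec k)) G z.
Proof.
rewrite /gQ grad_crd; apply: derive_congr => t /=.
by case: z => [[a b] c]; rewrite /qdir /= !pairZ !pairD !scaler0 !add0r.
Qed.

Lemma gP_crd G z k : crd k (gP G z) = 'D_(pdir (bvec k)) G z.
Proof.
rewrite /gP grad_crd; apply: derive_congr => t /=.
by case: z => [[a b] c]; rewrite /pdir /= !pairZ !pairD !scaler0 !add0r.
Qed.

Lemma grad_C1 (F : pt R m r -> R) : Ck_on 2 setT F -> Ck_on 1 setT (grad F).
Proof.
move=> FC; apply: C1_crd => k.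
have -> : (fun y => crd k (grad F y)) = (fun y => 'D_(bvec k) F y).
  by apply/funext => y; rewrite grad_crd.
exact: Ck2_D.
Qed.

Lemma gQ_C1 G : Ck_on 2 setT G -> Ck_on 1 setT (gQ G).
Proof.
move=> FC; apply: C1_crd => k.
have -> : (fun y => crd k (gQ G y)) = (fun y => 'D_(qdir (bvec k)) G y).
  by apply/funext => y; rewrite gQ_crd.
exact: Ck2_D.
Qed.

Lemma gP_C1 G : Ck_on 2 setT G -> Ck_on 1 setT (gP G).
Proof.
move=> FC; apply: C1_crd => k.
have -> : (fun y => crd k (gP G y)) = (fun y => 'D_(pdir (bvec k)) G y).
  by apply/funext => y; rewrite gP_crd.
exact: Ck2_D.
Qed.

Lemma gQ_periodic G : periodic_for extlat G -> periodic_for extlat (gQ G).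
Proof.
move=> pG z l Ll; apply: crd_inj => k; rewrite !gQ_crd.
exact: (periodic_derive (qdir (bvec k)) pG).
Qed.

Lemma gP_periodic G : periodic_for extlat G -> periodic_for extlat (gP G).
Proof.
move=> pG z l Ll; apply: crd_inj => k; rewrite !gP_crd.
exact: (periodic_derive (pdir (bvec k)) pG).
Qed.

Lemma ham_fieldE h G (eps : R) z : Ck_on 2 setT h -> Ck_on 2 setT G ->
  ham_field (hamiltonian h G eps) z =
    (grad h z.2 - eps ^+ 2 *: gP G z, eps ^+ 2 *: gQ G z).
Proof.
move=> hC GC; have dh x : differentiable h x by exact: hC.1.
have dG x : differentiable G x by exact: GC.1.
rewrite /ham_field /hamiltonian; congr pair; apply: crd_inj => k.
  rewrite grad_crd crdB crdZ grad_crd gP_crd.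
  have h1 : is_derive z.2 (bvec k) h ('D_(bvec k) h z.2).
    by apply: DeriveDef => //; exact: diff_derivable.
  have h2 : is_derive z.2 (bvec k) (fun p => G (z.1, p)) ('D_(pdir (bvec k)) G z).
    apply/is_derive_lineP.
    have : is_derive z (pdir (bvec k)) G ('D_(pdir (bvec k)) G z).
      by apply: DeriveDef => //; exact: diff_derivable.
    move=> /is_derive_lineP; apply: is_derive_ext => t.
    by case: z {h1} => [[a b] c]; rewrite /pdir /= !pairZ !pairD !scaler0 !addr0.
  have h3 := is_deriveZ (eps ^+ 2) h2.
  have [_ <-] := is_deriveB h1 h3.
  by [].
rewrite crdN grad_crd crdZ gQ_crd.
have h2 : is_derive z.1.2 (bvec k) (fun q => G (z.1.1, q, z.2)) ('D_(qdir (bvec k)) G z).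
  apply/is_derive_lineP.
  have : is_derive z (qdir (bvec k)) G ('D_(qdir (bvec k)) G z).
    by apply: DeriveDef => //; exact: diff_derivable.
  move=> /is_derive_lineP; apply: is_derive_ext => t.
  by case: z => [[a b] c]; rewrite /qdir /= !pairZ !pairD !scaler0 !addr0.
have h3 := is_deriveZ (eps ^+ 2) h2.
have h4 : is_derive z.1.2 (bvec k) (fun _ : pt R m r => h z.2) 0 by exact: is_derive_cst.
have [_ E] := is_deriveB h4 h3.
move: E; rewrite sub0r => E; rewrite -[RHS]opprK; congr (- _); exact: E.
Qed.

End Field.

Section C1Algebra.
Context {R : realType} {V : normedModType R} {fV : fdim V}.

Lemma diff_pair (W1 W2 : normedModType R) (f : V -> W1) (g : V -> W2) x :
  differentiable f x -> differentiable g x ->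
  differentiable (fun y => (f y, g y)) x /\
  forall v, 'd (fun y => (f y, g y)) x v = ('d f x v, 'd g x v).
Proof.
move=> df dg; pose L v : W1 * W2 := ('d f x v, 'd g x v).
have linL : linear L by move=> a u v; rewrite /L !linearP pairZ pairD.
have [|dF E] := @eps_diff R V (W1 * W2)%type fV (fun y => (f y, g y)) x L linL.
  move=> e e0; have [d1 d10 h1] := diff_eps df e0; have [d2 d20 h2] := diff_eps dg e0.
  exists (Num.min d1 d2); first by rewrite lt_min d10.
  move=> u; rewrite lt_min => /andP[u1 u2]; rewrite !pairN !pairD.
  by apply: norm_pair_le; [exact: h1|exact: h2].
by split=> // v; rewrite E.
Qed.

Lemma C1_pair (W1 W2 : normedModType R) (A : set V) (f : V -> W1) (g : V -> W2) :
  Ck_on 1 A f -> Ck_on 1 A g -> open A -> Ck_on 1 A (fun y => (f y, g y)).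
Proof.
move=> fC gC oA; split=> [x Ax|v x Ax].
  exact: (diff_pair (fC.1 x Ax) (gC.1 x Ax)).1.
have E y : A y -> 'D_v (fun y => (f y, g y)) y = ('D_v f y, 'D_v g y).
  move=> Ay; have [d e] := diff_pair (fC.1 y Ay) (gC.1 y Ay).
  by rewrite !deriveE ?e //; [exact: gC.1|exact: fC.1].
apply/cont_epsP => e e0.
have [d1 d10 h1] := (cont_epsP _ _).1 (fC.2 v x Ax) e e0.
have [d2 d20 h2] := (cont_epsP _ _).1 (gC.2 v x Ax) e e0.
have /nbhs_ballP[d3 d30 h3] : nbhs x A by exact: open_nbhs_nbhs.
exists (Num.min d3 (Num.min d1 d2)); first by rewrite !lt_min d10 d20 !andbT.
move=> y; rewrite !lt_min => /and3P[y3 y1 y2].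
have Ay : A y by apply: h3; rewrite -ball_normE /= distrC.
rewrite !E // pairN pairD; apply: norm_pair_le; [exact: h1|exact: h2].
Qed.

Lemma diff_axpy (W : normedModType R) (a : R) (f g : V -> W) x :
  differentiable f x -> differentiable g x ->
  differentiable (fun y => a *: f y + g y) x /\
  forall v, 'd (fun y => a *: f y + g y) x v = a *: 'd f x v + 'd g x v.
Proof.
move=> df dg; have d1 : differentiable (fun y => a *: f y) x by exact: differentiableZ.
have d2 : differentiable (fun y => a *: f y + g y) x by exact: differentiableD.
split=> // v; rewrite -!deriveE //.
have h1 : is_derive x v f ('D_v f x) by apply: DeriveDef => //; exact: diff_derivable.
have h2 : is_derive x v g ('D_v g x) by apply: DeriveDef => //; exact: diff_derivable.
by have [_ <-] := is_deriveD (is_deriveZ a h1) h2.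
Qed.

Lemma C1_axpy (W : normedModType R) (A : set V) (a : R) (f g : V -> W) :
  Ck_on 1 A f -> Ck_on 1 A g -> open A -> Ck_on 1 A (fun y => a *: f y + g y).
Proof.
move=> fC gC oA; split=> [x Ax|v x Ax].
  by apply: differentiableD; [apply: differentiableZ; exact: fC.1|exact: gC.1].
have E y : A y -> 'D_v (fun y => a *: f y + g y) y = a *: 'D_v f y + 'D_v g y.
  move=> Ay; have df := fC.1 y Ay; have dg := gC.1 y Ay.
  by have [d E] := diff_axpy a df dg; rewrite !deriveE.
have c : {for x, continuous (fun y => a *: 'D_v f y + 'D_v g y)}.
  apply: cvgD; last exact: gC.2.
  by apply: cvgZr; exact: fC.2.
apply/cont_epsP => e e0.
have [d1 d10 h1] := (cont_epsP _ _).1 c e e0.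
have /nbhs_ballP[d3 d30 h3] : nbhs x A by exact: open_nbhs_nbhs.
exists (Num.min d3 d1); first by rewrite !lt_min d10 !andbT.
move=> y; rewrite !lt_min => /andP[y3 y1].
have Ay : A y by apply: h3; rewrite -ball_normE /= distrC.
by rewrite !E //; exact: h1.
Qed.

Lemma diff_lin_comp (U W : normedModType R) {fU : fdim U} (L : V -> U) (f : U -> W) x :
  linear L -> differentiable f (L x) ->
  differentiable (fun y => f (L y)) x /\
  forall v, 'd (fun y => f (L y)) x v = 'd f (L x) (L v).
Proof.
move=> linL df; have LD u w : L (u + w) = L u + L w.
  by rewrite -[u]scale1r linL !scale1r.
have [C C0 bL] := linear_bound linL.
have linK : linear (fun v => 'd f (L x) (L v)) by move=> a u v; rewrite linL linearP.
have [|dF E] := @eps_diff R V W fV (fun y => f (L y)) x _ linK; last by split=> // v; rewrite E.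
move=> e e0; have C1 : 0 < C + 1 by lra.
have [d d0 h] := diff_eps df (divr_gt0 e0 C1).
exists (d / (C + 1)); first exact: divr_gt0.
move=> u; rewrite ltr_pdivlMr // => ud; rewrite LD.
have Lu : `|L u| <= (C + 1) * `|u|.
  by apply: le_trans (bL u) _; rewrite ler_wpM2r // lerDl.
apply: le_trans (h _ _) _; first by apply: le_lt_trans Lu _; rewrite mulrC.
by rewrite mulrAC ler_pdivrMr // -mulrA; apply: ler_wpM2l; [exact: ltW|rewrite mulrC].
Qed.

Lemma C1_lin_comp (U W : normedModType R) {fU : fdim U} (L : V -> U) (f : U -> W) :
  linear L -> Ck_on 1 setT f -> Ck_on 1 setT (fun y => f (L y)).
Proof.
move=> linL fC; split=> [x _|v x _].
  by apply: (@diff_lin_comp U W fU L f x linL _).1; exact: fC.1.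
have -> : (fun y => 'D_v (fun y => f (L y)) y) = (fun y => 'D_(L v) f (L y)).
  apply/funext => y; have [|d E] := @diff_lin_comp U W fU L f y linL; first exact: fC.1.
  by rewrite !deriveE ?E //; exact: fC.1.
have LB u w : L (u - w) = L u - L w.
  by rewrite addrC -scaleN1r linL scaleN1r addrC.
have [C C0 bL] := linear_bound linL.
apply/cont_epsP => e e0; have [d d0 h] := (cont_epsP _ _).1 (fC.2 (L v) (L x) I) e e0.
have C1 : 0 < C + 1 by lra.
exists (d / (C + 1)); first exact: divr_gt0.
move=> y; rewrite ltr_pdivlMr // => yd; apply: h; rewrite -LB.
apply: le_lt_trans (bL _) _; apply: le_lt_trans yd.
by rewrite mulrC ler_wpM2l // lerDl.
Qed.

Lemma diff_const (W : normedModType R) (c : W) (x v : V) : 'd (fun _ : V => c) x v = 0.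
Proof. by rewrite -deriveE; [exact: derive_cst|exact: differentiable_cst]. Qed.

Lemma diff_triple (U W : normedModType R) {fU : fdim U} (L : V -> U) (f : U -> W)
    (g : V -> W) (k : V -> W) (a b : R) x v :
  linear L -> differentiable f (L x) -> differentiable g x -> differentiable k x ->
  'd (fun y => (1 : R, a *: g y + f (L y), b *: k y)) x v =
    (0, a *: 'd g x v + 'd f (L x) (L v), b *: 'd k x v).
Proof.
move=> linL df dg dk; have [dfL EL] := @diff_lin_comp U W fU L f x linL df.
have [d2 E2] := @diff_axpy W a g (fun y => f (L y)) x dg dfL.
have dk' : differentiable (fun y => b *: k y) x by exact: differentiableZ.
have Ek : 'd (fun y => b *: k y) x v = b *: 'd k x v.
  rewrite -!deriveE //; have h1 : is_derive x v k ('D_v k x).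
    by apply: DeriveDef => //; exact: diff_derivable.
  by have [_ <-] := is_deriveZ b h1.
have d4 := @differentiable_cst R V R^o 1 x.
have [d5 E5] := diff_pair d4 d2; have [d6 E6] := diff_pair d5 dk'.
apply: etrans (E6 v) _; congr (_, _); last exact: Ek.
apply: etrans (E5 v) _; congr (_, _); first exact: diff_const.
by apply: etrans (E2 v) _; rewrite EL.
Qed.

Lemma C1_cst (W : normedModType R) (A : set V) (c : W) : Ck_on 1 A (fun _ => c).
Proof.
split=> [x _|v x _]; first exact: differentiable_cst.
have -> : (fun y : V => 'D_v (fun _ => c) y) = cst 0.
  by apply/funext => y; exact: derive_cst.
exact: cst_continuous.
Qed.

End C1Algebra.

Notation fd_pt R m r := (fdim_prod (fdim_rV R m) (fdim_rV R r)).
Notation fd_ext R m r := (fdim_prod (fdim_prod (fdim_R R) (fd_pt R m r)) (fd_pt R m r)).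

(** * The truncated Hamiltonian flow *)

Section Flow.
Context {R : realType} {m r : nat}.
Context (h : pt R m r -> R) (G : ext R m r -> R) (p0 : pt R m r).
Context (hC : Ck_on 2 setT h) (GC : Ck_on 2 setT G) (pG : periodic_for extlat G).

Notation X eps := (ext_field (hamiltonian h G eps)).

Lemma XE (eps : R) (z : ext R m r) : X eps z = (1, grad h z.2 - eps ^+ 2 *: gP G z, eps ^+ 2 *: gQ G z).
Proof. by rewrite /ext_field ham_fieldE. Qed.

Lemma snd_linear (V W : normedModType R) : linear (@snd V W).
Proof. by []. Qed.

Lemma X_C1 eps : Ck_on 1 setT (X eps).
Proof.
rewrite (_ : X eps = fun z => (1, - (eps ^+ 2) *: gP G z + grad h z.2, eps ^+ 2 *: gQ G z + 0)).
  apply: C1_pair; last exact: openT.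
    apply: C1_pair; [exact: C1_cst| |exact: openT].
    apply: C1_axpy; [exact: gP_C1| |exact: openT].
    apply: (@C1_lin_comp R (ext R m r) _ (pt R m r) (pt R m r) _ snd (grad h)) => //.
    exact: grad_C1.
  by apply: C1_axpy; [exact: gQ_C1|exact: C1_cst|exact: openT].
by apply/funext => z; rewrite XE addr0 scaleNr addrC.
Qed.

Definition dgrad (F : pt R m r -> R) (p v : pt R m r) : pt R m r :=
  'd (grad F : pt R m r -> pt R m r) p v.

Lemma X_diff (eps : R) (z v : ext R m r) : 'd (X eps) z v =
  (0, dgrad h z.2 v.2 - eps ^+ 2 *: 'd (gP G) z v, eps ^+ 2 *: 'd (gQ G) z v).
Proof.
rewrite /dgrad.
have dP : differentiable (gP G) z by exact: (gP_C1 GC).1.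
have dQ : differentiable (gQ G) z by exact: (gQ_C1 GC).1.
have dh : differentiable (grad h : pt R m r -> pt R m r) z.2 by exact: (grad_C1 hC).1.
have -> : X eps = fun z => (1, - eps ^+ 2 *: gP G z + grad h z.2, eps ^+ 2 *: gQ G z).
  by apply/funext => y; rewrite XE scaleNr addrC.
have := @diff_triple R (ext R m r) (fd_ext R m r) (pt R m r) (pt R m r) (fd_pt R m r) snd (grad h) (gP G) (gQ G)
  (- eps ^+ 2) (eps ^+ 2) z v (@snd_linear _ _) dh dP dQ.
by move=> ->; rewrite scaleNr addrC.
Qed.

Lemma X_periodic eps : periodic_for extlat (X eps).
Proof.
move=> z l Ll; rewrite !XE (gP_periodic pG) // (gQ_periodic pG) //.
by case: Ll => a [k [b ->]] /=; rewrite addr0.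
Qed.

Context (M : R) (M0 : 0 <= M).

Definition clamp1 (a : R) : R := Num.max (- M) (Num.min M a).

Lemma clamp1_le a : `|clamp1 a| <= M.
Proof.
rewrite ler_norml /clamp1; apply/andP; split; first by rewrite le_max lexx.
by rewrite ge_max ge_min lexx andbT; have := M0; lra.
Qed.

Lemma clamp1_id a : `|a| <= M -> clamp1 a = a.
Proof. by rewrite ler_norml => /andP[a1 a2]; rewrite /clamp1 min_r // max_r. Qed.

Lemma clamp1_lip a b : `|clamp1 a - clamp1 b| <= `|a - b|.
Proof.
wlog ab : a b / b <= a.
  move=> hw; have [|/ltW] := leP b a; first exact: hw.
  by move=> /hw; rewrite distrC [`|b - a|]distrC.
have M0' := M0; rewrite [leRHS]ger0_norm ?subr_ge0 // ger0_norm ?subr_ge0 /clamp1 /Num.max /Num.min;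
  by repeat (case: ifPn; rewrite -?leNgt); lra.
Qed.

(** Retraction onto the cube of radius [M] around [p0], nonexpansive because it acts coordinatewise
    in the sup norm. Composed with the field, which is periodic in (t, q), it gives a globally
    Lipschitz field with a complete flow, whose orbits are true ones as long as the momentum stays
    in the cube. *)
Definition clamp (p : pt R m r) : pt R m r := p0 + of_crd (fun k => clamp1 (crd k (p - p0))).

Lemma clamp_in p : `|clamp p - p0| <= M.
Proof.
rewrite addrC addKr; apply: norm_le_crd => // k; rewrite of_crdK; exact: clamp1_le.
Qed.

Lemma clamp_id p : `|p - p0| <= M -> clamp p = p.
Proof.
move=> pM; apply: crd_inj => k; rewrite crdD of_crdK clamp1_id; last exact: le_trans (crd_le _ _) pM.
by rewrite crdB addrC subrK.
Qed.

Lemma clamp_lip p q : `|clamp p - clamp q| <= `|p - q|.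
Proof.
apply: norm_le_crd => [|k]; first exact: normr_ge0.
rewrite crdB /clamp !crdD !of_crdK.
apply: le_trans (crd_le k (p - q)).
have -> : crd k (p - q) = crd k (p - p0) - crd k (q - p0) by rewrite -crdB; congr crd; crd_ring.
by apply: le_trans (clamp1_lip _ _); rewrite opprD addrACA subrr add0r.
Qed.

Definition clampz (z : ext R m r) : ext R m r := (z.1, clamp z.2).
Notation XM eps := (fun z => X eps (clampz z)).

Lemma clampz_strip z : strip p0 M (clampz z).
Proof. exact: clamp_in. Qed.

Lemma clampz_id z : strip p0 M z -> clampz z = z.
Proof. by case: z => a b h1; rewrite /clampz clamp_id. Qed.

Lemma clampz_lip y z : `|clampz y - clampz z| <= `|y - z|.
Proof.
case: y z => [a b] [a' b']; rewrite /clampz !pairN !pairD /=.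
apply: norm_pair_le; first exact: (norm_fst (a - a', b - b')).
by apply: le_trans (clamp_lip _ _) (norm_snd (a - a', b - b')).
Qed.

Lemma strip_segment (N : R) x y (s : R) : strip p0 N x -> strip p0 N y -> 0 <= s <= 1 ->
  strip p0 N (x + s *: (y - x)).
Proof.
move=> xM yM /andP[s0 s1]; rewrite /strip /=.
have -> : x.2 + s *: (y.2 - x.2) - p0 = (1 - s) *: (x.2 - p0) + s *: (y.2 - p0).
  by rewrite !scalerBl !scale1r; crd_ring.
apply: le_trans (ler_normD _ _) _; rewrite !normrZ [`|s|]ger0_norm // ger0_norm ?subr_ge0 //.
have := ler_wpM2l s0 yM; have s1' : 0 <= 1 - s by lra.
have := ler_wpM2l s1' xM; lra.
Qed.

Lemma X_lip_strip eps (N : R) : exists2 L : R, 0 <= L & forall x y,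
  strip p0 N x -> strip p0 N y -> `|X eps x - X eps y| <= L * `|x - y|.
Proof.
have [L L0 bL] := C1_diff_bound (tame_strip p0 N) (X_periodic eps) (X_C1 eps).
exists L => // x y xM yM; rewrite distrC [`|x - y|]distrC.
apply: (@C1_lip R _ _ _ _ (strip p0 N) (X eps) L (X_C1 eps) bL) => s s01.
exact: strip_segment.
Qed.

Lemma XM_lip eps : exists2 L : R, 0 <= L & forall x y,
  `|XM eps x - XM eps y| <= L * `|x - y|.
Proof.
have [L L0 bL] := X_lip_strip eps M; exists L => // x y.
apply: le_trans (bL _ _ (clampz_strip _) (clampz_strip _)) _.
by rewrite ler_wpM2l // clampz_lip.
Qed.

Definition is_XM_flow (eps : R) (phi : ext R m r -> R -> ext R m r) : Prop :=
  (forall z, phi z 0 = z) /\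
  forall z (s : R), is_derive s (1 : R) (phi z) (X eps (clampz (phi z s))).

Lemma XM_flow eps : exists phi, is_XM_flow eps phi.
Proof.
have [L L0 bL] := XM_lip eps.
have ex z : exists u : R -> ext R m r, u 0 = z /\
    forall s : R, is_derive s (1 : R) u (X eps (clampz (u s))).
  apply: (@picard R (ext R m r) _ (fun s => XM eps) L z L0) => [s|u cu s]; first exact: bL.
  apply/cont_epsP => e e0; have L1 : 0 < L + 1 by lra.
  have [d d0 hd] := (cont_epsP _ _).1 (cu s) (e / (L + 1)) (divr_gt0 e0 L1).
  exists d => // y yd; apply: le_trans (bL _ _) _.
  have := hd y yd; rewrite ler_pdivlMr // => k.
  by apply: le_trans k; rewrite mulrC ler_wpM2l // lerDl.
by have [phi hphi] := choice ex; exists phi; split=> z; have [] := hphi z.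
Qed.

Section Orbits.
Context (eps : R) (phi : ext R m r -> R -> ext R m r) (flow : is_XM_flow eps phi).

Lemma flow0 z : phi z 0 = z. Proof. exact: flow.1. Qed.

Lemma flow_time z (s : R) : (phi z s).1.1 = z.1.1 + s.
Proof.
have d (u : R) : is_derive u (1 : R) (fun u => (phi z u).1.1 - u) 0.
  have h1 : is_derive u (1 : R) (fun u => (phi z u).1.1) 1.
    have := flow.2 z u; rewrite XE.
    exact: (@is_derive_lin R (ext R m r) R^o _ (fun z => z.1.1)).
  by rewrite -(subrr 1); exact: is_deriveB.
have := @mean_value_sym R R (fdim_R R) (fun u => (phi z u).1.1 - u) (fun=> 0) 0 0 s.
rewrite mul0r flow0 subr0 => /(_ (fun u _ => d u)) k.
have := k (fun u _ => eq_ind_r (fun x => x <= 0) (lexx 0) (normr0 R)).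
rewrite normr_le0 subr_eq0 => /eqP E; move: E; lra.
Qed.

(** [h] does not enter the equation of the momenta, whose right-hand side is [eps ^+ 2] times a
    bounded function even after truncation. *)
Lemma flow_slow (C : R) : (forall z, strip p0 M z -> `|gQ G z| <= C) ->
  forall z (s : R), `|(phi z s).2 - z.2| <= eps ^+ 2 * C * `|s|.
Proof.
move=> bQ z s; have := @mean_value_sym R (pt R m r) (fdim_prod (fdim_rV R m) (fdim_rV R r))
  (fun u => (phi z u).2) (fun u => eps ^+ 2 *: gQ G (clampz (phi z u))) (eps ^+ 2 * C) 0 s.
rewrite /= flow0 subr0; apply=> u _.
  have := flow.2 z u; rewrite XE.
  exact: (@is_derive_lin R (ext R m r) (pt R m r) _ snd).
rewrite normrZ ger0_norm ?sqr_ge0 // ler_wpM2l ?sqr_ge0 //.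
by apply: bQ; exact: clampz_strip.
Qed.

Lemma flow_real z (s : R) : strip p0 M (phi z s) ->
  is_derive s (1 : R) (phi z) (X eps (phi z s)).
Proof. by move=> st; have := flow.2 z s; rewrite clampz_id. Qed.

End Orbits.

End Flow.

(** * Boundedness of the critical points of a convex function *)

Lemma diff_is_derive (R : realType) (V W : normedModType R) (f : V -> W) x v :
  differentiable f x -> is_derive x v f ('d f x v).
Proof. by move=> df; rewrite -deriveE //; apply: DeriveDef => //; exact: diff_derivable. Qed.

Lemma square_derive (R : realType) (a s : R) :
  is_derive s (1 : R) (fun s : R => a * s ^+ 2) (2 * a * s).
Proof.
apply: eps_derive => e e0; have a1 : 0 < `|a| + 1 by rewrite ltr_wpDl.
exists (e / (`|a| + 1)); first exact: divr_gt0.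
move=> k; rewrite ltr_pdivlMr // => ke.
have -> : a * (s + k) ^+ 2 - a * s ^+ 2 - k *: (2 * a * s) = a * k * k.
  by rewrite /GRing.scale /=; ring.
rewrite !normrM ler_wpM2r //; apply: le_trans (ltW ke).
by rewrite mulrC ler_wpM2l // lerDl.
Qed.

Section Convexity.
Context {R : realType} {m r : nat} (h : pt R m r -> R).
Context (hC : Ck_on 2 setT h) (hcvx : convex_fun h) (hpos : forall p, hessian_pos_def h p).

Definition dot2 (u v : pt R m r) : R := dot u.1 v.1 + dot u.2 v.2.

Lemma dot2_linl w : linear (dot2 ^~ w : pt R m r -> R).
Proof. by move=> a u v; rewrite /dot2 /= !dotDl !dotZl /GRing.scale /=; ring. Qed.

Lemma dot2_linr w : linear (dot2 w : pt R m r -> R).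
Proof. by move=> a u v; rewrite /dot2 /= !dotDr !dotZr /GRing.scale /=; ring. Qed.

Lemma dot2_bvec (u : pt R m r) k : dot2 u (bvec k) = crd k u.
Proof.
case: (split_ordP (k : 'I_(m + r))) => i ->.
  rewrite (@crd_pairl R 'rV[R]_m 'rV[R]_r (fdim_rV R m) (fdim_rV R r) i).
  rewrite (@bvec_pairl R 'rV[R]_m 'rV[R]_r (fdim_rV R m) (fdim_rV R r) i).
  rewrite /dot2 /= dot0r addr0 /dot (bigD1 i) //= /bvec /= /crd /= mxE !eqxx mulr1.
  by rewrite big1 ?addr0 // => j ji; rewrite mxE (negPf ji) andbF mulr0.
rewrite (@crd_pairr R 'rV[R]_m 'rV[R]_r (fdim_rV R m) (fdim_rV R r) i).
rewrite (@bvec_pairr R 'rV[R]_m 'rV[R]_r (fdim_rV R m) (fdim_rV R r) i).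
rewrite /dot2 /= dot0r add0r /dot (bigD1 i) //= /bvec /= /crd /= mxE !eqxx mulr1.
by rewrite big1 ?addr0 // => j ji; rewrite mxE (negPf ji) andbF mulr0.
Qed.

Lemma dot2_grad (F : pt R m r -> R) x w : differentiable F x ->
  dot2 (grad F x) w = 'D_w F x.
Proof.
move=> dF; rewrite deriveE // (diff_basis w dF) {1}(crd_basis w).
have sumE : forall s : seq 'I_(fd_n (pt R m r)),
    dot2 (grad F x) (\sum_(k <- s) crd k w *: bvec k) =
    \sum_(k <- s) crd k w *: 'D_(bvec k) F x.
  elim=> [|k s IH]; first by rewrite !big_nil /dot2 /= !dot0r addr0.
  by rewrite !big_cons dot2_linr IH dot2_bvec grad_crd.
exact: sumE.
Qed.

Lemma dot2_dgrad p v w : dot2 (dgrad h p v) w = hess h p w v.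
Proof.
rewrite /hess; have dg : differentiable (grad h : pt R m r -> pt R m r) p by exact: (grad_C1 hC).1.
have E : (fun y => 'D_w h y) = (fun y => dot2 (grad h y) w).
  by apply/funext => y; rewrite dot2_grad //; exact: hC.1.
rewrite E; have d : is_derive p v (fun y => dot2 (grad h y) w) (dot2 (dgrad h p v) w).
  apply/is_derive_lineP.
  apply: (@is_derive_lin R (pt R m r) R^o (fd_pt R m r) (dot2 ^~ w) (fun t => grad h (p + t *: v))).
    exact: dot2_linl.
  by apply: (is_derive_lineP _ _ _ _).1; exact: (diff_is_derive v dg).
by have [_ ->] := d.
Qed.

Lemma dgrad_linear p : linear (dgrad h p).
Proof. by move=> a u v; rewrite /dgrad linearP. Qed.

Lemma dgrad_pos p v : v != 0 -> 0 < dot2 (dgrad h p v) v.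
Proof. by move=> v0; rewrite dot2_dgrad; exact: hpos. Qed.

(** The derivative along [v] vanishes, so [h (x + t v) - h x] is at least [- e t] for some [t] in
    (0, 1]; convexity carries this inequality over to [t = 1]. *)
Lemma convex_critical x v : dot2 (grad h x) v = 0 -> h x <= h (x + v).
Proof.
have dh : differentiable h x by exact: hC.1.
rewrite dot2_grad // => D0; apply/ler_addgt0Pr => e' e0; pose e : R := e'; rewrite -/e in e0 *.
have d : is_derive (0 : R) (1 : R) (fun t : R => h (x + t *: v)) 0.
  by apply: (is_derive_lineP _ _ _ _).1; rewrite -D0 deriveE //; exact: diff_is_derive.
have [d1 d10 hd] := derive_eps d e0.
pose t := Num.min 1 (d1 / 2); have t0 : 0 < t by rewrite lt_min ltr01 divr_gt0.
have t1 : t <= 1 by rewrite ge_min lexx.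
have td : `|t| < d1 by rewrite ger0_norm ?ltW // gt_min; apply/orP; right; lra.
have := hd t td; rewrite add0r scale0r addr0 scaler0 subr0 [`|t|]ger0_norm ?(ltW t0) // => k1.
have k2 : - (e * t) <= h (x + t *: v) - h x by move: k1; rewrite ler_norml => /andP[].
have t01 : 0 <= t <= 1 by rewrite ltW.
have := hcvx (x + v) x t01.
have -> : t *: (x + v) + (1 - t) *: x = x + t *: v.
  by rewrite scalerBl scale1r; crd_ring.
move=> k3; rewrite -subr_ge0 -(pmulr_rge0 _ t0); lra.
Qed.

(** On the sphere of radius [d / 2] in the fibre the Hessian gives a gain of [cK * d ^+ 2 / 16];
    beyond it, convexity along rays extends this gain linearly, with slope [cK * d / 8]. *)
Lemma critical_coercive (p : pt R m r) : (grad h p).2 = 0 ->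
  exists d c : R, [/\ 0 < d, 0 < c & forall u : 'rV[R]_r, d <= `|u| ->
    h p + c * `|u| <= h (p + (0, u))].
Proof.
move=> g0; have [||N0 [M0 [cA [cK [_ [_ cK0] _ _ pK]]]]] := @posdef_blocks R m r (dgrad h p).
- exact: dgrad_linear.
- by move=> u u0; exact: dgrad_pos.
(* With [r * e] at most [cK / 2], half of the coercivity at [p] survives on the whole ball. *)
pose e := cK / (2 * (r%:R + 1)); have r1 : 0 < r%:R + 1 :> R by rewrite ltr_wpDl.
have e0 : 0 < e by rewrite divr_gt0 // mulr_gt0.
have [d d0 hd] := C1_diff_continuous openT (grad_C1 hC) (I : setT p) e0.
exists (d / 2), (cK * d / 8); split; [by rewrite divr_gt0|by rewrite divr_gt0 // mulr_gt0|].
(* The second derivative along the ray is at least [cK / 2], and the first one vanishes at the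
   start; integrating twice up to [d / 2] gives [cK / 4 * (d / 2) ^+ 2]. *)
have near (v : 'rV[R]_r) : `|v| = 1 -> h p + cK * d ^+ 2 / 16 <= h (p + (d / 2) *: (0, v)).
  move=> v1; pose w : pt R m r := (0, v).
  have nw : `|w| = 1 by rewrite norm_pair normr0 v1 max_r.
  pose f1 (t : R) := dot2 (grad h (p + t *: w)) w.
  pose f2 (t : R) := dot2 (dgrad h (p + t *: w) w) w.
  have D1 (t : R) : is_derive t (1 : R) (fun t => h (p + t *: w)) (f1 t).
    apply: is_derive_line; rewrite /f1 dot2_grad; last exact: hC.1.
    by apply: DeriveDef => //; apply: diff_derivable; exact: hC.1.
  have D2 (t : R) : is_derive t (1 : R) f1 (f2 t).
    apply: (@is_derive_lin R (pt R m r) R^o (fd_pt R m r) (dot2 ^~ w) (fun t => grad h (p + t *: w))).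
      exact: dot2_linl.
    apply: is_derive_line; apply: (diff_is_derive w); exact: (grad_C1 hC).1.
  have lo (t : R) : 0 <= t <= d / 2 -> cK / 2 <= f2 t.
    move=> /andP[t0 t1]; have yx : `|p + t *: w - p| < d.
      by rewrite addrC addKr normrZ nw mulr1 ger0_norm //; lra.
    have [_ k] := hd _ w yx; rewrite nw mulr1 in k.
    have := pK v; rewrite v1 expr1n mulr1 => k2.
    have -> : f2 t = dot (dgrad h p (0, v)).2 v +
       dot ((dgrad h (p + t *: w) w).2 - (dgrad h p w).2) v.
      by rewrite -dotDl addrC subrK /f2 /dot2 dot0r add0r.
    have k3 := dot_bound ((dgrad h (p + t *: w) w).2 - (dgrad h p w).2) v.
    rewrite v1 mulr1 in k3.
    have k4 : `|(dgrad h (p + t *: w) w).2 - (dgrad h p w).2| <= e.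
      exact: le_trans (norm_snd _) k.
    have k5 : r%:R * e <= cK / 2.
      have -> : cK / 2 = (r%:R + 1) * e by rewrite /e; field; rewrite gt_eqF.
      by rewrite ler_wpM2r ?(ltW e0) // lerDl.
    have k6 := ler_wpM2l (ler0n R r) k4.
    have := ler_norml (dot ((dgrad h (p + t *: w) w).2 - (dgrad h p w).2) v) (cK / 2).
    have -> : `|dot ((dgrad h (p + t *: w) w).2 - (dgrad h p w).2) v| <= cK / 2.
      exact: le_trans k3 (le_trans k6 k5).
    move=> /esym/andP[k7 _]; move: k2 k7; move: (dot _ _) (dot _ _) => x y; lra.
  have f10 : f1 0 = 0.
    by rewrite /f1 scale0r addr0 /dot2 g0 dot0l dot0r addr0.
  have step1 (t : R) : 0 <= t <= d / 2 -> cK / 2 * t <= f1 t.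
    move=> /andP[t0 t1]; rewrite -subr_ge0.
    have -> : 0 = f1 0 - cK / 2 * 0 by rewrite f10 mulr0 subr0.
    apply: (@der_ge0_le R (fun s => f1 s - cK / 2 * s) (fun s => f2 s - cK / 2)) => // s /andP[s0 s1].
      have k1 := D2 s; have k2 : is_derive s (1 : R) (fun s : R => cK / 2 * s) (cK / 2).
        have := is_deriveZ (cK / 2) (@is_derive_id R R^o s 1).
        by rewrite /GRing.scale /= mulr1.
      exact: is_deriveB.
    by rewrite subr_ge0; apply: lo; lra.
  rewrite -subr_ge0.
  have -> : 0 = h (p + 0 *: w) - cK / 4 * 0 ^+ 2 - h p by rewrite scale0r addr0 expr0n /= mulr0 subr0 subrr.
  have -> : h (p + (d / 2) *: w) - (h p + cK * d ^+ 2 / 16) =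
    h (p + (d / 2) *: w) - cK / 4 * (d / 2) ^+ 2 - h p by field.
  rewrite lerD2r.
  apply: (@der_ge0_le R (fun s => h (p + s *: w) - cK / 4 * s ^+ 2) (fun s => f1 s - cK / 2 * s)).
  - by rewrite divr_ge0 // ltW.
  - move=> s _; have k1 := D1 s.
    have k2 : is_derive s (1 : R) (fun s : R => cK / 4 * s ^+ 2) (cK / 2 * s).
      by have -> : cK / 2 * s = 2 * (cK / 4) * s; [field|exact: square_derive].
    exact: is_deriveB.
  - by move=> s sd; rewrite subr_ge0; exact: step1.
move=> u du; have u0 : 0 < `|u| by apply: lt_le_trans du; rewrite divr_gt0.
pose t := d / 2 / `|u|; have t0 : 0 < t by rewrite !divr_gt0.
have t1 : t <= 1 by rewrite /t ler_pdivrMr // mul1r.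
have nv : `| (`|u|)^-1 *: u | = 1.
  by rewrite normrZ ger0_norm ?invr_ge0 // mulVf // gt_eqF.
have k1 := near _ nv.
have E : p + (d / 2) *: (0, (`|u|)^-1 *: u) = t *: (p + (0, u)) + (1 - t) *: p.
  have -> : (0, (`|u|)^-1 *: u) = (`|u|)^-1 *: (0, u) :> pt R m r by rewrite pairZ scaler0.
  by rewrite /t scalerBl scale1r; crd_ring.
have t01 : 0 <= t <= 1 by rewrite ltW.
have k2 := hcvx (p + (0, u)) p t01; rewrite -E in k2.
rewrite -subr_ge0 -(pmulr_rge0 _ t0).
have tu : t * `|u| = d / 2 by rewrite /t divfK // gt_eqF.
have k3 := le_trans k1 k2.
have -> : t * (h (p + (0, u)) - (h p + cK * d / 8 * `|u|)) =
  t * h (p + (0, u)) - t * h p - cK * d / 8 * (t * `|u|) by ring.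
rewrite tu; lra.
Qed.

(* With [u] half of [P2 p1 - p.2], convexity bounds [h (p + (0, u))] by the mean of the
   minimum of [h] over the fibre of [p1] and of [h] at a point at distance at most [N]
   from [p]; but [h] grows linearly along the fibre of [p]. *)
Lemma critical_bounded (p : pt R m r) (B : set 'rV[R]_m) (P2 : 'rV[R]_m -> 'rV[R]_r) (N : R) :
  (grad h p).2 = 0 -> (forall p1, B p1 -> (grad h (p1, P2 p1)).2 = 0) ->
  (forall p1, B p1 -> `|p1 - p.1| <= N) ->
  exists2 M : R, 0 <= M & forall p1, B p1 -> `|(p1, P2 p1) - p| <= M.
Proof.
move=> g0 gB bB; have [d [c [d0 c0 co]]] := critical_coercive g0.
have ch : continuous h by move=> x; exact: differentiable_continuous (hC.1 x I).
have [C C0 bC] := tame_bdd (@tame_ball R (pt R m r) (fd_pt R m r) p N)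
  (@periodic_for0 R _ _ h) ch.
pose K := d + (C + C) / c; have K0 : 0 <= K.
  by rewrite /K addr_ge0 ?divr_ge0 ?addr_ge0 // ltW.
exists (Num.max N (2 * K)); first by rewrite le_max; apply/orP; right; lra.
move=> p1 Bp1; case: p g0 bB co bC => [b y] /= g0 bB co bC.
rewrite pairN pairD; apply: norm_pair_le; first by rewrite le_max bB.
rewrite le_max; apply/orP; right.
pose u : 'rV[R]_r := 2^-1 *: (P2 p1 - y).
have -> : P2 p1 - y = 2 *: u by rewrite /u scalerA divff ?pnatr_eq0 // scale1r.
rewrite normrZ ger0_norm // ler_pM2l //.
have [ud|/ltW du] := leP `|u| d; first by rewrite /K (le_trans ud) // lerDl divr_ge0 ?addr_ge0 // ltW.
have k1 := co u du.
have half : 0 <= (2^-1 : R) <= 1 by lra.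
(* The reflected point [b + b - p1] is chosen so that the midpoint lies over [b], at the distance
   [u] from [p] in the fibre. *)
have k2 := hcvx (p1, P2 p1) (b + b - p1, y) half.
have E : 2^-1 *: (p1, P2 p1) + (1 - 2^-1) *: (b + b - p1, y) = (b, y) + (0, u).
  have -> : 1 - 2^-1 = 2^-1 :> R by field.
  rewrite !pairZ !pairD addr0; congr pair.
    by apply: crd_inj => k; rewrite !(crdD, crdN, crdZ); field.
  by apply: crd_inj => k; rewrite !(crdD, crdN, crdZ); field.
rewrite E in k2.
have k3 : h (p1, P2 p1) <= h (p1, y).
  have -> : (p1, y) = (p1, P2 p1) + (0, y - P2 p1) by rewrite pairD addr0 addrC subrK.
  by apply: convex_critical; rewrite /dot2 (gB p1 Bp1) dot0l dot0r addr0.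
have k4 : `|h (p1, y)| <= C.
  by apply: bC => /=; rewrite pairN pairD subrr norm_pair normr0 ge_max (bB p1 Bp1) (le_trans (normr_ge0 _) (bB p1 Bp1)).
have k5 : `|h (b + b - p1, y)| <= C.
  apply: bC => /=; rewrite pairN pairD subrr norm_pair normr0 ge_max.
  rewrite (le_trans (normr_ge0 _) (bB p1 Bp1)) andbT.
  by rewrite (_ : b + b - p1 - b = b - p1); [rewrite distrC; exact: bB|crd_ring].
have k6 : `|h (b, y)| <= C.
  apply: bC => /=; rewrite subrr normr0; exact: le_trans (normr_ge0 _) (bB p1 Bp1).
have k7 : c * `|u| <= C + C.
  move: k1 k2 k3 k4 k5 k6; rewrite !ler_norml => k1 k2 k3 /andP[_ k4] /andP[_ k5] /andP[k6 _].
  lra.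
have : `|u| <= (C + C) / c by rewrite ler_pdivlMr // mulrC.
by rewrite /K; lra.
Qed.

End Convexity.

(** * Orbits on the cylinder *)

Section Norms.
Context {R : realType}.

Lemma near0_ex (P : R -> Prop) : (\forall e \near 0^'+, P e) <->
  exists2 d : R, 0 < d & forall e, 0 < e < d -> P e.
Proof.
split=> [|[d d0 h]].
  rewrite /at_right /within /= => /nbhs_ballP[d d0 h]; exists d => // e /andP[e0 ed].
  by apply: h => //=; rewrite -ball_normE /= sub0r normrN ger0_norm // ltW.
rewrite /at_right /within /=; apply/nbhs_ballP; exists d => // e.
rewrite -ball_normE /= sub0r normrN => ed e0; apply: h; rewrite e0 /=.
by apply: le_lt_trans ed; exact: ler_norm.
Qed.

Lemma dot_sqr n (x : 'rV[R]_n) : 0 <= dot x x <= n%:R * `|x| ^+ 2.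
Proof.
apply/andP; split; first by apply: sumr_ge0 => i _; rewrite -expr2 sqr_ge0.
by apply: le_trans (ler_norm _) _; rewrite expr2; exact: dot_bound.
Qed.

Lemma sup_dot n (x : 'rV[R]_n) : `|x| ^+ 2 <= dot x x.
Proof.
have /andP[d0 _] := dot_sqr x.
rewrite -(sqr_sqrtr d0) lerXn2r ?nnegrE ?sqrtr_ge0 //.
apply: rv_norm_le => [|i]; first exact: sqrtr_ge0.
rewrite -(ler_pXn2r (ltn0Sn 1)) ?nnegrE ?sqrtr_ge0 // sqr_sqrtr // real_normK ?num_real //.
rewrite /dot (bigD1 i) //= -expr2 lerDl; apply: sumr_ge0 => j _; rewrite -expr2; exact: sqr_ge0.
Qed.

Lemma sup_le_enorm n (x : 'rV[R]_n) : `|x| <= enorm x.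
Proof.
have /andP[d0 _] := dot_sqr x.
by rewrite -(ler_pXn2r (ltn0Sn 1)) ?nnegrE ?sqrtr_ge0 // sqr_sqrtr // sup_dot.
Qed.

Lemma sqrt_le_mul (a c y : R) : 0 <= c -> 0 <= y -> a <= c * y ^+ 2 ->
  Num.sqrt a <= (c + 1) * y.
Proof.
move=> c0 y0 h; have cy : 0 <= (c + 1) * y by rewrite mulr_ge0 // addr_ge0.
rewrite -[leRHS]ger0_norm // -sqrtr_sqr.
apply: ler_wsqrtr; apply: le_trans h _.
by rewrite exprMn ler_wpM2r ?sqr_ge0 // expr2; nra.
Qed.

Lemma enorm2_le n k (x : pt R n k) : enorm2 x <= (n%:R + k%:R + 1) * `|x|.
Proof.
apply: sqrt_le_mul => //.
have /andP[_ h1] := dot_sqr x.1; have /andP[_ h2] := dot_sqr x.2.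
rewrite mulrDl lerD //.
  apply: le_trans h1 _; rewrite ler_wpM2l // lerXn2r ?nnegrE //; exact: norm_fst.
apply: le_trans h2 _; rewrite ler_wpM2l // lerXn2r ?nnegrE //; exact: norm_snd.
Qed.

Lemma sup_le_enorm2 n k (x : pt R n k) : `|x| <= enorm2 x.
Proof.
have /andP[d1 _] := dot_sqr x.1; have /andP[d2 _] := dot_sqr x.2.
have h1 := sup_dot x.1; have h2 := sup_dot x.2.
rewrite [x]surjective_pairing; apply: norm_pair_le.
  rewrite -(ler_pXn2r (ltn0Sn 1)) ?nnegrE ?sqrtr_ge0 // sqr_sqrtr ?addr_ge0 //=; lra.
rewrite -(ler_pXn2r (ltn0Sn 1)) ?nnegrE ?sqrtr_ge0 // sqr_sqrtr ?addr_ge0 //=; lra.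
Qed.

Lemma enorm3_le n (x : base R n) : enorm3 x <= (1 + n%:R + n%:R + 1) * `|x|.
Proof.
apply: sqrt_le_mul => //.
have /andP[_ h1] := dot_sqr x.1.2; have /andP[_ h2] := dot_sqr x.2.
rewrite !mulrDl !mul1r !lerD //.
- rewrite -real_normK ?num_real // lerXn2r ?nnegrE //.
  exact: le_trans (norm_fst _) (norm_fst _).
- apply: le_trans h1 _; rewrite ler_wpM2l // lerXn2r ?nnegrE //.
  exact: le_trans (norm_snd _) (norm_fst _).
- apply: le_trans h2 _; rewrite ler_wpM2l // lerXn2r ?nnegrE //; exact: norm_snd.
Qed.

Lemma open_ball_open n (B : set 'rV[R]_n) : open_ball B -> open B.
Proof.
move=> [c [rad [rad0 ->]]]; rewrite openE => x /= xB.
have /andP[dx _] := dot_sqr (x - c).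
have lt2 : dot (x - c) (x - c) < rad ^+ 2.
  by move: xB; rewrite /enorm -(ltr_pXn2r (ltn0Sn 1)) ?nnegrE ?sqrtr_ge0 ?ltW // sqr_sqrtr.
pose E := n%:R * (2 * `|x - c| + 1) + 1; have E0 : 0 < E by rewrite ltr_wpDl // mulr_ge0 // addr_ge0 // mulr_ge0.
pose d := Num.min 1 ((rad ^+ 2 - dot (x - c) (x - c)) / E).
have d0 : 0 < d by rewrite lt_min ltr01 divr_gt0 // subr_gt0.
apply/nbhs_ballP; exists d => // y; rewrite -ball_normE /= lt_min distrC => /andP[y1].
rewrite ltr_pdivlMr // => y2.
have -> : rad = Num.sqrt (rad ^+ 2) by rewrite sqrtr_sqr ger0_norm // ltW.
rewrite /enorm ltr_sqrt ?exprn_gt0 //.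
have -> : dot (y - c) (y - c) = dot (x - c) (x - c) + dot (y - x) ((y - x) + 2 *: (x - c)).
  have -> : y - c = (y - x) + (x - c) by rewrite addrA subrK.
  move: (y - x) (x - c) => u v; rewrite !dotDr !dotDl dotZr [dot v u]dotC; ring.
have k1 := le_trans (ler_norm _) (dot_bound (y - x) ((y - x) + 2 *: (x - c))).
have k2 : `|(y - x) + 2 *: (x - c)| <= 2 * `|x - c| + 1.
  by apply: le_trans (ler_normD _ _) _; rewrite normrZ ger0_norm // addrC lerD2l ltW.
have k3 := ler_wpM2l (normr_ge0 (y - x)) k2.
have k4 := ler_wpM2l (ler0n R n) k3; have k5 := normr_ge0 (y - x).
move: k1 k4 y2 k5; rewrite /E; move: (y - x) (x - c) => u v.
lra.
Qed.

Lemma open_ball_bdd n (B : set 'rV[R]_n) (p : 'rV[R]_n) : open_ball B -> B p ->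
  exists2 N : R, 0 <= N & forall q, B q -> `|q - p| <= N.
Proof.
move=> [c [rad [rad0 ->]]] /= pB; exists (2 * rad); first by rewrite mulr_ge0 // ltW.
move=> q qB; have -> : q - p = (q - c) - (p - c) by crd_ring.
apply: le_trans (ler_normB _ _) _.
have := le_lt_trans (sup_le_enorm _) pB; have := le_lt_trans (sup_le_enorm _) qB; lra.
Qed.

End Norms.

Notation fd_base R m := (fdim_prod (fdim_prod (fdim_R R) (fdim_rV R m)) (fdim_rV R m)).

Section CurveBound.
Context {R : realType} {V W : normedModType R} {fV : fdim V}.

(** The constant depends on the curve, which is harmless: it enters only the Gronwall argument of
    [cylinder_orbit], where the initial value is zero. *)
Lemma C1_curve_bound (A : set V) (f : V -> W) (x : R -> V) (a b : R) : Ck_on 1 A f ->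
  (forall s : R, a <= s <= b -> A (x s) /\ {for s, continuous x}) ->
  exists2 K : R, 0 <= K & forall s v, a <= s <= b -> `|'d f (x s) v| <= K * `|v|.
Proof.
move=> fC hx.
have ex k : exists M : R, 0 <= M /\ forall s : R, a <= s <= b -> `|'D_(bvec k) f (x s)| <= M.
  have [|M M0 hM] := @segment_bounded R W (fun s => 'D_(bvec k) f (x s)) a b; last by exists M.
  move=> s /hx[As cx]; apply: (@continuous_comp _ _ _ x (fun y => 'D_(bvec k) f y)) => //.
  exact: fC.2.
have [M hM] := choice ex; exists (\sum_k M k).
  by apply: sumr_ge0 => k _; have [] := hM k.
move=> s v sab; have [As _] := hx s sab; rewrite (diff_basis v (fC.1 _ As)).
apply: le_trans (ler_norm_sum _ _ _) _; rewrite mulr_suml; apply: ler_sum => k _.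
rewrite normrZ mulrC; apply: ler_pM => //; last exact: crd_le.
by have [_ h] := hM k; exact: h.
Qed.

End CurveBound.

(** * Uniqueness of orbits and passage from weak invariance to invariance *)

Section Cylinder.
Context {R : realType} {m r : nat}.
Context (h : pt R m r -> R) (G : ext R m r -> R) (p0 : pt R m r).
Context (hC : Ck_on 2 setT h) (GC : Ck_on 2 setT G) (pG : periodic_for extlat G).
Context (eps : R).
Notation H := (hamiltonian h G eps).
Notation X := (ext_field H).

(** Two solutions are bounded on [0, 1], so they stay in a common strip, where the field is
    Lipschitz by periodicity. *)
Lemma time_one_unique z z1 z2 : time_one H z z1 -> time_one H z z2 -> z1 = z2.
Proof.
move=> [c1 [c10 <- d1]] [c2 [c20 <- d2]].
have bd (c : R -> phase R m r) : (forall s : R, 0 <= s <= 1 ->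
    is_derive s (1 : R) c (ham_field H (s, (c s).1, (c s).2))) ->
    exists2 M : R, 0 <= M & forall s : R, 0 <= s <= 1 -> `|c s| <= M.
  by move=> d; apply: segment_bounded => s /d; exact: eps_der_continuous.
have [M1 M10 b1] := bd _ d1; have [M2 M20 b2] := bd _ d2.
pose N := M1 + M2 + `|p0|.
have [L L0 hL] := X_lip_strip p0 hC GC pG eps N.
have st (c : R -> phase R m r) (M s : R) : `|c s| <= M -> M <= M1 + M2 ->
    strip p0 N (s, (c s).1, (c s).2).
  move=> cM MM; rewrite /strip /N /=; apply: le_trans (ler_normB _ _) _.
  by rewrite lerD2r (le_trans (norm_snd _)) // (le_trans cM).
have key (f g : phase R m r) : `|f - g| <= `|(1 : R, f.1, f.2) - (1 : R, g.1, g.2)|.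
  case: f g => [u1 u2] [w1 w2]; rewrite !pairN !pairD subrr; apply: norm_pair_le.
    by apply: le_trans (norm_fst (0 : R, u1 - w1, u2 - w2)); exact: (norm_snd (0 : R, u1 - w1)).
  exact: (norm_snd (0 : R, u1 - w1, u2 - w2)).
apply: (@ode_unique R (phase R m r) _ (fun s z => ham_field H (s, z.1, z.2)) L c1 c2 0 1) => //.
- move=> s s01; have s1 := st c1 M1 s (b1 s s01) ltac:(lra).
  have s2 := st c2 M2 s (b2 s s01) ltac:(lra).
  have k : `|ham_field H (s, (c1 s).1, (c1 s).2) - ham_field H (s, (c2 s).1, (c2 s).2)| <=
      `|X (s, (c1 s).1, (c1 s).2) - X (s, (c2 s).1, (c2 s).2)|.
    exact: key.
  apply: le_trans k (le_trans (hL _ _ s1 s2) _); apply: ler_wpM2l => //.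
  case: (c1 s) (c2 s) => [x1 x2] [y1 y2] /=; rewrite !pairN !pairD subrr.
  apply: norm_pair_le; last exact: (norm_snd (x1 - y1, x2 - y2)).
  by apply: norm_pair_le; [rewrite normr0|exact: (norm_fst (x1 - y1, x2 - y2))].
- by rewrite c10 c20.
Qed.

Lemma flow1E z z' : time_one H z z' -> flow1 H z = z'.
Proof.
move=> t; apply: (@time_one_unique z) => //; rewrite /flow1.
exact: (@xgetPex _ z [set z'' | time_one H z z''] (ex_intro _ z' t)).
Qed.

Lemma time_one_curve (c : R -> ext R m r) :
  (forall s : R, 0 <= s <= 1 -> (c s).1.1 = s) ->
  (forall s : R, 0 <= s <= 1 -> is_derive s (1 : R) c (X (c s))) ->
  time_one H ((c 0).1.2, (c 0).2) ((c 1).1.2, (c 1).2).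
Proof.
move=> tc dc; exists (fun s => ((c s).1.2, (c s).2)); split=> // s s01 /=.
have -> : (s, (c s).1.2, (c s).2) = c s by rewrite -{1}(tc s s01) -!surjective_pairing.
have := dc s s01; rewrite /ext_field => d.
have := @is_derive_lin R (ext R m r) (phase R m r) (fd_ext R m r) (fun z => (z.1.2, z.2)) c s _ _ d.
by move=> /(_ (fun _ _ _ => erefl)) /=; rewrite -(surjective_pairing (ham_field H (c s))).
Qed.

Context (B : set 'rV[R]_m) (Q P : base R m -> 'rV[R]_r).
Context (oB : open B) (QC : Ck_on 1 (Defs.over B) Q) (PC : Ck_on 1 (Defs.over B) P).
Context (inv : weakly_invariant H B Q P).

(** Extended phase space splits into the parameters (t, q1, p1) and the fibre (q2, p2), over which
    the cylinder is locally the graph of [QP]. *)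
Definition bs (z : ext R m r) : base R m := (z.1.1, z.1.2.1, z.2.1).
Definition fib (z : ext R m r) : pt R r r := (z.1.2.2, z.2.2).
Definition QP (x : base R m) : pt R r r := (Q x, P x).

Lemma over_open : open (Defs.over B).
Proof.
rewrite openE => x Bx; have /nbhs_ballP[d d0 hd] : nbhs x.2 B by exact: open_nbhs_nbhs.
apply/nbhs_ballP; exists d => // y; rewrite -ball_normE /= => xy; apply: hd.
by rewrite -ball_normE /=; apply: le_lt_trans xy; exact: (norm_snd (x - y)).
Qed.

Lemma QP_C1 : Ck_on 1 (Defs.over B) QP.
Proof. by apply: C1_pair => //; exact: over_open. Qed.

Lemma bs_linear : linear bs. Proof. by []. Qed.
Lemma fib_linear : linear fib. Proof. by []. Qed.

Lemma bs_param x : bs (param Q P x) = x.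
Proof. by case: x => [[t q] p]. Qed.

Lemma fib_param x : fib (param Q P x) = QP x. Proof. by []. Qed.

Lemma paramE z : fib z = QP (bs z) -> z = param Q P (bs z).
Proof. by case: z => [[t [q1 q2]] [p1 p2]] /= [-> ->]. Qed.

Lemma fiber_norm (w : pt R r r) :
  `|((0 : R, (0 : 'rV[R]_m, w.1), (0 : 'rV[R]_m, w.2)) : ext R m r)| <= `|w|.
Proof.
have z := normr_ge0 w; apply: norm_pair_le.
  apply: norm_pair_le; first by rewrite normr0.
  by apply: norm_pair_le; [rewrite normr0|exact: norm_fst].
by apply: norm_pair_le; [rewrite normr0|exact: norm_snd].
Qed.

Lemma param_diff x v : Defs.over B x ->
  differentiable (param Q P) x /\
  'd (param Q P) x v = (v.1.1, (v.1.2, ('d QP x v).1), (v.2, ('d QP x v).2)).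
Proof.
move=> Bx; pose L (v : base R m) : ext R m r :=
  (v.1.1, (v.1.2, ('d QP x v).1), (v.2, ('d QP x v).2)).
have linL : linear L.
  move=> a u w; have E : 'd QP x (a *: u + w) = a *: 'd QP x u + 'd QP x w by exact: linearP.
  by rewrite /L E.
have [|d E] := @eps_diff R (base R m) (ext R m r) _ (param Q P) x L linL; last by rewrite E.
move=> e e0; have [d d0 hd] := diff_eps (QP_C1.1 x Bx) e0.
exists d => // u ud; have := hd u ud; set w := QP (x + u) - QP x - 'd QP x u => hw.
have -> : param Q P (x + u) - param Q P x - L u = (0, (0, w.1), (0, w.2)).
  have z (U : zmodType) (a b : U) : a + b - a - b = 0 by rewrite [a + b]addrC addrK subrr.
  by rewrite /param /L !pairN !pairD /=; congr (_, (_, _), (_, _)); exact: z.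
exact: le_trans (fiber_norm w) hw.
Qed.

(** A tangent vector of a graph is determined by its base component, so weak invariance is the
    equality of the fibre component of the field with the image of its base component. *)
Lemma inv_eq x : Defs.over B x ->
  'd QP x (bs (X (param Q P x))) = fib (X (param Q P x)).
Proof.
move=> Bx; have [v] := inv Bx; have [_ ->] := param_diff v Bx => <-.
rewrite [X in 'd QP x X](_ : _ = v); first exact: surjective_pairing.
by case: v => [[? ?] ?].
Qed.

Context (M : R) (stP : forall x, Defs.over B x -> strip p0 M (param Q P x)).

(** The defect [fib c - QP (bs c)] starts at 0. By [inv_eq] its velocity vanishes on the cylinder,
    and it is bounded by a multiple of the defect because the field is Lipschitz in the strip;
    Gronwall keeps the defect at 0 as long as the orbit stays over [B]. *)
Lemma cylinder_orbit (c : R -> ext R m r) (S : R) :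
  (forall s : R, `|s| <= S ->
     [/\ is_derive s (1 : R) c (X (c s)), strip p0 M (c s) & B (c s).2.1]) ->
  c 0 = param Q P (bs (c 0)) ->
  forall s : R, `|s| <= S -> c s = param Q P (bs (c s)).
Proof.
move=> hc c0 s sS; apply: paramE; apply/eqP; rewrite -subr_eq0 -normr_le0.
have Bc (u : R) : `|u| <= S -> Defs.over B (bs (c u)) by move=> /hc[].
have db (u : R) : `|u| <= S -> is_derive u (1 : R) (fun u => bs (c u)) (bs (X (c u))).
  move=> /hc[d _ _].
  exact: (@is_derive_lin R (ext R m r) (base R m) (fd_ext R m r) bs _ _ _ bs_linear d).
have [L L0 hL] := X_lip_strip p0 hC GC pG eps M.
have [|K K0 hK] := @C1_curve_bound R (base R m) (pt R r r) (fd_base R m) (Defs.over B) QP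
  (fun u => bs (c u)) (- S) S QP_C1.
  move=> u uS; have {}uS : `|u| <= S by rewrite ler_norml.
  split; first exact: Bc.
  exact: (eps_der_continuous (db u uS)).
pose w u := fib (c u) - QP (bs (c u)).
pose w' u := fib (X (c u)) - 'd QP (bs (c u)) (bs (X (c u))).
have S0 : 0 <= S by apply: le_trans sS.
have w0 : w 0 = 0 by rewrite /w c0 bs_param fib_param subrr.
have dw (u : R) : `|u - 0| <= S -> is_derive u (1 : R) w (w' u).
  rewrite subr0 => uS; have [d _ _] := hc u uS.
  have d1 := @is_derive_lin R (ext R m r) (pt R r r) (fd_ext R m r) fib _ _ _ fib_linear d.
  have d2 := @is_derive_comp_diff R _ _ QP (fun u => bs (c u)) u _ (QP_C1.1 _ (Bc u uS)) (db u uS).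
  exact: is_deriveB.
have lw (u : R) : `|u - 0| <= S -> `|w' u| <= (L + K * L) * `|w u| + 0.
  rewrite subr0 addr0 => uS; have [_ st _] := hc u uS.
  set x := bs (c u); have Bx := Bc u uS.
  have cw : `|c u - param Q P x| <= `|w u|.
    have -> : c u - param Q P x = (0, (0, (w u).1), (0, (w u).2)).
      rewrite /w /x /param /bs /fib /QP; case: (c u) => [[t [q1 q2]] [p1 p2]] /=.
      by rewrite !pairN !pairD !subrr.
    exact: fiber_norm.
  have Xd := hL _ _ st (stP Bx).
  have -> : w' u = fib (X (c u) - X (param Q P x)) - 'd QP x (bs (X (c u) - X (param Q P x))).
    rewrite /w' -/x.
    have -> : bs (X (c u) - X (param Q P x)) = bs (X (c u)) - bs (X (param Q P x)) by [].
    have -> : fib (X (c u) - X (param Q P x)) = fib (X (c u)) - fib (X (param Q P x)) by [].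
    by rewrite linearB (inv_eq Bx) opprB addrA subrK.
  have fb z : `|fib z| <= `|z|.
    apply: norm_pair_le.
      by apply: le_trans (norm_snd _) (le_trans (norm_snd _) (norm_fst _)).
    by apply: le_trans (norm_snd _) (norm_snd _).
  have bb z : `|bs z| <= `|z|.
    apply: norm_pair_le; last by apply: le_trans (norm_fst _) (norm_snd _).
    apply: norm_pair_le; first by apply: le_trans (norm_fst _) (norm_fst _).
    by apply: le_trans (norm_fst _) (le_trans (norm_snd _) (norm_fst _)).
  have XL := le_trans Xd (ler_wpM2l L0 cw).
  apply: le_trans (ler_normB _ _) _; rewrite mulrDl; apply: lerD.
    exact: le_trans (fb _) XL.
  rewrite -mulrA; apply: le_trans (hK u _ _) _; first by rewrite -ler_norml.
  by apply: ler_wpM2l => //; exact: le_trans (bb _) XL.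
have := @gronwall R (pt R r r) (fd_pt R r r) w w' (L + K * L) 0 0 S.
rewrite w0 normr0 mul0r addr0 mulr0 mul0r; apply => //; last by rewrite subr0.
by rewrite addr_ge0 // mulr_ge0.
Qed.

End Cylinder.

Section Margin.
Context {R : realType}.

Lemma scale_derive (V : normedModType R) (g : V) (s : R) :
  is_derive s (1 : R) (fun u : R => u *: g) g.
Proof.
apply: eps_derive => e e0; exists 1 => // k _.
by rewrite scalerDl [s *: g + _]addrC addrK subrr normr0 mulr_ge0 // ltW.
Qed.

(** The indicator function of an open set is continuous at its points, and its uniform continuity on
    [K] with tolerance 1/2 is the required margin. *)
Lemma compact_margin (V : normedModType R) (K A : set V) : compact K -> open A -> K `<=` A ->
  exists2 d : R, 0 < d & forall x y, K x -> `|y - x| < d -> A y.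
Proof.
move=> cK oA KA; pose f x : R := (x \in A)%:R.
have h2 : 0 < (2^-1 : R) by rewrite invr_gt0.
have [||d d0 hd] := @compact_unif R V R K f cK _ (2^-1); last 1 first.
- exists d => // x y Kx yd; have := hd x y Kx yd.
  rewrite /f (mem_set (KA x Kx)); case: (boolP (y \in A)) => [/set_mem //|_].
  by rewrite sub0r normrN normr1; lra.
- move=> x /KA Ax; apply/cont_epsP => e e0.
  have /nbhs_ballP[d d0 hd] : nbhs x A by exact: open_nbhs_nbhs.
  exists d => // y yd; have Ay : A y by apply: hd; rewrite -ball_normE /= distrC.
  by rewrite /f (mem_set Ay) (mem_set Ax) subrr normr0 ltW.
- exact: h2.
Qed.

Lemma inner_margin n (p : 'rV[R]_n) (B B0 : set 'rV[R]_n) : open B -> inner_ball p B B0 ->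
  exists2 d : R, 0 < d & forall x y, B0 x -> `|y - x| < d -> B y.
Proof.
move=> oB [bB0 pB0 clB].
have [N N0 hN] := open_ball_bdd bB0 pB0.
have cK : compact (closure B0).
  apply: (@subclosed_compact _ _ [set x | `|x - p| <= N]); first exact: closed_closure.
    exact: ball_compact.
  have cl : closed [set x : 'rV[R]_n | `|x - p| <= N].
    by apply: compact_closed; [exact: norm_hausdorff|exact: ball_compact].
  by rewrite closureE => x /(_ [set x | `|x - p| <= N]); apply; split=> // y /hN.
have [d d0 hd] := compact_margin cK oB clB.
by exists d => // x y /subset_closure; exact: hd.
Qed.

End Margin.

(** * The time-one map on the cylinder *)

Section TimeOne.
Context {R : realType} {m r : nat}.
Context (h : pt R m r -> R) (G : ext R m r -> R) (p0 : pt R m r).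
Context (hC : Ck_on 2 setT h) (GC : Ck_on 2 setT G) (pG : periodic_for extlat G).

Lemma strip_bounds (M : R) : exists2 C : R, 0 < C &
  forall z, strip p0 M z ->
   [/\ `|gQ G z| <= C, `|gP G z| <= C, forall v, `|'d (gQ G) z v| <= C * `|v|,
       forall v, `|'d (gP G) z v| <= C * `|v| & forall v, `|dgrad h z.2 v| <= C * `|v|].
Proof.
have ts := tame_strip p0 M; have tb := @tame_ball R (pt R m r) (fd_pt R m r) p0 M.
have cQ : continuous (gQ G).
  by move=> x; apply: differentiable_continuous; exact: (gQ_C1 GC).1.
have cP : continuous (gP G).
  by move=> x; apply: differentiable_continuous; exact: (gP_C1 GC).1.
have [C1 C10 b1] := tame_bdd ts (gQ_periodic pG) cQ.
have [C2 C20 b2] := tame_bdd ts (gP_periodic pG) cP.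
have [C3 C30 b3] := C1_diff_bound ts (gQ_periodic pG) (gQ_C1 GC).
have [C4 C40 b4] := C1_diff_bound ts (gP_periodic pG) (gP_C1 GC).
have [C5 C50 b5] := C1_diff_bound tb (@periodic_for0 R _ _ (grad h : pt R m r -> pt R m r)) (grad_C1 hC).
exists (C1 + C2 + C3 + C4 + C5 + 1); first by lra.
move=> z zM; split=> [| |v|v|v].
- by apply: le_trans (b1 z zM) _; lra.
- by apply: le_trans (b2 z zM) _; lra.
- by apply: le_trans (b3 z v zM) _; apply: ler_wpM2r => //; lra.
- by apply: le_trans (b4 z v zM) _; apply: ler_wpM2r => //; lra.
- by apply: le_trans (b5 z.2 v zM) _; apply: ler_wpM2r => //; lra.
Qed.

Context (M : R) (M1 : 1 <= M) (C : R) (C0 : 0 < C).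
Context (bQ : forall z, strip p0 M z -> `|gQ G z| <= C).
Context (bP : forall z, strip p0 M z -> `|gP G z| <= C).
Context (eps : R) (eps0 : 0 < eps) (epsC : eps ^+ 2 * C <= 1).
Notation H := (hamiltonian h G eps).
Notation X := (ext_field H).
Context (phi : ext R m r -> R -> ext R m r) (flow : is_XM_flow h G p0 M eps phi).

(** The momentum may drift by 1 before reaching the truncation, which is why the cylinder is
    required to lie in the strip of radius [M - 1]. *)
Lemma flow_strip z (s : R) : strip p0 (M - 1) z -> `|s| * (eps ^+ 2 * C) <= 1 ->
  strip p0 M (phi z s).
Proof.
rewrite /strip /= => zM sC.
have M0 : 0 <= M by have := M1; lra.
have := flow_slow hC GC M0 flow bQ z s; rewrite [leRHS]mulrC => k.
have -> : (phi z s).2 - p0 = ((phi z s).2 - z.2) + (z.2 - p0) by rewrite addrA subrK.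
by apply: le_trans (ler_normD _ _) _; lra.
Qed.

Lemma unit_time (s : R) : 0 <= s <= 1 -> `|s| * (eps ^+ 2 * C) <= 1.
Proof.
move=> /andP[s0 s1]; rewrite ger0_norm //; apply: le_trans epsC; apply: ler_piMl => //.
by rewrite mulr_ge0 ?sqr_ge0 // ltW.
Qed.

Lemma flow_time_one z : z.1.1 = 0 -> strip p0 (M - 1) z ->
  time_one H (z.1.2, z.2) ((phi z 1).1.2, (phi z 1).2).
Proof.
move=> t0 zM; have := @time_one_curve R m r h G eps (phi z).
rewrite (flow0 flow); apply=> s s01.
  by rewrite (flow_time hC GC flow) t0 add0r.
by apply: (flow_real flow); apply: flow_strip => //; exact: unit_time.
Qed.

Lemma flow1_phi z : z.1.1 = 0 -> strip p0 (M - 1) z ->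
  flow1 H (z.1.2, z.2) = ((phi z 1).1.2, (phi z 1).2).
Proof. by move=> t0 zM; apply: (flow1E p0 hC GC pG); exact: flow_time_one. Qed.

Context (B : set 'rV[R]_m) (Q P : base R m -> 'rV[R]_r) (oB : open B).
Context (stP : forall x, Defs.over B x -> strip p0 (M - 1) (param Q P x)).

Definition start (x : pt R m m) : ext R m r := param Q P (0, x.1, x.2).

Lemma Phi_phi x : B x.2 ->
  Phi H Q P x = ((phi (start x) 1).1.2.1, (phi (start x) 1).2.1).
Proof.
by move=> Bx; rewrite /Phi (@flow1_phi (start x)) //; exact: stP.
Qed.

Lemma cylinder0_time_one z : cylinder0 B Q P z -> exists! z', time_one H z z'.
Proof.
move=> [x [l [Bx ->]]]; pose z0 : ext R m r := start x + (0, (0, zvec R l), 0).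
have zM : strip p0 (M - 1) z0.
  by rewrite /strip /z0 /= addr0; exact: (stP (x := (0, x.1, x.2))).
have t : time_one H (section Q P 0 x + ((0, zvec R l), 0)) ((phi z0 1).1.2, (phi z0 1).2).
  by have := @flow_time_one z0; rewrite /z0 /= addr0; apply.
exists ((phi z0 1).1.2, (phi z0 1).2); split=> // z'.
exact: (time_one_unique p0 hC GC pG t).
Qed.

Lemma Phi_close (P2 : 'rV[R]_m -> 'rV[R]_r) (e : R) x : B x.2 ->
  (forall s : R, 0 <= s <= 1 ->
     `|grad h (phi (start x) s).2 - grad h (x.2, P2 x.2)| <= e) ->
  `|Phi H Q P x - Phi0 h P2 x| <= e + eps ^+ 2 * C.
Proof.
move=> Bx he; have zM : strip p0 (M - 1) (start x) by exact: stP.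
have M0 : 0 <= M by have := M1; lra.
have e0 : 0 <= e.
  apply: le_trans (normr_ge0 _) (he 0 _); lra.
have ec : 0 <= eps ^+ 2 * C by rewrite mulr_ge0 ?sqr_ge0 // ltW.
rewrite Phi_phi // /Phi0 pairN pairD; apply: norm_pair_le; last first.
  have := flow_slow hC GC M0 flow bQ (start x) 1; rewrite normr1 mulr1 => k.
  by apply: le_trans (le_trans k _); [exact: (norm_fst ((phi (start x) 1).2 - (start x).2))|rewrite lerDr].
pose g := (grad h (x.2, P2 x.2)).1.
have := @mean_value_const R 'rV[R]_m (fdim_rV R m)
  (fun s => (phi (start x) s).1.2.1 - s *: g)
  (fun s => (X (phi (start x) s)).1.2.1 - g) (e + eps ^+ 2 * C) 0 1 ler01.
rewrite (flow0 flow) scale0r subr0 scale1r subr0 mulr1 opprD addrA addrAC.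
apply=> s s01.
  have sM : strip p0 M (phi (start x) s).
    by apply: flow_strip => //; exact: unit_time.
  have d1 : is_derive s (1 : R) (fun s => (phi (start x) s).1.2.1) (X (phi (start x) s)).1.2.1.
    have := flow_real flow sM.
    exact: (@is_derive_lin R (ext R m r) 'rV[R]_m (fd_ext R m r) (fun z => z.1.2.1)).
  have d2 : is_derive s (1 : R) (fun s : R => s *: g) g by exact: scale_derive.
  exact: is_deriveB.
have sM : strip p0 M (phi (start x) s).
  by apply: flow_strip => //; exact: unit_time.
rewrite (XE hC GC) /=.
have -> : (grad h (phi (start x) s).2).1 - eps ^+ 2 *: (gP G (phi (start x) s)).1 - g =
  (grad h (phi (start x) s).2 - grad h (x.2, P2 x.2)).1 - eps ^+ 2 *: (gP G (phi (start x) s)).1.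
  by rewrite /g addrAC.
apply: le_trans (ler_normB _ _) _; apply: lerD.
  exact: le_trans (norm_fst _) (he s s01).
rewrite normrZ ger0_norm ?sqr_ge0 // ler_wpM2l ?sqr_ge0 //.
by apply: le_trans (norm_fst _) (bP sM).
Qed.

Context (QC : Ck_on 1 (Defs.over B) Q) (PC : Ck_on 1 (Defs.over B) P).
Context (inv : weakly_invariant H B Q P).

Lemma start_orbit x (S : R) : B x.2 -> S * (eps ^+ 2 * C) <= 1 ->
  (forall p, `|p - x.2| <= S * (eps ^+ 2 * C) -> B p) ->
  forall s : R, `|s| <= S -> phi (start x) s = param Q P (bs (phi (start x) s)) /\
     B (phi (start x) s).2.1.
Proof.
move=> Bx SC mB s sS; have zM : strip p0 (M - 1) (start x) by exact: stP.
have M0 : 0 <= M by have := M1; lra.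
have ec : 0 <= eps ^+ 2 * C by rewrite mulr_ge0 ?sqr_ge0 // ltW.
have le (u : R) : `|u| <= S -> `|u| * (eps ^+ 2 * C) <= S * (eps ^+ 2 * C).
  by move=> uS; rewrite ler_wpM2r.
have inB (u : R) : `|u| <= S -> B (phi (start x) u).2.1.
  move=> uS; apply: mB; apply: le_trans (le u uS); rewrite mulrC.
  apply: le_trans (flow_slow hC GC M0 flow bQ (start x) u).
  exact: (norm_fst ((phi (start x) u).2 - (start x).2)).
split; last exact: inB.
have stP' y : Defs.over B y -> strip p0 M (param Q P y).
  by move=> By; apply: le_trans (stP By) _; rewrite lerBlDr lerDl.
apply: (@cylinder_orbit R m r h G p0 hC GC pG eps B Q P oB QC PC inv M stP' (phi (start x)) S) => //.
  move=> u uS; have st : strip p0 M (phi (start x) u).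
    by apply: flow_strip => //; exact: le_trans (le u uS) SC.
  by split=> //; [exact: (flow_real flow)|exact: inB].
by rewrite (flow0 flow) bs_param.
Qed.

Context (pQ : base_periodic B Q) (pP : base_periodic B P).

(** The orbit stays on the cylinder and ends over time 1; periodicity of [Q] and [P] in t brings it
    back to the section at time 0. The translate by [l] is again an orbit because the field is
    periodic. *)
Lemma cylinder0_step x l : B x.2 -> (forall p, `|p - x.2| <= eps ^+ 2 * C -> B p) ->
  cylinder0 B Q P (flow1 H (section Q P 0 x + ((0, zvec R l), 0))).
Proof.
move=> Bx mB; have zM : strip p0 (M - 1) (start x) by exact: stP.
have sp (s : R) : `|s| <= 1 -> phi (start x) s = param Q P (bs (phi (start x) s)) /\
     B (phi (start x) s).2.1.
  by apply: start_orbit => //; rewrite ?mul1r.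
pose L : ext R m r := (0, (0, zvec R l), 0).
have LL : extlat L.
  exists 0, 0, l; rewrite /L; congr (_, (_, _), _).
  by apply/matrixP => i j; rewrite !mxE.
pose c s := phi (start x) s + L.
have Xc s : X (c s) = X (phi (start x) s) by apply: (X_periodic hC GC pG).
have n1 (s : R) : 0 <= s <= 1 -> `|s| <= 1 by move=> /andP[? ?]; rewrite ger0_norm.
have t : time_one H ((c 0).1.2, (c 0).2) ((c 1).1.2, (c 1).2).
  apply: time_one_curve => s s01.
    by rewrite /c /= addr0 (flow_time hC GC flow) /= add0r.
  rewrite Xc; have st : strip p0 M (phi (start x) s).
    by apply: flow_strip => //; exact: unit_time.
  have d := flow_real flow st; rewrite -[X (phi _ _)]addr0.
  by apply: is_deriveD; exact: is_derive_cst.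
have E0 : section Q P 0 x + ((0, zvec R l), 0) = ((c 0).1.2, (c 0).2).
  by rewrite /c (flow0 flow).
have [E1 B1] := sp 1 (n1 1 ltac:(by rewrite ler01 lexx)).
rewrite E0 (flow1E p0 hC GC pG t) /c E1.
set y := bs (phi (start x) 1) in E1 *.
have y1 : y.1.1 = 1 by rewrite /y /= (flow_time hC GC flow) /= add0r.
exists (y.1.2, y.2), l; split=> //.
have shift F : base_periodic B F -> F y = F (0, y.1.2, y.2).
  move=> pF; have := pF 1 0 (0, y.1.2, y.2) B1; rewrite !pairD add0r !addr0.
  have -> : zvec R (0 : 'rV[int]_m) = 0 by apply/matrixP => i j; rewrite !mxE.
  by rewrite addr0 mulr1z => <-; rewrite -y1 -!surjective_pairing.
by rewrite /section /param (shift _ _ pQ) (shift _ _ pP).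
Qed.

End TimeOne.

(** * The linearised flow along the cylinder *)

Section LinearisedTools.
Context {R : realType}.

Lemma derive_near_unique (V : normedModType R) (f g : R -> V) (s : R) (v w : V) (d : R) :
  0 < d -> (forall k : R, `|k| < d -> f (s + k) = g (s + k)) ->
  is_derive s (1 : R) f v -> is_derive s (1 : R) g w -> v = w.
Proof.
move=> d0 fg df dg; have {}df : is_derive s (1 : R) g v.
  apply: eps_derive => e e0; have [d1 d10 h1] := derive_eps df e0.
  exists (Num.min d d1); first by rewrite lt_min d0.
  move=> k; rewrite lt_min => /andP[kd kd1]; rewrite -(fg k kd).
  by have := fg 0; rewrite addr0 normr0 => /(_ d0) <-; exact: h1.
by have [_ <-] := df; have [_ <-] := dg.
Qed.

Lemma diff_compE (U V W : normedModType R) (f : U -> V) (g : V -> W) x :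
  differentiable f x -> differentiable g (f x) ->
  differentiable (fun y => g (f y)) x /\
  forall v, 'd (fun y => g (f y)) x v = 'd g (f x) ('d f x v).
Proof.
move=> df dg; have dc : differentiable (g \o f) x by exact: differentiable_comp.
by split=> // v; have := diff_comp df dg => /(congr1 (fun k => k v)).
Qed.

Lemma diff_comp_eps (U V W : normedModType R) {fV : fdim V} (f : U -> V) (g : V -> W)
    (L : V -> W) x : linear L -> differentiable f x ->
  (forall e : R, 0 < e -> exists2 d : R, 0 < d &
    forall u, `|u| < d -> `|g (f x + u) - g (f x) - L u| <= e * `|u|) ->
  differentiable (fun y => g (f y)) x /\
  forall v, 'd (fun y => g (f y)) x v = L ('d f x v).
Proof.
move=> linL df hg; have [dg E] := @eps_diff R V W fV g (f x) L linL hg.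
by have [dc Ec] := diff_compE df dg; split=> // v; rewrite Ec E.
Qed.

Lemma diff_line (V W : normedModType R) (f : V -> W) x v : differentiable f x ->
  is_derive (0 : R) (1 : R) (fun t : R => f (x + t *: v)) ('d f x v).
Proof. by move=> df; apply: (is_derive_lineP _ _ _ _).1; exact: diff_is_derive. Qed.

Lemma C1_diff_curve (V W : normedModType R) {fV : fdim V} (f : V -> W) (y u : R -> V) (s : R) :
  Ck_on 1 setT f -> {for s, continuous y} -> {for s, continuous u} ->
  {for s, continuous (fun t => 'd f (y t) (u t))}.
Proof.
move=> fC cy cu; apply/cont_epsP => e e0.
have [C C0 bC] := linear_bound (fun a v w => linearP ('d f (y s)) a v w).
have u1 : 0 < `|u s| + 1 by rewrite ltr_wpDl.
have [d1 d10 h1] := C1_diff_continuous openT fC (I : setT (y s)) (divr_gt0 (divr_gt0 e0 (ltr0Sn R 1)) u1).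
have C1 : 0 < C + 1 by lra.
have [d2 d20 h2] := (cont_epsP _ _).1 cy (d1 / 2) (divr_gt0 d10 (ltr0Sn R 1)).
have [d3 d30 h3] := (cont_epsP _ _).1 cu (Num.min 1 (e / 2 / (C + 1)))
  ltac:(by rewrite lt_min ltr01 !divr_gt0).
exists (Num.min d2 d3); first by rewrite lt_min d20.
move=> t; rewrite lt_min => /andP[t2 t3].
have := h3 t t3; rewrite le_min => /andP[ut1]; rewrite ler_pdivlMr // => ut2.
have yt : `|y t - y s| < d1 by have := h2 t t2; lra.
have [_ k1] := h1 (y t) (u t) yt.
have -> : 'd f (y t) (u t) - 'd f (y s) (u s) =
  ('d f (y t) (u t) - 'd f (y s) (u t)) + 'd f (y s) (u t - u s).
  by rewrite linearB addrA subrK.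
have k2 := bC (u t - u s).
have ut : `|u t| <= `|u s| + 1.
  by have := ler_normD (u t - u s) (u s); rewrite subrK; lra.
have k3 : e / 2 / (`|u s| + 1) * `|u t| <= e / 2.
  by rewrite mulrAC ler_pdivrMr // ler_wpM2l // divr_ge0 // ltW.
have k4 : C * `|u t - u s| <= e / 2.
  by apply: le_trans ut2; rewrite mulrC ler_wpM2l // lerDl.
by apply: le_trans (ler_normD _ _) _; lra.
Qed.

End LinearisedTools.

Section Linearised.
Context {R : realType} {m r : nat}.
Context (h : pt R m r -> R) (G : ext R m r -> R) (p0 : pt R m r).
Context (hC : Ck_on 2 setT h) (GC : Ck_on 2 setT G) (pG : periodic_for extlat G).
Context (M : R) (M1 : 1 <= M) (C : R) (C0 : 0 < C).
Context (bQ : forall z, strip p0 M z -> `|gQ G z| <= C).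
Context (bP : forall z, strip p0 M z -> `|gP G z| <= C).
Context (eps : R) (eps0 : 0 < eps) (epsC : eps ^+ 2 * C <= 1).
Notation H := (hamiltonian h G eps).
Notation X := (ext_field H).
Context (phi : ext R m r -> R -> ext R m r) (flow : is_XM_flow h G p0 M eps phi).
Context (B : set 'rV[R]_m) (Q P : base R m -> 'rV[R]_r) (oB : open B).
Context (stP : forall x, Defs.over B x -> strip p0 (M - 1) (param Q P x)).
Context (QC : Ck_on 1 (Defs.over B) Q) (PC : Ck_on 1 (Defs.over B) P).
Context (inv : weakly_invariant H B Q P).
Context (x : pt R m m) (S d1 : R) (S1 : 1 <= S) (d10 : 0 < d1).
Context (SC : S * (eps ^+ 2 * C) <= 2^-1).
Context (mB : forall p, `|p - x.2| < S * (eps ^+ 2 * C) + d1 -> B p).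
Notation z0 := (start Q P x).

Let M0 : 0 <= M. Proof. by have := M1; lra. Qed.
Let ec : 0 <= eps ^+ 2 * C. Proof. by rewrite mulr_ge0 ?sqr_ge0 // ltW. Qed.
Let sec : 0 <= S * (eps ^+ 2 * C). Proof. by rewrite mulr_ge0 // (le_trans ler01). Qed.

Lemma center_in : B x.2.
Proof. by apply: mB; rewrite subrr normr0 ltr_wpDl. Qed.

Lemma near_orbit y (s : R) : `|y - x| < d1 -> `|s| <= S ->
  B y.2 /\ phi (start Q P y) s = param Q P (bs (phi (start Q P y) s)).
Proof.
move=> yx sS; have y2 : `|y.2 - x.2| < d1 by apply: le_lt_trans yx; exact: (norm_snd (y - x)).
have By : B y.2 by apply: mB; rewrite ltr_wpDl.
split=> //; have := @start_orbit R m r h G p0 hC GC pG M M1 C C0 bQ eps phi flow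
  B Q P oB stP QC PC inv y S By.
have SC1 : S * (eps ^+ 2 * C) <= 1 by have := SC; lra.
move=> /(_ SC1) k; have [] := k _ s sS => // p py; apply: mB.
have -> : p - x.2 = (p - y.2) + (y.2 - x.2) by rewrite addrA subrK.
by apply: le_lt_trans (ler_normD _ _) _; rewrite ler_ltD.
Qed.

Definition inc (v : pt R m m) : base R m := (0, v.1, v.2).
Lemma inc_linear : linear inc. Proof. by move=> a u v; rewrite /inc !pairZ !pairD scaler0 addr0. Qed.

Lemma start_diff v : differentiable (start Q P) x /\
  'd (start Q P) x v = 'd (param Q P) (inc x) (inc v).
Proof.
have Bx : Defs.over B (inc x) by exact: center_in.
have [d _] := param_diff oB QC PC (inc v) Bx.
have [d' E] := @diff_lin_comp R (pt R m m) (fd_pt R m m) (base R m) (ext R m r) (fd_base R m)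
  inc (param Q P) x inc_linear d.
by split=> //; exact: E.
Qed.

Lemma orbit_strip (s : R) : `|s| <= S -> strip p0 (M - 2^-1) (phi z0 s).
Proof.
move=> sS; have zM : strip p0 (M - 1) z0 by exact: (stP (x := inc x) center_in).
have k := flow_slow hC GC M0 flow bQ z0 s.
have k2 : `|s| * (eps ^+ 2 * C) <= S * (eps ^+ 2 * C) by rewrite ler_wpM2r.
rewrite /strip /= in zM *.
have -> : (phi z0 s).2 - p0 = ((phi z0 s).2 - z0.2) + (z0.2 - p0) by rewrite addrA subrK.
apply: le_trans (ler_normD _ _) _; rewrite mulrC in k; have := SC; lra.
Qed.

Lemma strip_mono (N N' : R) z : N <= N' -> strip p0 N z -> strip p0 N' z.
Proof. by move=> NN zN; exact: le_trans NN. Qed.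

(** [V v] solves the variational equation along the orbit of [x], so it is the differential of the
    flow in the direction tangent to the cylinder defined by [v]. Injectivity is Gronwall back to
    time 0, where the base component of the vector is [inc v]. *)
Lemma linearised : exists V : pt R m m -> R -> ext R m r,
  [/\ forall v, V v 0 = 'd (param Q P) (inc x) (inc v),
      forall v (s : R), `|s| <= S -> is_derive s (1 : R) (V v) ('d X (phi z0 s) (V v s)),
      forall s, linear (V ^~ s) &
      [/\ forall v (s : R), V v s = 0 -> v = 0,
          forall v (s : R), `|s| <= S ->
            fib (V v s) = 'd (QP Q P) (bs (phi z0 s)) (bs (V v s)),
          forall v (s : R), (V v s).1.1 = 0 &
          differentiable (Phi H Q P) x /\
          forall v, 'd (Phi H Q P) x v = ((V v 1).1.2.1, (V v 1).2.1)]].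
Proof.
have XC1 := X_C1 hC GC eps; have pX := X_periodic hC GC pG eps.
have [L L0 hL] := XM_lip p0 hC GC pG M0 eps.
have [LA LA0 hLA] := C1_diff_bound (tame_strip p0 M) pX XC1.
pose A s v := 'd X (clampz p0 M (phi z0 s)) v.
have linA s : linear (A s) by move=> a u v; rewrite /A linearP.
have bA s v : `|A s v| <= LA * `|v| by apply: hLA; exact: clampz_strip.
have cA (u : R -> ext R m r) : continuous u -> continuous (fun s => A s (u s)).
  move=> cu s; apply: (@C1_diff_curve R (ext R m r) (ext R m r) (fd_ext R m r) X
    (fun s => clampz p0 M (phi z0 s)) u s) => //; last exact: cu.
  have cphi := eps_der_continuous (flow.2 z0 s).
  apply/cont_epsP => e e0; have [d d0 hd] := (cont_epsP _ _).1 cphi e e0.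
  by exists d => // y yd; apply: le_trans (clampz_lip _ _ _ _) (hd y yd).
have tay (e : R) : 0 < e -> exists2 d : R, 0 < d & forall (s : R) u, `|s| <= S ->
     `|u| < d -> `|X (clampz p0 M (phi z0 s + u)) - X (clampz p0 M (phi z0 s)) - A s u| <= e * `|u|.
  move=> e0; have [d d0 hd] := C1_taylor_unif (tame_strip p0 M) pX XC1 e0.
  (* The orbit stays in the strip of radius [M - 1 / 2], so displacements below 1/2 leave the
     truncation inactive. *)
  exists (Num.min d 2^-1); first by rewrite lt_min d0 invr_gt0 ltr0n.
  move=> s u sS; rewrite lt_min => /andP[ud u2].
  have st := orbit_strip sS.
  have st1 : strip p0 M (phi z0 s) by apply: strip_mono st; lra.
  have st2 : strip p0 M (phi z0 s + u).
    rewrite /strip /=; have -> : (phi z0 s).2 + u.2 - p0 = ((phi z0 s).2 - p0) + u.2 by rewrite addrAC.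
    apply: le_trans (ler_normD _ _) _; have := norm_snd u; move: st; rewrite /strip /=.
    by move: `|_ - p0| `|u.2| `|u| u2 => ? ? ? ?; lra.
  by rewrite /A !clampz_id //; exact: hd.
have [Y [Y0 dY linY hY]] := flow_differentiable L0 LA0 (le_trans ler01 S1) hL flow.1 flow.2
  linA bA cA tay.
have [dst _] := start_diff 0.
have Est v := (start_diff v).2.
pose V (v : pt R m m) (s : R) : ext R m r := Y ('d (start Q P) x v) s.
have dcomp (s : R) : `|s| <= S -> differentiable (fun y : pt R m m => phi (start Q P y) s) x /\
    forall v : pt R m m, 'd (fun y : pt R m m => phi (start Q P y) s) x v = V v s.
  move=> sS; exact: (@diff_comp_eps R (pt R m m) (ext R m r) (ext R m r) (fd_ext R m r)
    (start Q P) (phi ^~ s) (Y ^~ s) x (linY s) dst (hY s sS)).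
exists V; split.
- by move=> v; rewrite /V Y0 Est.
- move=> v s sS; have := dY ('d (start Q P) x v) s; rewrite /A clampz_id //.
  by apply: strip_mono (orbit_strip sS); lra.
- by move=> s a u v; rewrite /V linearP linY.
split.
- move=> v s Vs0.
  have g := @gronwall R (ext R m r) (fd_ext R m r) (V v) (fun u => A u (V v u)) LA 0 s `|s|
    LA0 (lexx 0) (fun u _ => dY _ u) (fun u _ => eq_ind_r (fun t => `|A u (V v u)| <= t) (bA _ _) (addr0 _)) 0.
  move: g; rewrite sub0r normrN Vs0 normr0 mul0r addr0 mulr0 mul0r => /(_ (lexx _)).
  rewrite normr_le0 /V Y0 Est => /eqP E.
  have [_ E'] := param_diff oB QC PC (inc v) (center_in : Defs.over B (inc x)).
  by move: E; rewrite E' => -[]; case: v {Vs0 E'} => [v1 v2] /= -> _ -> _.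
(* All orbits starting near [x] stay on the cylinder up to time [S], so the relation between fibre
   and base can be differentiated along [x + t v] at [t = 0]. *)
- move=> v s sS; have [d E] := dcomp s sS.
  have dline : is_derive (0 : R) (1 : R) (fun t : R => phi (start Q P (x + t *: v)) s) (V v s).
    rewrite -E; exact: (@diff_line R (pt R m m) (ext R m r) (fun y => phi (start Q P y) s) x v d).
  have Bs : Defs.over B (bs (phi z0 s)).
    have [_ e] := near_orbit (y := x) (s := s) ltac:(by rewrite subrr normr0) sS.
    have [_ ] := @start_orbit R m r h G p0 hC GC pG M M1 C C0 bQ eps phi flow
      B Q P oB stP QC PC inv x S center_in ltac:(have := SC; lra)
      (fun p px => mB (le_lt_trans px (ltr_pwDr d10 (lexx _)))) s sS.
    by [].
  have d1' := @is_derive_lin R (ext R m r) (pt R r r) (fd_ext R m r) fib _ 0 _ (@fib_linear R m r) dline.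
  have d2' := @is_derive_lin R (ext R m r) (base R m) (fd_ext R m r) bs _ 0 _ (@bs_linear R m r) dline.
  have dQP : differentiable (QP Q P) (bs (phi (start Q P (x + (0 : R) *: v)) s)).
    by rewrite scale0r addr0; apply: (QP_C1 oB QC PC).1.
  have d3' := @is_derive_comp_diff R _ _ (QP Q P) (fun t : R => bs (phi (start Q P (x + t *: v)) s)) 0 _ dQP d2'.
  rewrite scale0r addr0 in d3'.
  have vn : 0 < d1 / (`|v| + 1) by rewrite divr_gt0 // ltr_wpDl.
  apply: (derive_near_unique vn _ d1' d3') => k; rewrite add0r ltr_pdivlMr ?ltr_wpDl // => kd.
  have yx : `|x + k *: v - x| < d1.
    rewrite addrC addKr normrZ; apply: le_lt_trans kd.
    by apply: ler_wpM2l => //; rewrite lerDl.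
  by have [_ {1}->] := near_orbit yx sS; rewrite fib_param.
- move=> v s; have dd (u : R) : is_derive u (1 : R) (fun u => (V v u).1.1) 0.
    have := @is_derive_lin R (ext R m r) R^o (fd_ext R m r) (fun z => z.1.1) (V v) u _
      (fun _ _ _ => erefl) (dY ('d (start Q P) x v) u).
    by rewrite /A (X_diff hC GC).
  have := @mean_value_sym R R (fdim_R R) (fun u => (V v u).1.1) (fun=> 0) 0 0 s (fun u _ => dd u)
    (fun u _ => eq_ind_r (fun t => t <= 0) (lexx 0) (normr0 R)).
  rewrite mul0r normr_le0 /V Y0 Est.
  have [_ ->] := param_diff oB QC PC (inc v) (center_in : Defs.over B (inc x)).
  by rewrite /= subr0 => /eqP.
- have nS : `|1 : R| <= S by rewrite normr1.
  have [d E] := dcomp 1 nS.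
  pose LP v : pt R m m := ((V v 1).1.2.1, (V v 1).2.1).
  have linP : linear LP by move=> a u v; rewrite /LP /V linearP linY.
  have [|dP EP] := @eps_diff R (pt R m m) (pt R m m) (fd_pt R m m) (Phi H Q P) x LP linP; last first.
    by split=> // v; rewrite EP.
  move=> e e0; have [d2 d20 hd] := diff_eps d e0.
  exists (Num.min d1 d2); first by rewrite lt_min d10.
  move=> u; rewrite lt_min => /andP[u1 u2].
  have yx : `|x + u - x| < d1 by rewrite addrC addKr.
  have [By _] := near_orbit yx nS; have k := hd u u2; rewrite E in k.
  rewrite !(Phi_phi hC GC pG M1 C0 bQ epsC flow stP) //; last exact: center_in.
  rewrite /LP !pairN !pairD; apply: norm_pair_le.
    apply: le_trans k; apply: le_trans (le_trans (norm_snd _) (norm_fst _)).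
    by apply: le_trans (norm_fst _) => /=.
  by apply: le_trans k; apply: le_trans (norm_snd _); exact: le_trans (norm_fst _).
Qed.

End Linearised.

Lemma norm_arith (R : realType) (C w x b y z : R) : 0 <= w -> 0 <= x -> 0 <= y -> 0 <= b ->
  0 <= C * b -> z <= y + C * b ->
  [/\ w <= w + x + (1 + C) * b + y, x <= w + x + (1 + C) * b + y,
      b <= w + x + (1 + C) * b + y & z <= w + x + (1 + C) * b + y].
Proof. by move=> *; split; lra. Qed.

(** * Reduction of the linearised equations to a shear and a saddle *)

Section ConeBuild.
Context {R : realType} {m r : nat}.
Context (C cA cK cV k1 : R) (C1 : 1 <= C) (cA0 : 0 < cA) (cK0 : 0 < cK) (cV0 : 0 < cV) (k10 : 0 < k1).
Context (F : pt R m r -> pt R m r) (N0 : 'rV[R]_m -> 'rV[R]_r) (M0 : 'rV[R]_r -> 'rV[R]_m).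
Context (linF : linear F) (linN : linear N0) (linM : linear M0).
Context (bF : forall u, `|F u| <= C * `|u|) (bN : forall b, `|N0 b| <= C * `|b|)
  (bM : forall y, `|M0 y| <= C * `|y|).
Context (FN : forall b, (F (b, N0 b)).2 = 0 /\ cA * `|b| ^+ 2 <= dot (F (b, N0 b)).1 b).
Context (FM : forall y, (F (0, y)).1 + M0 (F (0, y)).2 = 0).
Context (FK : forall y, cK * `|y| ^+ 2 <= dot (F (0, y)).2 y).

Let LA b := (F (b, N0 b)).1.
Let LK y := (F (0, y)).2.

(* [d] and [e] are the position and momentum parts of solutions of the linearised
   equations; [chi] corrects the momenta so that the oscillating coefficient [g] is
   replaced by its time average [ghat], close to [(0, LV)] *)
Record linearised_data (eps dl : R) (T : R)
    (d e Dd kk : pt R m m -> R -> pt R m r)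
    (g chi ghat : R -> pt R m r -> pt R m r) (LV : R -> 'rV[R]_r -> 'rV[R]_r) : Prop := {
  ld_lin : forall s, linear (d ^~ s) /\ linear (e ^~ s);
  ld_chilin : forall s, linear (chi s);
  ld_inj : forall v (s : R), eps * `|s| <= T -> d v s = 0 -> e v s = 0 -> v = 0;
  ld_d : forall v (s : R), eps * `|s| <= T -> is_derive s (1 : R) (d v) (Dd v s);
  ld_Dd : forall v (s : R), eps * `|s| <= T ->
    `|Dd v s - F (e v s)| <= dl * `|(eps *: d v s, e v s)|;
  ld_e : forall v (s : R), eps * `|s| <= T ->
    is_derive s (1 : R) (e v) (eps *: (g s (eps *: d v s) + kk v s));
  ld_kk : forall v (s : R), eps * `|s| <= T -> `|kk v s| <= dl * `|(eps *: d v s, e v s)|;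
  ld_chi : forall (s : R) u, eps * `|s| <= T -> `|eps *: chi s u| <= dl * `|u|;
  ld_chid : forall v (s : R), eps * `|s| <= T ->
    is_derive s (1 : R) (fun s => chi s (eps *: d v s))
      (chi s (eps *: Dd v s) + g s (eps *: d v s) - ghat s (eps *: d v s));
  ld_ghat : forall (s : R) u, eps * `|s| <= T -> `|ghat s u - (0, LV s u.2)| <= dl * `|u|;
  ld_LV : forall (s : R) u, eps * `|s| <= T ->
    `|LV s u| <= C * `|u| /\ cV * `|u| ^+ 2 <= dot (LV s u) u;
  ld_slice : forall v (s : R), eps * `|s| <= T -> (d v s).1 = 0 ->
    `|eps *: (d v s).2| <= k1 * `|(e v s).1| /\ `|(e v s).2| <= k1 * `|(e v s).1| }.

(** The change to [W = eps dq1 + M0 (eps dq2)], [B = dp1], [X = eps dq2] and [Y = dp2 - N0 dp1].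
    With [N0] the momenta (dp1, N0 dp1) do not move [X], and with [M0] the variable [Y] does not
    move [W]. *)
Let Lz (x : phase R m r) : pt R m m * pt R r r :=
  ((x.1.1 + M0 x.1.2, x.2.1), (x.1.2, x.2.2 - N0 x.2.1)).

Lemma linD (V W : normedModType R) (L : V -> W) u v : linear L -> L (u + v) = L u + L v.
Proof. by move=> lL; rewrite -[u]scale1r lL !scale1r. Qed.

Lemma linB (V W : normedModType R) (L : V -> W) u v : linear L -> L (u - v) = L u - L v.
Proof. by move=> lL; rewrite addrC -scaleN1r lL scaleN1r addrC. Qed.

Lemma linZ (V W : normedModType R) (L : V -> W) a u : linear L -> L (a *: u) = a *: L u.
Proof.
move=> lL; have L0 : L 0 = 0 by have := @linB _ _ L 0 0 lL; rewrite !subrr.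
by rewrite -[a *: u]addr0 lL L0 addr0.
Qed.

Lemma Lz_linear : linear Lz.
Proof.
move=> a u v; rewrite /Lz /= linM linN !pairZ !pairD; congr ((_, _), (_, _)); crd_ring.
Qed.

Section Family.
Context (eps dl T : R) (d e Dd kk : pt R m m -> R -> pt R m r)
    (g chi ghat : R -> pt R m r -> pt R m r) (LV : R -> 'rV[R]_r -> 'rV[R]_r).
Context (eps0 : 0 < eps) (dl0 : 0 < dl <= 1) (dlk : dl * k1 <= 2^-1).
Context (ld : linearised_data eps dl T d e Dd kk g chi ghat LV).

(** The corrected momentum: subtracting [eps *: chi] replaces [g] by its window average in the
    equation of dp, and [eps *: qq] is the resulting velocity. *)
Let ph v s := e v s - eps *: chi s (eps *: d v s).
Let qq v s := kk v s - chi s (eps *: Dd v s) + ghat s (eps *: d v s).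
Let zz v s := Lz (eps *: d v s, ph v s).
Let zeta v s := `|(eps *: d v s, e v s)|.

Let dl_gt0 : 0 < dl. Proof. by have /andP[] := dl0. Qed.
Let dl_le1 : dl <= 1. Proof. by have /andP[] := dl0. Qed.
Let C_ge0 : 0 <= C. Proof. exact: le_trans ler01 C1. Qed.

Lemma ph_close v (s : R) : eps * `|s| <= T -> `|ph v s - e v s| <= dl * `|eps *: d v s|.
Proof. by move=> sT; rewrite /ph addrC addKr normrN; exact: (ld_chi ld). Qed.

Lemma zeta_d v s : `|eps *: d v s| <= zeta v s.
Proof. exact: (norm_fst (eps *: d v s, e v s)). Qed.

Lemma zeta_e v s : `|e v s| <= zeta v s.
Proof. exact: (norm_snd (eps *: d v s, e v s)). Qed.

Lemma ph_zeta v (s : R) : eps * `|s| <= T -> `|ph v s - e v s| <= dl * zeta v s.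
Proof.
move=> sT; apply: le_trans (ph_close v sT) _; rewrite ler_wpM2l ?zeta_d //; exact: ltW dl_gt0.
Qed.

Lemma zeta_zz v (s : R) : eps * `|s| <= T -> zeta v s <= 2 * (1 + C) * `|zz v s|.
Proof.
move=> sT; have [n1 n2 n3 n4] := Zt_comp (zz v s).
have z0 := normr_ge0 (zz v s); have cz := mulr_ge0 C_ge0 z0.
set u := eps *: d v s in n1 n3; set p := ph v s in n2 n4.
have x1 : `|u.2| <= `|zz v s| by exact: n3.
have w1 : `|u.1| <= (1 + C) * `|zz v s|.
  have -> : u.1 = (zz v s).1.1 - M0 u.2 by rewrite /zz /Lz /= addrK.
  apply: le_trans (ler_normB _ _) _; rewrite mulrDl mul1r lerD //.
  by apply: le_trans (bM _) _; rewrite ler_wpM2l.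
have du : `|u| <= (1 + C) * `|zz v s|.
  rewrite [u]surjective_pairing; apply: norm_pair_le => //; apply: le_trans x1 _; lra.
have b1 : `|p.1| <= `|zz v s| by exact: n2.
have p2 : `|p.2| <= (1 + C) * `|zz v s|.
  have -> : p.2 = (zz v s).2.2 + N0 p.1 by rewrite /zz /Lz /= subrK.
  apply: le_trans (ler_normD _ _) _; rewrite mulrDl mul1r lerD //.
  by apply: le_trans (bN _) _; rewrite ler_wpM2l.
have pp : `|p| <= (1 + C) * `|zz v s|.
  rewrite [p]surjective_pairing; apply: norm_pair_le => //; apply: le_trans b1 _; lra.
have ee : `|e v s| <= `|p| + `|u|.
  have -> : e v s = p - (p - e v s) by rewrite subKr.
  apply: le_trans (ler_normB _ _) _; rewrite lerD2l; apply: le_trans (ph_close v sT) _.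
  by rewrite ler_piMl.
apply: norm_pair_le; first by rewrite -/u; lra.
lra.
Qed.

Lemma Dd_bound v (s : R) : eps * `|s| <= T -> `|Dd v s| <= (C + 1) * zeta v s.
Proof.
move=> sT; have := ld_Dd ld v sT; rewrite -/(zeta v s) => k.
have k2 := le_trans (bF (e v s)) (ler_wpM2l C_ge0 (zeta_e v s)).
have z0 : 0 <= zeta v s by exact: normr_ge0.
have k3 : dl * zeta v s <= zeta v s by rewrite ler_piMl.
have := ler_normD (Dd v s - F (e v s)) (F (e v s)); rewrite subrK; lra.
Qed.

Lemma qq_close v (s : R) : eps * `|s| <= T ->
  `|qq v s - (0, LV s (eps *: d v s).2)| <= (3 + C) * (dl * zeta v s).
Proof.
move=> sT; have k1' := ld_kk ld v sT; rewrite -/(zeta v s) in k1'.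
have z0 : 0 <= zeta v s by exact: normr_ge0.
have k2 : `|chi s (eps *: Dd v s)| <= dl * ((C + 1) * zeta v s).
  rewrite (linZ _ _ (ld_chilin ld s)); apply: le_trans (ld_chi ld _ sT) _.
  by rewrite ler_wpM2l ?(ltW dl_gt0) //; exact: Dd_bound.
have k3 : `|ghat s (eps *: d v s) - (0, LV s (eps *: d v s).2)| <= dl * zeta v s.
  apply: le_trans (ld_ghat ld _ sT) _; rewrite ler_wpM2l ?(ltW dl_gt0) //; exact: zeta_d.
have -> : qq v s - (0, LV s (eps *: d v s).2) = kk v s - chi s (eps *: Dd v s) +
  (ghat s (eps *: d v s) - (0, LV s (eps *: d v s).2)) by rewrite /qq addrA.
apply: le_trans (ler_normD _ _) _; apply: le_trans (lerD (ler_normB _ _) (lexx _)) _.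
lra.
Qed.

Lemma zz_derive v (s : R) : eps * `|s| <= T ->
  is_derive s (1 : R) (zz v) (eps *: Lz (Dd v s, qq v s)).
Proof.
move=> sT; have d1 := ld_d ld v sT; have e1 := ld_e ld v sT; have c1 := ld_chid ld v sT.
have d2 := is_deriveZ eps d1; have c2 := is_deriveZ eps c1.
have p1 : is_derive s (1 : R) (ph v) (eps *: qq v s).
  have -> : eps *: qq v s = eps *: (g s (eps *: d v s) + kk v s) -
     eps *: (chi s (eps *: Dd v s) + g s (eps *: d v s) - ghat s (eps *: d v s)).
    by rewrite /qq; crd_ring.
  exact: is_deriveB.
have := @is_derive_lin R (phase R m r) (pt R m m * pt R r r)%type
  (fdim_prod (fd_pt R m r) (fd_pt R m r)) Lz _ s _ Lz_linear (is_derive_pair d2 p1).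
by rewrite -pairZ (linZ _ _ Lz_linear).
Qed.

(** [LA] composes [F] with the graph map of [N0], each bounded by [C]. In [cone_kap] the factor 2
    compensates for the corrector, which may halve dp1. In [cone_D] the first two factors bound the
    errors after [Lz], and the last one is the norm of its inverse including the corrector. *)
Definition cone_C := C ^+ 2.
Definition cone_kap := 2 * k1 + 1 + C.
Definition cone_D := (1 + C) * (3 + C) * (2 * (1 + C)).

(** In the slow time [t = eps * s] the factor [eps] of [zz_derive] disappears, and all remaining
    errors are of order [dl]. The form [eps^-1 * t + 0] is the one produced by
    [is_derive_affine]. *)
Lemma build_family : cone_family cone_C cA cK cV cone_kap (cone_D * dl) T LA LK M0
  (fun t => LV (eps^-1 * t + 0))
  (fun v t => zz v (eps^-1 * t + 0)) (fun v t => Lz (Dd v (eps^-1 * t + 0), qq v (eps^-1 * t + 0))).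
Proof.
have C1' := C1; have tT (t : R) : `|t| <= T -> eps * `|eps^-1 * t + 0| <= T.
  move=> h; rewrite addr0 normrM ger0_norm ?invr_ge0 ?(ltW eps0) // mulrA mulfV ?gt_eqF // mul1r.
  exact: h.
have CC : C <= cone_C by rewrite /cone_C expr2 ler_peMl.
have le2 n (x : 'rV[R]_n) (a : R) : a <= C * `|x| -> a <= cone_C * `|x|.
  by move=> h; apply: le_trans h _; rewrite ler_wpM2r.
have pr b : `|(b, N0 b)| <= C * `|b|.
  by apply: norm_pair_le => //; rewrite ler_peMl.
have p0r y : `|((0, y) : pt R m r)| <= `|y|.
  by apply: norm_pair_le => //; rewrite normr0.
have LAlin : linear LA.
  move=> a u v; rewrite /LA -[RHS]/((a *: F (u, N0 u) + F (v, N0 v)).1) -linF.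
  by congr (F _).1; rewrite pairZ pairD linN.
have bLA b : `|LA b| <= C ^+ 2 * `|b|.
  apply: le_trans (norm_fst _) (le_trans (bF _) _); rewrite expr2 -mulrA ler_wpM2l //.
have bLK y : `|LK y| <= C * `|y|.
  by apply: le_trans (norm_snd _) (le_trans (bF _) _); rewrite ler_wpM2l.
have linZs s : linear (zz ^~ s).
  move=> a u v; have [l1 l2] := ld_lin ld s; have l3 := ld_chilin ld s.
  rewrite /zz -Lz_linear; congr Lz; rewrite pairZ pairD /ph l1 l2; congr pair; first by crd_ring.
  have -> : eps *: (a *: d u s + d v s) = a *: (eps *: d u s) + eps *: d v s by crd_ring.
  by rewrite l3; crd_ring.
have split_e v s : e v s = ((e v s).1, N0 (e v s).1) + (0, (e v s).2 - N0 (e v s).1).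
  by rewrite pairD addr0 addrC subrK -surjective_pairing.
have Fe v s : (F (e v s)).1 = LA (e v s).1 + (F (0, (e v s).2 - N0 (e v s).1)).1 /\
    (F (e v s)).2 = LK ((e v s).2 - N0 (e v s).1).
  have Eq : F (e v s) = F ((e v s).1, N0 (e v s).1) + F (0, (e v s).2 - N0 (e v s).1).
    by rewrite -(linD _ _ linF) -split_e.
  by rewrite Eq; split=> //=; rewrite (FN _).1 add0r.
have LKlin : linear LK.
  move=> a u w; rewrite /LK -[RHS]/((a *: F (0, u) + F (0, w)).2) -linF.
  by congr (F _).2; rewrite pairZ pairD scaler0 addr0.
(* The contribution [f] of [Y] to the velocity of [W] cancels against [M0 k], by the choice of
   [M0]. *)
have algW (b p f r1 : 'rV[R]_m) (k r2 : 'rV[R]_r) : f + M0 k = 0 ->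
    LA b + f + r1 + M0 (k + r2) - LA p = r1 + M0 r2 - LA (p - b).
  move=> /eqP; rewrite addr_eq0 => /eqP ->.
  by rewrite (linD _ _ linM) (linB _ _ LAlin); crd_ring.
have algX (y2 p2 r2 : 'rV[R]_r) (y1 p1 : 'rV[R]_m) :
    LK (y2 - N0 y1) + r2 - LK (p2 - N0 p1) = r2 - LK ((p2 - y2) - N0 (p1 - y1)).
  by rewrite (linB _ _ linN) !(linB _ _ LKlin); crd_ring.
have err v s : eps * `|s| <= T -> let zt := dl * zeta v s in
    [/\ `|(Lz (Dd v s, qq v s)).1.1 - LA (zz v s).1.2| <= (1 + C) * (3 + C) * zt,
        `|(Lz (Dd v s, qq v s)).1.2| <= (1 + C) * (3 + C) * zt,
        `|(Lz (Dd v s, qq v s)).2.1 - LK (zz v s).2.2| <= (1 + C) * (3 + C) * zt &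
        `|(Lz (Dd v s, qq v s)).2.2 - LV s (zz v s).2.1| <= (1 + C) * (3 + C) * zt].
  move=> sT zt; have zt0 : 0 <= zt by rewrite mulr_ge0 ?(ltW dl_gt0) ?normr_ge0.
  have r1 := ld_Dd ld v sT; rewrite -/(zeta v s) -/zt in r1.
  set rr := Dd v s - F (e v s) in r1.
  have r11 := le_trans (norm_fst _) r1; have r12 := le_trans (norm_snd _) r1.
  have pz := ph_zeta v sT; rewrite -/zt in pz.
  have pz1 := le_trans (norm_fst _) pz; have pz2 := le_trans (norm_snd _) pz.
  have qz := qq_close v sT; rewrite -/zt in qz.
  have qz1 := le_trans (norm_fst _) qz; have qz2 := le_trans (norm_snd _) qz.
  have [F1 F2] := Fe v s.
  have DE : Dd v s = F (e v s) + rr by rewrite /rr addrC subrK.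
  have DE1 : (Dd v s).1 = (F (e v s)).1 + rr.1 by rewrite {1}DE.
  have DE2 : (Dd v s).2 = (F (e v s)).2 + rr.2 by rewrite {1}DE.
  have cz := mulr_ge0 C_ge0 zt0; have ccz := mulr_ge0 C_ge0 cz.
  rewrite /zz /Lz /=; split.
  - have -> : (Dd v s).1 + M0 (Dd v s).2 - LA (ph v s).1 =
      rr.1 + M0 rr.2 - LA ((ph v s).1 - (e v s).1).
      by rewrite DE1 DE2 F1 F2; apply: algW; exact: FM.
    apply: le_trans (ler_normB _ _) _; apply: le_trans (lerD (ler_normD _ _) (lexx _)) _.
    have := le_trans (bM rr.2) (ler_wpM2l C_ge0 r12).
    have := le_trans (bLA ((ph v s).1 - (e v s).1)) (ler_wpM2l (sqr_ge0 C) pz1).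
    lra.
  - have := qz1; rewrite /= subr0; lra.
  - have -> : (Dd v s).2 - LK ((ph v s).2 - N0 (ph v s).1) =
      rr.2 - LK (((ph v s).2 - (e v s).2) - N0 ((ph v s).1 - (e v s).1)).
      by rewrite DE2 F2; exact: algX.
    apply: le_trans (ler_normB _ _) _.
    have k2 : `|((ph v s).2 - (e v s).2) - N0 ((ph v s).1 - (e v s).1)| <= (1 + C) * zt.
      apply: le_trans (ler_normB _ _) _.
      have := le_trans (bN ((ph v s).1 - (e v s).1)) (ler_wpM2l C_ge0 pz1).
      by move: pz2 => /=; lra.
    have := le_trans (bLK _) (ler_wpM2l C_ge0 k2); move: r12; lra.
  - have -> : (qq v s).2 - N0 (qq v s).1 - LV s (eps *: (d v s).2) =
      ((qq v s).2 - LV s (eps *: d v s).2) - N0 ((qq v s).1 - 0) by rewrite subr0 addrAC.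
    apply: le_trans (ler_normB _ _) _.
    have := le_trans (bN ((qq v s).1 - 0)) (ler_wpM2l C_ge0 qz1).
    by move: qz2 => /=; lra.
have D0 : 0 <= (1 + C) * (3 + C) by rewrite mulr_ge0 //; lra.
have fin v s : eps * `|s| <= T ->
    (1 + C) * (3 + C) * (dl * zeta v s) <= cone_D * dl * `|zz v s|.
  move=> sT; rewrite /cone_D -[_ * dl * _]mulrA -[_ * (2 * _) * _]mulrA ler_wpM2l //.
  by rewrite mulrCA ler_wpM2l ?(ltW dl_gt0) //; exact: zeta_zz.
split.
- by split=> // [b|y]; [exact: (FN b).2|exact: le2].
- split=> [y|y|t y /tT tt|t y /tT tt]; [exact/le2/bLK|exact: FK| |].
    by apply: le2; have [] := ld_LV ld y tt.
  by have [] := ld_LV ld y tt.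
- split=> [t|v t /tT tt|v t /tT tt].
  + exact: linZs.
  + have := zz_derive v tt => dd; have := is_derive_affine dd.
    by rewrite scalerA mulVf ?gt_eqF // scale1r.
  + move=> zz0; have zl := zeta_zz v tt; rewrite zz0 normr0 mulr0 in zl.
    have [e1 e2] : d v (eps^-1 * t + 0) = 0 /\ e v (eps^-1 * t + 0) = 0.
      split; apply/eqP; rewrite -normr_le0; last exact: le_trans (zeta_e _ _) zl.
      have := le_trans (zeta_d _ _) zl; rewrite normrZ ger0_norm ?(ltW eps0) //.
      by rewrite pmulr_rle0.
    exact: (ld_inj ld tt).
- split=> v t /tT tt; have [x1 x2 x3 x4] := err v _ tt; apply: le_trans (fin v _ tt) => //.
(* The corrector changes neither [W] nor [X], and [W - M0 X] is eps dq1; so the slice consists of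
   the vectors with dq1 = 0, to which [ld_slice] applies. *)
- move=> v t /tT tt; set s := eps^-1 * t + 0 in tt *; rewrite /zz /Lz /= => wE.
  have d10 : (d v s).1 = 0.
    have : eps *: (d v s).1 = 0 by apply: (@addIr _ (M0 (eps *: (d v s).2))); rewrite wE add0r.
    by move/eqP; rewrite scaler_eq0 gt_eqF //= => /eqP.
  have [s1 s2] := ld_slice ld tt d10.
  have du : `|eps *: d v s| <= k1 * `|(e v s).1|.
    rewrite [d v s]surjective_pairing d10 pairZ scaler0; apply: norm_pair_le => //.
    by rewrite normr0 mulr_ge0 // ltW.
  have b0 := normr_ge0 (e v s).1.
  have pe : `|ph v s - e v s| <= 2^-1 * `|(e v s).1|.
    apply: le_trans (ph_close v tt) _; apply: le_trans (ler_wpM2l (ltW dl_gt0) du) _.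
    by rewrite mulrA ler_wpM2r.
  have pe1 := le_trans (norm_fst _) pe; have pe2 := le_trans (norm_snd _) pe.
  have bB : `|(e v s).1| <= 2 * `|(ph v s).1|.
    have := ler_normB (ph v s).1 ((ph v s).1 - (e v s).1); rewrite subKr.
    by move: pe1 => /=; lra.
  have k1b := ler_wpM2l (ltW k10) bB.
  have n1 := bN (ph v s).1; have B0 := normr_ge0 (ph v s).1; have cB := mulr_ge0 C_ge0 B0.
  apply: norm_pair_le.
    by apply: le_trans s1 _; rewrite /cone_kap; lra.
  apply: le_trans (ler_normB _ _) _.
  have : `|(ph v s).2| <= `|(e v s).2| + 2^-1 * `|(e v s).1|.
    have := ler_normD (e v s).2 ((ph v s).2 - (e v s).2); rewrite addrC subrK.
    by move: pe2 => /=; lra.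
  by rewrite /cone_kap; lra.
Qed.

End Family.

(** All terms are bounded by multiples of [s + x + y]; since [eta1 * K2] is at most 1/2, the part in
    [x + y] is absorbed on the left, which doubles the constant. *)
Let cone_arith (K2 eta1 s w x b y zt Y W B dl : R) : 0 <= x -> 0 <= y -> 0 <= w -> 0 <= b ->
  0 <= zt -> 0 < eta1 <= 1 -> 0 <= dl <= eta1 -> s = w + b -> K2 = 4 + 4 * C + (1 + C) ^+ 2 ->
  eta1 * K2 <= 2^-1 ->
  zt <= w + x + (1 + C) * b + y -> W <= w + C * x -> B <= b + dl * zt ->
  x <= eta1 * (W + B) -> Y <= eta1 * (W + B) -> y <= Y + (1 + C) * (dl * zt) ->
  x + y <= 2 * (eta1 * K2) * s.
Proof.
have C1' := C1.
move=> x0 y0 w0 b0 zt0 /andP[e0 e1] /andP[dl0 dle] sE KE eK hzt hW hB hx hY hy.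
have S0 : 0 <= s + x + y by lra.
have cb := mulr_ge0 (le_trans ler01 C1) b0; have cx := mulr_ge0 (le_trans ler01 C1) x0.
have cw := mulr_ge0 (le_trans ler01 C1) w0; have cy := mulr_ge0 (le_trans ler01 C1) y0.
have dz : dl * zt <= eta1 * ((1 + C) * (s + x + y)).
  apply: ler_pM => //; rewrite sE; lra.
have dz2 : dl * zt <= (1 + C) * (s + x + y).
  apply: le_trans dz _; apply: ler_piMl => //; apply: mulr_ge0 => //; lra.
have hWB : W + B <= (2 + 2 * C) * (s + x + y) by rewrite sE in dz2 *; lra.
have h1 := ler_wpM2l (ltW e0) hWB.
have h2 : (1 + C) * (dl * zt) <= (1 + C) * (eta1 * ((1 + C) * (s + x + y))).
  by apply: ler_wpM2l => //; lra.
have h3 : x + y <= eta1 * K2 * (s + x + y) by rewrite KE; lra.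
have h4 : eta1 * K2 * (x + y) <= 2^-1 * (x + y) by apply: ler_wpM2r => //; lra.
lra.
Qed.

(** At time 0 the corrector is undone: it perturbs dp by [dl] times the size of the vector, and
    [dl <= eta1] makes this negligible in the cone. [T] and [dl0] are chosen before [eps] and before
    the family. *)
Lemma cone_conclusion (eta : R) : 0 < eta -> exists T dl0 : R, [/\ 0 < T, 0 < dl0 &
  forall (eps dl : R) d e Dd kk g chi ghat LV, 0 < eps -> 0 < dl <= dl0 ->
  linearised_data eps dl T d e Dd kk g chi ghat LV -> forall v,
  `|eps *: (d v 0).2| + `|(e v 0).2 - N0 (e v 0).1| <= eta * (`|eps *: (d v 0).1| + `|(e v 0).1|)].
Proof.
move=> eta0; have C1' := C1; have C00 : 0 <= C by lra.
pose K2 := 4 + 4 * C + (1 + C) ^+ 2; have K20 : 0 < K2.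
  by rewrite /K2 ltr_wpDr ?sqr_ge0 //; lra.
pose eta1 := Num.min 1 (Num.min (1 / (2 * K2)) (eta / (2 * K2))).
have K22 : 0 < 2 * K2 by lra.
have e10 : 0 < eta1 by rewrite !lt_min ltr01 !divr_gt0.
have e11 : eta1 <= 1 by rewrite ge_min lexx.
have e12 : eta1 * K2 <= 2^-1.
  have : eta1 <= 1 / (2 * K2) by rewrite !ge_min lexx !orbT.
  by rewrite ler_pdivlMr //; lra.
have e13 : 2 * (eta1 * K2) <= eta.
  have : eta1 <= eta / (2 * K2) by rewrite !ge_min lexx !orbT.
  by rewrite ler_pdivlMr //; lra.
move: eta1 e10 e11 e12 e13 => eta1 e10 e11 e12 e13.
have kap0 : 0 < cone_kap by rewrite /cone_kap; have := k10; lra.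
have CC0 : 0 < cone_C by rewrite /cone_C exprn_gt0 //; lra.
have [T [d0 [T0 d00 hc]]] := @cone_lemma R m r cone_C cA cK cV cone_kap eta1
  CC0 cA0 cK0 cV0 kap0 e10.
have D0 : 0 < cone_D by rewrite /cone_D !mulr_gt0 //; lra.
exists T, (Num.min (Num.min 1 eta1) (Num.min (1 / (2 * k1)) (d0 / cone_D))); split=> //.
  by rewrite !lt_min ltr01 e10 /= !divr_gt0 // mulr_gt0.
move=> eps dl d e Dd kk g chi ghat LV eps0 /andP[dl0]; rewrite !le_min.
move=> /andP[/andP[dl1 dl2] /andP[dl3 dl4]] ld v.
have dl01 : 0 < dl <= 1 by rewrite dl0.
have dlk : dl * k1 <= 2^-1.
  by move: dl3; rewrite ler_pdivlMr ?mulr_gt0 //; lra.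
have dlD : 0 < cone_D * dl <= d0.
  by rewrite mulr_gt0 //= mulrC -ler_pdivlMr.
have fam := build_family eps0 dl01 dlk ld.
have s0 : eps * `|0 : R| <= T by rewrite normr0 mulr0 ltW.
have [ph [hv pz]] : exists ph : pt R m r,
    `|(Lz (eps *: d v 0, ph)).2| <=
      eta1 * (`|(Lz (eps *: d v 0, ph)).1.1| + `|(Lz (eps *: d v 0, ph)).1.2|) /\
    `|ph - e v 0| <= dl * `|(eps *: d v 0, e v 0)|.
  exists (e v 0 - eps *: chi 0 (eps *: d v 0)); split; last exact: (ph_zeta dl01 ld v s0).
  by have := hc _ _ _ _ _ _ _ dlD fam v; rewrite mulr0 addr0.
have hx := le_trans (norm_fst _) hv; have hY := le_trans (norm_snd _) hv.
rewrite /= in hx hY.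
have pz1 := le_trans (norm_fst _) pz; have pz2 := le_trans (norm_snd _) pz; rewrite /= in pz1 pz2.
apply: le_trans (ler_wpM2r (addr_ge0 (normr_ge0 _) (normr_ge0 _)) e13).
apply: (@cone_arith K2 eta1 (`|eps *: (d v 0).1| + `|(e v 0).1|) `|eps *: (d v 0).1|
  `|eps *: (d v 0).2| `|(e v 0).1| `|(e v 0).2 - N0 (e v 0).1| `|(eps *: d v 0, e v 0)|
  `|ph.2 - N0 ph.1| `|eps *: (d v 0).1 + M0 (eps *: (d v 0).2)| `|ph.1| dl) => //.
- by rewrite e10.
- by rewrite (ltW dl0).
- have e2 : `|(e v 0).2| <= `|(e v 0).2 - N0 (e v 0).1| + C * `|(e v 0).1|.
    have := ler_normD ((e v 0).2 - N0 (e v 0).1) (N0 (e v 0).1); rewrite subrK => k.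
    by apply: le_trans k _; rewrite lerD2l.
  have p1 := normr_ge0 (eps *: (d v 0).1); have p2 := normr_ge0 (eps *: (d v 0).2).
  have p3 := normr_ge0 ((e v 0).2 - N0 (e v 0).1); have p4 := normr_ge0 (e v 0).1.
  have p5 := mulr_ge0 C00 p4.
  have [a1 a2 a3 a4] := norm_arith p1 p2 p3 p4 p5 e2.
  apply: norm_pair_le.
    rewrite [d v 0]surjective_pairing pairZ; exact: norm_pair_le.
  by rewrite [e v 0]surjective_pairing; apply: norm_pair_le.
- by apply: le_trans (ler_normD _ _) _; rewrite lerD2l.
- have := ler_normD (ph.1 - (e v 0).1) (e v 0).1; rewrite subrK; lra.
- have -> : (e v 0).2 - N0 (e v 0).1 = (ph.2 - N0 ph.1) -
    ((ph.2 - (e v 0).2) - N0 (ph.1 - (e v 0).1)) by rewrite (linB _ _ linN); crd_ring.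
  apply: le_trans (ler_normB _ _) _; rewrite lerD2l.
  apply: le_trans (ler_normB _ _) _.
  by have := le_trans (bN (ph.1 - (e v 0).1)) (ler_wpM2l C00 pz1); lra.
Qed.

End ConeBuild.

(** * Averaging along the orbits *)

Section Corrector.
Context {R : realType} {U W : normedModType R} {fU : fdim U} {fW : fdim W}.
Context (g : R -> U -> W) (Cg S T' : R) (T'0 : 0 < T') (Cg0 : 0 <= Cg).
Context (ling : forall s, linear (g s)) (cg : forall u, continuous (fun s => g s u)).
Context (bg : forall (s : R) u, `|s| <= S -> `|g s u| <= Cg * `|u|).

Lemma sum_crd_le (a : 'I_(fd_n U) -> W) (u : U) (e : R) : 0 <= e ->
  (forall k, `|a k| <= e) -> `|\sum_k crd k u *: a k| <= (fd_n U)%:R * e * `|u|.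
Proof.
move=> e0 ha; apply: le_trans (ler_norm_sum _ _ _) _.
apply: (@le_trans _ _ (\sum_(k < fd_n U) (e * `|u|))); last first.
  by rewrite sumr_const card_ord -[leLHS]mulr_natl mulrA.
apply: ler_sum => k _; rewrite normrZ mulrC; apply: ler_pM => //; exact: crd_le.
Qed.

Lemma sum_crd_linear (a : 'I_(fd_n U) -> W) : linear (fun u => \sum_k crd k u *: a k).
Proof.
move=> c u v; rewrite scaler_sumr -big_split; apply: eq_bigr => k _ /=.
by rewrite crdD crdZ scalerDl scalerA.
Qed.

Lemma sum_crd_derive (a a' : R -> 'I_(fd_n U) -> W) (u : R -> U) u' (s : R) :
  (forall k, is_derive s (1 : R) (a ^~ k) (a' s k)) -> is_derive s (1 : R) u u' ->
  is_derive s (1 : R) (fun s => \sum_k crd k (u s) *: a s k)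
    (\sum_k crd k u' *: a s k + \sum_k crd k (u s) *: a' s k).
Proof.
move=> da du; apply: crd_is_derive => j.
rewrite crdD !crd_sum -big_split /=.
have h k : is_derive s (1 : R) (fun s => crd k (u s) * crd j (a s k))
    (crd j (crd k u' *: a s k) + crd j (crd k (u s) *: a' s k)).
  have h1 := is_derive_crd k du; have h2 := is_derive_crd j (da k).
  have := @is_deriveM _ _ _ _ _ _ _ _ h1 h2.
  by rewrite /GRing.scale /= !crdZ addrC [crd j _ * _]mulrC.
have := @is_derive_sum _ _ _ _ (fun k t => crd k (u t) * crd j (a t k)) s 1 _ h.
apply: is_derive_ext => t; rewrite fct_sumE crd_sum; apply: eq_bigr => k _.
by rewrite crdZ.
Qed.

Lemma linear_basis (L : U -> W) u : linear L -> L u = \sum_k crd k u *: L (bvec k).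
Proof.
move=> lL; rewrite {1}(crd_basis u).
elim/big_rec2: _ => [|k y x _ IH]; first by have := linB 0 0 lL; rewrite !subrr.
by rewrite lL IH.
Qed.

(** Moving averages: with Gam a primitive of [g], [ghat s] is the mean of [g] over [s, s + T'], and
    [chi s] is Gam minus its mean over the same window, so that its derivative is [g - ghat]. The
    bound on [chi] is linear in [T'] and involves no inverse of a frequency combination. Operators
    are handled through their values on the basis. *)
Lemma corrector : exists chi ghat : R -> U -> W,
  [/\ forall s, linear (chi s),
      forall (s : R) u, `|s| + T' <= S -> `|chi s u| <= (fd_n U)%:R * (Cg * T') * `|u|,
      forall (u : R -> U) u' (s : R), is_derive s (1 : R) u u' ->
        is_derive s (1 : R) (fun s => chi s (u s)) (chi s u' + g s (u s) - ghat s (u s)) &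
      forall (s e : R) (A : U -> W), 0 <= e -> linear A ->
        (forall k (Gam : R -> W), (forall t : R, is_derive t (1 : R) Gam (g t (bvec k))) ->
          `|Gam (s + T') - Gam s - T' *: A (bvec k)| <= e * T') ->
        forall u, `|ghat s u - A u| <= (fd_n U)%:R * e * `|u|].
Proof.
have exG k : exists Gam : R -> W, forall s : R, is_derive s (1 : R) Gam (g s (bvec k)).
  by have [Gam [_ h]] := primitive 0 (@cg (bvec k)); exists Gam.
have [Gam dGam] := choice exG.
have exL k : exists Lam : R -> W, forall s : R, is_derive s (1 : R) Lam (Gam k s).
  have cG : continuous (Gam k) by move=> s; exact: eps_der_continuous (dGam k s).
  by have [Lam [_ h]] := primitive 0 cG; exists Lam.
have [Lam dLam] := choice exL.
pose ck (s : R) k := Gam k s - T'^-1 *: (Lam k (s + T') - Lam k s).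
pose gk (s : R) k := T'^-1 *: (Gam k (s + T') - Gam k s).
have shift (F F' : R -> W) (s : R) : (forall t : R, is_derive t (1 : R) F (F' t)) ->
    is_derive s (1 : R) (fun s => F (s + T')) (F' (s + T')).
  move=> dF; have := dF (1 * s + T') => /is_derive_affine; rewrite scale1r mul1r.
  by apply: is_derive_ext => t; rewrite mul1r.
have dck k (s : R) : is_derive s (1 : R) (ck ^~ k) (g s (bvec k) - gk s k).
  have h1 := dGam k s; have h2 := shift _ _ s (dLam k); have h3 := dLam k s.
  have h4 := is_deriveB h2 h3; have h5 := is_deriveZ T'^-1 h4.
  exact: is_deriveB.
exists (fun s u => \sum_k crd k u *: ck s k), (fun s u => \sum_k crd k u *: gk s k); split.
- by move=> s; exact: sum_crd_linear.
- move=> s u sS; apply: sum_crd_le; first by rewrite mulr_ge0 // ltW.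
  move=> k.
  have bG (t : R) : s <= t <= s + T' -> `|Gam k t - Gam k s| <= Cg * T'.
    move=> /andP[t1 t2].
    have := @mean_value_const R W fW (Gam k) (fun t => g t (bvec k)) Cg s t t1.
    move=> h; apply: le_trans (h _ _) _.
    + move=> v /andP[v1 v2]; apply: le_trans (bg _ _) _.
        rewrite ler_norml; have := ler_norm s; have := ler_norm (- s); rewrite normrN; lra.
      by rewrite ler_piMr // bvec_norm.
    + by apply: ler_wpM2l => //; lra.
  rewrite /ck.
  (* Up to sign, the corrector is the mean over the window of [Gam k t - Gam k s], bounded by
     [Cg * T'] however large [Gam] itself may be. *)
  have -> : Gam k s - T'^-1 *: (Lam k (s + T') - Lam k s) =
    - (T'^-1 *: (Lam k (s + T') - (s + T') *: Gam k s - (Lam k s - s *: Gam k s))).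
    apply: crd_inj => j; rewrite !(crdD, crdN, crdZ); field; exact: lt0r_neq0.
  rewrite normrN normrZ ger0_norm ?invr_ge0 ?(ltW T'0) // mulrC ler_pdivrMr //.
  have sT : s <= s + T' by rewrite lerDl ltW.
  have := @mean_value_const R W fW (fun t => Lam k t - t *: Gam k s)
    (fun t => Gam k t - Gam k s) (Cg * T') s (s + T') sT.
  have -> : s + T' - s = T' by ring.
  apply=> t tT; last exact: bG.
  by have h1 := dLam k t; have h2 := scale_derive (Gam k s) t; exact: is_deriveB.
- move=> u u' s du; have := sum_crd_derive (a' := fun s k => g s (bvec k) - gk s k) (fun k => dck k s) du.
  rewrite (linear_basis (u s) (ling s)) -addrA -sumrB; congr is_derive; congr (_ + _).
  by apply: eq_bigr => k _; rewrite scalerBr.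
- move=> s e A e0 linA hA u; rewrite (linear_basis u linA) -sumrB.
  under eq_bigr do rewrite -scalerBr.
  apply: sum_crd_le => // k; rewrite /gk.
  have := hA k (Gam k) (dGam k); move=> h.
  have -> : T'^-1 *: (Gam k (s + T') - Gam k s) - A (bvec k) =
     T'^-1 *: (Gam k (s + T') - Gam k s - T' *: A (bvec k)).
    by rewrite [RHS]scalerBr scalerA mulVf ?gt_eqF // scale1r.
  by rewrite normrZ ger0_norm ?invr_ge0 ?(ltW T'0) // mulrC ler_pdivrMr.
Qed.

End Corrector.

Section RowForm.
Context {R : realType} {n : nat} {S : 'rV[R]_n -> 'rV[R]_n -> R}.

Lemma row_form_linear : (forall u a v w, S u (a *: v + w) = a * S u v + S u w) ->
  linear (fun x => \row_j S (delta_mx 0 j) x).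
Proof. by move=> h a u v; apply/rowP => j; rewrite !mxE h. Qed.

Lemma row_form_dot x : (forall w a u v, S (a *: u + v) w = a * S u w + S v w) ->
  (forall u a v w, S u (a *: v + w) = a * S u v + S u w) ->
  dot (\row_j S (delta_mx 0 j) x) x = S x x.
Proof.
move=> h1 h2; have ex := bilin_expand h1 h2; rewrite (ex x x) /dot; apply: eq_bigr => i _.
rewrite mxE ex (bigD1 i) //= [X in _ + X]big1 ?addr0 => [|l li].
  by rewrite mulr_suml; apply: eq_bigr => j _; rewrite mxE !eqxx mul1r; ring.
by apply: big1 => j _; rewrite mxE eqxx /= (negPf li) !mul0r.
Qed.

End RowForm.

(** * The averaged Hessian and its approximation over a window *)

Section Window.
Context {R : realType} {m r : nat}.
Context (G : ext R m r -> R) (p0 : pt R m r) (omega : 'rV[R]_m).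
Context (GC : Ck_on 2 setT G) (pG : periodic_for extlat G).
Let om : 'rV[R]_m.+1 := row_mx (1%:M : 'rV[R]_1) omega.
Context (nonres : forall k : 'rV[int]_m.+1, k != 0 -> dot (zvec R k) om != 0).

Definition gqq (k : 'I_(fd_n (pt R m r))) z : pt R m r := 'd (gQ G) z (qdir (bvec k)).
Definition LVq (q x : 'rV[R]_r) : 'rV[R]_r := \row_j avg_hess p0 G q (delta_mx 0 j) x.

Lemma crd_gqq j k z : crd j (gqq k z) =
  'D_(qdir (bvec k)) (fun y => 'D_(qdir (bvec j)) G y) z.
Proof.
rewrite /gqq; have [|_ ->] := @diff_crd R (ext R m r) (pt R m r) (fd_ext R m r) (fd_pt R m r) (gQ G) z.
  move=> i; have -> : (fun y => crd i (gQ G y)) = (fun y => 'D_(qdir (bvec i)) G y).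
    by apply/funext => y; rewrite gQ_crd.
  exact: (Ck2_D _ GC).1.
have -> : (fun y => crd j (gQ G y)) = (fun y => 'D_(qdir (bvec j)) G y).
  by apply/funext => y; rewrite gQ_crd.
by rewrite deriveE //; exact: (Ck2_D _ GC).1.
Qed.

Lemma crd_gqq_fun j k : (fun z => crd j (gqq k z)) =
  (fun z => 'D_(qdir (bvec k)) (fun y => 'D_(qdir (bvec j)) G y) z).
Proof. by apply/funext => z; exact: crd_gqq. Qed.

Lemma gqq_periodic j k : periodic_for extlat (fun z => crd j (gqq k z)).
Proof. by rewrite crd_gqq_fun; apply: periodic_derive; exact: periodic_derive. Qed.

Lemma gqq_continuous j k : continuous (fun z => crd j (gqq k z)).
Proof. by rewrite crd_gqq_fun; apply: C1_D_continuous; exact: Ck2_D. Qed.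

Lemma pt_bvec (k : 'I_(fd_n (pt R m r))) :
  (exists2 v, bvec k = (v, 0) & forall x, crd k (0, x) = 0) \/
  exists j : 'I_r, bvec k = (0, delta_mx 0 j) /\ forall u, crd k u = u.2 0 j.
Proof.
case: (split_ordP (k : 'I_(m + r))) => i ->; [left|right].
  exists (@bvec R 'rV[R]_m (fdim_rV R m) i); first exact: (@bvec_pairl R 'rV[R]_m 'rV[R]_r (fdim_rV R m) (fdim_rV R r) i).
  move=> x; rewrite (@crd_pairl R 'rV[R]_m 'rV[R]_r (fdim_rV R m) (fdim_rV R r) i).
  by rewrite /crd /= mxE.
exists i; split.
  by rewrite (@bvec_pairr R 'rV[R]_m 'rV[R]_r (fdim_rV R m) (fdim_rV R r) i).
by move=> u; rewrite (@crd_pairr R 'rV[R]_m 'rV[R]_r (fdim_rV R m) (fdim_rV R r) i).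
Qed.

Let hess_per v w : periodic_for extlat (fun z => hess G z v w).
Proof. by apply: periodic_derive; exact: periodic_derive. Qed.

Let hess_cont v w : continuous (fun z => hess G z v w).
Proof. by apply: C1_D_continuous; exact: Ck2_D. Qed.

Lemma avg_hess_linr q u a v w : avg_hess p0 G q u (a *: v + w) =
  a * avg_hess p0 G q u v + avg_hess p0 G q u w.
Proof.
rewrite [RHS]addrC /avg_hess -avg_lin //; [|exact: hess_cont..].
by congr avg; apply/funext => z; rewrite q2dirP hess_linr // addrC.
Qed.

Lemma avg_hess_linl q w a u v : avg_hess p0 G q (a *: u + v) w =
  a * avg_hess p0 G q u w + avg_hess p0 G q v w.
Proof.
rewrite [RHS]addrC /avg_hess -avg_lin //; [|exact: hess_cont..].
by congr avg; apply/funext => z; rewrite q2dirP hess_linl // addrC.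
Qed.

Lemma LVqE q x j : LVq q x 0 j = avg_hess p0 G q (delta_mx 0 j) x.
Proof. by rewrite /LVq; move: (avg_hess p0 G q) => S; rewrite mxE. Qed.

Lemma LVq_linear q : linear (LVq q).
Proof. exact: (row_form_linear (avg_hess_linr q)). Qed.

Lemma LVq_dot q x : dot (LVq q x) x = avg_hess p0 G q x x.
Proof. exact: (row_form_dot x (avg_hess_linl q) (avg_hess_linr q)). Qed.

(** Every entry of the Hessian with at least one derivative in q1 has zero average, so only the
    block in q2 survives, and it is the Hessian of the averaged potential. *)
Lemma avg_gqq (j k : 'I_(fd_n (pt R m r))) q :
  avg p0 (fun z => crd j (gqq k z)) q = crd j ((0, LVq q (bvec k).2) : pt R m r).
Proof.
rewrite crd_gqq_fun.
have [[v -> _]|[i [-> _]]] := pt_bvec k.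
  have -> : LVq q ((v, 0) : pt R m r).2 = 0.
    by have := linB 0 0 (LVq_linear q); rewrite !subrr.
  rewrite (_ : (0, 0) = 0 :> pt R m r) // crd0.
  exact: (@avg_q1_derive R m r p0 om (fun y => 'D_(qdir (bvec j)) G y) v q nonres
    (periodic_derive _ pG) (Ck2_D _ GC)).
(* When the inner derivative is the one in q1, its average vanishes for all [q], and so does the
   derivative of this average in q2. *)
have [[v jE c0]|[i' [jE c1]]] := pt_bvec j.
  rewrite c0 jE.
  have := @avg_derive R m r p0 (fun z => 'D_(q1dir v) G z) (delta_mx 0 i) q
    (periodic_derive (q1dir v) pG) (Ck2_D (q1dir v) GC).
  have -> : avg p0 (fun z => 'D_(q1dir v) G z) = cst 0.
    apply/funext => q'; exact: (@avg_q1_derive R m r p0 om G v q' nonres pG (Ck2_1 GC)).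
  by move=> [_ <-]; rewrite derive_cst.
have E : crd j ((0, LVq q (delta_mx 0 i)) : pt R m r) =
    avg_hess p0 G q (delta_mx 0 i') (delta_mx 0 i).
  by rewrite c1; exact: LVqE.
rewrite jE; apply: eq_trans (esym E); reflexivity.
Qed.

Lemma LVq_bound : exists2 C : R, 0 < C & forall q x, `|LVq q x| <= C * `|x|.
Proof.
have ts := tame_strip p0 0.
have ex i : exists2 C : R, 0 <= C & forall z v, strip p0 0 z ->
    `|'d (fun y => 'D_(q2dir (delta_mx 0 i)) G y) z v| <= C * `|v|.
  exact: (C1_diff_bound ts (periodic_derive _ pG) (Ck2_D _ GC)).
have ex2 i : exists C : R, 0 <= C /\ forall z v, strip p0 0 z ->
    `|'d (fun y => 'D_(q2dir (delta_mx 0 i)) G y) z v| <= C * `|v|.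
  by have [C0 h1 h2] := ex i; exists C0.
have [C hC] := choice ex2; exists (1 + \sum_i C i).
  by rewrite ltr_pwDl // sumr_ge0 // => i _; have [] := hC i.
have Cs0 : 0 <= \sum_i C i by apply: sumr_ge0 => i _; have [] := hC i.
move=> q x; apply: rv_norm_le => [|j]; first by rewrite mulr_ge0 // addr_ge0.
rewrite mxE /avg_hess /avg; have [Cj0 hj] := hC j.
have c0 : continuous (fun _ : ext R m r => 0 : R) by exact: cst_continuous.
have z0 : avg p0 (fun _ : ext R m r => 0) q = 0.
  have := @avg_lin R m r p0 (fun=> 0) (fun=> 0) (-1) q (fun _ _ _ => erefl) c0 (fun _ _ _ => erefl) c0.
  have -> : (fun _ : ext R m r => 0 + -1 * 0 : R) = fun=> 0 by apply/funext => z; rewrite mulr0 addr0.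
  by move: (avg p0 _ q) => y; lra.
rewrite -[X in `|X|]subr0 -[X in `|_ - X|]z0 /avg; apply: torus_integral_dist.
- exact: (emb_unif_on p0 q (hess_per _ _) (@hess_cont _ _)).
- by move=> e e0; exists 1 => // ? ? _ _; rewrite subrr normr0 ltW.
move=> y; rewrite subr0 /hess deriveE; last exact: (Ck2_D _ GC).1.
apply: le_trans (hj _ _ _) _.
  by have := emb_strip p0 y q.
apply: ler_pM => //.
  rewrite (bigD1 j) //= -[leLHS]add0r; apply: lerD => //; rewrite lerDl sumr_ge0 // => i _.
  by have [] := hC i.
rewrite /q2dir; apply: norm_pair_le; last by rewrite normr0.
by apply: norm_pair_le; [rewrite normr0|apply: norm_pair_le => //; rewrite normr0].
Qed.

(** The Hessian has finitely many entries, each equidistributed for all large times, so a single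
    window serves them all. *)
Lemma window_time (N e : R) : 0 < e -> exists2 T' : R, 1 <= T' &
  forall j k q x (F : R -> R), `|q| <= N ->
    (forall s : R, is_derive s (1 : R) F (crd j (gqq k (emb p0 (x + s *: om) q)))) ->
    `|F T' - F 0 - T' * crd j ((0, LVq q (bvec k).2) : pt R m r)| <= e * T'.
Proof.
move=> e0.
have near_all : \forall T \near +oo%R, forall jk : 'I_(fd_n (pt R m r)) * 'I_(fd_n (pt R m r)),
   forall q, `|q| <= N -> forall x (F : R -> R),
     (forall s : R, is_derive s (1 : R) F (crd jk.1 (gqq jk.2 (emb p0 (x + s *: om) q)))) ->
     `|F T - F 0 - T * avg p0 (fun z => crd jk.1 (gqq jk.2 z)) q| <= e * T.
  apply: filter_forall => jk.
  exact: (@weyl_strip R m r p0 om (fun z => crd jk.1 (gqq jk.2 z)) N e nonres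
    (gqq_periodic _ _) (@gqq_continuous _ _) e0).
have [T' [h1 h2]] := filter_ex (filterI near_all (nbhs_pinfty_ge (num_real (1 : R)))).
exists T' => // j k q x F qN dF; rewrite -avg_gqq; exact: (h1 (j, k)).
Qed.

End Window.

Lemma is_derive_sub (R : realType) (V : normedModType R) (f g : R -> V) (s : R) (a b : V) :
  is_derive s (1 : R) f a -> is_derive s (1 : R) g b ->
  is_derive s (1 : R) (fun t => f t - g t) (a - b).
Proof. by move=> h1 h2; exact: is_deriveB. Qed.

Section WindowOrbit.
Context {R : realType} {m r : nat}.
Context (G : ext R m r -> R) (p0 : pt R m r) (omega : 'rV[R]_m).
Context (GC : Ck_on 2 setT G) (pG : periodic_for extlat G).
Let om : 'rV[R]_m.+1 := row_mx (1%:M : 'rV[R]_1) omega.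
Context (nonres : forall k : 'rV[int]_m.+1, k != 0 -> dot (zvec R k) om != 0).

Lemma emb_line (w : R * pt R m r) : exists x : 'rV[R]_m.+1,
  forall s : R, emb p0 (x + s *: om) w.2.2 = (w + s *: (1, (omega, 0)), p0).
Proof.
case: w => [t [q1 q2]] /=; exists (row_mx (t%:M : 'rV[R]_1) q1) => u.
rewrite /emb /om.
have -> : row_mx (t%:M : 'rV[R]_1) q1 + u *: row_mx (1%:M : 'rV[R]_1) omega =
  row_mx ((t + u)%:M : 'rV[R]_1) (q1 + u *: omega).
  rewrite scale_row_mx add_row_mx; congr row_mx.
  by apply/matrixP => i k; rewrite !ord1 !mxE eqxx !mulr1n mulr1.
rewrite row_mx0 row_mxKr !pairZ !pairD scaler0 addr0; congr (_, _, _).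
by rewrite !mxE eqxx mulr1n -[u *: 1]/(u * 1) mulr1.
Qed.

(** The window [T'] is fixed first; a velocity close to (1, omega, 0) and a momentum close to [p0]
    then keep the orbit within [d] of the straight line through its starting point. One [e] comes
    from equidistribution on that line, the other one from the deviation of the orbit. *)
Lemma window_orbit (N e : R) : 0 < e -> exists T' d : R, [/\ 1 <= T', 0 < d &
  forall (z z' : R -> ext R m r) (s rho : R), rho * T' < d -> `|(z s).1.2.2| <= N ->
    (forall u : R, s <= u <= s + T' -> is_derive u (1 : R) z (z' u)) ->
    (forall u : R, s <= u <= s + T' -> `|(z' u).1 - (1, (omega, 0))| <= rho) ->
    (forall u : R, s <= u <= s + T' -> `|(z u).2 - p0| < d) ->
    forall k (Gam : R -> pt R m r),
      (forall u : R, is_derive u (1 : R) Gam (gqq G k (z u))) ->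
      `|Gam (s + T') - Gam s - T' *: (0, LVq G p0 (z s).1.2.2 (bvec k).2)| <= 2 * e * T'].
Proof.
move=> e0; have [T' T1 hT] := window_time p0 GC pG nonres N e0.
have [jk d d' /andP[d'0 dd'] K x y Sx xy|jk|d d0 hd] := @fin_common_delta R
  ('I_(fd_n (pt R m r)) * 'I_(fd_n (pt R m r)))%type
  (fun jk d => forall x y, strip p0 0 x -> `|y - x| < d ->
     `|crd jk.1 (gqq G jk.2 y) - crd jk.1 (gqq G jk.2 x)| <= e).
- by apply: K => //; exact: lt_le_trans xy dd'.
- exact: (tame_unif (tame_strip p0 0) (gqq_periodic GC pG jk.1 jk.2) (@gqq_continuous _ _ _ _ GC jk.1 jk.2) e0).
exists T', d; split=> // z z' s rho rd qN dz zrho zp k Gam dG.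
have T0 : 0 <= T' by lra.
have rho0 : 0 <= rho.
  apply: le_trans (normr_ge0 _) (zrho s _); rewrite lexx lerDl //.
have [x hx] := emb_line (z s).1.
apply: norm_le_crd; first by rewrite !mulr_ge0 // ltW.
move=> j; rewrite !crdB crdZ.
have cF : continuous (fun u : R => crd j (gqq G k (emb p0 (x + u *: om) (z s).1.2.2))).
  move=> u; have cl := scale_derive ((1, (omega, 0)) : R * pt R m r) u.
  have -> : (fun u : R => crd j (gqq G k (emb p0 (x + u *: om) (z s).1.2.2))) =
      (fun y => crd j (gqq G k y)) \o (fun u : R => ((z s).1 + u *: (1, (omega, 0)), p0)).
    by apply/funext => v /=; rewrite hx.
  apply: continuous_comp; last exact: (@gqq_continuous _ _ _ _ GC j k).
  apply/cont_epsP => e1 e10.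
  have [d1 d10 h1] := (cont_epsP _ _).1 (eps_der_continuous cl) e1 e10.
  exists d1 => // y yu; rewrite pairN pairD subrr; apply: norm_pair_le; last by rewrite normr0 ltW.
  by rewrite opprD addrACA subrr add0r; exact: h1.
have [F [_ dF]] := real_primitive cF.
have k1 := hT j k _ x F qN dF.
have dist (u : R) : 0 <= u <= T' ->
   `|z (s + u) - emb p0 (x + u *: om) (z s).1.2.2| < d.
  move=> /andP[u0 uT]; rewrite hx [z (s + u)]surjective_pairing pairN pairD.
  have k2 : `|(z (s + u)).1 - ((z s).1 + u *: (1, (omega, 0)))| <= rho * u.
    have := @mean_value_const R (R * pt R m r)%type (fdim_prod (fdim_R R) (fd_pt R m r))
      (fun v => (z (s + v)).1 - v *: (1, (omega, 0))) (fun v => (z' (s + v)).1 - (1, (omega, 0)))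
      rho 0 u u0.
    rewrite addr0 scale0r !subr0 opprD addrA [_ - (z s).1]addrAC; apply.
      move=> v /andP[v0 vu]; have sv : s <= s + v <= s + T' by lra.
      have h1 : is_derive v (1 : R) (fun v => (z (s + v)).1) (z' (s + v)).1.
        have := dz _ sv; have -> : s + v = 1 * v + s by rewrite mul1r addrC.
        move=> /is_derive_affine; rewrite scale1r.
        move=> /(@is_derive_lin R (ext R m r) (R * pt R m r)%type (fd_ext R m r) fst _ _ _ (fun _ _ _ => erefl)).
        by apply: is_derive_ext => w; rewrite mul1r addrC.
      have h2 := scale_derive ((1, (omega, 0)) : R * pt R m r) v.
      exact: is_deriveB.
    by move=> v /andP[v0 vu]; apply: zrho; lra.
  apply: le_lt_trans (_ : Num.max (rho * T') `|(z (s + u)).2 - p0| < d).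
    apply: norm_pair_le; rewrite le_max; apply/orP; [left|by right].
    by apply: le_trans k2 _; rewrite ler_wpM2l.
  by rewrite gt_max rd /=; apply: zp; lra.
have k3 : `|(crd j (Gam (s + T')) - F T') - (crd j (Gam (s + 0)) - F 0)| <= e * (T' - 0).
  apply: (@mean_value_const R R (fdim_R R) (fun v => crd j (Gam (s + v)) - F v)
    (fun v => crd j (gqq G k (z (s + v))) - crd j (gqq G k (emb p0 (x + v *: om) (z s).1.2.2)))) => //.
    move=> v vT; have h1 : is_derive v (1 : R) (fun v => crd j (Gam (s + v))) (crd j (gqq G k (z (s + v)))).
      have := dG (1 * v + s) => /is_derive_affine; rewrite scale1r mul1r [v + s]addrC.
      move=> /(is_derive_crd j); apply: is_derive_ext => w; by rewrite mul1r addrC.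
    exact: (is_derive_sub h1 (dF v)).
  move=> v vT; apply: (hd (j, k)); last exact: dist.
  exact: emb_strip.
rewrite addr0 subr0 in k3.
have E : crd j (Gam (s + T')) - crd j (Gam s) - T' * crd j ((0, LVq G p0 (z s).1.2.2 (bvec k).2) : pt R m r) =
  ((crd j (Gam (s + T')) - F T') - (crd j (Gam s) - F 0)) +
  (F T' - F 0 - T' * crd j ((0, LVq G p0 (z s).1.2.2 (bvec k).2) : pt R m r)).
  by move: (crd j (0, _)) => a; ring.
rewrite E; apply: le_trans (ler_normD _ _) _; move: k1 k3.
by move: (F T' - F 0 - _) (_ - F T' - _) => a b; lra.
Qed.

End WindowOrbit.

(** * The linearised time-one map on vectors of the cone *)

Section TimeOneEstimate.
Context {R : realType} {m r : nat}.
Context (C cV k1 : R) (C1 : 1 <= C).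
Context (F : pt R m r -> pt R m r) (N0 : 'rV[R]_m -> 'rV[R]_r).
Context (linF : linear F) (linN : linear N0).
Context (bF : forall u, `|F u| <= C * `|u|) (bN : forall b, `|N0 b| <= C * `|b|).
Context (eps dl T : R) (d e Dd kk : pt R m m -> R -> pt R m r)
    (g chi ghat : R -> pt R m r -> pt R m r) (LV : R -> 'rV[R]_r -> 'rV[R]_r).
Context (eps0 : 0 < eps <= 1) (epsT : eps <= T) (dl0 : 0 < dl <= 1).
Context (ld : linearised_data C cV k1 F eps dl T d e Dd kk g chi ghat LV).
Context (bg : forall (s : R) u, eps * `|s| <= T -> `|g s u| <= C * `|u|).

Let zeta v s := `|(eps *: d v s, e v s)|.
Let Kg := 2 * expR (2 * (C + 1)).
Let C_ge0 : 0 <= C. Proof. exact: le_trans ler01 C1. Qed.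
Let inT (s : R) : `|s| <= 1 -> eps * `|s| <= T.
Proof.
move=> s1; apply: le_trans epsT; have /andP[e0 _] := eps0.
by rewrite ler_piMr // ltW.
Qed.

Lemma zeta_growth v (s : R) : `|s| <= 1 -> zeta v s <= Kg * zeta v 0.
Proof.
move=> s1; have /andP[e0 e1] := eps0; have /andP[dl00 dl1] := dl0.
have := @gronwall R (phase R m r) (fdim_prod (fd_pt R m r) (fd_pt R m r))
  (fun s => (eps *: d v s, e v s))
  (fun s => (eps *: Dd v s, eps *: (g s (eps *: d v s) + kk v s))) (C + 1) 0 0 1.
have -> : 2 * (`|(eps *: d v 0, e v 0)| + 0 * 1) * expR (2 * (C + 1) * 1) = Kg * zeta v 0.
  by rewrite /Kg /zeta !mulr1 addr0; ring.
move=> h; apply: h => //; first by have := C_ge0; lra.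
- move=> u; rewrite subr0 => /inT uT.
  by apply: is_derive_pair; [apply: is_deriveZ; exact: (ld_d ld)|exact: (ld_e ld)].
- move=> u; rewrite subr0 addr0 => /inT uT.
  have z0 := normr_ge0 (eps *: d v u, e v u); rewrite -/(zeta v u) in z0 *.
  have n1 : `|eps *: d v u| <= zeta v u by exact: (norm_fst (eps *: d v u, e v u)).
  have n2 : `|e v u| <= zeta v u by exact: (norm_snd (eps *: d v u, e v u)).
  have dz : dl * zeta v u <= zeta v u by rewrite ler_piMl.
  have sc (y : pt R m r) : `|y| <= (C + 1) * zeta v u -> `|eps *: y| <= (C + 1) * zeta v u.
    by move=> hy; rewrite normrZ ger0_norm ?(ltW e0) //; apply: le_trans hy; rewrite ler_piMl.
  apply: norm_pair_le; apply: sc.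
    have k := ld_Dd ld v uT; rewrite -/(zeta v u) in k.
    have := ler_normD (Dd v u - F (e v u)) (F (e v u)); rewrite subrK.
    have := le_trans (bF (e v u)) (ler_wpM2l C_ge0 n2); lra.
  have k := ld_kk ld v uT; rewrite -/(zeta v u) in k.
  apply: le_trans (ler_normD _ _) _.
  have := le_trans (bg (eps *: d v u) uT) (ler_wpM2l C_ge0 n1); lra.
- by rewrite subr0.
Qed.

Definition t1_const := (C + 1) * (C + 1) * (2 * expR (2 * (C + 1))).

(** Unit time is only [eps] in slow time: dp is frozen up to O(eps), while dq advances by [F]
    applied to it. *)
Lemma time_one_drift v :
  `|e v 1 - e v 0| <= t1_const * (eps * zeta v 0) /\
  `|d v 1 - d v 0 - F (e v 0)| <= t1_const * ((dl + eps) * zeta v 0).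
Proof.
have /andP[e0 e1] := eps0; have /andP[dl00 dl1] := dl0; have c0 := C_ge0; have C1' := C1.
have Kg0 : 0 < Kg by rewrite mulr_gt0 // expR_gt0.
have z0 : 0 <= zeta v 0 by exact: normr_ge0.
have i1 (u : R) : 0 <= u <= 1 -> `|u| <= 1 by move=> /andP[? ?]; rewrite ger0_norm.
have KZ : 0 <= Kg * zeta v 0 by rewrite mulr_ge0 // ltW.
have E (u : R) : 0 <= u <= 1 -> `|e v u - e v 0| <= eps * ((C + 1) * (Kg * zeta v 0)).
  move=> /andP[u0 u1].
  have := @mean_value_const R (pt R m r) (fd_pt R m r) (e v)
    (fun s => eps *: (g s (eps *: d v s) + kk v s)) (eps * ((C + 1) * (Kg * zeta v 0))) 0 u u0.
  move=> hm; apply: le_trans (hm _ _) _.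
  - by move=> s /andP[s0 su]; apply: (ld_e ld); apply: inT; rewrite ger0_norm //; lra.
  - move=> s /andP[s0 su]; have s1 : `|s| <= 1 by rewrite ger0_norm //; lra.
    have sT := inT s1; have zg := zeta_growth v s1.
    rewrite normrZ ger0_norm ?(ltW e0) // ler_wpM2l ?(ltW e0) //.
    have k := ld_kk ld v sT; rewrite -/(zeta v s) in k.
    have n1 : `|eps *: d v s| <= zeta v s by exact: (norm_fst (eps *: d v s, e v s)).
    have zs0 : 0 <= zeta v s by exact: normr_ge0.
    have dz : dl * zeta v s <= zeta v s by rewrite ler_piMl.
    apply: le_trans (ler_normD _ _) _.
    have := le_trans (bg (eps *: d v s) sT) (ler_wpM2l C_ge0 n1).
    have := ler_wpM2l (_ : 0 <= C + 1) zg; rewrite addr_ge0 // => /(_ isT); lra.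
  - by rewrite subr0 ler_piMr // mulr_ge0 ?(ltW e0) // mulr_ge0 // addr_ge0.
have CK : (C + 1) * Kg <= t1_const.
  by rewrite /t1_const -/Kg ler_wpM2r ?(ltW Kg0) // ler_peMl //; lra.
split.
  apply: le_trans (E 1 _) _; first by rewrite ler01 lexx.
  have := ler_wpM2r (mulr_ge0 (ltW e0) z0) CK; lra.
have := @mean_value_const R (pt R m r) (fd_pt R m r) (fun s => d v s - s *: F (e v 0))
  (fun s => Dd v s - F (e v 0)) (t1_const * ((dl + eps) * zeta v 0)) 0 1 ler01.
rewrite scale0r scale1r !subr0 mulr1 [_ - d v 0]addrAC; apply=> s s01.
  apply: (is_derive_sub _ (scale_derive _ _)); apply: (ld_d ld); apply: inT; exact: i1.
have sT := inT (i1 s s01); have zg := zeta_growth v (i1 s s01).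
have k := ld_Dd ld v sT; rewrite -/(zeta v s) in k.
have -> : Dd v s - F (e v 0) = (Dd v s - F (e v s)) + F (e v s - e v 0).
  by rewrite (linB _ _ linF) addrA subrK.
apply: le_trans (ler_normD _ _) _.
have k2 := le_trans (bF (e v s - e v 0)) (ler_wpM2l C_ge0 (E s s01)).
have k3 := ler_wpM2l (ltW dl00) zg.
have k4 : C * ((C + 1) * Kg) <= t1_const.
  by rewrite /t1_const -/Kg mulrA ler_wpM2r ?(ltW Kg0) // ler_wpM2r //; lra.
have k5 : Kg <= t1_const.
  by apply: le_trans CK; rewrite ler_peMl ?(ltW Kg0) //; lra.
have := ler_wpM2r (mulr_ge0 (ltW e0) z0) k4; have := ler_wpM2r (mulr_ge0 (ltW dl00) z0) k5.
lra.
Qed.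

Context (eta : R) (eta0 : 0 < eta <= 1).

(** In the drift, the cone estimate allows dp to be replaced by (dp1, N0 dp1). This is the shape of
    the derivative of [Phi0], since [N0] is the differential of [P2] at the centre by
    [graph_slope]. *)
Lemma time_one_graph v :
  `|eps *: (d v 0).2| + `|(e v 0).2 - N0 (e v 0).1| <= eta * (`|eps *: (d v 0).1| + `|(e v 0).1|) ->
  let E := (t1_const * (dl + eps) * (2 + C) + C * eta) * (`|eps *: (d v 0).1| + `|(e v 0).1|) in
  `|(e v 1).1 - (e v 0).1| <= E /\
  `|(d v 1).1 - (d v 0).1 - (F ((e v 0).1, N0 (e v 0).1)).1| <= E.
Proof.
have /andP[e0 e1] := eps0; have /andP[dl00 dl1] := dl0; have c0 := C_ge0; have /andP[et0 et1] := eta0.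
move=> hc; set w := `|eps *: (d v 0).1| in hc *; set b := `|(e v 0).1| in hc *; move=> E.
have w0 : 0 <= w by exact: normr_ge0.
have b0 : 0 <= b by exact: normr_ge0.
have x0 := normr_ge0 (eps *: (d v 0).2); have y0 := normr_ge0 ((e v 0).2 - N0 (e v 0).1).
have s0 : 0 <= w + b by exact: addr_ge0.
have ew : eta * (w + b) <= w + b by rewrite ler_piMl.
have cb : 0 <= C * b by exact: mulr_ge0.
have cw : 0 <= C * w by exact: mulr_ge0.
have zt : zeta v 0 <= (2 + C) * (w + b).
  apply: norm_pair_le.
    rewrite [d v 0]surjective_pairing pairZ; apply: norm_pair_le; rewrite -?/w /=; lra.
  have e2 : `|(e v 0).2| <= `|(e v 0).2 - N0 (e v 0).1| + C * b.
    have := ler_normD ((e v 0).2 - N0 (e v 0).1) (N0 (e v 0).1); rewrite subrK => k.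
    by apply: le_trans k _; rewrite lerD2l; exact: bN.
  rewrite [e v 0]surjective_pairing; apply: norm_pair_le; rewrite -?/b /=; lra.
have t0 : 0 <= t1_const.
  by rewrite /t1_const !mulr_ge0 ?expR_ge0 //; lra.
have z0 : 0 <= zeta v 0 by exact: normr_ge0.
have [k1' k2'] := time_one_drift v.
have tz : t1_const * ((dl + eps) * zeta v 0) <= t1_const * (dl + eps) * (2 + C) * (w + b).
  have de0 : 0 <= dl + eps by lra.
  have := ler_wpM2l t0 (ler_wpM2l de0 zt); move: t1_const => K; lra.
have ce : 0 <= C * eta * (w + b) by rewrite !mulr_ge0 // ltW.
split.
  apply: le_trans (le_trans (norm_fst (e v 1 - e v 0)) k1') _; rewrite /E mulrDl.
  have : t1_const * (eps * zeta v 0) <= t1_const * ((dl + eps) * zeta v 0).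
    by rewrite ler_wpM2l // ler_wpM2r //; lra.
  lra.
have split_e : F (e v 0) = F ((e v 0).1, N0 (e v 0).1) + F (0, (e v 0).2 - N0 (e v 0).1).
  by rewrite -(linD _ _ linF) pairD addr0 addrC subrK -surjective_pairing.
have -> : (d v 1).1 - (d v 0).1 - (F ((e v 0).1, N0 (e v 0).1)).1 =
  (d v 1 - d v 0 - F (e v 0)).1 + (F (0, (e v 0).2 - N0 (e v 0).1)).1.
  by rewrite split_e; move: (F (0, _)) (F _) (d v 1) (d v 0) => [? ?] [? ?] [? ?] [? ?] /=; crd_ring.
apply: le_trans (ler_normD _ _) _; rewrite /E mulrDl; apply: lerD.
  exact: le_trans (norm_fst _) (le_trans k2' tz).
apply: le_trans (norm_fst _) (le_trans (bF _) _); rewrite -mulrA ler_wpM2l //.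
by apply: norm_pair_le; [rewrite normr0 mulr_ge0 // ltW|lra].
Qed.

End TimeOneEstimate.

Lemma norm_window (R : realType) (s t T : R) : s <= t <= s + T -> `|t| <= `|s| + T.
Proof.
move=> /andP[st tT]; have := ler_norm s; have := ler_norm (- s); rewrite normrN ler_norml.
by move=> *; apply/andP; split; lra.
Qed.

Lemma two_halves (R : realType) (a p b q c z : R) :
  a <= p -> p <= c / 2 * z -> b <= q -> q <= c / 2 * z -> a + b <= c * z.
Proof. by move=> *; lra. Qed.

(** * The linearised flow along the cylinder as input for the cone estimate *)

Section TangentData.
Context {R : realType} {m r : nat}.
Context (h : pt R m r -> R) (G : ext R m r -> R) (p0 : pt R m r) (omega : 'rV[R]_m).
Context (hC : Ck_on 2 setT h) (GC : Ck_on 2 setT G) (pG : periodic_for extlat G).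
Context (gh0 : grad h p0 = (omega, 0)).
Context (M : R) (M1 : 1 <= M) (C cV rho : R) (C1 : 1 <= C).
Context (bQ : forall z, strip p0 M z -> `|gQ G z| <= C).
Context (bP : forall z, strip p0 M z -> `|gP G z| <= C).
Context (bdQ : forall z, strip p0 M z -> forall v, `|'d (gQ G) z v| <= C * `|v|).
Context (bdP : forall z, strip p0 M z -> forall v, `|'d (gP G) z v| <= C * `|v|).
Context (bLV : forall q u, `|LVq G p0 q u| <= C * `|u|).
Context (pLV : forall q, `|q| < rho -> forall u, cV * `|u| ^+ 2 <= avg_hess p0 G q u u).
Context (rho1 : rho <= 1).
Context (eps : R) (eps0 : 0 < eps <= 1) (epsC : eps ^+ 2 * C <= 1).
Notation H := (hamiltonian h G eps).
Notation X := (ext_field H).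
Context (phi : ext R m r -> R -> ext R m r) (flow : is_XM_flow h G p0 M eps phi).
Context (B : set 'rV[R]_m) (Q P : base R m -> 'rV[R]_r) (oB : open B).
Context (stP : forall x, Defs.over B x -> strip p0 (M - 1) (param Q P x)).
Context (QC : Ck_on 1 (Defs.over B) Q) (PC : Ck_on 1 (Defs.over B) P).
Context (Qrho : forall x, Defs.over B x -> `|Q x| < rho).
Context (inv : weakly_invariant H B Q P).
Context (T dl T' dw r1 rw e1 : R) (T0 : 0 < T) (dl0 : 0 < dl <= 1) (T'1 : 1 <= T').
Context (k1 : R) (slice : forall y b, Defs.over B y -> `|y.2 - p0.1| <= r1 ->
  `|eps *: ('d (QP Q P) y (0, 0, b)).1| <= k1 * `|b| /\ `|('d (QP Q P) y (0, 0, b)).2| <= k1 * `|b|).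
Let N : R := (fd_n (pt R m r))%:R.
Context (e10 : 0 <= e1) (e1dl : N * (2 * e1) <= dl) (rwT : rw * T' < dw) (r1w : r1 < dw).
Context (gr1 : forall p, `|p - p0| <= r1 -> `|grad h p - grad h p0| <= rw / 2).
Context (dgr1 : forall p u, `|p - p0| <= r1 -> `|dgrad h p u - dgrad h p0 u| <= dl / 2 * `|u|).
Context (ew : eps ^+ 2 * C <= rw / 2) (ed : eps * C <= dl / 2) (ec : eps * (N * (C * T')) <= dl).
Context (win : forall (z z' : R -> ext R m r) (s rho : R), rho * T' < dw -> `|(z s).1.2.2| <= 1 ->
    (forall u : R, s <= u <= s + T' -> is_derive u (1 : R) z (z' u)) ->
    (forall u : R, s <= u <= s + T' -> `|(z' u).1 - (1, (omega, 0))| <= rho) ->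
    (forall u : R, s <= u <= s + T' -> `|(z u).2 - p0| < dw) ->
    forall k (Gam : R -> pt R m r),
      (forall u : R, is_derive u (1 : R) Gam (gqq G k (z u))) ->
      `|Gam (s + T') - Gam s - T' *: (0, LVq G p0 (z s).1.2.2 (bvec k).2)| <= 2 * e1 * T').
Context (x : pt R m m) (S d1 : R) (d10 : 0 < d1) (ST : T / eps + T' <= S).
Context (SC : S * (eps ^+ 2 * C) <= 2^-1).
Context (mB : forall p, `|p - x.2| < S * (eps ^+ 2 * C) + d1 -> B p).
Notation z0 := (start Q P x).
Context (near0 : forall s : R, `|s| <= S -> `|(phi z0 s).2 - p0| <= r1).

(** Here [d] and [e] are dq and dp along the orbit, and [g] is the Hessian of [G] in q. The equation
    of dp has the prefactor [eps ^+ 2]; one [eps] is given to dq, and the mixed derivative of [G]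
    applied to dp keeps a factor [eps], so that it becomes the small term [kk]. *)
Lemma tangent_data : exists d e Dd kk g chi ghat LV,
  [/\ linearised_data C cV k1 (dgrad h p0) eps dl T d e Dd kk g chi ghat LV,
      forall (s : R) u, eps * `|s| <= T -> `|g s u| <= C * `|u|,
      forall v, (d v 0).1 = v.1 /\ (e v 0).1 = v.2,
      differentiable (Phi H Q P) x &
      forall v, 'd (Phi H Q P) x v = ((d v 1).1, (e v 1).1)].
Proof.
have /andP[eps00 eps1] := eps0; have /andP[dl00 dl1] := dl0.
have C0 : 0 < C by apply: lt_le_trans C1.
have S1 : 1 <= S.
  by apply: le_trans ST; apply: le_trans T'1 _; rewrite lerDr divr_ge0 // ltW.
have bx : B x.2 := center_in C0 (eps := eps) S1 d10 mB.
have st (s : R) : `|s| <= S -> strip p0 M (phi z0 s).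
  move=> sS; apply: strip_mono (@orbit_strip R m r h G p0 hC GC M M1 C C0 bQ eps phi flow B Q P stP x S d1 S1 d10 SC mB s sS).
  by lra.
have ob (s : R) : `|s| <= S -> phi z0 s = param Q P (bs (phi z0 s)) /\ B (phi z0 s).2.1.
  apply: (@start_orbit R m r h G p0 hC GC pG M M1 C C0 bQ eps phi flow
      B Q P oB stP QC PC inv x S bx).
    by have := SC; lra.
  by move=> p px; apply: mB; apply: le_lt_trans px _; rewrite ltrDl.
have sin (s : R) : eps * `|s| <= T -> `|s| + T' <= S.
  by move=> sT; apply: le_trans ST; rewrite lerD2r ler_pdivlMr // mulrC.
have sin' (s : R) : eps * `|s| <= T -> `|s| <= S.
  by move=> /sin; have := T'1; lra.
have [V [V0 dV linV [injV fibV V11 [dPhi EPhi]]]] := @linearised R m r h G p0 hC GC pG M M1 C C0 bQ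
  eps epsC phi flow B Q P oB stP QC PC inv x S d1 S1 d10 SC mB.
have VE v s : V v s = (0, (V v s).1.2, (V v s).2).
  by rewrite -(V11 v s) -!surjective_pairing.
pose d v s : pt R m r := (V v s).1.2.
pose e v s : pt R m r := (V v s).2.
pose g s (u : pt R m r) : pt R m r := 'd (gQ G) (phi z0 s) (qdir u).
pose kk v s : pt R m r := eps *: 'd (gQ G) (phi z0 s) (pdir (e v s)).
pose Dd v s : pt R m r := dgrad h (phi z0 s).2 (e v s) - eps ^+ 2 *: 'd (gP G) (phi z0 s) (V v s).
have dirV v s : V v s = qdir (d v s) + pdir (e v s).
  by rewrite VE /qdir /pdir !pairD !addr0 !add0r.
have ling s : linear (g s) by move=> a u v; rewrite /g qdirP linearP.
have cphi : continuous (phi z0) by move=> s; exact: eps_der_continuous (flow.2 z0 s).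
have cg u : continuous (fun s => g s u).
  move=> s; apply: (@C1_diff_curve R (ext R m r) (pt R m r) (fd_ext R m r) (gQ G)
    (phi z0) (fun=> qdir u) s (gQ_C1 GC)); [exact: cphi|exact: cvg_cst].
have qn u : `|qdir u : ext R m r| <= `|u|.
  by apply: norm_pair_le; [apply: norm_pair_le|]; rewrite ?normr0.
have pn u : `|pdir u : ext R m r| <= `|u|.
  by apply: norm_pair_le; [apply: norm_pair_le|]; rewrite ?normr0.
have bg (s : R) u : `|s| <= S -> `|g s u| <= C * `|u|.
  move=> sS; apply: le_trans (bdQ (st s sS) _) _; apply: ler_wpM2l; [exact: ltW|exact: qn].
have T'0 : 0 < T' by apply: lt_le_trans T'1.
have [chi [ghat [linchi bchi dchi aghat]]] := @corrector R (pt R m r) (pt R m r) (fd_pt R m r) (fd_pt R m r)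
  g C S T' T'0 (ltW C0) ling cg bg.
have Qs (s : R) : `|s| <= S -> `|(phi z0 s).1.2.2| < rho.
  by move=> sS; have [-> Bs] := ob s sS; exact: Qrho.
exists d, e, Dd, kk, g, chi, ghat, (fun s => LVq G p0 (phi z0 s).1.2.2).
have dd v (s : R) : eps * `|s| <= T -> is_derive s (1 : R) (d v) (Dd v s).
  move=> /sin' sS; have := dV v s sS; rewrite (X_diff hC GC) => k.
  exact: (@is_derive_lin R (ext R m r) (pt R m r) (fd_ext R m r) (fun z => z.1.2) _ _ _ (fun _ _ _ => erefl) k).
split.
split.
- by move=> s; split=> a u v; rewrite /d /e linV.
- exact: linchi.
- by move=> v s _ d0 e0; apply: (injV v s); rewrite dirV d0 e0 /qdir /pdir !pairD !addr0.
- exact: dd.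
- move=> v s /sin' sS; have k := near0 sS.
  have zn : `|eps *: V v s| <= `|(eps *: d v s, e v s)|.
    rewrite VE !pairZ scaler0; apply: norm_pair_le.
      apply: norm_pair_le; first by rewrite normr0.
      exact: (norm_fst (eps *: d v s, e v s)).
    apply: le_trans (norm_snd (eps *: d v s, e v s)).
    by rewrite normrZ ger0_norm ?(ltW eps00) // ler_piMl.
  have k2 := norm_snd (eps *: d v s, e v s).
  have k3 := dgr1 (e v s) k.
  have k4 := bdP (st s sS) (eps *: V v s).
  rewrite /Dd addrAC; apply: le_trans (ler_normB _ _) _.
  have -> : eps ^+ 2 *: 'd (gP G) (phi z0 s) (V v s) = eps *: 'd (gP G) (phi z0 s) (eps *: V v s).
    by rewrite linearZ scalerA.
  rewrite normrZ (ger0_norm (ltW eps00)).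
  have k5 := ler_wpM2l (ltW eps00) (le_trans k4 (ler_wpM2l (ltW C0) zn)).
  have k6 := ler_wpM2r (normr_ge0 (eps *: d v s, e v s)) ed.
  have k7 := ler_wpM2l (_ : 0 <= dl / 2) k2; rewrite divr_ge0 ?(ltW dl00) // in k7.
  by have k8 := k7 isT; rewrite mulrA in k5; exact: two_halves k3 k8 k5 k6.
- move=> v s /sin' sS; have := dV v s sS; rewrite (X_diff hC GC) => k.
  have := @is_derive_lin R (ext R m r) (pt R m r) (fd_ext R m r) snd _ _ _ (fun _ _ _ => erefl) k.
  move=> {}k; suff -> : eps *: (g s (eps *: d v s) + kk v s) = eps ^+ 2 *: 'd (gQ G) (phi z0 s) (V v s) by [].
  rewrite (linZ _ _ (ling s)) /kk -scalerDr scalerA -expr2; congr (_ *: _).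
  by rewrite /g -raddfD -dirV.
- move=> v s /sin' sS; rewrite /kk normrZ (ger0_norm (ltW eps00)).
  have k4 := le_trans (bdQ (st s sS) (pdir (e v s))) (ler_wpM2l (ltW C0) (pn _)).
  have k5 := ler_wpM2l (ltW eps00) k4.
  have k2 := norm_snd (eps *: d v s, e v s).
  have z0' := normr_ge0 (eps *: d v s, e v s).
  apply: le_trans k5 _; rewrite mulrA.
  apply: ler_pM => //; first by rewrite mulr_ge0 // ltW.
  by apply: le_trans ed _; rewrite ler_pdivrMr // ler_peMr ?(ltW dl00) // ler1n.
- move=> s u /sin sS; rewrite normrZ (ger0_norm (ltW eps00)).
  apply: le_trans (ler_wpM2l (ltW eps00) (bchi s u sS)) _.
  rewrite -/N [leLHS]mulrA; exact: ler_wpM2r (normr_ge0 u) _ _ ec.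
- move=> v s sT; apply: dchi; exact: is_deriveZ (dd v s sT).
- move=> s u sT; have sS := sin s sT.
  have iu (t : R) : s <= t <= s + T' -> `|t| <= S.
    by move=> tw; exact: le_trans (norm_window tw) sS.
  apply: (@le_trans _ _ (N * (2 * e1) * `|u|)); last by rewrite ler_wpM2r.
  apply: (aghat s (2 * e1) (fun u => (0, LVq G p0 (phi z0 s).1.2.2 u.2))).
  - by rewrite mulr_ge0.
  - move=> a u1 u2 /=; rewrite pairZ pairD scaler0 addr0; congr (_, _).
    exact: LVq_linear.
  - move=> k Gam dGam.
    apply: (win (z := phi z0) (z' := fun t => X (phi z0 t)) (rho := rw)) => //.
    + by apply: ltW; apply: lt_le_trans (Qs s (sin' _ sT)) _.
    + by move=> t /iu tS; apply: (flow_real flow); exact: st.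
    + move=> t /iu tS; rewrite (XE hC GC) -gh0 pairN pairD subrr.
      apply: norm_pair_le.
        have q0 : 0 <= eps ^+ 2 * C by rewrite mulr_ge0 ?sqr_ge0 // ltW.
        by have := le_trans q0 ew; rewrite ler_pdivlMr // mul0r normr0.
      change (`|grad h (phi z0 t).2 - eps ^+ 2 *: gP G (phi z0 t) - grad h p0| <= rw).
      rewrite addrAC; apply: le_trans (ler_normB _ _) _.
      have k4 := gr1 (near0 tS); have k5 := bP (st t tS).
      rewrite normrZ (ger0_norm (sqr_ge0 _)).
      rewrite [leRHS]splitr; apply: lerD k4 _; exact: le_trans (ler_wpM2l (sqr_ge0 eps) k5) ew.
    + by move=> t /iu tS; apply: le_lt_trans (near0 tS) _.
- move=> s u sT; split; first exact: bLV.
  by rewrite (LVq_dot p0 GC pG); apply: pLV; apply: Qs; exact: sin'.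
(* The time component always vanishes, so with dq1 = 0 the base component is (0, 0, dp1), and
   tangency reduces the claim to the bound on the derivatives in p1. *)
- move=> v s sT d0; have sS := sin' s sT; have [E Bs] := ob s sS.
  have k := fibV v s sS; have bV : bs (V v s) = (0, 0, (e v s).1).
    by rewrite /bs V11 [(V v s).1.2.1]d0.
  rewrite bV in k; have [k2 k3] := slice (y := bs (phi z0 s)) (e v s).1 Bs
    (le_trans (norm_fst ((phi z0 s).2 - p0)) (near0 sS)).
  by move: k2 k3; rewrite -k.
- by move=> s u /sin' sS; exact: bg.
- move=> v; rewrite /d /e V0.
  by have [_ ->] := param_diff oB QC PC (inc v) (bx : Defs.over B (inc x)).
- exact: dPhi.
- by move=> v; rewrite EPhi.
Qed.

End TangentData.

(** * Convergence of the derivative of the time-one map *)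
Section SkewDiff.
Context {R : realType}.

Lemma skew_diff (V W : normedModType R) {fV : fdim V} {fW : fdim W} (g : W -> V) (x : V * W) :
  differentiable g x.2 -> forall v : V * W,
  'd (fun y : V * W => (y.1 + g y.2, y.2)) x v = (v.1 + 'd g (x.2) v.2, v.2).
Proof.
move=> dg; pose L (v : V * W) : V * W := (v.1 + 'd g (x.2) v.2, v.2).
have linL : linear L.
  move=> a u v; rewrite /L pairZ pairD; congr (_, _).
  have -> : 'd g (x.2) (a *: u + v).2 = a *: 'd g (x.2) u.2 + 'd g (x.2) v.2 by rewrite -linearP.
  by rewrite /= scalerDr addrACA.
have [|_ E] := @eps_diff R (V * W)%type (V * W)%type (fdim_prod fV fW)
    (fun y => (y.1 + g y.2, y.2)) x L linL; last by move=> v; rewrite E.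
move=> e e0; have [d d0 hd] := diff_eps dg e0; exists d => // u ud.
have k := hd u.2 (le_lt_trans (norm_snd u) ud).
rewrite /L !pairN !pairD /=; apply: norm_pair_le; last first.
  by rewrite [x.2 + _]addrC addrK subrr normr0 mulr_ge0 // ltW.
have -> : x.1 + u.1 + g (x.2 + u.2) - (x.1 + g x.2) - (u.1 + 'd g (x.2) u.2) =
    g (x.2 + u.2) - g x.2 - 'd g (x.2) u.2 by crd_ring.
by apply: le_trans k _; rewrite ler_wpM2l ?(ltW e0) //; exact: norm_snd.
Qed.

Lemma fst_diff (V W : normedModType R) {fV : fdim V} {fW : fdim W} (x : V * W) :
  differentiable (fst : V * W -> V) x /\ forall v, 'd (fst : V * W -> V) x v = v.1.
Proof.
have [|dL E] := @eps_diff R (V * W)%type V (fdim_prod fV fW) fst x fst (fun _ _ _ => erefl).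
  move=> e e0; exists 1 => // u _ /=.
  by rewrite -addrA -opprD subrr normr0 mulr_ge0 // ltW.
by split=> // v; rewrite E.
Qed.

Lemma id_diff (V : normedModType R) {fV : fdim V} (x : V) :
  differentiable (fun y : V => y) x /\ forall v, 'd (fun y : V => y) x v = v.
Proof.
have [|dL E] := @eps_diff R V V fV (fun y => y) x (fun y => y) (fun _ _ _ => erefl).
  move=> e e0; exists 1 => // u _ /=.
  by rewrite -addrA -opprD subrr normr0 mulr_ge0 // ltW.
by split=> // v; rewrite E.
Qed.

Lemma pair_sub2 (V W : normedModType R) (a b c : V) (d : W) :
  (a + b, d) - (a + c, d) = (b - c, 0).
Proof. by rewrite pairN pairD subrr opprD addrACA subrr add0r. Qed.

Lemma norm_tri (V : normedModType R) (a b c : V) (s t : R) :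
  `|a - b| <= s -> `|b - c| <= t -> `|a - c| <= s + t.
Proof.
move=> ab bc; rewrite -(subrK b a) -addrA.
by apply: le_trans (ler_normD _ _) _; exact: lerD.
Qed.

Lemma near_bound (V : normedModType R) (a b : V) (K t : R) :
  `|a - b| <= t -> `|b| <= K * t -> `|a| <= (K + 1) * t.
Proof.
move=> ab bK; rewrite -(subrK b a) mulrDl mul1r addrC.
by apply: le_trans (ler_normD _ _) _; exact: lerD.
Qed.

Lemma sub_snd_diff (V W Z : normedModType R) {fV : fdim V} {fW : fdim W}
    (f : V * W -> Z) (g : W -> Z) (y v : V * W) :
  differentiable f y -> differentiable g y.2 ->
  'd (fun x => f x - g x.2) y v = 'd f y v - 'd g (y.2) v.2.
Proof.
move=> df dg.
have [dc Ec] := @diff_lin_comp R (V * W)%type (fdim_prod fV fW) W Z fW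
  snd g y (fun _ _ _ => erefl) dg.
have [_ Ea] := @diff_axpy R (V * W)%type Z (-1) (fun y => g y.2) f y dc df.
have -> : (fun x => f x - g x.2) = (fun x => -1 *: g x.2 + f x).
  by apply/funext => z; rewrite scaleN1r addrC.
by apply: etrans (Ea v) _; rewrite Ec scaleN1r addrC.
Qed.

Lemma graph_comp_diff (V W Z : normedModType R) {fV : fdim V} (f : V * W -> Z) (g : V -> W) x :
  differentiable g x -> differentiable f (x, g x) ->
  differentiable (fun y => f (y, g y)) x /\
  forall v, 'd (fun y => f (y, g y)) x v = 'd f (x, g x) (v, 'd g x v).
Proof.
move=> dg df; have [di Ei] := id_diff x.
have [dp Ep] := diff_pair di dg.
have [dc Ec] := @diff_compE R V (V * W)%type Z (fun y => (y, g y)) f x dp df.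
by split=> // v; rewrite Ec Ep Ei.
Qed.

End SkewDiff.

(** * The critical graph and the limit map near the centre *)

Section Graph.
Context {R : realType} {m r : nat}.
Context (h : pt R m r -> R) (p0 : pt R m r) (hC : Ck_on 2 setT h).
Context (B : set 'rV[R]_m) (oB : open B) (Bp : B p0.1) (P2 : 'rV[R]_m -> 'rV[R]_r).
Context (P2C : Ck_on 1 B P2) (P20 : P2 p0.1 = p0.2).
Context (crit : forall p1, B p1 -> (grad h (p1, P2 p1)).2 = 0).

Lemma grad_graph_diff p1 : B p1 ->
  differentiable (fun y => grad h (y, P2 y)) p1 /\
  forall v, 'd (fun y => grad h (y, P2 y)) p1 v = dgrad h (p1, P2 p1) (v, 'd P2 p1 v).
Proof.
move=> Bp1; apply: (@graph_comp_diff R 'rV[R]_m 'rV[R]_r (pt R m r) (fdim_rV R m) (grad h) P2 p1).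
  exact: P2C.1.
exact: (grad_C1 hC).1.
Qed.

Lemma graph_critical b : (dgrad h p0 (b, 'd P2 (p0.1) b)).2 = 0.
Proof.
have [dg Eg] := grad_graph_diff Bp.
have E := Eg b; have p0E : (p0.1, P2 p0.1) = p0 by rewrite P20 -surjective_pairing.
rewrite p0E in E.
have := @diff_line R 'rV[R]_m (pt R m r) (fun y => grad h (y, P2 y)) p0.1 b dg.
rewrite E => k.
have k2 := @is_derive_lin R (pt R m r) 'rV[R]_r (fd_pt R m r) snd _ _ _ (fun _ _ _ => erefl) k.
have [d d0 hd] : exists2 d : R, 0 < d & forall y, `|y - p0.1| < d -> B y.
  have := oB Bp; move=> /nbhs_ballP[d d0 hd]; exists d => // y yd; apply: hd.
  by rewrite -ball_normE /= distrC.
have vn : 0 < d / (`|b| + 1) by rewrite divr_gt0 // ltr_wpDl.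
apply: (@derive_near_unique R 'rV[R]_r _ (fun=> 0) 0 _ 0 _ vn _ k2).
move=> t; rewrite ltr_pdivlMr ?ltr_wpDl // add0r => td; apply: crit; apply: hd.
rewrite addrC addKr normrZ; apply: le_lt_trans td.
by apply: ler_wpM2l => //; rewrite lerDl.
Qed.

(** Differentiating the critical equation shows that the differential of [P2] solves the equation
    defining [N0]; the difference of two solutions is annihilated by a positive definite block. *)
Lemma graph_slope (N0 : 'rV[R]_m -> 'rV[R]_r) (cK : R) : 0 < cK ->
  (forall b, (dgrad h p0 (b, N0 b)).2 = 0) ->
  (forall y, cK * `|y| ^+ 2 <= dot (dgrad h p0 (0, y)).2 y) ->
  forall b, 'd P2 (p0.1) b = N0 b.
Proof.
move=> cK0 hN hK b; apply/eqP; rewrite -subr_eq0 -normr_eq0; set y := _ - _.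
have Fy : (dgrad h p0 (0, y)).2 = 0.
  have -> : (0, y) = (b, 'd P2 (p0.1) b) - (b, N0 b) by rewrite /y pairN pairD subrr.
  by rewrite (linB _ _ (dgrad_linear h p0)) /= graph_critical hN subrr.
have := hK y; rewrite Fy dot0l pmulr_rle0 // => k.
by have := sqr_ge0 `|y|; rewrite -sqrf_eq0 eq_le k => ->.
Qed.

Lemma Phi0_diff (x v : pt R m m) : B x.2 -> 'd (Phi0 h P2) x v =
  (v.1 + (dgrad h (x.2, P2 x.2) (v.2, 'd P2 (x.2) v.2)).1, v.2).
Proof.
move=> Bx; have [dg Eg] := grad_graph_diff Bx.
have [df Ef] := @fst_diff R 'rV[R]_m 'rV[R]_r (fdim_rV R m) (fdim_rV R r) (grad h (x.2, P2 x.2)).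
have [dc Ec] := @diff_compE R 'rV[R]_m (pt R m r) 'rV[R]_m
  (fun y => grad h (y, P2 y)) fst x.2 dg df.
have -> := @skew_diff R 'rV[R]_m 'rV[R]_m (fdim_rV R m) (fdim_rV R m) (fun y => (grad h (y, P2 y)).1) x dc v.
by rewrite Ec Ef Eg.
Qed.

Lemma ball_sub : exists2 d : R, 0 < d & forall y, `|y - p0.1| < d -> B y.
Proof.
have := oB Bp; move=> /nbhs_ballP[d d0 hd]; exists d => // y yd; apply: hd.
by rewrite -ball_normE /= distrC.
Qed.

Lemma P2_close (e : R) : 0 < e -> exists2 d : R, 0 < d & forall p1, `|p1 - p0.1| < d ->
  B p1 /\ `|P2 p1 - p0.2| <= e.
Proof.
move=> e0; have [d1 d10 h1] := ball_sub.
have := differentiable_continuous (P2C.1 _ Bp) => /cont_epsP/(_ e e0)[d2 d20 h2].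
exists (Num.min d1 d2); first by rewrite lt_min d10.
move=> p1; rewrite lt_min => /andP[k1 k2]; split; first exact: h1.
by rewrite -P20; exact: h2.
Qed.

Lemma dP2_close (e : R) : 0 < e -> exists2 d : R, 0 < d & forall p1 b, `|p1 - p0.1| < d ->
  B p1 /\ `|'d P2 p1 b - 'd P2 (p0.1) b| <= e * `|b|.
Proof.
move=> e0; exact: (@C1_diff_continuous R 'rV[R]_m 'rV[R]_r (fdim_rV R m) B P2 p0.1 oB P2C Bp e e0).
Qed.

Lemma dgrad_close (e : R) : 0 < e -> exists2 d : R, 0 < d & forall p u, `|p - p0| < d ->
  `|dgrad h p u - dgrad h p0 u| <= e * `|u|.
Proof.
move=> e0.
have [d d0 hd] := @C1_diff_continuous R (pt R m r) (pt R m r) (fd_pt R m r) setT (grad h) p0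
  openT (grad_C1 hC) I e e0.
by exists d => // p u /(hd p u)[].
Qed.

Lemma Phi0_diff_close (C e : R) : 0 < C -> (forall u, `|dgrad h p0 u| <= C * `|u|) -> 0 < e ->
  exists2 d : R, 0 < d & forall x v : pt R m m, `|x.2 - p0.1| < d ->
   `|'d (Phi0 h P2) x v - (v.1 + (dgrad h p0 (v.2, 'd P2 (p0.1) v.2)).1, v.2)| <= e * `|v|.
Proof.
move=> C0 bF e0.
have [K K0 hK] : exists2 K : R, 0 <= K & forall b, `|'d P2 (p0.1) b| <= K * `|b|.
  by apply: (@linear_bound R 'rV[R]_m (fdim_rV R m)) => a u v; rewrite linearP.
have K20 : 0 < K + 1 by rewrite ltr_wpDl.
have [d1 d10 h1] := dgrad_close (divr_gt0 e0 (mulr_gt0 (ltr0n R 2) K20 : 0 < 2 * (K + 1))).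
have e1 : 0 < Num.min 1 (e / (2 * C)) by rewrite lt_min ltr01 divr_gt0 // mulr_gt0.
have [d2 d20 h2] := dP2_close e1.
have d12 : 0 < d1 / 2 by rewrite divr_gt0.
have [d3 d30 h3] := P2_close d12.
exists (Num.min (d1 / 2) (Num.min d2 d3)); first by rewrite !lt_min d20 d30 d12.
move=> x v; rewrite !lt_min => /and3P[x1 x2 x3].
have [Bx px] := h3 _ x3; have [_ dx] := h2 x.2 v.2 x2; rewrite (Phi0_diff v Bx) pair_sub2.
have dx1 : `|'d P2 (x.2) v.2 - 'd P2 (p0.1) v.2| <= `|v.2|.
  by apply: le_trans dx _; rewrite ler_piMl // ge_min lexx.
have dx2 : `|'d P2 (x.2) v.2 - 'd P2 (p0.1) v.2| <= e / (2 * C) * `|v.2|.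
  by apply: le_trans dx _; rewrite ler_wpM2r // ge_min lexx orbT.
have pp : `|(x.2, P2 x.2) - p0| < d1.
  rewrite [p0]surjective_pairing pairN pairD; apply: (@le_lt_trans _ _ (d1 / 2)); last by lra.
  by apply: norm_pair_le => //; exact: ltW.
have nv : `|(v.2, 'd P2 (x.2) v.2)| <= (K + 1) * `|v.2|.
  apply: norm_pair_le; first by rewrite ler_peMl //; lra.
  exact: near_bound dx1 (hK _).
have k1 := h1 _ (v.2, 'd P2 (x.2) v.2) pp.
have Fs : dgrad h p0 (v.2, 'd P2 (x.2) v.2) - dgrad h p0 (v.2, 'd P2 (p0.1) v.2) =
  dgrad h p0 (0, 'd P2 (x.2) v.2 - 'd P2 (p0.1) v.2).
  by rewrite -(linB _ _ (dgrad_linear h p0)) pairN pairD subrr.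
have k2 : `|dgrad h (x.2, P2 x.2) (v.2, 'd P2 (x.2) v.2) - dgrad h p0 (v.2, 'd P2 (p0.1) v.2)| <= e * `|v.2|.
  have a1 : `|dgrad h (x.2, P2 x.2) (v.2, 'd P2 (x.2) v.2) - dgrad h p0 (v.2, 'd P2 (x.2) v.2)| <= e / 2 * `|v.2|.
    apply: le_trans k1 _; have ee : 0 <= e / (2 * (K + 1)) by rewrite divr_ge0 ?mulr_ge0 // ltW.
    apply: le_trans (ler_wpM2l ee nv) _; rewrite mulrA ler_wpM2r //.
    by rewrite [leLHS](_ : _ = e / 2) //; field; rewrite gt_eqF.
  have a2 : `|dgrad h p0 (0, 'd P2 (x.2) v.2 - 'd P2 (p0.1) v.2)| <= e / 2 * `|v.2|.
    apply: le_trans (bF _) _.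
    have n2 : `|((0 : 'rV[R]_m), 'd P2 (x.2) v.2 - 'd P2 (p0.1) v.2)| <= e / (2 * C) * `|v.2|.
      apply: norm_pair_le => //; rewrite normr0 mulr_ge0 // divr_ge0 ?mulr_ge0 // ltW //.
    apply: le_trans (ler_wpM2l (ltW C0) n2) _; rewrite mulrA ler_wpM2r //.
    by rewrite [leLHS](_ : _ = e / 2) //; field; rewrite gt_eqF.
  by rewrite -Fs in a2; apply: le_trans (norm_tri a1 a2) _; rewrite -mulrDl -splitr.
apply: norm_pair_le; last by rewrite normr0 mulr_ge0 // ltW.
apply: le_trans (norm_fst (dgrad h (x.2, P2 x.2) (v.2, 'd P2 (x.2) v.2) - dgrad h p0 (v.2, 'd P2 (p0.1) v.2))) _.
by apply: le_trans k2 _; rewrite ler_wpM2l ?(ltW e0) //; exact: norm_snd.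
Qed.

(** In the direction p1 the bound on [P - P2] adds kappa to the slope of [P2], and the bound
    [kappa / eps] on [Q] becomes kappa after scaling by [eps]; [D] converts between the Euclidean
    norm of the parameters and the sup norm. *)
Lemma slice_bound (kappa : R) : 0 < kappa -> exists k1 d : R, [/\ 0 < k1, 0 < d &
  forall (eps : R) Q P, 0 < eps -> Ck_on 1 (Defs.over B) Q -> Ck_on 1 (Defs.over B) P ->
  C1_bound (Defs.over B) (fun x => P x - P2 x.2) kappa -> C1_bound (Defs.over B) Q (kappa / eps) ->
  forall y b, Defs.over B y -> `|y.2 - p0.1| < d ->
  `|eps *: ('d (QP Q P) y (0, 0, b)).1| <= k1 * `|b| /\ `|('d (QP Q P) y (0, 0, b)).2| <= k1 * `|b|].
Proof.
move=> ka0.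
have [K K0 hK] : exists2 K : R, 0 <= K & forall b, `|'d P2 (p0.1) b| <= K * `|b|.
  by apply: (@linear_bound R 'rV[R]_m (fdim_rV R m)) => a u v; rewrite linearP.
have [d d0 hd] := dP2_close ltr01.
pose D : R := 1 + m%:R + m%:R + 1.
have D0 : 0 <= D by rewrite /D !addr_ge0.
have kD : 0 <= kappa * D by rewrite mulr_ge0 // ltW.
exists (kappa * D + K + 1), d; split=> //; first by rewrite ltr_wpDl ?addr_ge0.
move=> eps Q P eps0 QC PC bP bQ y b By yd.
have dQ := QC.1 y By; have dP := PC.1 y By.
have [_ ->] := diff_pair dQ dP; rewrite /=.
have n3 : enorm3 ((0, 0, b) : base R m) <= D * `|b|.
  apply: le_trans (enorm3_le _) _; rewrite ler_wpM2l //.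
  by apply: norm_pair_le => //; apply: norm_pair_le; rewrite normr0.
have b0 : 0 <= `|b| by exact: normr_ge0.
split.
  have [_ /(_ (0, 0, b)) k] := bQ y By.
  rewrite normrZ gtr0_norm //.
  have kk : 0 <= kappa / eps by rewrite divr_ge0 // ltW.
  have k2 := le_trans (sup_le_enorm _) (le_trans k (ler_wpM2l kk n3)).
  apply: le_trans (ler_wpM2l (ltW eps0) k2) _.
  rewrite (_ : eps * _ = kappa * D * `|b|); last by field; rewrite gt_eqF.
  by rewrite ler_wpM2r // -addrA lerDl addr_ge0.
have [_ /(_ (0, 0, b)) k] := bP y By.
have dP2 : differentiable P2 (snd y) by exact: P2C.1.
have E := @sub_snd_diff R (R * 'rV[R]_m)%type 'rV[R]_m 'rV[R]_r (fdim_prod (fdim_R R) (fdim_rV R m))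
  (fdim_rV R m) P P2 y (0, 0, b) dP dP2.
have k' : enorm ('d P y (0, 0, b) - 'd P2 (y.2) b) <= kappa * enorm3 ((0, 0, b) : base R m).
  by rewrite -E; exact: k.
have k2 := le_trans (sup_le_enorm _) (le_trans k' (ler_wpM2l (ltW ka0) n3)).
have [_ k3] := hd y.2 b yd; rewrite mul1r in k3.
have k4 := near_bound k3 (hK b).
have := ler_normD ('d P y (0, 0, b) - 'd P2 (y.2) b) ('d P2 (y.2) b); rewrite subrK => k5.
apply: le_trans k5 _; rewrite -addrA [leRHS]mulrDl.
by apply: lerD k4; rewrite -mulrA.
Qed.

End Graph.

Section SmallArith.
Context {R : realType}.

(** One product below [c] provides all smallness conditions on [eps]. The fourth one is the momentum
    drift over the slow time [T] plus one window, of size [eps * C * T] to leading order. *)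
Lemma small_eps (eps C T T' n c : R) : 0 < eps <= 1 -> 1 <= C -> 0 < T -> 1 <= T' -> 0 <= n ->
  eps * (C * (1 + T + T') * (1 + n)) < c ->
  [/\ eps * C <= c, eps ^+ 2 * C <= c, eps * (n * (C * T')) <= c,
      (T / eps + T') * (eps ^+ 2 * C) <= c & eps <= c].
Proof.
move=> /andP[e0 e1] C1 T0 T'1 n0 h.
have C0 : 0 <= C by lra.
have T'0 : 0 <= T' by lra.
have eC : 0 <= eps * C by rewrite mulr_ge0 // ltW.
have eCT : 0 <= eps * C * T by rewrite mulr_ge0 // ltW.
have eCT' : 0 <= eps * C * T' by rewrite mulr_ge0.
have eCn : 0 <= eps * C * n by rewrite mulr_ge0.
have eCTn : 0 <= eps * C * T * n by rewrite mulr_ge0.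
have eCT'n : 0 <= eps * C * T' * n by rewrite mulr_ge0.
have E : eps * (C * (1 + T + T') * (1 + n)) = eps * C + eps * C * T + eps * C * T' +
  eps * C * n + eps * C * T * n + eps * C * T' * n by ring.
rewrite E in h.
have e2 : eps ^+ 2 * C <= eps * C.
  by rewrite expr2 -mulrA ler_piMl.
split.
- lra.
- lra.
- rewrite (_ : _ * _ = eps * C * T' * n); [lra|ring].
- rewrite (_ : _ * _ = eps * C * T + eps * (eps * C * T')); last by field; rewrite gt_eqF.
  have : eps * (eps * C * T') <= eps * C * T' by rewrite ler_piMl.
  lra.
- have : eps <= eps * C by rewrite ler_peMr // ltW.
  lra.
Qed.

Lemma half_lt (a b : R) : 0 < a -> 2 * a <= b -> a < b.
Proof. by move=> a0 ab; lra. Qed.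

Lemma quarters (a : R) : 0 < a ->
  [/\ 0 < a / 4, a / 4 <= a / 2, a / 4 + a / 4 <= a / 2, a / 2 <= a & a / 2 + a / 2 <= a].
Proof. by move=> a0; split; lra. Qed.

Lemma margin_arith (a b s c d : R) : a < s + d / 4 -> s <= c -> c <= d / 4 -> b < d / 2 -> a + b < d.
Proof. by move=> *; lra. Qed.

(* the bound of [time_one_graph], for the choices [eta1 = min 1 (eta / (8 C))] and
   [dl <= eta / (32 K1 (2 + C))] *)
Lemma small_error (K1 C dl eps eta1 eta w b nv : R) : 0 < K1 -> 0 < C -> 0 < eps <= dl ->
  dl <= eta / (32 * (K1 * (2 + C))) -> 0 < eta1 -> eta1 <= eta / (8 * C) ->
  0 <= w <= nv -> 0 <= b <= nv ->
  (K1 * (dl + eps) * (2 + C) + C * eta1) * (w + b) <= eta / 2 * nv.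
Proof.
move=> K0 C0 /andP[e0 edl] dle et0 ete /andP[w0 wn] /andP[b0 bn].
have KC : 0 < K1 * (2 + C) by rewrite mulr_gt0 // ltr_wpDl.
have h1 : K1 * (2 + C) * dl <= eta / 32.
  rewrite -ler_pdivlMl //; apply: le_trans dle _.
  by rewrite [leLHS](_ : _ = (K1 * (2 + C))^-1 * (eta / 32)) //; field; rewrite !gt_eqF // ltr_wpDl // ltW.
have h1' : K1 * (2 + C) * eps <= K1 * (2 + C) * dl by rewrite ler_pM2l.
have h2 : C * eta1 <= eta / 8.
  rewrite -ler_pdivlMl //; apply: le_trans ete _.
  by rewrite [leLHS](_ : _ = C^-1 * (eta / 8)) //; field; rewrite gt_eqF.
have h3 : K1 * (dl + eps) * (2 + C) + C * eta1 <= eta / 4.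
  rewrite (_ : K1 * _ * _ = K1 * (2 + C) * dl + K1 * (2 + C) * eps); last by ring.
  have : 0 < C * eta1 by rewrite mulr_gt0.
  lra.
have s0 : 0 <= w + b by rewrite addr_ge0.
apply: le_trans (ler_wpM2r s0 h3) _.
have eta0 : 0 <= eta / 4.
  have : 0 < C * eta1 by rewrite mulr_gt0.
  lra.
have := ler_wpM2l eta0 (lerD wn bn); lra.
Qed.

End SmallArith.

(** * Choice of the constants and closeness of the derivatives *)

Section CylinderFamily.
Context {R : realType} {m r : nat}.
Context (h : pt R m r -> R) (G : ext R m r -> R) (p0 : pt R m r) (omega : 'rV[R]_m).
Context (hC : Ck_on 2 setT h) (GC : Ck_on 2 setT G) (pG : periodic_for extlat G).
Context (gh0 : grad h p0 = (omega, 0)).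
Context (nonres : forall k : 'rV[int]_m.+1, k != 0 ->
  dot (zvec R k) (row_mx (1%:M : 'rV[R]_1) omega) != 0).
Context (hcvx : convex_fun h) (hpos : forall p, hessian_pos_def h p).
Context (rho cV : R) (rho1 : rho <= 1) (cV0 : 0 < cV).
Context (pLV : forall q, `|q| < rho -> forall u, cV * `|u| ^+ 2 <= avg_hess p0 G q u u).
Context (kappa : R) (B : set 'rV[R]_m) (P2 : 'rV[R]_m -> 'rV[R]_r) (U : set 'rV[R]_r) (eps0 : R).
Context (Q P : R -> base R m -> 'rV[R]_r).
Context (kappa0 : 0 < kappa) (bB : open_ball B) (Bp : B p0.1) (P2C : Ck_on 1 B P2).
Context (P20 : P2 p0.1 = p0.2) (crit : forall p1, B p1 -> (grad h (p1, P2 p1)).2 = 0).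
Context (Urho : forall q2, U q2 -> enorm q2 < rho) (eps00 : 0 < eps0).
Context (fam : cylinder_family h G P2 kappa B U eps0 Q P).

Let oB : open B := open_ball_open bB.

Definition family_bounds (M C ebar : R) : Prop :=
  [/\ 1 <= M, 1 <= C, 0 < ebar /\ ebar <= Num.min 1 eps0,
      forall z, strip p0 M z ->
       [/\ `|gQ G z| <= C, `|gP G z| <= C, forall v, `|'d (gQ G) z v| <= C * `|v|,
           forall v, `|'d (gP G) z v| <= C * `|v| & forall v, `|dgrad h z.2 v| <= C * `|v|] &
      (forall q u, `|LVq G p0 q u| <= C * `|u|) /\
      forall eps : R, 0 < eps < ebar -> eps ^+ 2 * C <= 1 /\
        forall x, Defs.over B x -> strip p0 (M - 1) (param (Q eps) (P eps) x)].

Lemma family_P (d : R) : 0 < d -> exists2 e : R, 0 < e & forall eps : R, 0 < eps < e ->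
  forall x, Defs.over B x -> `|P eps x - P2 x.2| <= d.
Proof.
move=> d0; have [_ /(_ d d0)/near0_ex[e e0 he]] := fam; exists e => // eps he' x Bx.
exact: le_trans (sup_le_enorm _) (he eps he' x Bx).
Qed.

(** The radius [M' + 2] exceeds the bound of the critical graph by 1 for the distance of [P eps] to
    [P2] and by 1 for the drift along orbits. The argument [C0] lets the common bound [C] also
    dominate constants chosen beforehand. *)
Lemma family_boundsP (C0 : R) : exists M C ebar, C0 <= C /\ family_bounds M C ebar.
Proof.
have [N N0 hN] := open_ball_bdd bB Bp.
have gp0 : (grad h p0).2 = 0 by rewrite gh0.
have [M' M'0 hM] := critical_bounded hC hcvx hpos gp0 crit hN.
have [C1 C10 h1] := strip_bounds p0 hC GC pG (M' + 2).
have [C2 C20 h2] := LVq_bound p0 GC pG.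
have [e e0 he] := family_P ltr01.
pose C := `|C0| + C1 + C2 + 1.
have c00 : 0 <= `|C0| by [].
have C1C : C1 <= C by rewrite /C; lra.
have C2C : C2 <= C by rewrite /C; lra.
have Cg1 : 1 <= C by rewrite /C; lra.
have Cp : 0 < C by lra.
have up (V : normedModType R) (a : R) (v : V) c : c <= C -> a <= c * `|v| -> a <= C * `|v|.
  by move=> cC k; apply: le_trans k _; rewrite ler_wpM2r.
exists (M' + 2), C, (Num.min (Num.min 1 eps0) (Num.min e C^-1)); split.
  by have := ler_norm C0; rewrite /C; lra.
split => //; first by lra.
- by rewrite !lt_min ltr01 eps00 e0 invr_gt0 Cp ge_min lexx.
- move=> z /h1[a1 a2 a3 a4 a5]; split; try (by apply: le_trans C1C); move=> v.
  + exact: up C1C (a3 v).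
  + exact: up C1C (a4 v).
  + exact: up C1C (a5 v).
split; first by move=> q u; exact: up C2C (h2 q u).
move=> eps /andP[ep]; rewrite !lt_min => /andP[/andP[ep1 _] /andP[epe epC]]; split.
  have k : eps * C < 1 by rewrite -ltr_pdivlMr // div1r.
  rewrite expr2 -mulrA; apply: le_trans (ltW k).
  by rewrite ler_piMl ?mulr_ge0 ?(ltW ep) ?(ltW Cp) ?(ltW ep1).
move=> x Bx; rewrite /strip /=.
have k1 := hM _ Bx; have k2 := he eps (introT andP (conj ep epe)) x Bx.
have E : (x.2, P eps x) - p0 = ((x.2, P2 x.2) - p0) + (0, P eps x - P2 x.2).
  rewrite [p0]surjective_pairing !pairN !pairD addr0; congr (_, _).
  by rewrite /= [RHS]addrC addrA subrK.
rewrite E; apply: le_trans (ler_normD _ _) _.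
have -> : M' + 2 - 1 = M' + 1 by lra.
by apply: lerD => //; apply: norm_pair_le => //; rewrite normr0.
Qed.

Lemma family_at (eps : R) : 0 < eps < eps0 ->
  [/\ [/\ Ck_on 1 (Defs.over B) (Q eps), Ck_on 1 (Defs.over B) (P eps),
          base_periodic B (Q eps), base_periodic B (P eps) &
          forall x, Defs.over B x -> `|Q eps x| < rho],
      weakly_invariant (hamiltonian h G eps) B (Q eps) (P eps),
      C1_bound (Defs.over B) (fun x => P eps x - P2 x.2) kappa &
      C1_bound (Defs.over B) (Q eps) (kappa / eps)].
Proof.
move=> he; have [/(_ eps he)[[a1 a2 a3 a4 a5] a6 [a7 a8] _ _] _] := fam; split=> //; split=> //.
by move=> x /a5/Urho; apply: le_lt_trans; exact: sup_le_enorm.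
Qed.

(** Each constant depends only on the previous ones: the opening [eta1] of the cone, the slow time
    [T] with its tolerance, [dl], the window [T'], the neighbourhood [r1] of [p0], the threshold for
    [eps]. Orbits start within [r1 / 2] of [p0] and drift by at most [r1 / 2]. *)
Lemma derivative_close (eta : R) : 0 < eta -> exists d e : R, [/\ 0 < d, 0 < e &
  forall eps : R, 0 < eps < e -> forall x : pt R m m, `|x.2 - p0.1| < d ->
  [/\ B x.2, differentiable (Phi (hamiltonian h G eps) (Q eps) (P eps)) x &
      forall v, `|'d (Phi (hamiltonian h G eps) (Q eps) (P eps)) x v - 'd (Phi0 h P2) x v| <= eta * `|v|]].
Proof.
move=> eta0.
pose F := dgrad h p0; have linF : linear F := dgrad_linear h p0.
have [N0 [M0 [cA [cK [[linN linM] [cA0 cK0] FN FM FK]]]]] :=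
  posdef_blocks linF (fun u u0 => dgrad_pos hC hpos p0 u0).
have [CN CN0 bN'] := @linear_bound R 'rV[R]_m (fdim_rV R m) 'rV[R]_r N0 linN.
have [CM CM0 bM'] := @linear_bound R 'rV[R]_r (fdim_rV R r) 'rV[R]_m M0 linM.
have [M [C [ebar [C0C [M1 C1 [eb0 eb1] hz [bLV hs]]]]]] := family_boundsP (CN + CM).
have Cp : 0 < C by exact: lt_le_trans ltr01 C1.
have bN b : `|N0 b| <= C * `|b|.
  by apply: le_trans (bN' b) _; rewrite ler_wpM2r //; lra.
have bM b : `|M0 b| <= C * `|b|.
  by apply: le_trans (bM' b) _; rewrite ler_wpM2r //; lra.
have sp0 : strip p0 M (0, 0, p0) by rewrite /strip /= subrr normr0 (le_trans ler01).
have bF u : `|F u| <= C * `|u| by have [_ _ _ _] := hz _ sp0; exact.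
have dN b : 'd P2 (p0.1) b = N0 b.
  exact: (graph_slope hC oB Bp P2C P20 crit cK0 (fun b => (FN b).1) FK).
have [k1 [dP [k10 dP0 hsl]]] := slice_bound oB Bp P2C kappa0.
pose eta1 := Num.min 1 (eta / (8 * C)).
have eta10 : 0 < eta1 by rewrite lt_min ltr01 divr_gt0 // mulr_gt0.
have eta11 : 0 < eta1 <= 1 by rewrite eta10 ge_min lexx.
have eta1e : eta1 <= eta / (8 * C) by rewrite ge_min lexx orbT.
move: eta1 eta10 eta11 eta1e => eta1 eta10 eta11 eta1e.
have [T [dl0 [T0 dl00 hcone]]] := cone_conclusion C1 cA0 cK0 cV0 k10 linF linN linM bF bN bM FN FM FK eta10.
have [K1 K1E] : exists K1 : R, K1 = t1_const C by exists (t1_const C).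
have K10 : 0 < K1 by rewrite K1E /t1_const !mulr_gt0 ?expR_gt0 // ltr_wpDl // ltW.
pose dl := Num.min dl0 (Num.min 1 (eta / (32 * (K1 * (2 + C))))).
have dlp : 0 < dl.
  by rewrite !lt_min dl00 ltr01 divr_gt0 // mulr_gt0 // mulr_gt0 // ltr_wpDl.
have dl1 : dl <= 1 by rewrite !ge_min lexx orbT.
have dl2 : dl <= dl0 by rewrite ge_min lexx.
have dl3 : dl <= eta / (32 * (K1 * (2 + C))) by rewrite !ge_min lexx !orbT.
move: dl dlp dl1 dl2 dl3 => dl dlp dl1 dl2 dl3.
pose n := (@fd_n R (pt R m r) (fd_pt R m r))%:R : R; have n0 : (0 : R) <= n by exact: ler0n.
(* The error [2 * e1] of [window_orbit] is summed over the [n] coordinates by [corrector] and has to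
   stay below [dl]. *)
pose e1 := dl / (2 * (n + 1)).
have n1 : 0 < n + 1 by rewrite ltr_wpDl.
have e10 : 0 < e1 by rewrite divr_gt0 // mulr_gt0.
have e1dl : n * (2 * e1) <= dl.
  rewrite (_ : n * _ = dl * (n / (n + 1))); last by rewrite /e1; field; rewrite gt_eqF.
  by rewrite ler_piMr ?(ltW dlp) // ler_pdivrMr // mul1r lerDl.
have [T' [dw [T'1 dw0 hwin]]] := window_orbit p0 GC pG nonres 1 e10.
have T'0 : 0 < T' by exact: lt_le_trans T'1.
(* A velocity error of [rw] displaces the orbit by less than [dw] during one window. *)
pose rw := dw / (2 * T').
have rw0 : 0 < rw by rewrite divr_gt0 // mulr_gt0.
have rwT : rw * T' < dw.
  rewrite (_ : rw * T' = dw / 2); last by rewrite /rw; field; rewrite gt_eqF.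
  by rewrite ltr_pdivrMr // ltr_pMr // ltr1n.
move: rw rw0 rwT => rw rw0 rwT.
have [da da0 hda] : exists2 d : R, 0 < d & forall p, `|p - p0| < d -> `|grad h p - grad h p0| <= rw / 2.
  have := differentiable_continuous ((grad_C1 hC).1 p0 I) => /cont_epsP; apply.
  by rewrite divr_gt0.
have dlh : 0 < dl / 2 by rewrite divr_gt0.
have [_ _ _ dlh' _] := quarters dlp.
have [db db0 hdb] := @dgrad_close R m r h p0 hC (dl / 2) dlh.
(* Within [r1] of [p0] the frequency, the Hessian of [h] and the slopes of the slices are all under
   control; the halving makes the inequalities strict. *)
pose r1 := Num.min (Num.min dw da) (Num.min db dP) / 2.
have r1' : 0 < 2 * r1 /\ [/\ 2 * r1 <= dw, 2 * r1 <= da, 2 * r1 <= db & 2 * r1 <= dP].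
  have -> : 2 * r1 = Num.min (Num.min dw da) (Num.min db dP) by rewrite /r1; field.
  by split; [rewrite !lt_min dw0 da0 db0 dP0|split; rewrite !ge_min lexx ?orbT].
move: r1 r1' => r1 [r1p [rdw rda rdb rdP]].
have r10 : 0 < r1 by rewrite -(pmulr_rgt0 r1 (ltr0n R 2)).
move: (half_lt r10 rdw) (half_lt r10 rda) (half_lt r10 rdb) (half_lt r10 rdP) => {}rdw {}rda {}rdb {}rdP.
have [r14 r42 r44 _ r22] := quarters r10.
have [dc dc0 hdc] := P2_close oB Bp P2C P20 r14.
have eta2 : 0 < eta / 2 by rewrite divr_gt0.
have [dd dd0 hdd] := Phi0_diff_close hC oB Bp P2C P20 Cp bF eta2.
have [dB dB0 hdB] := ball_sub oB Bp.
have [ef ef0 hef] := family_P r14.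
(* A common bound for the products of [small_eps]: two entries serve the tolerances of the
   averaging, the others the truncation, the distance to [p0], the margin inside [B] and the slow
   time. *)
pose c := Num.min (Num.min (dl / 2) (rw / 2)) (Num.min (Num.min 2^-1 (r1 / 2)) (Num.min (dB / 4) T)).
have cs : 0 < c /\ [/\ c <= dl / 2, c <= rw / 2, c <= 2^-1, c <= r1 / 2 & c <= dB / 4 /\ c <= T].
  split; last by split; try split; rewrite !ge_min lexx ?orbT.
  by rewrite !lt_min T0 !divr_gt0 // invr_gt0 ltr0n.
move: c cs => c [c0 [cdl crw c2 cr [cB cT]]].
pose K := C * (1 + T + T') * (1 + n).
have K0 : 0 < K by rewrite /K !mulr_gt0 ?(addr_gt0 (addr_gt0 ltr01 T0) T'0) // ltr_pwDl.
exists (Num.min (Num.min dc dd) (Num.min (dB / 2) (r1 / 4))), (Num.min ebar (Num.min ef (c / K))); split.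
- by rewrite !lt_min dc0 dd0 r14 divr_gt0.
- by rewrite !lt_min eb0 ef0 divr_gt0.
move=> eps /andP[ep]; rewrite !lt_min => /and3P[epb epf]; rewrite ltr_pdivlMr // => epK x.
rewrite !lt_min => /andP[/andP[xc xd] /andP[xB xr]].
move: eb1; rewrite le_min => /andP[eb1 ebe].
have ep1 : eps <= 1 by exact: le_trans (ltW epb) eb1.
have ep01 : 0 < eps <= 1 by rewrite ep.
have [[QC PC pQ pP Qrho] inv bP bQ] := family_at (introT andP (conj ep (lt_le_trans epb ebe))).
have [epsC stP] := hs eps (introT andP (conj ep epb)).
have [s1 s2 s3 s4 s5] := small_eps ep01 C1 T0 T'1 n0 epK.
have [Bx P2x] := hdc _ xc.
have M00 : 0 <= M by exact: le_trans ler01 M1.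
have [phi flow] := XM_flow p0 hC GC pG M00 eps.
(* The average attached to a time s uses the orbit on [s, s + T'], so the orbit is followed for one
   window beyond the slow time [T]. *)
pose S := T / eps + T'.
have near0 (s : R) : `|s| <= S -> `|(phi (start (Q eps) (P eps) x) s).2 - p0| <= r1.
  move=> sS; have k := flow_slow hC GC M00 flow (fun z hz' => let: And5 a _ _ _ _ := hz z hz' in a)
    (start (Q eps) (P eps) x) s.
  have k2 : `|(phi (start (Q eps) (P eps) x) s).2 - (start (Q eps) (P eps) x).2| <= r1 / 2.
    apply: le_trans k _; apply: le_trans cr; apply: le_trans s4.
    by rewrite mulrC ler_wpM2r // mulr_ge0 ?sqr_ge0 // ltW.
  have k3 : `|(start (Q eps) (P eps) x).2 - p0| <= r1 / 2.
    rewrite /start /param /= [p0]surjective_pairing pairN pairD; apply: norm_pair_le; first exact: le_trans (ltW xr) r42.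
    have k4 := hef eps (introT andP (conj ep epf)) (0, x.1, x.2) Bx.
    exact: le_trans (norm_tri k4 P2x) r44.
  exact: le_trans (norm_tri k2 k3) r22.
have slice y b : Defs.over B y -> `|y.2 - p0.1| <= r1 ->
  `|eps *: ('d (QP (Q eps) (P eps)) y (0, 0, b)).1| <= k1 * `|b| /\
  `|('d (QP (Q eps) (P eps)) y (0, 0, b)).2| <= k1 * `|b|.
  move=> By yr; apply: (hsl eps (Q eps) (P eps) ep QC PC bP bQ y b By).
  exact: le_lt_trans yr rdP.
have mB p : `|p - x.2| < S * (eps ^+ 2 * C) + dB / 4 -> B p.
  move=> px; apply: hdB; rewrite -(subrK x.2 p) -addrA.
  by apply: le_lt_trans (ler_normD _ _) _; exact: margin_arith px s4 cB xB.
have gr1 p : `|p - p0| <= r1 -> `|grad h p - grad h p0| <= rw / 2.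
  by move=> pr; apply: hda; exact: le_lt_trans pr rda.
have dgr1 p u : `|p - p0| <= r1 -> `|dgrad h p u - dgrad h p0 u| <= dl / 2 * `|u|.
  by move=> pr; apply: hdb; exact: le_lt_trans pr rdb.
have dl01 : 0 < dl <= 1 by rewrite dlp.
have s3' : eps * (n * (C * T')) <= dl by exact: le_trans s3 (le_trans cdl dlh').
have ew : eps ^+ 2 * C <= rw / 2 by exact: le_trans s2 crw.
have ed : eps * C <= dl / 2 by exact: le_trans s1 cdl.
have dB4 : 0 < dB / 4 by rewrite divr_gt0.
have SC : S * (eps ^+ 2 * C) <= 2^-1 by apply: le_trans s4 _.
have [d [e [Dd [kk [g [chi [ghat [LV [ld bg hv dPhi EPhi]]]]]]]]] :=
  @tangent_data R m r h G p0 omega hC GC pG gh0 M M1 C cV rho C1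
   (fun z hz' => let: And5 a _ _ _ _ := hz z hz' in a)
   (fun z hz' => let: And5 _ a _ _ _ := hz z hz' in a)
   (fun z hz' => let: And5 _ _ a _ _ := hz z hz' in a)
   (fun z hz' => let: And5 _ _ _ a _ := hz z hz' in a)
   bLV pLV rho1 eps ep01 epsC phi flow B (Q eps) (P eps) oB stP QC PC Qrho inv
   T dl T' dw r1 rw e1 T0 dl01 T'1 k1 slice (ltW e10) e1dl rwT rdw gr1 dgr1 ew ed s3' hwin
   x S (dB / 4) dB4 (lexx _) SC mB near0.
split=> // v.
have cone := hcone eps dl d e Dd kk g chi ghat LV ep (introT andP (conj dlp dl2)) ld v.
have epsT : eps <= T by exact: le_trans s5 cT.
have := time_one_graph C1 linF bF bN ep01 epsT dl01 ld bg eta11 cone.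
have [d0 e0] := hv v; rewrite /= d0 e0 -K1E => -[g1 g2].
have wv : 0 <= `|eps *: v.1| <= `|v|.
  rewrite normr_ge0 normrZ (ger0_norm (ltW ep)) /=.
  by apply: le_trans (norm_fst v); rewrite ler_piMl.
have bv : 0 <= `|v.2| <= `|v| by rewrite normr_ge0 norm_snd.
have epdl : 0 < eps <= dl by rewrite ep /=; exact: le_trans s5 (le_trans cdl dlh').
have err := small_error K10 Cp epdl dl3 eta10 eta1e wv bv.
have k1' : `|'d (Phi (hamiltonian h G eps) (Q eps) (P eps)) x v - (v.1 + (F (v.2, N0 v.2)).1, v.2)| <= eta / 2 * `|v|.
  rewrite EPhi pairN pairD opprD addrA; apply: norm_pair_le.
    exact: le_trans g2 err.
  exact: le_trans g1 err.
have k2' := hdd x v xd; rewrite dN distrC in k2'.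
by apply: le_trans (norm_tri k1' k2') _; rewrite -mulrDl -splitr.
Qed.

End CylinderFamily.

(** * Existence, convergence and inclusion for the time-one map *)

Section FamilyMap.
Context {R : realType} {m r : nat}.
Context (h : pt R m r -> R) (G : ext R m r -> R) (p0 : pt R m r) (omega : 'rV[R]_m).
Context (hC : Ck_on 2 setT h) (GC : Ck_on 2 setT G) (pG : periodic_for extlat G).
Context (gh0 : grad h p0 = (omega, 0)).
Context (hcvx : convex_fun h) (hpos : forall p, hessian_pos_def h p).
Context (rho kappa : R) (B : set 'rV[R]_m) (P2 : 'rV[R]_m -> 'rV[R]_r) (U : set 'rV[R]_r) (eps0 : R).
Context (Q P : R -> base R m -> 'rV[R]_r).
Context (bB : open_ball B) (Bp : B p0.1).
Context (crit : forall p1, B p1 -> (grad h (p1, P2 p1)).2 = 0).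
Context (Urho : forall q2, U q2 -> enorm q2 < rho) (eps00 : 0 < eps0).
Context (fam : cylinder_family h G P2 kappa B U eps0 Q P).
Notation H := (hamiltonian h G).

Let oB : open B := open_ball_open bB.
Let bounds := family_boundsP hC GC pG gh0 hcvx hpos bB Bp crit eps00 fam 0.

Lemma family_time_one : exists2 e : R, 0 < e & forall eps : R, 0 < eps < e ->
  forall z, cylinder0 B (Q eps) (P eps) z -> exists! z', time_one (H eps) z z'.
Proof.
have [M [C [e [_ [M1 C1 [e0 _] hz [_ hs]]]]]] := bounds; exists e => // eps he z.
have [epsC stP] := hs eps he; have /andP[ep _] := he.
have [phi flow] := XM_flow p0 hC GC pG (le_trans ler01 M1) eps.
exact: (@cylinder0_time_one R m r h G p0 hC GC pG M M1 C (lt_le_trans ltr01 C1)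
  (fun z hz' => let: And5 a _ _ _ _ := hz z hz' in a) eps epsC phi flow B (Q eps) (P eps) stP z).
Qed.

(** On the orbit the momentum is within [2 * d] of (p1, P2 p1): [d] for the initial point and [d]
    for the drift in unit time. The gradient of [h], Lipschitz of constant [C] in the cube, is
    therefore within [delta / 2] of its limit. *)
Lemma family_Phi_close (delta : R) : 0 < delta -> exists2 e : R, 0 < e & forall eps : R, 0 < eps < e ->
  forall x : pt R m m, B x.2 -> `|Phi (H eps) (Q eps) (P eps) x - Phi0 h P2 x| <= delta.
Proof.
move=> d0; have [M [C [e [_ [M1 C1 [e0 e1] hz [_ hs]]]]]] := bounds.
have C0 : 0 < C := lt_le_trans ltr01 C1.
pose d := Num.min 1 (delta / (4 * C)).
have dp : 0 < d by rewrite lt_min ltr01 divr_gt0 // mulr_gt0.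
have d1 : d <= 1 by rewrite ge_min lexx.
have dC : C * d <= delta / 4.
  rewrite -ler_pdivlMl // ge_min; apply/orP; right.
  by rewrite [leLHS](_ : _ = C^-1 * (delta / 4)) //; field; rewrite gt_eqF.
move: d dp d1 dC => d dp d1 dC.
have [e' e'0 he'] := family_P fam dp.
have e20 : 0 < Num.min (d / C) (delta / (4 * C)) by rewrite lt_min !divr_gt0 // mulr_gt0.
exists (Num.min (Num.min e e') (Num.min (d / C) (delta / (4 * C)))); first by rewrite lt_min e20 lt_min e0 e'0.
move=> eps /andP[ep]; rewrite !lt_min => /andP[/andP[epe epe'] /andP[epd epD]] x Bx.
move: e1; rewrite le_min => /andP[e1 _]; have ep1 : eps <= 1 := le_trans (ltW epe) e1.
have eC : eps ^+ 2 * C <= eps * C.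
  by rewrite expr2 -mulrA ler_piMl // mulr_ge0 // ltW.
have eCd : eps ^+ 2 * C <= d by apply: le_trans eC _; rewrite -ler_pdivlMr // ltW.
have eCD : eps ^+ 2 * C <= delta / 4.
  apply: le_trans eC _; rewrite -ler_pdivlMr //; apply: le_trans (ltW epD) _.
  by rewrite [leLHS](_ : _ = delta / 4 / C) //; field; rewrite gt_eqF.
have hee : 0 < eps < e by rewrite ep.
have [epsC stP] := hs eps hee.
have [phi flow] := XM_flow p0 hC GC pG (le_trans ler01 M1) eps.
have bQ z hz' := let: And5 a _ _ _ _ := hz z hz' in a.
have bD (p v : pt R m r) : `|p - p0| <= M -> `|dgrad h p v| <= C * `|v|.
  by move=> pM; have [_ _ _ _] := hz (0, 0, p) pM; apply.
set z := start (Q eps) (P eps) x.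
have stz : strip p0 (M - 1) z := stP (0, x.1, x.2) Bx.
have P2z : `|z.2 - (x.2, P2 x.2)| <= d.
  rewrite /z /start /param /= pairN pairD subrr; apply: norm_pair_le; first by rewrite normr0 ltW.
  by apply: (he' eps _ (0, x.1, x.2) Bx); rewrite ep.
have key (s : R) : 0 <= s <= 1 -> `|grad h (phi z s).2 - grad h (x.2, P2 x.2)| <= delta / 2.
  move=> s01; have /andP[s0 s1] := s01.
  have slow := flow_slow hC GC (le_trans ler01 M1) flow bQ z s.
  have slow1 : `|(phi z s).2 - z.2| <= d.
    apply: le_trans slow _; apply: le_trans eCd; rewrite ger0_norm // ler_piMr //.
    by rewrite mulr_ge0 ?sqr_ge0 // ltW.
  have close := norm_tri slow1 P2z.
  have sM : strip p0 M (phi z s).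
    apply: (@flow_strip R m r h G p0 hC GC M M1 C bQ eps phi flow z s stz).
    by rewrite ger0_norm //; apply: le_trans epsC; rewrite ler_piMl // mulr_ge0 ?sqr_ge0 // ltW.
  have pM : `|(x.2, P2 x.2) - p0| <= M.
    rewrite distrC in P2z; apply: le_trans (norm_tri P2z stz) _.
    by rewrite addrCA gerDl subr_le0.
  have lip := @C1_lip R (pt R m r) (pt R m r) (fd_pt R m r) (fd_pt R m r) [set p : pt R m r | `|p - p0| <= M] (grad h) C
    (grad_C1 hC) (fun p v hp => bD p v hp) (x.2, P2 x.2) (phi z s).2.
  apply: le_trans (lip _) _.
    move=> t t01; exact: (@strip_segment R m r p0 M (0, 0, (x.2, P2 x.2)) (0, 0, (phi z s).2) t pM sM t01).
  apply: le_trans (ler_wpM2l (ltW C0) close) _; rewrite mulrDr.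
  by apply: le_trans (lerD dC dC) _; have [_ _ k _ _] := quarters d0.
apply: le_trans (Phi_close hC GC pG M1 C0 bQ (fun z hz' => let: And5 _ a _ _ _ := hz z hz' in a) epsC flow stP Bx key) _.
have [_ k1 _ _ k2] := quarters d0.
apply: le_trans (lerD (lexx (delta / 2)) (le_trans eCD k1)) k2.
Qed.

Lemma family_step (B0 : set 'rV[R]_m) : inner_ball p0.1 B B0 ->
  exists2 e : R, 0 < e & forall eps : R, 0 < eps < e ->
  flow1 (H eps) @` cylinder0 B0 (Q eps) (P eps) `<=` cylinder0 B (Q eps) (P eps).
Proof.
move=> iB0; have [d d0 hd] := inner_margin oB iB0.
have [M [C [e [_ [M1 C1 [e0 e1] hz [_ hs]]]]]] := bounds.
have C0 : 0 < C := lt_le_trans ltr01 C1.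
exists (Num.min e (d / C)); first by rewrite lt_min e0 divr_gt0.
move=> eps /andP[ep]; rewrite lt_min => /andP[epe epd] _ [_ [x [l [Bx ->]]] <-].
move: e1; rewrite le_min => /andP[e1 ee]; have ep1 : eps <= 1 := le_trans (ltW epe) e1.
have eCd : eps ^+ 2 * C < d.
  apply: (@le_lt_trans _ _ (eps * C)); last by rewrite -ltr_pdivlMr.
  by rewrite expr2 -mulrA ler_piMl // mulr_ge0 // ltW.
have hee : 0 < eps < e by rewrite ep.
have hee0 : 0 < eps < eps0 by rewrite ep (lt_le_trans epe ee).
have [epsC stP] := hs eps hee.
have [[QC PC pQ pP _] inv _ _] := family_at Urho fam hee0.
have [phi flow] := XM_flow p0 hC GC pG (le_trans ler01 M1) eps.
have bQ z hz' := let: And5 a _ _ _ _ := hz z hz' in a.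
apply: (cylinder0_step hC GC pG M1 C0 bQ epsC flow oB stP QC PC inv pQ pP).
  by apply: (hd x.2) => //; rewrite subrr normr0.
by move=> p px; apply: (hd x.2) => //; exact: le_lt_trans px eCd.
Qed.

End FamilyMap.

Lemma small_inner_ball (R : realType) (n : nat) (p : 'rV[R]_n) (B : set 'rV[R]_n) (d : R) :
  open B -> B p -> 0 < d ->
  exists2 B0, inner_ball p B B0 & forall x, B0 x -> `|x - p| < d.
Proof.
move=> oB Bp d0; have := oB _ Bp; move=> /nbhs_ballP[c c0 hc].
pose e := Num.min d (c / 2); have e0 : 0 < e by rewrite lt_min d0 divr_gt0.
have ec : e + e <= c.
  by rewrite [leRHS]splitr; apply: lerD; rewrite ge_min lexx orbT.
exists [set x | enorm (x - p) < e]; last first.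
  move=> x /= xe; apply: le_lt_trans (sup_le_enorm _) _; apply: lt_le_trans xe _.
  by rewrite ge_min lexx.
split; first by exists p, e.
  by rewrite /= subrr /enorm dot0l sqrtr0.
move=> x xB; have [y [/= yp xy]] := xB (ball x e) (nbhsx_ballx x e e0).
apply: hc; rewrite -ball_normE /= distrC; rewrite -ball_normE /= in xy.
apply: lt_le_trans ec; rewrite -(subrK y x) -addrA.
apply: le_lt_trans (ler_normD _ _) _; apply: ltrD => //.
exact: le_lt_trans (sup_le_enorm _) yp.
Qed.

(** [rho] makes explicit how small the neighbourhood [U] is taken: the averaged potential has a
    uniformly positive definite Hessian on the ball of this radius. *)
Theorem proposition2 (R : realType) (m r : nat) (tau : R)
    (m_ge1 : (1 <= m)%N) (r_ge1 : (1 <= r)%N) (tau_gt0 : 0 < tau) :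
  exists s : nat,
  forall (h : pt R m r -> R) (G : ext R m r -> R)
         (p0 : pt R m r) (omega : 'rV[R]_m),
    Ck_on s setT h -> Ck_on s setT G -> ham_periodic G ->
    grad h p0 = (omega, 0) -> diophantine tau omega ->
    convex_fun h -> (forall p, hessian_pos_def h p) ->
    nondegenerate_local_min (averaged G p0) 0 ->
  exists rho : R, 0 < rho < 2^-1 /\
  forall (kappa : R) (B : set 'rV[R]_m) (P2 : 'rV[R]_m -> 'rV[R]_r)
         (U : set 'rV[R]_r) (eps0 : R) (Q P : R -> base R m -> 'rV[R]_r),
    0 < kappa -> open_ball B -> B p0.1 ->
    Ck_on s.-1 B P2 -> P2 p0.1 = p0.2 ->
    (forall p1, B p1 -> (grad h (p1, P2 p1)).2 = 0) ->
    nbhs (0 : 'rV[R]_r) U -> (forall q2, U q2 -> enorm q2 < rho) ->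
    0 < eps0 -> cylinder_family h G P2 kappa B U eps0 Q P ->
  let H := hamiltonian h G in
  [/\ (* phi is well-defined on A_0^eps for small eps *)
      (\forall eps \near 0^'+, forall z, cylinder0 B (Q eps) (P eps) z ->
         exists! z', time_one (H eps) z z'),
      (* (i) *)
      (forall B0, inner_ball p0.1 B B0 ->
         forall delta : R, 0 < delta ->
         \forall eps \near 0^'+, forall x : pt R m m, B0 x.2 ->
         exists k : 'rV[int]_m,
           enorm2 (Phi (H eps) (Q eps) (P eps) x - Phi0 h P2 x - (zvec R k, 0))
             <= delta),
      (* (ii) *)
      (forall B0, inner_ball p0.1 B B0 ->
         \forall eps \near 0^'+,
           flow1 (H eps) @` cylinder0 B0 (Q eps) (P eps)
             `<=` cylinder0 B (Q eps) (P eps)) &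
      (* (iii) *)
      (forall eta : R, 0 < eta ->
         exists2 B0, inner_ball p0.1 B B0 &
         \forall eps \near 0^'+, forall x : pt R m m, B0 x.2 ->
           differentiable (Phi (H eps) (Q eps) (P eps)) x /\
           forall v : pt R m m,
             enorm2 ('d (Phi (H eps) (Q eps) (P eps)) x v - 'd (Phi0 h P2) x v)
               <= eta * enorm2 v)].
Proof.
(* Two derivatives make the Hamiltonian field C^1 and the averaged Hessian continuous; the function
   [P2] is then C^1. *)
exists 2%N => h G p0 omega hC GC hper gh0 dio hcvx hpos ndeg.
have pG : periodic_for extlat G by move=> z _ [a [k [l ->]]]; exact: hper.
have nonres := diophantine_nonresonant dio.
have [rho [cV [rho0 cV0 pLV]]] := avg_hess_posdef GC pG ndeg.
exists rho; split=> // kappa B P2 U eps0 Q P ka0 bB Bp P2C P20 crit _ Urho eps00 fam H.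
have rho1 : rho <= 1 by move: rho0 => /andP[_ k]; lra.
have oB := open_ball_open bB.
(* Conversion factor from the sup norm to [enorm2]. *)
pose D : R := m%:R + m%:R + 1.
have D0 : 0 < D by rewrite /D ltr_wpDl.
split.
- apply/near0_ex; exact: (family_time_one hC GC pG gh0 hcvx hpos bB Bp crit eps00 fam).
- move=> B0 iB0 delta d0; apply/near0_ex.
  have [e e0 he] := family_Phi_close hC GC pG gh0 hcvx hpos bB Bp crit eps00 fam (divr_gt0 d0 D0).
  (* The lift [Phi] follows an orbit of the universal cover starting from the same [x.1] as [Phi0],
     so the integer translation is 0. *)
  exists e => // eps hee x Bx; exists 0.
  have Bx' : B x.2 by case: iB0 => _ _; apply; exact: subset_closure.
  have -> : zvec R (0 : 'rV[int]_m) = 0 by apply/rowP => i; rewrite !mxE.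
  rewrite subr0; apply: le_trans (enorm2_le _) _.
  by rewrite mulrC -ler_pdivlMr //; exact: he.
- move=> B0 iB0; apply/near0_ex.
  exact: (family_step hC GC pG gh0 hcvx hpos bB Bp crit Urho eps00 fam iB0).
- move=> eta eta0.
  have [d [e [d0 e0 he]]] := derivative_close hC GC pG gh0 nonres hcvx hpos rho1 cV0 pLV ka0 bB Bp
    P2C P20 crit Urho eps00 fam (divr_gt0 eta0 D0).
  have [B0 iB0 hB0] := small_inner_ball oB Bp d0.
  exists B0 => //; apply/near0_ex; exists e => // eps hee x Bx.
  have [_ dPhi k] := he eps hee x (hB0 _ Bx); split=> // v.
  apply: le_trans (enorm2_le _) _; rewrite mulrC -ler_pdivlMr //.
  apply: le_trans (k v) _; rewrite mulrAC; apply: ler_wpM2r; first by rewrite invr_ge0 ltW.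
  by apply: ler_wpM2l; [exact: ltW|exact: sup_le_enorm2].
Qed.
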